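(* Let $k$ be a differential field of characteristic zero with an algebraically closed field of constants $C$. Let $E$ be an iterated strongly normal extension of $k$ and let $K$ be a differential field with $k\subseteq K\subseteq E$ and $\mathrm{tr.deg}(K|k)=1$. Then there is a finite algebraic extension $\tilde{k}$ of $k$ and an element $t\in\tilde{k}K$ such that one of the following holds: (i) $\tilde{k}K$ is a finite algebraic extension of $\tilde{k}(t)$ and $t$ is a solution of a Riccati differential equation over $\tilde{k}$. (ii) $\tilde{k}K$ is a finite algebraic extension of $\tilde{k}(t,t')$ and $t$ is a solution of a Weierstrass differential equation over $\tilde{k}$.
   Context: Derivations are denoted by $'$; algebraic extensions of differential fields carry the unique extended derivation. $\tilde kK$ denotes the compositum of $\tilde k$ and $K$ in an algebraic closure of $E$. A Riccati differential equation over a differential field $F$ is an equation $t'=a_2t^2+a_1t+a_0$ with $a_0,a_1,a_2\in F$ not all zero. A Weierstrass differential equation over a differential field $F$ (containing $C$) is an equation $(t')^2=\alpha^2(4t^3-g_2t-g_3)$ with $g_2,g_3\in C$, $\alpha\in F$ and $27g_3^2-g_2^3\neq0$. Strongly normal extension: a differential field extension $E$ of $k$ that is finitely differentially generated over $k$ and such that every differential $k$-isomorphism $\sigma$ of $E$ (into a differential field extension of $E$) satisfies $E\,\sigma E=E\,C(\sigma)=\sigma E\,C(\sigma)$, where $C(\sigma)$ is the field of constants of the compositum $E\,\sigma E$, and $\sigma(c)=c$ for all constants $c$ of $E$. (Such an $E$ has $C$ as its field of constants.) Iterated strongly normal extension: a differential field extension $E$ of $k$ for which there is a tower of differential fields $k=E_0\subseteq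 E_1\subseteq\cdots\subseteq E_n=E$ with $E_i$ a strongly normal extension of $E_{i-1}$ for each $i=1,\dots,n$. *)

(* Defs.v *)
From mathcomp Require Import all_boot all_order all_algebra.
From mathcomp Require Import mpoly.
From mathcomp Require Import boolp classical_sets.

Set Implicit Arguments.
Unset Strict Implicit.
Unset Printing Implicit Defensive.

Import GRing.Theory.

Local Open Scope ring_scope.
Local Open Scope classical_set_scope.

(* Fields in a tower are represented as subsets [F : set L] of one ambient
   field [L], whose derivation [d] they inherit. *)

Definition derivation (L : fieldType) (d : L -> L) : Prop :=
  {morph d : x y / x + y} /\ (forall x y, d (x * y) = d x * y + x * d y).

Section Subfields.
Variable L : fieldType.
Implicit Types (F K A B : set L) (x : L) (p : {poly L}).

Definition subfield F : Prop := GRing.divring_closed [pred x in F].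

Definition adjoin F A : set L := smallest subfield (F `|` A).

Definition compositum F K : set L := smallest subfield (F `|` K).

Definition algebraic_over F x : Prop :=
  exists2 p, p \is a polyOver [pred x in F] & (p != 0) && root p x.

Definition alg_closed F : Prop :=
  forall p, p \is a polyOver [pred x in F] -> (1 < size p)%N ->
    exists2 x, x \in F & root p x.

Definition finite_extension F K : Prop :=
  [/\ subfield F, subfield K, F `<=` K &
      exists (n : nat) (e : 'I_n -> L), (forall i, e i \in K) /\
        forall x, x \in K ->
          exists2 c : 'I_n -> L,
            forall i, c i \in F & x = \sum_(i < n) c i * e i].

Definition alg_independent F (n : nat) (b : 'I_n -> L) : Prop :=
  forall p : {mpoly L[n]},
    p \is a mpolyOver n [pred x in F] -> p.@[b] = 0 -> p = 0.

(* tr.deg(K|F) = n: K has a transcendence basis over F with n elements. *)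
Definition trdeg_is F K (n : nat) : Prop :=
  exists b : 'I_n -> L,
    [/\ forall i, b i \in K, alg_independent F b &
        forall x, x \in K -> algebraic_over (adjoin F (range b)) x].

End Subfields.

Section Differential.
Variables (L : fieldType) (d : L -> L).
Implicit Types (k F E : set L) (t : L).

Definition diff_subfield F : Prop :=
  subfield F /\ (forall x, x \in F -> d x \in F).

Definition constants F : set L := F `&` [set x | d x = 0].

Definition diff_fin_generated k E : Prop :=
  exists s : seq L, E = smallest diff_subfield (k `|` [set` s]).

(* [f] restricts to an embedding of differential fields E -> M; its values
   outside E are irrelevant. *)
Definition diff_embedding E (M : fieldType) (dM : M -> M) (f : L -> M) : Prop :=
  [/\ f 1 = 1,
      {in E &, {morph f : x y / x + y}},
      {in E &, {morph f : x y / x * y}} &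
      {in E, forall x, f (d x) = dM (f x)}].

End Differential.

(* The differential field extension of E is a differential field M with an
   embedding [i] of E in M: "x" in M reads [i x], and sigma : E -> M is a
   k-isomorphism onto its image when it agrees with [i] on k. *)
Definition strongly_normal (L : fieldType) (d : L -> L) (k E : set L) : Prop :=
  [/\ diff_subfield d k, diff_subfield d E, k `<=` E,
      diff_fin_generated d k E &
      forall (M : fieldType) (dM : M -> M) (i sigma : L -> M),
        derivation dM ->
        diff_embedding d E dM i ->
        diff_embedding d E dM sigma ->
        {in k, sigma =1 i} ->
        let iE := i @` E in
        let sE := sigma @` E in
        let Csigma := constants dM (compositum iE sE) in
        [/\ compositum iE sE = compositum iE Csigma,
            compositum iE sE = compositum sE Csigma &
            {in constants d E, sigma =1 i}]].

Definition iterated_strongly_normal (L : fieldType) (d : L -> L)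
    (k E : set L) : Prop :=
  exists (n : nat) (T : nat -> set L),
    [/\ T 0%N = k, T n = E &
        forall i, (i < n)%N -> strongly_normal d (T i) (T i.+1)].

Definition riccati_solution (L : fieldType) (d : L -> L) (F : set L) (t : L) :
    Prop :=
  exists a2 a1 a0 : L,
    [/\ a2 \in F, a1 \in F, a0 \in F,
        ~~ [&& a2 == 0, a1 == 0 & a0 == 0] &
        d t = a2 * t ^+ 2 + a1 * t + a0].

Definition weierstrass_solution (L : fieldType) (d : L -> L) (C F : set L)
    (t : L) : Prop :=
  exists alpha g2 g3 : L,
    [/\ alpha \in F, g2 \in C, g3 \in C,
        27%:R * g3 ^+ 2 - g2 ^+ 3 != 0 &
        d t ^+ 2 = alpha ^+ 2 * (4%:R * t ^+ 3 - g2 * t - g3)].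

(* Main.v *)
(* Let y in K be transcendental over k, and let T_i be the last step of the tower
   over which y is transcendental. An ultrapower of L contains two copies of L that
   are linearly disjoint over F = acl(T_i); it carries a derivation extending
   both. By strong normality the second copy Y of y is algebraic over the first
   copy of L extended by finitely many constants. Let Om be the algebraic closure
   of the first copy and of all but the last of these constants: then Om(Y, Y')
   acquires a new constant, so that its constants C1 form a function field of one
   variable over C = const(Om).

   The derivations of Om(Y, Y') that preserve Om and kill Y and the constants k1
   of the base act on C1. They are spanned over Om by derivations of C1 over C
   that form a Lie algebra stable at every place of C1 (a place of C1/C yields a
   valuation of Om(Y, Y') over Om that these derivations must respect). Such a
   Lie algebra of vector fields on a curve is at most sl_2 acting on the line or
   a regular vector field on an elliptic curve, hence some f in C1 satisfies
   Riccati equations, or some W a Weierstrass equation, with respect to all of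
   them. Finally Om is specialized into k0 = acl(k) by another ultrapower
   embedding which fixes Y: the image t of f or W lies in an ultrapower of
   k0(Y, Y'), and since the derivation only feels the specialization through the
   derivations above, t satisfies a Riccati or Weierstrass equation over k0. *)
From HB Require Import structures.
Require Import Defs.
From mathcomp Require Import all_boot all_order all_algebra.
From mathcomp Require Import generic_quotient.
From mathcomp Require mpoly.
From mathcomp Require Import zify ring boolp classical_sets filter.

Set Implicit Arguments.
Unset Strict Implicit.
Unset Printing Implicit Defensive.

Import Order.TTheory GRing.Theory Num.Theory.

Local Open Scope ring_scope.
Local Open Scope classical_set_scope.

(** * Subfields and relative algebraic closures *)

(** Strong normality is applied to a single pair of embeddings, whose images must be linearly
    disjoint over acl(T_i). The ultrapower supplies such a pair together with an algebraically
    closed field around it, so that relative algebraic closures such as [Om] are algebraically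
    closed. The last constant is withheld from [Om] because Y has to stay transcendental over [Om];
    by exchange that constant is then algebraic over Om(Y), which is the origin of the new constant
    of Om(Y, Y').

    The derivation D kills C1 and says nothing about the curve. Let [psi] be the specialization. The
    defect x -> D (psi x) - psi (D x) is a derivation along [psi] that kills k1 and Y, hence a
    combination of maps x -> psi (d x) where d kills k1 and Y. At f in C1, where D f = 0, the defect
    is D (psi f). So equations for all the d f are exactly what produces an equation for D (psi f).

    For the defect to kill k1, the constants adjoined in [Om] must be specialized to constants of
    k0. This is possible because transcendental elements can be sent to natural numbers. *)

Section SubfieldClosure.
Variables (T : fieldType) (F : set T).

Lemma subfieldP : subfield F <->
  [/\ F 1, forall x y, F x -> F y -> F (x - y)
    & forall x y, F x -> F y -> F (x / y)].
Proof.
split=> -[h1 hB hD]; split.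
- exact: (set_mem h1).
- by move=> x y Fx Fy; apply: (set_mem (hB x y (mem_set Fx) (mem_set Fy))).
- by move=> x y Fx Fy; apply: (set_mem (hD x y (mem_set Fx) (mem_set Fy))).
- exact: (mem_set h1).
- by move=> x y Fx Fy; apply: mem_set; apply: hB; apply: set_mem.
- by move=> x y Fx Fy; apply: mem_set; apply: hD; apply: set_mem.
Qed.

Hypothesis hF : subfield F.

Lemma sf1 : F 1. Proof. by case/subfieldP: hF. Qed.
Lemma sfB x y : F x -> F y -> F (x - y).
Proof. by case/subfieldP: hF => _ h _; apply: h. Qed.
Lemma sfdiv x y : F x -> F y -> F (x / y).
Proof. by case/subfieldP: hF => _ _ h; apply: h. Qed.
Lemma sf0 : F 0. Proof. by rewrite -(subrr 1); apply: sfB; apply: sf1. Qed.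
Lemma sfN x : F x -> F (- x).
Proof. by move=> Fx; rewrite -sub0r; apply: sfB => //; apply: sf0. Qed.
Lemma sfD x y : F x -> F y -> F (x + y).
Proof. by move=> Fx Fy; rewrite -[y]opprK; apply: sfB => //; apply: sfN. Qed.
Lemma sfV x : F x -> F x^-1.
Proof. by move=> Fx; rewrite -div1r; apply: sfdiv => //; apply: sf1. Qed.
Lemma sfM x y : F x -> F y -> F (x * y).
Proof. by move=> Fx Fy; rewrite -[y]invrK; apply: sfdiv => //; apply: sfV. Qed.
Lemma sfX x n : F x -> F (x ^+ n).
Proof.
by move=> Fx; elim: n => [|n IH]; rewrite ?expr0 ?exprS; [apply: sf1|apply: sfM].
Qed.
Lemma sfMn x n : F x -> F (x *+ n).
Proof.
by move=> Fx; elim: n => [|n IH]; rewrite ?mulr0n ?mulrS; [apply: sf0|apply: sfD].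
Qed.
Lemma sfnat n : F n%:R. Proof. by apply: sfMn; apply: sf1. Qed.
Lemma sf_sum (I : Type) (r : seq I) (P : pred I) (E : I -> T) :
  (forall i, P i -> F (E i)) -> F (\sum_(i <- r | P i) E i).
Proof. by move=> h; elim/big_ind: _ => //; [apply: sf0|apply: sfD]. Qed.
End SubfieldClosure.

Ltac sfa h := repeat first
  [ assumption | exact: (sf0 h) | exact: (sf1 h) | exact: (sfnat h)
  | apply: (sfB h) | apply: (sfD h) | apply: (sfN h) | apply: (sfdiv h)
  | apply: (sfM h) | apply: (sfV h) | apply: (sfX h) | apply: (sfMn h) ].

Section SubfieldType.
Variables (T : fieldType) (F : set T).
(** The proof of [subfield F] is an argument of the predicate, so that closure instances can be
    attached to it. The field type [sftype] built on it gives access to matrix kernels, Euclidean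
    division and algebraic elements over a set. *)
Definition sfpred of subfield F : {pred T} := fun x => x \in F.
Variable hF : subfield F.

Lemma sfpred_closed : GRing.divring_closed (sfpred hF).
Proof. exact: hF. Qed.
HB.instance Definition _ := GRing.isDivringClosed.Build T (sfpred hF) sfpred_closed.
Definition sftype := {x : T | sfpred hF x}.
HB.instance Definition _ := SubType.copy sftype {x : T | sfpred hF x}.
HB.instance Definition _ := [Choice of sftype by <:].
HB.instance Definition _ := [SubChoice_isSubComUnitRing of sftype by <:].
HB.instance Definition _ := [SubComUnitRing_isSubIntegralDomain of sftype by <:].
HB.instance Definition _ := [SubIntegralDomain_isSubField of sftype by <:].
Definition sfval : sftype -> T := val.
HB.instance Definition _ := GRing.RMorphism.on sfval.

Lemma sfvalP (x : sftype) : F (sfval x).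
Proof. by have := valP x; rewrite /sfpred inE. Qed.

Definition sfin x (Fx : F x) : sftype := Sub x (mem_set Fx).
Lemma sfinK x (Fx : F x) : sfval (sfin Fx) = x. Proof. by []. Qed.
Lemma sfval_inj : injective sfval. Proof. exact: val_inj. Qed.

End SubfieldType.

(** Quantifying over all indices avoids boolean membership, and the notion applies to subrings as
    well as to subfields. *)
Definition pov (T : fieldType) (F : set T) (p : {poly T}) := forall i, F p`_i.

Definition acl (T : fieldType) (F : set T) : set T := [set x | algebraic_over F x].

Section Pov.
Variables (T : fieldType) (F : set T) (hF : subfield F).

Lemma povP (p : {poly T}) : pov F p <-> p \is a polyOver [pred x in F].
Proof.
split=> [h|/(all_nthP 0) h i].
  by apply/(all_nthP 0) => i _; apply: mem_set; apply: h.
have [lt|ge] := ltnP i (size p); first exact: (set_mem (h i lt)).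
by rewrite nth_default //; exact: (sf0 hF).
Qed.

Lemma povC c : F c -> pov F c%:P.
Proof. by move=> Fc i; rewrite coefC; case: eqP => // _; exact: (sf0 hF). Qed.
Lemma povX : pov F 'X.
Proof. by move=> i; rewrite coefX; exact: (sfnat hF). Qed.
Lemma pov0 : pov F 0.
Proof. by move=> i; rewrite coef0; exact: (sf0 hF). Qed.
Lemma povD p q : pov F p -> pov F q -> pov F (p + q).
Proof. by move=> hp hq i; rewrite coefD; apply: (sfD hF). Qed.
Lemma povN p : pov F p -> pov F (- p).
Proof. by move=> hp i; rewrite coefN; apply: (sfN hF). Qed.
Lemma povM p q : pov F p -> pov F q -> pov F (p * q).
Proof.
move=> hp hq i; rewrite coefM; apply: (sf_sum hF) => j _.
by apply: (sfM hF).
Qed.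
Lemma povZ c p : F c -> pov F p -> pov F (c *: p).
Proof. by move=> Fc hp i; rewrite coefZ; apply: (sfM hF). Qed.
Lemma pov_deriv p : pov F p -> pov F p^`().
Proof. by move=> hp i; rewrite coef_deriv; apply: (sfMn hF). Qed.
Lemma pov_horner p x : pov F p -> F x -> F p.[x].
Proof.
move=> hp Fx; rewrite horner_coef; apply: (sf_sum hF) => i _.
by apply: (sfM hF) => //; apply: (sfX hF).
Qed.
Lemma pov_prod (I : Type) (r : seq I) (E : I -> {poly T}) :
  (forall i, pov F (E i)) -> pov F (\prod_(i <- r) E i).
Proof.
move=> h; elim/big_ind: _ => // [|p q]; last exact: povM.
exact: (povC (sf1 hF)).
Qed.
Lemma pov_lift p : pov F p -> exists q : {poly sftype hF}, p = map_poly (@sfval _ _ hF) q.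
Proof.
move=> hp; exists (\poly_(i < size p) sfin hF (hp i)).
apply/polyP => i; rewrite coef_map coef_poly.
case: ltnP => h //=.
by rewrite nth_default // rmorph0.
Qed.
Lemma pov_map (q : {poly sftype hF}) : pov F (map_poly (@sfval _ _ hF) q).
Proof. by move=> i; rewrite coef_map; exact: sfvalP. Qed.

Lemma aclP x : acl F x <-> algebraicOver (@sfval _ _ hF) x.
Proof.
split.
  move=> [p /povP hp /andP[p0 px]].
  have [q pq] := pov_lift hp; exists q; rewrite -?pq //.
  by apply: contraNneq p0 => q0; rewrite pq q0 rmorph0.
move=> [q q0 qx]; exists (map_poly (@sfval _ _ hF) q).
  by apply/povP; exact: pov_map.
by rewrite map_poly_eq0 q0.
Qed.

Lemma sub_acl : F `<=` acl F.
Proof.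
by move=> x Fx; apply/aclP; have := algebraic_id (@sfval _ _ hF) (sfin hF Fx).
Qed.

Lemma acl_sf : subfield (acl F).
Proof.
apply/subfieldP; split.
- by apply: sub_acl; exact: (sf1 hF).
- by move=> x y /aclP hx /aclP hy; apply/aclP; exact: algebraic_sub.
- by move=> x y /aclP hx /aclP hy; apply/aclP; exact: algebraic_div.
Qed.

(** Over a field algebraic means integral, and integrality is transitive. *)
Lemma acl_root p x : pov (acl F) p -> p != 0 -> root p x -> acl F x.
Proof.
move=> hp p0 px; apply/aclP/integral_algebraic.
apply: (integral_root p0 px) => y /(nthP 0)[i _ <-].
by apply/integral_algebraic/aclP; exact: hp.
Qed.

End Pov.

Lemma acl_acl (T : fieldType) (F : set T) : subfield F -> acl (acl F) `<=` acl F.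
Proof.
move=> hF x [p /(povP (acl_sf hF)) hp /andP[p0 px]].
exact: (acl_root hF hp p0 px).
Qed.

Lemma acl_mono (T : fieldType) (F G : set T) : F `<=` G -> acl F `<=` acl G.
Proof.
move=> FG x [p /(all_nthP 0) hp px]; exists p => //.
by apply/(all_nthP 0) => i lt; apply: mem_set; apply: FG; exact: (set_mem (hp i lt)).
Qed.

Lemma aclI (T : fieldType) (F : set T) p x :
  pov F p -> p != 0 -> root p x -> acl F x.
Proof.
move=> hp p0 px; exists p; last by rewrite p0.
by apply/(all_nthP 0) => i _; apply: mem_set; exact: hp.
Qed.

Section Adjoin.
Variables (T : fieldType).
Implicit Types (F G A B : set T) (x y z : T).

Lemma smallest_sf A : subfield (smallest (@subfield T) A).
Proof.
apply/subfieldP; split.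
- by move=> M [hM _]; exact: (sf1 hM).
- by move=> x y hx hy M hM; case: (hM) => h _; apply: (sfB h); [apply: hx|apply: hy].
- by move=> x y hx hy M hM; case: (hM) => h _; apply: (sfdiv h); [apply: hx|apply: hy].
Qed.
Lemma adjoin_sf F A : subfield (adjoin F A). Proof. exact: smallest_sf. Qed.
Lemma sub_adjoinl F A : F `<=` adjoin F A.
Proof. by move=> x Fx M [_ h]; apply: h; left. Qed.
Lemma sub_adjoinr F A : A `<=` adjoin F A.
Proof. by move=> x Fx M [_ h]; apply: h; right. Qed.
Lemma adjoin_min F A G : subfield G -> F `<=` G -> A `<=` G -> adjoin F A `<=` G.
Proof. by move=> hG FG AG x; apply; split => // y [/FG|/AG]. Qed.
Lemma adjoin_mono F A F' A' : F `<=` F' -> A `<=` adjoin F' A' -> adjoin F A `<=` adjoin F' A'.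
Proof.
move=> FF AA; apply: adjoin_min => //; first exact: adjoin_sf.
by move=> x /FF; exact: sub_adjoinl.
Qed.

Lemma adjoin_fin F A x : adjoin F A x ->
  exists2 s : seq T, (forall y, y \in s -> A y) & adjoin F [set` s] x.
Proof.
apply: (@adjoin_min F A [set x | exists2 s : seq T, (forall y, y \in s -> A y) &
  adjoin F [set` s] x]) => /=; last 2 first.
- by move=> y Fy; exists [::] => //; exact: sub_adjoinl.
- move=> y Ay; exists [:: y] => [z|]; first by rewrite inE => /eqP ->.
  by apply: sub_adjoinr => /=; rewrite inE.
have mon s1 s2 : adjoin F [set` s1] `<=` adjoin F [set` s1 ++ s2].
  apply: adjoin_mono => // z /= zs; apply: sub_adjoinr => /=.
  by rewrite mem_cat zs.
have mon' s1 s2 : adjoin F [set` s2] `<=` adjoin F [set` s1 ++ s2].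
  apply: adjoin_mono => // z /= zs; apply: sub_adjoinr => /=.
  by rewrite mem_cat zs orbT.
apply/subfieldP; split.
- by exists [::] => //; exact: (sf1 (adjoin_sf _ _)).
- move=> y z [s1 h1 e1] [s2 h2 e2]; exists (s1 ++ s2).
    by move=> w; rewrite mem_cat => /orP[/h1|/h2].
  by apply: (sfB (adjoin_sf _ _)); [apply: mon|apply: mon'].
- move=> y z [s1 h1 e1] [s2 h2 e2]; exists (s1 ++ s2).
    by move=> w; rewrite mem_cat => /orP[/h1|/h2].
  by apply: (sfdiv (adjoin_sf _ _)); [apply: mon|apply: mon'].
Qed.

Lemma adjoin1P F x z : subfield F -> adjoin F [set x] z ->
  exists u v, [/\ pov F u, pov F v, v.[x] != 0 & z = u.[x] / v.[x]].
Proof.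
move=> hF; apply: (@adjoin_min F [set x] [set z | exists u v,
  [/\ pov F u, pov F v, v.[x] != 0 & z = u.[x] / v.[x]]]) => /=; last 2 first.
- move=> y Fy; exists y%:P, 1%:P; split; try exact: (povC hF).
  + by apply: (povC hF); exact: (sf1 hF).
  + by rewrite hornerC oner_neq0.
  + by rewrite !hornerC divr1.
- move=> _ ->; exists 'X, 1%:P; split; first exact: (povX hF).
  + by apply: (povC hF); exact: (sf1 hF).
  + by rewrite hornerC oner_neq0.
  + by rewrite hornerX hornerC divr1.
apply/subfieldP; split.
- exists 1%:P, 1%:P; rewrite !hornerC divr1 oner_neq0.
  by split=> //; apply: (povC hF); exact: (sf1 hF).
- move=> _ _ [u [v [hu hv v0 ->]]] [u' [v' [hu' hv' v0' ->]]].
  exists (u * v' - u' * v), (v * v'); split.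
  + by apply: (povD hF); last apply: (povN hF); apply: (povM hF).
  + exact: (povM hF).
  + by rewrite hornerM mulf_neq0.
  + by rewrite !hornerE -mulNr addf_div // mulNr.
- move=> _ _ [u [v [hu hv v0 ->]]] [u' [v' [hu' hv' v0' ->]]].
  have [u0|u0] := eqVneq u'.[x] 0.
    exists 0, v; split => //; first exact: (pov0 hF).
    by rewrite u0 mul0r invr0 mulr0 horner0 mul0r.
  exists (u * v'), (v * u'); split; try exact: (povM hF).
    by rewrite hornerM mulf_neq0.
  by rewrite !hornerE invf_div mulf_div.
Qed.

Lemma common_den F x (p : {poly T}) : subfield F -> pov (adjoin F [set x]) p ->
  exists v (w : nat -> {poly T}), [/\ pov F v, v.[x] != 0, forall i, pov F (w i) &
    forall i, v.[x] * p`_i = (w i).[x]].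
Proof.
move=> hF hp.
have /choice[f hf] : forall i, exists uv : {poly T} * {poly T},
  [/\ pov F uv.1, pov F uv.2, uv.2.[x] != 0 & p`_i = uv.1.[x] / uv.2.[x]].
  by move=> i; have [u [v h]] := adjoin1P hF (hp i); exists (u, v).
pose v := \prod_(i < size p) (f i).2.
exists v, (fun i => if (i < size p)%N then (f i).1 * \prod_(j < size p | j != i :> nat) (f j).2 else 0).
split.
- by apply: (pov_prod hF) => i; case: (hf i).
- rewrite horner_prod; apply/prodf_neq0 => i _; by case: (hf i).
- move=> i; case: ifP => _; last exact: (pov0 hF).
  apply: (povM hF); first by case: (hf i).
  rewrite big_mkcond /=; apply: (pov_prod hF) => j; case: ifP => _; first by case: (hf j).
  by apply: (povC hF); exact: (sf1 hF).
- move=> i; case: ltnP => [lt|ge]; last by rewrite nth_default // mulr0 horner0.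
  have [_ _ n0 ->] := hf i.
  rewrite /v (bigD1 (Ordinal lt)) //= hornerM hornerM.
  by rewrite [RHS]mulrC mulrAC mulrCA mulfV // mulr1 mulrC.
Qed.

Lemma acl_exchange F x y : subfield F -> ~ acl F y ->
  acl (adjoin F [set x]) y -> acl (adjoin F [set y]) x.
Proof.
move=> hF ny [p /(povP (adjoin_sf _ _)) hp /andP[p0 py]].
have [v [w [hv v0 hw hvw]]] := common_den hF hp.
have hFy := adjoin_sf F [set y].
have Fy : adjoin F [set y] y by exact: sub_adjoinr.
have FF : F `<=` adjoin F [set y] by exact: sub_adjoinl.
(* the coefficients of the bivariate relation, read as a polynomial in x over F(y) *)
pose q := \sum_(i < size p) (y ^+ i) *: w i.
have s0 : (0 < size p)%N by rewrite size_poly_gt0.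
have hq : pov (adjoin F [set y]) q.
  move=> j; rewrite coef_sum; apply: (sf_sum hFy) => i _; rewrite coefZ.
  by apply: (sfM hFy); [apply: (sfX hFy)|apply: FF; apply: hw].
apply: (aclI hq).
- apply/eqP => q0; apply: ny.
  (* If q vanished, the coefficients of some X^j in the [w i] would form a nonzero polynomial over F
     with root y. *)
  have [j [i nz]] : exists j, exists i : 'I_(size p), (w i)`_j != 0.
    apply: contrapT => h; move: p0; rewrite -lead_coef_eq0 => /eqP; apply.
    have wi0 : w (size p).-1 = 0.
      apply/polyP => j; rewrite coef0; apply: contrapT => /eqP n0; apply: h; exists j.
      have lt : ((size p).-1 < size p)%N by rewrite prednK.
      by exists (Ordinal lt).
    have := hvw (size p).-1; rewrite wi0 horner0 => /eqP.
    by rewrite mulf_eq0 (negbTE v0) => /eqP.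
  apply: (@aclI _ _ (\poly_(i < size p) (w i)`_j)).
  + move=> k; rewrite coef_poly; case: ifP => _; [exact: hw|exact: (sf0 hF)].
  + apply/eqP => /polyP/(_ i); rewrite coef_poly ltn_ord coef0 => e; by rewrite e eqxx in nz.
  + rewrite /root horner_poly; apply/eqP.
    have : q`_j = 0 by rewrite q0 coef0.
    rewrite coef_sum => e; rewrite -[RHS]e.
    by apply: eq_bigr => k _; rewrite coefZ mulrC.
- rewrite /root horner_sum.
  rewrite (eq_bigr (fun i : 'I_(size p) => v.[x] * (p`_i * y ^+ i))); last first.
    by move=> i _; rewrite hornerZ -hvw mulrC mulrA.
  by rewrite -mulr_sumr -horner_coef; move: py => /eqP ->; rewrite mulr0.
Qed.

End Adjoin.

(** * Derivations and linear disjointness *)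

Section Derivations.
Variables (T : fieldType) (d : T -> T).
Hypothesis hd : derivation d.

Lemma derD x y : d (x + y) = d x + d y. Proof. by case: hd => h _; apply: h. Qed.
Lemma derM x y : d (x * y) = d x * y + x * d y. Proof. by case: hd => _. Qed.
Lemma der0 : d 0 = 0.
Proof. by apply: (addrI (d 0)); rewrite -derD !addr0. Qed.
Lemma derN x : d (- x) = - d x.
Proof. by apply: (addrI (d x)); rewrite -derD !subrr der0. Qed.
Lemma derB x y : d (x - y) = d x - d y. Proof. by rewrite derD derN. Qed.
Lemma der1 : d 1 = 0.
Proof. by apply: (addrI (d 1)); rewrite addr0 -[in RHS](mulr1 1) derM mulr1 mul1r. Qed.
Lemma der_sum (I : Type) (r : seq I) (P : pred I) (E : I -> T) :
  d (\sum_(i <- r | P i) E i) = \sum_(i <- r | P i) d (E i).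
Proof. by apply: (big_morph d); [exact: derD|exact: der0]. Qed.
Lemma derMn x n : d (x *+ n) = d x *+ n.
Proof. by elim: n => [|n IH]; rewrite ?mulr0n ?der0 // !mulrS derD IH. Qed.
Lemma dernat n : d n%:R = 0. Proof. by rewrite derMn der1 mul0rn. Qed.
Lemma derX x n : d (x ^+ n.+1) = d x * x ^+ n *+ n.+1.
Proof.
elim: n => [|n IH]; first by rewrite expr1 expr0 mulr1.
by rewrite exprS derM IH mulrnAr mulrCA -exprS [RHS]mulrS.
Qed.
Lemma derV x : x != 0 -> d x^-1 = - d x / x ^+ 2.
Proof.
move=> x0; have : d (x * x^-1) = 0 by rewrite mulfV // der1.
rewrite derM => /eqP; rewrite addr_eq0 => /eqP e.
apply: (mulfI x0); rewrite -[LHS]opprK -e; by field.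
Qed.
Lemma der_div x y : y != 0 -> d (x / y) = (d x * y - x * d y) / y ^+ 2.
Proof.
by move=> y0; rewrite derM derV //; field.
Qed.
Lemma der_stable_smallest (A : set T) :
  (forall x, A x -> smallest (@subfield T) A (d x)) ->
  forall x, smallest (@subfield T) A x -> smallest (@subfield T) A (d x).
Proof.
move=> h x hx; have hS := smallest_sf A.
suff : [set x | smallest (@subfield T) A x /\ smallest (@subfield T) A (d x)] x by case.
apply: hx; split; last by move=> y Ay; split; [move=> M [_]; apply|apply: h].
apply/subfieldP; split.
- by split; rewrite ?der1; [exact: (sf1 hS)|exact: (sf0 hS)].
- by move=> y z [hy dy] [hz dz]; split; rewrite ?derB; apply: (sfB hS).
- move=> y z [hy dy] [hz dz]; split; first exact: (sfdiv hS).
  have [->|z0] := eqVneq z 0; first by rewrite invr0 mulr0 der0; exact: (sf0 hS).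
  by rewrite der_div //; sfa hS.
Qed.
Lemma der_adjoin (F A : set T) :
  (forall x, F x -> adjoin F A (d x)) -> (forall x, A x -> adjoin F A (d x)) ->
  forall x, adjoin F A x -> adjoin F A (d x).
Proof. by move=> h1 h2; apply: der_stable_smallest => x [/h1|/h2]. Qed.
Lemma constants_sf F : subfield F -> subfield (constants d F).
Proof.
move=> hF; apply/subfieldP; split.
- by split; [exact: (sf1 hF)|exact: der1].
- by move=> x y [Fx /= dx] [Fy /= dy]; split; [exact: (sfB hF)|rewrite /= derB dx dy subrr].
- move=> x y [Fx /= dx] [Fy /= dy]; split; first exact: (sfdiv hF).
  have [->|y0] := eqVneq y 0; first by rewrite /= invr0 mulr0 der0.
  by rewrite /= der_div // dx dy mul0r mulr0 subrr mul0r.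
Qed.

End Derivations.

(** * Linear algebra over subfields, and descent of linear relations along derivations *)

Section LinearAlgebra.
Variables (T : fieldType).
Implicit Types (F G Q : set T).

(** The family is indexed by a subset of a finite type, so repeated vectors are allowed and a
    maximal free A can be extracted from any family. *)
Definition lfree F (I : finType) (A : {set I}) (v : I -> T) :=
  forall c : I -> T, (forall i, F (c i)) -> \sum_(i in A) c i * v i = 0 ->
  forall i, i \in A -> c i = 0.

Lemma lfree_max F (I : finType) (v : I -> T) : subfield F ->
  exists A : {set I}, lfree F A v /\
    forall j, exists2 c : I -> T, forall i, F (c i) & v j = \sum_(i in A) c i * v i.
Proof.
move=> hF; pose P := fun A : {set I} => `[< lfree F A v >].
have P0 : P finset.set0 by apply/asboolP => c _ _ i; rewrite finset.in_set0.
have [A /asboolP PA maxA] := arg_maxnP (fun A : {set I} => #|A|) P0.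
exists A; split => // j; have [jA|jA] := boolP (j \in A).
  exists (fun i => if i == j then 1 else 0).
    by move=> i; case: ifP => _; [exact: (sf1 hF)|exact: (sf0 hF)].
  rewrite (bigD1 j) //= eqxx mul1r big1 ?addr0 // => i /andP[_ /negbTE ->].
  by rewrite mul0r.
have : ~ lfree F (j |: A)%SET v.
  move=> h; have Pj : P (j |: A)%SET by apply/asboolP.
  by have := maxA _ Pj; rewrite cardsU1 jA add1n /= ltnn.
move=> /existsNP[c /not_implyP[hc /not_implyP[]]].
rewrite big_setU1 //= => s0 /existsNP[i /not_implyP[]].
have [cj0 iA ci0|cj0 _ _] := eqVneq (c j) 0.
  exfalso; apply: ci0; move: s0; rewrite cj0 mul0r add0r => s0.
  by move: iA; rewrite finset.in_setU1 => /orP[/eqP -> //|]; exact: PA.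
exists (fun i => - (c i / c j)); first by move=> k; sfa hF; apply: hc.
move: s0 => /eqP; rewrite addr_eq0 => /eqP s0.
apply: (mulfI cj0); rewrite s0 mulr_sumr -sumrN; apply: eq_bigr => k _.
by rewrite mulrA mulrN mulrCA mulfV // mulr1 mulNr.
Qed.

Lemma underdetermined F (I J : finType) (A : I -> J -> T) : subfield F ->
  (forall i j, F (A i j)) -> (#|I| < #|J|)%N ->
  exists c : J -> T, [/\ forall j, F (c j), exists j, c j != 0 &
    forall i, \sum_j A i j * c j = 0].
Proof.
move=> hF hA lt.
pose M : 'M[sftype hF]_(#|J|, #|I|) := \matrix_(a, b) sfin hF (hA (enum_val b) (enum_val a)).
have k0 : kermx M != 0.
  rewrite -mxrank_eq0 mxrank_ker subn_eq0 -ltnNge.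
  exact: leq_ltn_trans (rank_leq_col _) lt.
have [a ra] : exists a, row a (kermx M) != 0.
  apply/existsP; rewrite -negb_forall; apply: contra k0 => /forallP h.
  by apply/eqP/row_matrixP => a; rewrite row0; apply/eqP.
exists (fun j => sfval (row a (kermx M) 0 (enum_rank j))); split.
- by move=> j; exact: sfvalP.
- have [b hb] : exists b, row a (kermx M) 0 b != 0.
    apply/existsP; rewrite -negb_forall; apply: contra ra => /forallP h.
    by apply/eqP/matrixP => x y; rewrite !ord1 [RHS]mxE; apply/eqP.
  exists (enum_val b); rewrite enum_valK; apply: contra hb => /eqP h.
  by apply/eqP; apply: (@sfval_inj _ _ hF); rewrite h rmorph0.
- move=> i; have : row a (kermx M) *m M = 0 by rewrite -row_mul mulmx_ker row0.
  move=> /matrixP/(_ 0 (enum_rank i)); rewrite mxE [RHS]mxE => /(congr1 (@sfval _ _ hF)).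
  rewrite rmorph_sum rmorph0 => e; rewrite -[RHS]e.
  rewrite (reindex (@enum_rank J)); last by apply/onW_bij; exact: enum_rank_bij.
  apply: eq_bigr => j _; rewrite rmorphM mulrC !mxE; congr (_ * _).
  by rewrite [RHS]sfinK !enum_rankK.
Qed.

(** The image of the tensor product of F and G in T, that is the ring generated by the two
    fields. *)
Definition ten F G x := exists2 s : seq (T * T),
  forall p, p \in s -> F p.1 /\ G p.2 & x = \sum_(p <- s) p.1 * p.2.

Section Ten.
Variables (F G : set T) (hF : subfield F) (hG : subfield G).

Lemma ten_l x : F x -> ten F G x.
Proof.
move=> Fx; exists [:: (x, 1)]; last by rewrite big_seq1 mulr1.
by move=> p; rewrite inE => /eqP -> /=; split => //; exact: (sf1 hG).
Qed.
Lemma ten_r x : G x -> ten F G x.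
Proof.
move=> Gx; exists [:: (1, x)]; last by rewrite big_seq1 mul1r.
by move=> p; rewrite inE => /eqP -> /=; split => //; exact: (sf1 hF).
Qed.
Lemma tenD x y : ten F G x -> ten F G y -> ten F G (x + y).
Proof.
move=> [s hs ->] [t ht ->]; exists (s ++ t); last by rewrite big_cat.
by move=> p; rewrite mem_cat => /orP[/hs|/ht].
Qed.
Lemma tenM x y : ten F G x -> ten F G y -> ten F G (x * y).
Proof.
move=> [s hs ->] [t ht ->]; exists [seq (p.1 * q.1, p.2 * q.2) | p <- s, q <- t].
  move=> p /allpairsP[[a b] [/= /hs[Fa Ga] /ht[Fb Gb] ->]].
  by split; [exact: (sfM hF)|exact: (sfM hG)].
rewrite big_allpairs_dep /= mulr_suml; apply: eq_bigr => p _.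
by rewrite mulr_sumr; apply: eq_bigr => q _; rewrite mulrACA.
Qed.
Lemma tenN x : ten F G x -> ten F G (- x).
Proof.
move=> hx; rewrite -mulN1r; apply: tenM => //; apply: ten_l.
by apply: (sfN hF); exact: (sf1 hF).
Qed.
Lemma compositumP x : adjoin F G x ->
  exists P S : T, [/\ ten F G P, ten F G S, S != 0 & x = P / S].
Proof.
have t1 : ten F G 1 by apply: ten_l; exact: (sf1 hF).
apply: (@adjoin_min T F G [set x | exists P S : T,
  [/\ ten F G P, ten F G S, S != 0 & x = P / S]]) => /=; last 2 first.
- by move=> y Fy; exists y, 1; rewrite divr1 oner_neq0; split => //; exact: ten_l.
- by move=> y Fy; exists y, 1; rewrite divr1 oner_neq0; split => //; exact: ten_r.
apply/subfieldP; split.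
- by exists 1, 1; rewrite divr1 oner_neq0; split.
- move=> _ _ [P [S [hP hS S0 ->]]] [P' [S' [hP' hS' S0' ->]]].
  exists (P * S' - P' * S), (S * S'); split.
  + by apply: tenD; last apply: tenN; exact: tenM.
  + exact: tenM.
  + by rewrite mulf_neq0.
  + by rewrite -mulNr addf_div // mulNr.
- move=> _ _ [P [S [hP hS S0 ->]]] [P' [S' [hP' hS' S0' ->]]].
  have [->|P0'] := eqVneq P' 0.
    exists 0, 1; split; rewrite ?oner_neq0 //; first by apply: ten_l; exact: (sf0 hF).
    by rewrite mul0r invr0 mulr0 mul0r.
  exists (P * S'), (S * P'); split; rewrite ?mulf_neq0 //; try exact: tenM.
  by rewrite invf_div mulf_div.
Qed.

Lemma ten_sub : ten F G `<=` adjoin F G.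
Proof.
move=> x [s hs ->]; have h := adjoin_sf F G.
rewrite big_seq; apply: (sf_sum h) => p /hs[Fp Gp].
by apply: (sfM h); [exact: sub_adjoinl|exact: sub_adjoinr].
Qed.

(* Both elements are expanded over one family of G, independent over K. *)
Lemma ten_free2 K x y : subfield K -> K `<=` F -> ten F G x -> ten F G y ->
  exists (J : finType) (A : {set J}) (m a b : J -> T),
    [/\ forall j, G (m j), lfree K A m, forall j, F (a j) /\ F (b j),
        x = \sum_(j in A) a j * m j & y = \sum_(j in A) b j * m j].
Proof.
move=> hK KF [s hs ->] [t ht ->].
pose J := 'I_(size (s ++ t)); pose m (j : J) := (nth (0, 0) (s ++ t) j).2.
have Gm j : G (m j).
  rewrite /m; have := mem_nth (0, 0) (ltn_ord j); rewrite mem_cat.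
  by move=> /orP[/hs[]|/ht[]].
have [A [hA span]] := lfree_max m hK.
have /choice[c hc] : forall j, exists c : J -> T, (forall i, K (c i)) /\ m j = \sum_(i in A) c i * m i.
  by move=> j; have [c h1 h2] := span j; exists c.
have key (u : seq (T * T)) : (forall p, p \in u -> F p.1 /\ exists j, p.2 = m j) ->
    exists2 a : J -> T, forall j, F (a j) & \sum_(p <- u) p.1 * p.2 = \sum_(j in A) a j * m j.
  elim: u => [|p u IH] h.
    exists (fun=> 0); first by move=> j; exact: (sf0 hF).
    by rewrite big_nil big1 // => j _; rewrite mul0r.
  have [a Fa e] := IH (fun q qu => h q (@mem_behead _ (p :: u) q qu)).
  have [Fp [j pj]] := h p (mem_head _ _).
  exists (fun i => p.1 * c j i + a i).
    by move=> i; apply: (sfD hF) => //; apply: (sfM hF) => //; apply: KF; case: (hc j).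
  rewrite big_cons e pj; case: (hc j) => _ {1}->; rewrite mulr_sumr -big_split /=.
  by apply: eq_bigr => i _; rewrite mulrDl mulrA.
have [a Fa ea] : exists2 a : J -> T, forall j, F (a j) & \sum_(p <- s) p.1 * p.2 = \sum_(j in A) a j * m j.
  apply: key => p ps; split; first by case: (hs p ps).
  have lt : (index p (s ++ t) < size (s ++ t))%N by rewrite index_mem mem_cat ps.
  by exists (Ordinal lt); rewrite /m nth_index // mem_cat ps.
have [b Fb eb] : exists2 b : J -> T, forall j, F (b j) & \sum_(p <- t) p.1 * p.2 = \sum_(j in A) b j * m j.
  apply: key => p ps; split; first by case: (ht p ps).
  have lt : (index p (s ++ t) < size (s ++ t))%N by rewrite index_mem mem_cat ps orbT.
  by exists (Ordinal lt); rewrite /m nth_index // mem_cat ps orbT.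
by exists J, A, m, a, b; split.
Qed.

End Ten.

Section Pivot.
Variables (Q : set T) (hQ : subfield Q) (J : finType) (Delta : set (T -> T)).
Hypothesis hD : forall d, Delta d -> derivation d.
Variable W : set (J -> T).
Hypothesis WQ : forall w j, W w -> Q (w j).
Hypothesis W0 : W (fun=> 0).
Hypothesis WL : forall w w' c, W w -> W w' -> Q c -> W (fun j => w j + c * w' j).
Hypothesis WD : forall d w, Delta d -> W w -> W (fun j => d (w j)).

(* A vector of minimal support with an entry 1 is killed by every derivation. *)
Lemma pivot w i0 : W w -> w i0 != 0 -> exists v i,
  [/\ W v, v i = 1, w i != 0, forall j, w j = 0 -> v j = 0
    & forall d j, Delta d -> d (v j) = 0].
Proof.
move=> Ww wi0.
pose P n := `[< exists v i, [/\ W v, v i != 0, forall j, w j = 0 -> v j = 0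
   & #|[set j | v j != 0]%SET| = n] >].
have exP : exists n, P n.
  by exists #|[set j | w j != 0]%SET|; apply/asboolP; exists w, i0; split.
case: (ex_minnP exP) => n /asboolP[v [i [Wv vi vw vn]]] min.
have Wu : W (fun j => v j / v i).
  have := WL W0 Wv (sfV hQ (WQ i Wv)).
  by congr W; apply: funext => j; rewrite add0r mulrC.
exists (fun j => v j / v i), i; split => //.
- by rewrite mulfV.
- by apply: contraNneq vi => /vw ->.
- by move=> j /vw ->; rewrite mul0r.
- move=> d j Dd; apply: contrapT => /eqP nz.
  have Pm : P #|[set j | d (v j / v i) != 0]%SET|.
    apply/asboolP; exists (fun j => d (v j / v i)), j; split => //.
    - exact: (WD Dd Wu).
    - by move=> k /vw ->; rewrite mul0r (der0 (hD Dd)).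
  have := min _ Pm; rewrite leqNgt => /negP; apply.
  rewrite -vn; apply: proper_card; apply/properP; split.
    apply/fintype.subsetP => k; rewrite !inE; apply: contra => /eqP ->.
    by rewrite mul0r (der0 (hD Dd)).
  by exists i; rewrite !inE ?vi // mulfV // (der1 (hD Dd)) eqxx.
Qed.

(** Subtracting [w i] times a pivot kills the entry i without enlarging the support, so induction on
    the support expresses w through vectors killed by all the derivations. *)
Lemma pivot_span w : W w -> exists r (c : 'I_r -> T) (v : 'I_r -> J -> T),
  [/\ forall p, Q (c p), forall p, W (v p), forall d p j, Delta d -> d (v p j) = 0
    & forall j, w j = \sum_p c p * v p j].
Proof.
have [n] := ubnP #|[set j | w j != 0]%SET|; elim: n w => // n IH w lt Ww.
have [w0|] := pselect (forall j, w j = 0).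
  exists 0%N, (fun=> 0), (fun _ _ => 0); split => //; try by case.
  - by move=> d [].
  - by move=> j; rewrite w0 big_ord0.
move=> /existsNP[i0 /eqP wi0].
have [v [i [Wv vi wi vw vD]]] := pivot Ww wi0.
have Wu := WL Ww Wv (sfN hQ (WQ i Ww)).
have [|r [c [u [cQ uW uD e]]]] := IH _ _ Wu.
  rewrite -ltnS; apply: leq_ltn_trans lt; apply: proper_card.
  apply/properP; split.
    apply/fintype.subsetP => k; rewrite !inE; apply: contra => /eqP wk.
    by rewrite wk vw // mulr0 addr0.
  by exists i; rewrite !inE ?wi // vi mulr1 subrr eqxx.
exists r.+1, (fun p => if unlift ord0 p is Some k then c k else w i),
  (fun p => if unlift ord0 p is Some k then u k else v); split.
- by move=> p; case: unliftP => [k _|_] //; exact: WQ.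
- by move=> p; case: unliftP.
- by move=> d p j Dd; case: unliftP => [k _|_]; [exact: uD|exact: vD].
- move=> j; rewrite big_ord_recl unlift_none.
  under eq_bigr do rewrite liftK.
  by rewrite -e mulNr addrCA subrr addr0.
Qed.

End Pivot.

Section Descent.
Variables (Q : set T) (hQ : subfield Q) (J : finType) (Delta : set (T -> T)).
Hypothesis hD : forall d, Delta d -> derivation d.
Hypothesis QD : forall d x, Delta d -> Q x -> Q (d x).

(* The relations over Q form a Delta-stable subspace. *)
Lemma descent_constants (a b : J -> T) :
  (forall d j, Delta d -> d (a j) = 0) -> (forall j, Q (b j)) ->
  (exists j, b j != 0) -> \sum_j b j * a j = 0 ->
  exists b' : J -> T, [/\ forall j, Q (b' j), forall d j, Delta d -> d (b' j) = 0,
    exists j, b' j != 0 & \sum_j b' j * a j = 0].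
Proof.
move=> aD bQ [i0 bi] e.
pose W : set (J -> T) := [set r | (forall j, Q (r j)) /\ \sum_j r j * a j = 0].
have [] := @pivot Q hQ J Delta hD W _ _ _ _ b i0 _ bi.
- by move=> w j [].
- split; first by move=> j; exact: (sf0 hQ).
  by rewrite big1 // => j _; rewrite mul0r.
- move=> w w' c [hw ew] [hw' ew'] Qc; split; first by move=> j; sfa hQ.
  under eq_bigr do rewrite mulrDl -mulrA.
  by rewrite big_split /= ew -mulr_sumr ew' mulr0 addr0.
- move=> d w Dd [hw ew]; split; first by move=> j; exact: QD.
  have /(congr1 d) := ew; rewrite (der_sum (hD Dd)) (der0 (hD Dd)) => ed.
  rewrite -[RHS]ed; apply: eq_bigr => j _.
  by rewrite (derM (hD Dd)) (aD d j Dd) mulr0 addr0.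
- by split.
- move=> v [i [[vQ ev] vi _ _ vD]]; exists v; split => //.
  by exists i; rewrite vi oner_neq0.
Qed.

(** The relations over Q satisfied by a form a Delta-stable space, hence so does its orthogonal W.
    This W is nonzero: expand a in a basis drawn from its own entries; each coordinate vector lies
    in W. As q is a relation of a, a pivot of W is orthogonal to q. *)
Lemma descent_invariants (q a : J -> T) :
  (forall d j, Delta d -> d (a j) = 0) -> (forall j, Q (q j)) ->
  (exists j, a j != 0) -> \sum_j a j * q j = 0 ->
  exists b : J -> T, [/\ forall j, Q (b j), forall d j, Delta d -> d (b j) = 0,
    exists j, b j != 0 & \sum_j b j * q j = 0].
Proof.
move=> aD qQ [j0 aj0] e.
have [A [hA span]] := lfree_max a hQ.
have /choice[m hm] : forall j, exists c : J -> T, (forall i, Q (c i)) /\ a j = \sum_(i in A) c i * a i.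
  by move=> j; have [c h1 h2] := span j; exists c.
have [i0 iA] : exists i0, i0 \in A.
  apply: contrapT => h; move: aj0; case: (hm j0) => _ ->.
  by rewrite big1 ?eqxx // => i iA; exfalso; apply: h; exists i.
pose W : set (J -> T) := [set b | (forall j, Q (b j)) /\
  forall r : J -> T, (forall j, Q (r j)) -> \sum_j a j * r j = 0 -> \sum_j b j * r j = 0].
have Wm : W (fun j => m j i0).
  split=> [j|r rQ er]; first by case: (hm j).
  have er' : \sum_(i in A) (\sum_j m j i * r j) * a i = 0.
    rewrite -[RHS]er; under eq_bigr do rewrite mulr_suml.
    rewrite exchange_big /=; apply: eq_bigr => j _; case: (hm j) => _ ej.
    by rewrite [in RHS]ej mulr_suml; apply: eq_bigr => i _; rewrite mulrAC.
  apply: (hA (fun i => \sum_j m j i * r j) _ er' _ iA) => i.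
  by apply: (sf_sum hQ) => j _; apply: (sfM hQ) => //; case: (hm j).
have mi0 : m i0 i0 != 0.
  apply/eqP => m0.
  have hc i : Q (m i0 i - (if i == i0 then 1 else 0)).
    by apply: (sfB hQ); [case: (hm i0)|case: ifP => _; [exact: (sf1 hQ)|exact: (sf0 hQ)]].
  have s0 : \sum_(i in A) (m i0 i - (if i == i0 then 1 else 0)) * a i = 0.
    under eq_bigr do rewrite mulrBl.
    rewrite sumrB; case: (hm i0) => _ <-.
    rewrite (bigD1 i0) //= eqxx mul1r big1 ?addr0 ?subrr // => i /andP[_ /negbTE ->].
    by rewrite mul0r.
  have := hA _ hc s0 i0 iA; rewrite m0 eqxx sub0r => /eqP.
  by rewrite oppr_eq0 oner_eq0.
have [] := @pivot Q hQ J Delta hD W _ _ _ _ _ i0 Wm mi0.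
- by move=> w j [].
- split; first by move=> j; exact: (sf0 hQ).
  by move=> r _ _; rewrite big1 // => j _; rewrite mul0r.
- move=> w w' c [hw ew] [hw' ew'] Qc; split; first by move=> j; sfa hQ.
  move=> r rQ er; under eq_bigr do rewrite mulrDl -mulrA.
  by rewrite big_split /= ew // -mulr_sumr ew' // mulr0 addr0.
- move=> d w Dd [hw ew]; split; first by move=> j; exact: QD.
  move=> r rQ er; have dd := hD Dd.
  have /(congr1 d) := ew r rQ er; rewrite (der_sum dd) (der0 dd).
  under eq_bigr do rewrite (derM dd).
  rewrite big_split /= [X in _ + X = _](ew (fun j => d (r j))) ?addr0 //.
    by move=> j; exact: QD.
  have /(congr1 d) := er; rewrite (der_sum dd) (der0 dd) => ed.
  by rewrite -[RHS]ed; apply: eq_bigr => j _; rewrite (derM dd) aD // mul0r add0r.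
- move=> v [i [[vQ ev] vi _ _ vD]]; exists v; split => //.
    by exists i; rewrite vi oner_neq0.
  exact: ev.
Qed.

End Descent.

End LinearAlgebra.

(** * Uniqueness of derivations on algebraic extensions *)

Section Uniqueness.
Variable T : fieldType.
Hypothesis char0 : [pchar T] =i pred0.

Lemma natr_neq0 n : n.+1%:R != 0 :> T.
Proof. by have /pcharf0P -> := char0. Qed.

Lemma mulrSn_eq0 (x : T) n : (x *+ n.+1 == 0) = (x == 0).
Proof. by rewrite -mulr_natr mulf_eq0 (negbTE (natr_neq0 n)) orbF. Qed.

(** A polynomial of least degree works: in characteristic zero its derivative is nonzero, and it is
    too small to vanish at x. *)
Lemma separable_root (F : set T) x : subfield F -> acl F x ->
  exists p, [/\ pov F p, p != 0, root p x & p^`().[x] != 0].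
Proof.
move=> hF ax.
pose P n := `[< exists p, [/\ pov F p, p != 0, root p x & size p = n] >].
have exP : exists n, P n.
  by have [p /(povP hF) hp /andP[p0 px]] := ax; exists (size p); apply/asboolP; exists p.
case: (ex_minnP exP) => n /asboolP[p [hp p0 px sp]] min.
exists p; split => //; apply/eqP => e.
have s2 : (1 < size p)%N by apply: (root_size_gt1 p0 px).
have dp0 : p^`() != 0.
  apply/eqP => /polyP/(_ (size p).-2); rewrite coef0 coef_deriv.
  have -> : (size p).-2.+1 = (size p).-1 by case: (size p) s2 => [|[|]].
  move=> /eqP; case es: (size p) s2 => [|[|m]] //= _.
  rewrite mulrSn_eq0; have := p0; rewrite -lead_coef_eq0 /lead_coef es /=.
  by move=> /negbTE ->.
have := min (size p^`()); have Pd : P (size p^`()).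
  by apply/asboolP; exists p^`(); split => //; [exact: (pov_deriv hF)|apply/eqP].
by move=> /(_ Pd); rewrite -sp leqNgt lt_size_deriv.
Qed.

Section Along.
Variables (T' : fieldType) (psi : {rmorphism T -> T'}) (eta : T -> T').
Hypothesis etaD : forall x y, eta (x + y) = eta x + eta y.
Hypothesis etaM : forall x y, eta (x * y) = eta x * psi y + psi x * eta y.

(** Applying [eta] to a separable equation of x isolates [eta x]. Derivations along a homomorphism
    are allowed because the defect [dstar D (psi x) - psi (D x)] of a specialization is of this
    kind. *)
Lemma along_zero (F : set T) : subfield F -> (forall x, F x -> eta x = 0) ->
  forall x, acl F x -> eta x = 0.
Proof.
move=> hF h x ax; have [p [hp p0 px dpx]] := separable_root hF ax.
have eta0 : eta 0 = 0 by apply: (addrI (eta 0)); rewrite -etaD !addr0.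
have eta1 : eta 1 = 0.
  by apply: (addrI (eta 1)); rewrite addr0 -[in RHS](mulr1 1) etaM rmorph1 mulr1 mul1r.
have etaX n : eta (x ^+ n.+1) = eta x * psi x ^+ n *+ n.+1.
  elim: n => [|n IH]; first by rewrite expr1 expr0 mulr1.
  by rewrite exprS etaM IH mulrnAr mulrCA -exprS rmorphXn [RHS]mulrS.
have key (q : {poly T}) : pov F q -> eta q.[x] = psi q^`().[x] * eta x.
  elim/poly_ind: q => [|q c IH] hq.
    by rewrite deriv0 horner0 eta0 rmorph0 mul0r.
  have hq' : pov F q by move=> i; have := hq i.+1; rewrite coefD coefMX coefC /= addr0.
  have hc : F c by have := hq 0%N; rewrite coefD coefMX coefC /= add0r.
  rewrite hornerMXaddC etaD (h c hc) addr0 etaM (IH hq') derivD derivM derivX derivC.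
  rewrite mulr1 addr0 hornerD hornerM hornerX rmorphD rmorphM mulrDl.
  by rewrite mulrAC.
have := key p hp; move: px => /eqP ->; rewrite eta0 => /esym/eqP.
by rewrite mulf_eq0 fmorph_eq0 (negbTE dpx) => /eqP.
Qed.

End Along.

Lemma der_zero_acl (d : T -> T) (F : set T) : derivation d ->
  subfield F -> (forall x, F x -> d x = 0) -> forall x, acl F x -> d x = 0.
Proof.
move=> h hF e; apply: (@along_zero T idfun d _ _ F) => //; first exact: (derD h).
exact: (derM h).
Qed.

Lemma der_horner (d : T -> T) p x : derivation d ->
  d p.[x] = (map_poly d p).[x] + p^`().[x] * d x.
Proof.
move=> h; have d0 := der0 h; elim/poly_ind: p => [|p c IH].
  by rewrite map_poly0 deriv0 !horner0 mul0r addr0.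
have -> : map_poly d (p * 'X + c%:P) = map_poly d p * 'X + (d c)%:P.
  apply/polyP => i; rewrite coef_map_id0 // !coefD !coefMX !coefC.
  by case: i => [|i] /=; rewrite ?add0r ?addr0 ?coef_map_id0.
rewrite !hornerMXaddC (derD h) (derM h) IH derivD derivM derivX derivC.
by rewrite mulr1 addr0 hornerD hornerM hornerX; ring.
Qed.

Lemma acl_der_stable (d : T -> T) (F : set T) : derivation d -> subfield F ->
  (forall x, F x -> acl F (d x)) -> forall x, acl F x -> acl F (d x).
Proof.
move=> h hF hd x ax; have [p [hp p0 px dpx]] := separable_root hF ax.
have hA := acl_sf hF.
have e : d x = - ((map_poly d p).[x] / p^`().[x]).
  have := der_horner p x h; move: px => /eqP ->; rewrite (der0 h) => /esym/eqP.
  rewrite addr_eq0 => /eqP ->.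
  by rewrite mulNr opprK mulrAC mulfV // mul1r.
rewrite e; apply: (sfN hA); apply: (sfdiv hA); apply: (pov_horner hA) => //.
- by move=> i; rewrite coef_map_id0 ?(der0 h) //; apply: hd.
- by move=> i; apply: (sub_acl hF); apply: (pov_deriv hF).
Qed.

End Uniqueness.

Lemma map_polyC0 (T : fieldType) (d : T -> T) c : d 0 = 0 ->
  map_poly d c%:P = (d c)%:P.
Proof. by move=> d0; apply/polyP => i; rewrite coef_map_id0 // !coefC; case: eqP. Qed.

(** * Extension of derivations to larger fields *)

Section Extension.
Variable T : fieldType.
Hypothesis char0 : [pchar T] =i pred0.

Definition deriv_on (Om : set T) (d : T -> T) :=
  [/\ forall x, Om x -> Om (d x),
      forall x y, Om x -> Om y -> d (x + y) = d x + d y &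
      forall x y, Om x -> Om y -> d (x * y) = d x * y + x * d y].

Lemma deriv_onT d : deriv_on setT d -> derivation d.
Proof. by case=> _ h1 h2; split => x y; [exact: h1|exact: h2]. Qed.

Section Graph.
Variables (Om : set T) (hOm : subfield Om).

(* A derivation is encoded by its graph, a subring of the dual numbers. *)
Definition pmul (p q : T * T) := (p.1 * q.1, p.1 * q.2 + p.2 * q.1).
Definition psub (p q : T * T) := (p.1 - q.1, p.2 - q.2).

(** The clause on (0, b) is single-valuedness, since X is closed under subtraction. *)
Definition graph_ring (X : set (T * T)) :=
  [/\ X (1, 0), forall p q, X p -> X q -> X (psub p q),
      forall p q, X p -> X q -> X (pmul p q),
      forall b, X (0, b) -> b = 0 & forall p, X p -> Om p.1 /\ Om p.2].

Lemma pmulC p q : pmul p q = pmul q p.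
Proof. by congr pair; rewrite /= ?[q.1 * _]mulrC ?[q.2 * _]mulrC // addrC mulrC. Qed.
Lemma pmulA p q r : pmul p (pmul q r) = pmul (pmul p q) r.
Proof. by congr pair; rewrite /= ?mulrA //; ring. Qed.
Lemma pmulBl p q r : pmul (psub p q) r = psub (pmul p r) (pmul q r).
Proof. by congr pair; rewrite /=; ring. Qed.

Section AdjoinGraph.
Variables (G : set T) (hG : subfield G) (d : T -> T).
Hypothesis GOm : G `<=` Om.
Hypothesis dOm : forall x, G x -> Om (d x).
Hypothesis dD : forall x y, G x -> G y -> d (x + y) = d x + d y.
Hypothesis dM : forall x y, G x -> G y -> d (x * y) = d x * y + x * d y.
Variables (x v : T).
Hypotheses (Omx : Om x) (Omv : Om v).

Let D (p : {poly T}) := (map_poly d p).[x] + p^`().[x] * v.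
Hypothesis wd : forall p, pov G p -> p.[x] = 0 -> D p = 0.

(** If x is to be sent to v, the chain rule leaves [D p] as the only possible value at p(x); by [wd]
    this value depends on p(x) alone. *)
Definition adjoin_graph : set (T * T) := [set q | exists2 p, pov G p & q = (p.[x], D p)].

Let d0 : d 0 = 0.
Proof.
have G0 := sf0 hG.
by apply: (addrI (d 0)); rewrite -dD // !addr0.
Qed.
Let dN y : G y -> d (- y) = - d y.
Proof. by move=> Gy; apply: (addrI (d y)); rewrite -dD ?subrr //; exact: (sfN hG). Qed.
Let d1 : d 1 = 0.
Proof.
have G1 := sf1 hG.
by apply: (addrI (d 1)); rewrite addr0 -[in RHS](mulr1 1) dM // mulr1 mul1r.
Qed.
Let dsum n (E : 'I_n -> T) : (forall i, G (E i)) -> d (\sum_i E i) = \sum_i d (E i).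
Proof.
elim: n E => [|n IH] E hE; first by rewrite !big_ord0.
rewrite !big_ord_recl dD // ?IH //.
by apply: (sf_sum hG).
Qed.
Let Dmul p q : pov G p -> pov G q -> D (p * q) = p.[x] * D q + D p * q.[x].
Proof.
move=> hp hq; rewrite /D.
have -> : map_poly d (p * q) = map_poly d p * q + p * map_poly d q.
  apply/polyP => i; rewrite coef_map_id0 // coefD !coefM dsum; last first.
    by move=> j; apply: (sfM hG).
  rewrite -big_split /=; apply: eq_bigr => j _.
  by rewrite dM // !coef_map_id0.
by rewrite derivM !hornerE; ring.
Qed.
Let Dsub p q : pov G p -> pov G q -> D (p - q) = D p - D q.
Proof.
move=> hp hq; rewrite /D.
have -> : map_poly d (p - q) = map_poly d p - map_poly d q.
  apply/polyP => i; rewrite coef_map_id0 // !coefB dD ?dN ?coef_map_id0 //.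
  exact: (sfN hG).
by rewrite derivB !hornerE; ring.
Qed.

Lemma adjoin_graph_ring : graph_ring adjoin_graph.
Proof.
split.
- exists 1%:P; first by apply: (povC hG); exact: (sf1 hG).
  by rewrite /D hornerC derivC horner0 mul0r addr0 map_polyC0 // d1 hornerC.
- move=> _ _ [p hp ->] [q hq ->]; exists (p - q).
    by apply: (povD hG) => //; exact: (povN hG).
  by rewrite /psub /= Dsub // hornerD hornerN.
- move=> _ _ [p hp ->] [q hq ->]; exists (p * q); first exact: (povM hG).
  by rewrite /pmul /= Dmul // hornerM.
- by move=> b [p hp [p0 ->]]; exact: wd.
- move=> _ [p hp ->] /=.
  have hp' : pov Om p by move=> i; apply: GOm.
  split; first exact: (pov_horner hOm).
  rewrite /D; apply: (sfD hOm).
    by apply: (pov_horner hOm) => // i; rewrite coef_map_id0 //; apply: dOm.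
  by apply: (sfM hOm) => //; apply: (pov_horner hOm) => //; exact: (pov_deriv hOm).
Qed.

Lemma adjoin_graph_base y : G y -> adjoin_graph (y, d y).
Proof.
move=> Gy; exists y%:P; first exact: (povC hG).
by rewrite /D derivC horner0 mul0r addr0 map_polyC0 // !hornerC.
Qed.

Lemma adjoin_graph_gen : adjoin_graph (x, v).
Proof.
exists 'X; first exact: (povX hG).
rewrite /D derivX hornerX hornerC mul1r.
have -> : map_poly d 'X = 0.
  by apply/polyP => i; rewrite coef_map_id0 // coefX coef0; case: eqP; rewrite ?d1 ?d0.
by rewrite horner0 add0r.
Qed.

End AdjoinGraph.

(** Zorn's lemma is run on the sets Y whose union with X is a graph ring, so that the empty chain is
    covered by X itself. *)
Lemma graph_max (X : set (T * T)) : graph_ring X -> exists M : set (T * T),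
  [/\ graph_ring M, X `<=` M & forall Y, graph_ring Y -> M `<=` Y -> Y `<=` M].
Proof.
move=> hX.
pose P (Y : set (T * T)) := graph_ring (Y `|` X).
have chain (F : set (set (T * T))) : F `<=` P -> total_on F subset ->
    P (\bigcup_(Y in F) Y).
  move=> FP tot.
  have two p q : (\bigcup_(Y in F) Y `|` X) p -> (\bigcup_(Y in F) Y `|` X) q ->
     (X p /\ X q) \/ exists2 Y, F Y & (Y `|` X) p /\ (Y `|` X) q.
    case=> [[Y FY Yp]|Xp] [[Z FZ Zq]|Xq].
    - right; have [YZ|ZY] := tot _ _ FY FZ.
        by exists Z => //; split; left => //; exact: YZ.
      by exists Y => //; split; left => //; exact: ZY.
    - by right; exists Y => //; split; [left|right].
    - by right; exists Z => //; split; [right|left].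
    - by left.
  have inc Y : F Y -> Y `|` X `<=` \bigcup_(Y in F) Y `|` X.
    by move=> FY p [Yp|Xp]; [left; exists Y|right].
  split.
  - by right; case: hX.
  - move=> p q hp hq; have [[Xp Xq]|[Y FY [Yp Yq]]] := two p q hp hq.
      by right; case: hX => _ h _ _ _; exact: h.
    by apply: (inc Y FY); case: (FP Y FY) => _ h _ _ _; exact: h.
  - move=> p q hp hq; have [[Xp Xq]|[Y FY [Yp Yq]]] := two p q hp hq.
      by right; case: hX => _ _ h _ _; exact: h.
    by apply: (inc Y FY); case: (FP Y FY) => _ _ h _ _; exact: h.
  - move=> b [[Y FY Yb]|Xb]; last by case: hX => _ _ _ h _; exact: h.
    by case: (FP Y FY) => _ _ _ h _; apply: h; left.
  - move=> p [[Y FY Yb]|Xb]; last by case: hX => _ _ _ _ h; exact: h.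
    by case: (FP Y FY) => _ _ _ _ h; apply: h; left.
have [A [PA maxA]] := Zorn_bigcup chain.
exists (A `|` X); split; [exact: PA|by move=> p Xp; right|].
move=> Y hY AY; apply: contrapT => nYA.
apply: (maxA (A `|` Y)); last first.
  rewrite /P; suff -> : A `|` Y `|` X = Y by [].
  apply/seteqP; split=> [p [[Ap|]|Xp]|p Yp] //; first by apply: AY; left.
    by apply: AY; right.
  by left; right.
split; first by move=> p; left.
by move=> h; apply: nYA => p Yp; left; apply: h; right.
Qed.

(** In characteristic zero a maximal graph is total on Om: a missing element either is
    transcendental over the domain and accepts any value, or is algebraic and its separable equation
    dictates the value. *)
Lemma graph_total (X : set (T * T)) : graph_ring X ->
  exists d, deriv_on Om d /\ forall p, X p -> d p.1 = p.2.
Proof.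
move=> hX; have [M [hM XM maxM]] := graph_max hX.
case: (hM) => M1 MB MM Mi MOm.
have M0 : M (0, 0).
  have := MB _ _ M1 M1; congr M.
  by rewrite /psub /= subrr subrr.
have MN p : M p -> M (- p.1, - p.2).
  by move=> Mp; have := MB _ _ M0 Mp; rewrite /psub /= !sub0r.
have MD p q : M p -> M q -> M (p.1 + q.1, p.2 + q.2).
  by move=> Mp Mq; have := MB _ _ Mp (MN _ Mq); rewrite /psub /= !opprK.
have uniq u v w : M (u, v) -> M (u, w) -> v = w.
  move=> h1 h2; have := MB _ _ h1 h2; rewrite /psub /= subrr => /Mi/eqP.
  by rewrite subr_eq0 => /eqP.
(* maximality makes the domain a field ... *)
have inv a b : M (a, b) -> a != 0 -> M (a^-1, - b / a ^+ 2).
  move=> Mab a0.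
  pose pw := fix pw n := if n is n'.+1 then pmul (a, b) (pw n') else (1, 0).
  have pw1 n : (pw n).1 = a ^+ n by elim: n => //= n ->; rewrite exprS.
  have Mpw n : M (pw n) by elim: n => //= n IH; apply: MM.
  have pwD n m : pw (n + m)%N = pmul (pw n) (pw m).
    elim: n => [|n IH]; first by rewrite /= /pmul /= !(mul1r, mulr1, mul0r, mulr0, addr0, add0r); case: (pw m).
    by rewrite addSn /= IH pmulA.
  (* The localization of M at the powers of (a, b), taken in the dual numbers, is again a graph
     ring. *)
  pose Y : set (T * T) := [set p | Om p.1 /\ Om p.2 /\ exists n, M (pmul p (pw n))].
  have shift p n m : M (pmul p (pw n)) -> M (pmul p (pw (n + m)%N)).
    by move=> h; rewrite pwD pmulA; apply: MM.
  have hY : graph_ring Y.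
    split.
    - split; first exact: (sf1 hOm); split; first exact: (sf0 hOm).
      by exists 0%N; rewrite /pmul /= !(mul1r, mulr1, mul0r, mulr0, addr0, add0r).
    - move=> p q [p1 [p2 [n hn]]] [q1 [q2 [m hm]]].
      do 2!(split; first exact: (sfB hOm)).
      exists (n + m)%N; rewrite pmulBl; apply: MB; first exact: shift.
      by rewrite addnC; exact: shift.
    - move=> p q [p1 [p2 [n hn]]] [q1 [q2 [m hm]]].
      split; first exact: (sfM hOm).
      split; first by apply: (sfD hOm); apply: (sfM hOm).
      exists (n + m)%N; rewrite pwD -pmulA [pmul q _]pmulA [pmul q _]pmulC.
      by rewrite -!pmulA pmulA; apply: MM.
    - move=> c [_ [_ [n]]]; rewrite /pmul /= mul0r mul0r add0r => /Mi/eqP.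
      by rewrite pw1 mulf_eq0 expf_eq0 (negbTE a0) andbF orbF => /eqP.
    - by move=> p [h1 [h2 _]].
  have MY : M `<=` Y.
    move=> p Mp; case: (MOm p Mp) => h1 h2; split => //; split => //.
    by exists 0%N; rewrite /pmul /= !(mul1r, mulr1, mul0r, mulr0, addr0, add0r); case: p Mp {h1 h2}.
  apply: (maxM Y hY MY); case: (MOm _ Mab) => /= Oa Ob.
  split; first exact: (sfV hOm); split; first by sfa hOm.
  exists 1%N; have -> : pmul (a^-1, - b / a ^+ 2) (pw 1%N) = (1, 0); last by [].
  by rewrite /pmul /= !(mul1r, mulr1, mul0r, mulr0, addr0, add0r); congr pair; field.
pose G : set T := [set u | exists w, M (u, w)].
have hG : subfield G.
  apply/subfieldP; split.
  - by exists 0.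
  - by move=> u w [u' hu] [w' hw]; exists (u' - w'); exact: (MB _ _ hu hw).
  - move=> u w [u' hu] [w' hw]; have [->|w0] := eqVneq w 0.
      by rewrite invr0 mulr0; exists 0.
    by have := MM _ _ hu (inv _ _ hw w0); rewrite /pmul /= => h; eexists; exact: h.
have /choice[d hd] : forall u, exists w, G u -> M (u, w).
  move=> u; have [[w Mw]|h] := pselect (G u); first by exists w.
  by exists 0.
have dD u w : G u -> G w -> d (u + w) = d u + d w.
  move=> Gu Gw; apply: (uniq (u + w)); first by apply: hd; exact: (sfD hG).
  exact: (MD _ _ (hd _ Gu) (hd _ Gw)).
have dM u w : G u -> G w -> d (u * w) = d u * w + u * d w.
  move=> Gu Gw; apply: (uniq (u * w)); first by apply: hd; exact: (sfM hG).
  have := MM _ _ (hd _ Gu) (hd _ Gw); rewrite /pmul /=.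
  by rewrite [X in (_, X)]addrC.
have GOm : G `<=` Om by move=> u [w /MOm[]].
have dOm u : G u -> Om (d u) by move=> /hd/MOm[].
have Gd p : M p -> d p.1 = p.2.
  case: p => u w Mp /=; apply: (uniq u) => //; apply: hd; by exists w.
(* ... and then all of Om. *)
suff GT : Om `<=` G.
  exists d; split; last by move=> p /XM/Gd.
  by split; [move=> u /GT/dOm|move=> u w /GT Gu /GT Gw; exact: dD|
             move=> u w /GT Gu /GT Gw; exact: dM].
move=> x Omx.
suff [v [Omv wd]] : exists v, Om v /\ forall p, pov G p -> p.[x] = 0 ->
    (map_poly d p).[x] + p^`().[x] * v = 0.
  have hY := adjoin_graph_ring hG GOm dOm dD dM Omx Omv wd.
  have MY : M `<=` adjoin_graph G d x v.
    move=> [u w] Mu; rewrite -[w](Gd _ Mu).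
    by apply: (adjoin_graph_base hG dD); exists w.
  by exists v; apply: (maxM _ hY MY); exact: (adjoin_graph_gen hG dD dM).
have d0 : d 0 = 0 by rewrite (Gd _ M0).
have [ax|nax] := pselect (acl G x); last first.
  exists 0; split; first exact: (sf0 hOm).
  move=> p hp px; suff -> : p = 0 by rewrite map_poly0 deriv0 !horner0 mul0r addr0.
  apply: contrapT => /eqP p0; apply: nax; apply: (aclI hp p0); exact/eqP.
have := ax; move=> /(aclP hG) [q0 q0n q0x].
pose f := @sfval _ _ hG.
(* A minimal polynomial of x over G. Every relation of x is a multiple of it, so the value it
   dictates is compatible with all of them. *)
have [q [q_n qx qmin]] : exists q : {poly sftype hG}, [/\ q != 0, root (map_poly f q) x
    & forall r : {poly sftype hG}, root (map_poly f r) x -> (size r < size q)%N -> r = 0].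
  pose P n := `[< exists q : {poly sftype hG}, [/\ q != 0, root (map_poly f q) x & size q = n] >].
  have exP : exists n, P n by exists (size q0); apply/asboolP; exists q0.
  case: (ex_minnP exP) => n /asboolP[q [q_n qx sq]] min.
  exists q; split => // r rx lt; apply: contrapT => /eqP r0.
  have Pr : P (size r) by apply/asboolP; exists r.
  by have := min _ Pr; rewrite -sq leqNgt lt.
set p := map_poly f q.
have hp : pov G p by exact: pov_map.
have p'x : p^`().[x] != 0.
  apply/eqP => e; have : q^`() = 0.
    by apply: qmin; rewrite ?lt_size_deriv // /root -deriv_map; apply/eqP.
  have s2 : (1 < size q)%N.
    have : (1 < size p)%N by apply: (root_size_gt1 _ qx); rewrite map_poly_eq0.
    by rewrite size_map_poly.
  move=> /polyP/(_ (size q).-2); rewrite coef0 coef_deriv.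
  have -> : (size q).-2.+1 = (size q).-1 by case: (size q) s2 => [|[|]].
  move=> /(congr1 (@sfval _ _ hG)); rewrite raddfMn raddf0.
  move=> /eqP; case es: (size q) s2 => [|[|m]] //= _.
  rewrite (mulrSn_eq0 char0) fmorph_eq0; have := q_n; rewrite -lead_coef_eq0 /lead_coef es /=.
  by move=> /negbTE ->.
have hpO : pov Om p by move=> i; exact: GOm.
exists (- ((map_poly d p).[x] / p^`().[x])); split.
  apply: (sfN hOm); apply: (sfdiv hOm); apply: (pov_horner hOm) => //.
    by move=> i; rewrite coef_map_id0 //; apply: dOm; exact: hp.
  exact: (pov_deriv hOm).
set v := - _ => r hr rx.
have pv : (map_poly d p).[x] + p^`().[x] * v = 0.
  by rewrite /v mulrN mulrCA mulfV // mulr1 subrr.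
have [r1 er] := pov_lift hG hr.
have e1 : r1 = r1 %/ q * q.
  rewrite {1}(divp_eq r1 q); suff -> : r1 %% q = 0 by rewrite addr0.
  apply: qmin; last by rewrite ltn_modp.
  have := rx; rewrite er {1}(divp_eq r1 q) rmorphD rmorphM hornerD hornerM.
  by move: qx => /eqP ->; rewrite mulr0 add0r => /eqP.
have {er e1}-> : r = map_poly f (r1 %/ q) * p by rewrite er {1}e1 rmorphM.
set s := map_poly f _.
have hs : pov G s by exact: pov_map.
have dsum n (E : 'I_n -> T) : (forall i, G (E i)) -> d (\sum_i E i) = \sum_i d (E i).
  elim: n E => [|n IH] E hE; first by rewrite !big_ord0.
  by rewrite !big_ord_recl dD // ?IH //; apply: (sf_sum hG).
have -> : map_poly d (s * p) = map_poly d s * p + s * map_poly d p.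
  apply/polyP => i; rewrite coef_map_id0 // coefD !coefM dsum; last first.
    by move=> j; apply: (sfM hG).
  rewrite -big_split /=; apply: eq_bigr => j _.
  by rewrite dM // !coef_map_id0.
have px0 : p.[x] = 0 by apply/eqP.
rewrite derivM !hornerD !hornerM px0.
transitivity (s.[x] * ((map_poly d p).[x] + p^`().[x] * v)); first by ring.
by rewrite pv mulr0.
Qed.

End Graph.

Lemma der_extend (Om G : set T) (d : T -> T) x v : subfield Om -> subfield G ->
  G `<=` Om -> (forall a, G a -> Om (d a)) ->
  (forall a b, G a -> G b -> d (a + b) = d a + d b) ->
  (forall a b, G a -> G b -> d (a * b) = d a * b + a * d b) ->
  Om x -> ~ acl G x -> Om v ->
  exists d', [/\ deriv_on Om d', forall a, G a -> d' a = d a & d' x = v].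
Proof.
move=> hOm hG GOm dOm dD dM Omx nx Omv.
have wd p : pov G p -> p.[x] = 0 -> (map_poly d p).[x] + p^`().[x] * v = 0.
  move=> hp px; suff -> : p = 0 by rewrite map_poly0 deriv0 !horner0 mul0r addr0.
  by apply: contrapT => /eqP p0; apply: nx; apply: (aclI hp p0); exact/eqP.
have [d' [h1 h2]] := graph_total hOm (adjoin_graph_ring hOm hG GOm dOm dD dM Omx Omv wd).
exists d'; split => //.
  by move=> a Ga; apply: (h2 (a, d a)); exact: (adjoin_graph_base hG dD).
by apply: (h2 (x, v)); exact: (adjoin_graph_gen hG dD dM).
Qed.

End Extension.

(** * Embeddings into ultrapowers *)

Section Ultrapower.
Local Open Scope quotient_scope.
Local Open Scope ring_scope.
Local Open Scope classical_set_scope.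
Variables (T : fieldType) (J : Type) (U : set_system J).
Hypothesis hU : UltraFilter U.

Definition ueq (f g : J -> T) : bool := `[< U [set j | f j = g j] >].

Lemma ueq_equiv : equiv_class_of ueq.
Proof.
split.
- by move=> f; apply/asboolP; apply: filterE.
- move=> f g; apply/asboolP/asboolP; apply: filterS => j /= e; exact: esym.
- move=> g f h /asboolP h1 /asboolP h2; apply/asboolP.
  by apply: filterS (filterI h1 h2) => j /= [-> ->].
Qed.
Canonical ueq_rel := EquivRelPack ueq_equiv.

Definition upow := {eq_quot ueq_rel}.
Notation up := upow.
HB.instance Definition _ := Choice.on up.

Definition cls (f : J -> T) : up := (\pi_({eq_quot ueq_rel}) f)%qT.
Definition rep (x : up) : J -> T := repr (x : {eq_quot ueq_rel}).

Lemma repK x : cls (rep x) = x. Proof. exact: reprK. Qed.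
Lemma clsE f g : cls f = cls g <-> U [set j | f j = g j].
Proof. by split=> [/eqmodP/asboolP|h] //; apply/eqmodP/asboolP. Qed.
Lemma clsK f : U [set j | rep (cls f) j = f j].
Proof. by apply/clsE; rewrite repK. Qed.
Lemma clsS f g : (forall j, f j = g j) -> cls f = cls g.
Proof. by move=> h; apply/clsE; apply: filterE. Qed.

Definition uadd (x y : up) := cls (fun j => rep x j + rep y j).
Definition umul (x y : up) := cls (fun j => rep x j * rep y j).
Definition uopp (x : up) := cls (fun j => - rep x j).
Definition uinv (x : up) := cls (fun j => (rep x j)^-1).
Definition diag (x : T) : up := cls (fun=> x).

Lemma uaddE f g : uadd (cls f) (cls g) = cls (fun j => f j + g j).
Proof. by apply/clsE; apply: filterS (filterI (clsK f) (clsK g)) => j /= [-> ->]. Qed.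
Lemma umulE f g : umul (cls f) (cls g) = cls (fun j => f j * g j).
Proof. by apply/clsE; apply: filterS (filterI (clsK f) (clsK g)) => j /= [-> ->]. Qed.
Lemma uoppE f : uopp (cls f) = cls (fun j => - f j).
Proof. by apply/clsE; apply: filterS (clsK f) => j /= ->. Qed.
Lemma uinvE f : uinv (cls f) = cls (fun j => (f j)^-1).
Proof. by apply/clsE; apply: filterS (clsK f) => j /= ->. Qed.

Lemma up_ind (P : up -> Prop) : (forall f, P (cls f)) -> forall x, P x.
Proof. by move=> h x; rewrite -(repK x). Qed.

Fact uaddA : associative uadd.
Proof.
elim/up_ind=> f; elim/up_ind=> g; elim/up_ind=> h.
by rewrite !uaddE; apply: clsS => j; rewrite addrA.
Qed.
Fact uaddC : commutative uadd.
Proof. by elim/up_ind=> f; elim/up_ind=> g; rewrite !uaddE; apply: clsS => j; rewrite addrC. Qed.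
Fact uadd0 : left_id (diag 0) uadd.
Proof. by elim/up_ind=> f; rewrite !uaddE; apply: clsS => j; rewrite add0r. Qed.
Fact uaddN : left_inverse (diag 0) uopp uadd.
Proof. by elim/up_ind=> f; rewrite uoppE uaddE; apply: clsS => j; rewrite addNr. Qed.
HB.instance Definition _ := GRing.isZmodule.Build up uaddA uaddC uadd0 uaddN.

Fact umulA : associative umul.
Proof.
elim/up_ind=> f; elim/up_ind=> g; elim/up_ind=> h.
by rewrite !umulE; apply: clsS => j; rewrite mulrA.
Qed.
Fact umulC : commutative umul.
Proof. by elim/up_ind=> f; elim/up_ind=> g; rewrite !umulE; apply: clsS => j; rewrite mulrC. Qed.
Fact umul1 : left_id (diag 1) umul.
Proof. by elim/up_ind=> f; rewrite !umulE; apply: clsS => j; rewrite mul1r. Qed.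
Fact umulD : left_distributive umul uadd.
Proof.
elim/up_ind=> f; elim/up_ind=> g; elim/up_ind=> h.
by rewrite !(umulE, uaddE); apply: clsS => j; rewrite mulrDl.
Qed.
Fact u1n0 : diag 1 != diag 0.
Proof.
apply/eqP => /clsE /filter_ex[j /= /eqP]; by rewrite oner_eq0.
Qed.
HB.instance Definition _ :=
  GRing.Zmodule_isComNzRing.Build up umulA umulC umul1 umulD u1n0.

Fact umulV (x : up) : x != 0 -> uinv x * x = 1.
Proof.
elim/up_ind: x => f f0; rewrite uinvE [LHS]umulE; apply/clsE.
have [h|h] := in_ultra_setVsetC [set j | f j = 0] hU.
  by exfalso; move/eqP: f0; apply; apply/clsE.
by apply: filterS h => j /= /eqP h; rewrite mulVf.
Qed.
Fact uinv0 : uinv 0 = 0.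
Proof. by rewrite [LHS]uinvE; apply: clsS => j; rewrite invr0. Qed.
HB.instance Definition _ := GRing.ComNzRing_isField.Build up umulV uinv0.

Lemma clsD f g : cls f + cls g = cls (fun j => f j + g j). Proof. exact: uaddE. Qed.
Lemma clsN f : - cls f = cls (fun j => - f j). Proof. exact: uoppE. Qed.
Lemma clsB f g : cls f - cls g = cls (fun j => f j - g j).
Proof. by rewrite clsN clsD. Qed.
Lemma clsM f g : cls f * cls g = cls (fun j => f j * g j). Proof. exact: umulE. Qed.
Lemma clsV f : (cls f)^-1 = cls (fun j => (f j)^-1). Proof. exact: uinvE. Qed.
Lemma cls_sum (I : Type) (r : seq I) (P : pred I) (f : I -> J -> T) :
  \sum_(i <- r | P i) cls (f i) = cls (fun j => \sum_(i <- r | P i) f i j).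
Proof.
elim: r => [|i r IH]; first by rewrite big_nil; apply: clsS => j; rewrite big_nil.
rewrite big_cons IH; case: ifP => Pi; last by apply: clsS => j; rewrite big_cons Pi.
by rewrite clsD; apply: clsS => j; rewrite big_cons Pi.
Qed.
Lemma clsX f n : cls f ^+ n = cls (fun j => f j ^+ n).
Proof.
elim: n => [|n IH]; first by rewrite expr0; apply: clsS.
by rewrite exprS IH clsM; apply: clsS => j; rewrite exprS.
Qed.

Fact diagB : zmod_morphism diag.
Proof. by move=> x y; rewrite clsB. Qed.
HB.instance Definition _ := GRing.isZmodMorphism.Build T up diag diagB.
Fact diagM : monoid_morphism diag.
Proof. by split=> // x y; rewrite clsM. Qed.
HB.instance Definition _ := GRing.isMonoidMorphism.Build T up diag diagM.

(** The ultrapower of F inside that of T. Membership is read on the chosen representative; [starP]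
    removes the dependence on this choice. *)
Definition star (F : set T) : set up := [set x | U [set j | F (rep x j)]].

Lemma starP F f : star F (cls f) <-> U [set j | F (f j)].
Proof.
split=> h; first by apply: filterS (filterI (clsK f) h) => j /= [<-].
by apply: (filterS _ (filterI (clsK f) h)) => j /= [->].
Qed.

Lemma star_mono F G : F `<=` G -> star F `<=` star G.
Proof. by move=> FG x; apply: filterS => j; exact: FG. Qed.

Lemma starT x : star setT x. Proof. exact: filterE. Qed.

Lemma star_diag F x : star F (diag x) <-> F x.
Proof. by split=> [/starP/filter_ex[j]|Fx] //; apply/starP; apply: filterE. Qed.

Lemma star_notin F f : ~ star F (cls f) -> U [set j | ~ F (f j)].
Proof.
by move=> h; have [/(iffRL (starP F f))|] := in_ultra_setVsetC [set j | F (f j)] hU.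
Qed.

Lemma star_sf F : subfield F -> subfield (star F).
Proof.
move=> hF; apply/subfieldP; split.
- by apply/star_diag; exact: (sf1 hF).
- elim/up_ind=> f; elim/up_ind=> g /starP hf /starP hg; rewrite clsB; apply/starP.
  by apply: filterS (filterI hf hg) => j /= [h1 h2]; exact: (sfB hF).
- elim/up_ind=> f; elim/up_ind=> g /starP hf /starP hg; rewrite clsV clsM; apply/starP.
  by apply: filterS (filterI hf hg) => j /= [h1 h2]; exact: (sfdiv hF).
Qed.

(** A polynomial over the ultrapower is a family of polynomials of bounded size. At almost every
    index its coefficients lie in F and its leading coefficient l is nonzero; a root is chosen
    there, and 0 serves as the default elsewhere. *)
Lemma star_closed F : subfield F -> alg_closed F -> alg_closed (star F).
Proof.
move=> hF cF p /(povP (star_sf hF)) hp sp.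
pose q j := \poly_(i < size p) rep p`_i j.
pose l := rep (lead_coef p).
have l0 : U [set j | l j != 0].
  have [h|h] := in_ultra_setVsetC [set j | l j = 0] hU; last first.
    by apply: filterS h => j /= /eqP.
  exfalso; have : lead_coef p = 0 by rewrite -[LHS]repK; apply/clsE.
  by move/eqP; rewrite lead_coef_eq0 -size_poly_eq0; case: (size p) sp.
have hq : U [set j | forall i, F ((q j)`_i)].
  suff : U [set j | forall i : 'I_(size p), F (rep p`_i j)].
    apply: filterS => j /= h i; rewrite coef_poly; case: ltnP => [lt|_]; last exact: (sf0 hF).
    exact: (h (Ordinal lt)).
  have : forall i : nat, star F p`_i by [].
  elim: (size p) => [|n IH] h; first by apply: filterE => j [].
  apply: filterS (filterI (IH h) (h n)) => j /= [h1 h2] i.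
  have [e|ne] := eqVneq (i : nat) n; first by rewrite e.
  have lt : (i < n)%N by rewrite ltn_neqAle ne -ltnS ltn_ord.
  exact: (h1 (Ordinal lt)).
have /choice[r hr] : forall j, exists x, l j != 0 -> (forall i, F ((q j)`_i)) -> F x /\ root (q j) x.
  move=> j; have [/eqP lj|] := boolP (l j == 0); first by exists 0 => /eqP.
  move=> lj; have [hj|hj] := pselect (forall i, F ((q j)`_i)); last by exists 0.
  have hs : size (q j) = size p by apply: size_poly_eq; exact: lj.
  have [||x Fx qx] := cF (q j); first by apply/(povP hF).
    by rewrite hs.
  by exists x => _ _; split => //; exact: (set_mem Fx).
exists (cls r).
  apply: mem_set; apply/starP; apply: filterS (filterI l0 hq) => j [/= h1 h2].
  by case: (hr j h1 h2).
rewrite /root horner_coef; apply/eqP.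
under eq_bigr do rewrite -[p`__]repK clsX clsM.
rewrite cls_sum; apply/clsE; apply: filterS (filterI l0 hq) => j [/= h1 h2].
case: (hr j h1 h2) => _ /eqP; rewrite horner_coef => e; rewrite -[RHS]e.
have hs : size (q j) = size p by apply: size_poly_eq.
by rewrite hs; apply: eq_bigr => i _; rewrite coef_poly ltn_ord.
Qed.

(** This is the linear disjointness over F of the diagonal copy of T and [star F]: a relation with
    coefficients in [star F] is a relation over F at almost every index. *)
Lemma star_lfree F (I : finType) (A : {set I}) (m : I -> T) : subfield F ->
  lfree F A m -> lfree (star F) A (fun i => diag (m i)).
Proof.
move=> hF hA c hc; under eq_bigr do rewrite -[c _]repK clsM.
rewrite cls_sum => /clsE h i iA; rewrite -[LHS]repK; apply/clsE.
have hall : U [set j | forall i, F (rep (c i) j)].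
  suff : forall s : seq I, U [set j | forall i, i \in s -> F (rep (c i) j)].
    by move=> /(_ (enum I)); apply: filterS => j /= h' k; apply: h'; rewrite mem_enum.
  elim=> [|k s IH]; first by apply: filterE.
  apply: filterS (filterI IH (hc k)) => j /= [h1 h2] k'.
  by rewrite inE => /orP[/eqP ->|/h1].
by apply: filterS (filterI h hall) => j /= [h1 h2]; exact: (hA _ h2 h1).
Qed.

Definition dstar (d : T -> T) (x : up) := cls (fun j => d (rep x j)).

Lemma dstarE d f : dstar d (cls f) = cls (fun j => d (f j)).
Proof. by apply/clsE; apply: filterS (clsK f) => j /= ->. Qed.
Lemma dstar_diag d x : dstar d (diag x) = diag (d x). Proof. exact: dstarE. Qed.
Lemma dstar_der d : derivation d -> derivation (dstar d).
Proof.
move=> hd; split; elim/up_ind=> f; elim/up_ind=> g.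
  by rewrite clsD !dstarE clsD; apply: clsS => j; rewrite (derD hd).
by rewrite clsM !dstarE !clsM clsD; apply: clsS => j; rewrite (derM hd).
Qed.
Lemma dstar_star d F x : (forall a, F a -> F (d a)) -> star F x -> star F (dstar d x).
Proof.
move=> h; elim/up_ind: x => f /starP hf; rewrite dstarE; apply/starP.
by apply: filterS hf => j; exact: h.
Qed.

Lemma up_char0 : [pchar T] =i pred0 -> [pchar up] =i pred0.
Proof.
move=> h; apply/pcharf0P => n; rewrite -(rmorph_nat diag) fmorph_eq0.
by move/pcharf0P: h => ->.
Qed.

End Ultrapower.

(** * Homomorphisms of finitely generated rings into an algebraically closed field *)

Section Subrings.
Variable T : fieldType.

Definition sring (R : set T) := [/\ R 1, forall x y, R x -> R y -> R (x - y)
  & forall x y, R x -> R y -> R (x * y)].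

Lemma sf_sring F : subfield F -> sring F.
Proof. by move=> hF; split; [exact: sf1|exact: sfB|exact: sfM]. Qed.

Section Closure.
Variables (R : set T) (hR : sring R).
Lemma sr1 : R 1. Proof. by case: hR. Qed.
Lemma srB x y : R x -> R y -> R (x - y). Proof. by case: hR => _ h _; apply: h. Qed.
Lemma srM x y : R x -> R y -> R (x * y). Proof. by case: hR => _ _; apply. Qed.
Lemma sr0 : R 0. Proof. by rewrite -(subrr 1); apply: srB; exact: sr1. Qed.
Lemma srN x : R x -> R (- x).
Proof. by move=> h; rewrite -sub0r; apply: srB => //; exact: sr0. Qed.
Lemma srD x y : R x -> R y -> R (x + y).
Proof. by move=> hx hy; rewrite -[y]opprK; apply: srB => //; exact: srN. Qed.
Lemma srX x n : R x -> R (x ^+ n).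
Proof.
by move=> h; elim: n => [|n IH]; rewrite ?expr0 ?exprS; [exact: sr1|exact: srM].
Qed.
Lemma sr_sum (I : Type) (r : seq I) (P : pred I) (E : I -> T) :
  (forall i, P i -> R (E i)) -> R (\sum_(i <- r | P i) E i).
Proof. by move=> h; elim/big_ind: _ => //; [exact: sr0|exact: srD]. Qed.
Lemma sr_prod (I : Type) (r : seq I) (P : pred I) (E : I -> T) :
  (forall i, P i -> R (E i)) -> R (\prod_(i <- r | P i) E i).
Proof. by move=> h; elim/big_ind: _ => //; [exact: sr1|exact: srM]. Qed.
Lemma rpovC c : R c -> pov R c%:P.
Proof. by move=> h i; rewrite coefC; case: eqP => // _; exact: sr0. Qed.
Lemma rpovX : pov R 'X.
Proof. by move=> i; rewrite coefX; case: eqP => _; [exact: sr1|exact: sr0]. Qed.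
Lemma rpovB p q : pov R p -> pov R q -> pov R (p - q).
Proof. by move=> hp hq i; rewrite coefB; exact: srB. Qed.
Lemma rpovD p q : pov R p -> pov R q -> pov R (p + q).
Proof. by move=> hp hq i; rewrite coefD; exact: srD. Qed.
Lemma rpovM p q : pov R p -> pov R q -> pov R (p * q).
Proof. by move=> hp hq i; rewrite coefM; apply: sr_sum => j _; exact: srM. Qed.
Lemma rpov_horner p x : pov R p -> R x -> R p.[x].
Proof.
by move=> hp h; rewrite horner_coef; apply: sr_sum => i _; apply: srM => //; exact: srX.
Qed.

Lemma frac_of x : smallest (@subfield T) R x -> exists a b, [/\ R a, R b, b != 0 & x = a / b].
Proof.
move=> hx; suff : [set x | exists a b, [/\ R a, R b, b != 0 & x = a / b]] x by [].
apply: hx; split; last first.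
  by move=> y Ry; exists y, 1; rewrite oner_neq0 divr1; split => //; exact: sr1.
apply/subfieldP; split.
- by exists 1, 1; rewrite oner_neq0 divr1; split => //; exact: sr1.
- move=> _ _ [a [b [Ra Rb b0 ->]]] [a' [b' [Ra' Rb' b0' ->]]].
  exists (a * b' - a' * b), (b * b'); split; rewrite ?mulf_neq0 //.
  + by apply: srB; exact: srM.
  + exact: srM.
  + by rewrite -mulNr addf_div // mulNr.
- move=> _ _ [a [b [Ra Rb b0 ->]]] [a' [b' [Ra' Rb' b0' ->]]].
  have [->|a0] := eqVneq a' 0.
    exists 0, 1; rewrite mul0r invr0 mulr0 mul0r oner_neq0; split => //; [exact: sr0|exact: sr1].
  exists (a * b'), (b * a'); split; rewrite ?mulf_neq0 //; try exact: srM.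
  by rewrite invf_div mulf_div.
Qed.

Lemma clear_den x : acl (smallest (@subfield T) R) x ->
  exists p, [/\ pov R p, p != 0 & p.[x] = 0].
Proof.
move=> [p /(povP (smallest_sf R)) hp /andP[p0 /eqP px]].
have /choice[f hf] : forall i, exists ab : T * T, [/\ R ab.1, R ab.2, ab.2 != 0 & p`_i = ab.1 / ab.2].
  by move=> i; have [a [b h]] := frac_of (hp i); exists (a, b).
pose b := \prod_(i < size p) (f i).2.
have b0 : b != 0 by apply/prodf_neq0 => i _; case: (hf i).
exists (b *: p); split.
- move=> i; rewrite coefZ; case: (ltnP i (size p)) => [lt|ge]; last first.
    by rewrite nth_default // mulr0; exact: sr0.
  have [h1 h2 h3 ->] := hf i; rewrite /b (bigD1 (Ordinal lt)) //= mulrC -mulrA.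
  rewrite (mulrA (f i).2^-1) mulVf // mul1r; apply: srM => //.
  by apply: sr_prod => j _; case: (hf j).
- by rewrite scaler_eq0 negb_or b0.
- by rewrite hornerZ px mulr0.
Qed.

(** A relation of least size is not divisible by the indeterminate, since x is nonzero. *)
Lemma clear_den0 x : x != 0 -> acl (smallest (@subfield T) R) x ->
  exists p, [/\ pov R p, p`_0 != 0 & p.[x] = 0].
Proof.
move=> x0 /clear_den ex.
pose P n := `[< exists p, [/\ pov R p, p != 0, p.[x] = 0 & size p = n] >].
have exP : exists n, P n.
  by have [p [h1 h2 h3]] := ex; exists (size p); apply/asboolP; exists p.
case: (ex_minnP exP) => n /asboolP[p [hp p0 px sp]] min.
exists p; split => //; apply/eqP => e.
have s0 : (0 < size p)%N by rewrite size_poly_gt0.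
pose q := \poly_(i < (size p).-1) p`_i.+1.
have eq : p = q * 'X.
  apply/polyP => -[|i]; first by rewrite coefMX e.
  rewrite coefMX /= coef_poly; case: ltnP => // ge.
  by rewrite nth_default // -(prednK s0).
have q0 : q != 0 by apply: contraNneq p0 => q0; rewrite eq q0 mul0r.
have := min (size q); rewrite leqNgt => h; apply/negP: isT; move: h; apply: contraPN => _.
  move=> h; have : P (size q).
    apply/asboolP; exists q; split => //.
      move=> i; rewrite coef_poly; case: ifP => _; [exact: hp|exact: sr0].
    by move/eqP: px; rewrite eq hornerM hornerX mulf_eq0 (negbTE x0) orbF => /eqP.
  move=> /h; rewrite -sp => /negP; apply.
  by rewrite eq size_mulX // ltnS.
Qed.

End Closure.

Definition radj R z : set T := [set x | exists2 p, pov R p & x = p.[z]].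

Lemma radj_sring R z : sring R -> sring (radj R z).
Proof.
move=> hR; split.
- by exists 1%:P; rewrite ?hornerC //; apply: (rpovC hR); exact: sr1.
- by move=> _ _ [p hp ->] [q hq ->]; exists (p - q); rewrite ?hornerE //; exact: rpovB.
- by move=> _ _ [p hp ->] [q hq ->]; exists (p * q); rewrite ?hornerE //; exact: rpovM.
Qed.
Lemma sub_radj R z : sring R -> R `<=` radj R z.
Proof. by move=> hR x Rx; exists x%:P; rewrite ?hornerC //; exact: rpovC. Qed.
Lemma radj_gen R z : sring R -> radj R z z.
Proof. by move=> hR; exists 'X; rewrite ?hornerX //; exact: rpovX. Qed.
Definition rgen F (zs : seq T) := foldr (fun z R => radj R z) F zs.
Lemma rgen_sring F zs : sring F -> sring (rgen F zs).
Proof. by move=> hF; elim: zs => //= z zs; exact: radj_sring. Qed.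
Lemma sub_rgen F zs : sring F -> F `<=` rgen F zs.
Proof.
move=> hF; elim: zs => //= z zs IH x Fx.
by apply: sub_radj; [exact: rgen_sring|exact: IH].
Qed.
Lemma rgen_mem F zs z : sring F -> z \in zs -> rgen F zs z.
Proof.
move=> hF; elim: zs => //= y zs IH; rewrite inE => /orP[/eqP ->|/IH h].
  by apply: radj_gen; exact: rgen_sring.
by apply: sub_radj => //; exact: rgen_sring.
Qed.
Lemma rgen_min F zs R : sring R -> F `<=` R -> (forall z, z \in zs -> R z) -> rgen F zs `<=` R.
Proof.
move=> hR FR; elim: zs => //= z zs IH h x [p hp ->].
apply: (rpov_horner hR); last by apply: h; rewrite mem_head.
by move=> i; apply: IH => // y yz; apply: h; rewrite inE yz orbT.
Qed.

(** A homomorphism of F-algebras from R to F, carried by a total function whose values outside R are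
    irrelevant. *)
Definition rhom (F R : set T) (f : T -> T) := [/\ forall x, R x -> F (f x),
  forall x, F x -> f x = x, forall x y, R x -> R y -> f (x + y) = f x + f y
  & forall x y, R x -> R y -> f (x * y) = f x * f y].

Section Hom.
Variables (F R : set T) (hF : subfield F) (hR : sring R) (FR : F `<=` R).
Variables (f : T -> T) (hf : rhom F R f).

Lemma rhom0 : f 0 = 0.
Proof. by case: hf => _ h _ _; apply: h; exact: sf0. Qed.
Lemma rhom1 : f 1 = 1.
Proof. by case: hf => _ h _ _; apply: h; exact: sf1. Qed.
Lemma rhom_sum (I : Type) (r : seq I) (E : I -> T) :
  (forall i, R (E i)) -> f (\sum_(i <- r) E i) = \sum_(i <- r) f (E i).
Proof.
move=> h; case: hf => _ _ fD _; elim: r => [|i r IH]; first by rewrite !big_nil rhom0.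
by rewrite !big_cons fD ?IH //; apply: (sr_sum hR).
Qed.
Lemma rhomN x : R x -> f (- x) = - f x.
Proof.
move=> Rx; case: hf => _ _ fD _; apply: (addrI (f x)); rewrite -fD ?subrr ?rhom0 //.
exact: srN.
Qed.
Lemma rhomX x n : R x -> f (x ^+ n) = f x ^+ n.
Proof.
move=> Rx; case: hf => _ _ _ fM; elim: n => [|n IH]; first by rewrite !expr0 rhom1.
by rewrite !exprS fM ?IH //; exact: srX.
Qed.
Lemma rmapD p q : pov R p -> pov R q -> map_poly f (p + q) = map_poly f p + map_poly f q.
Proof.
move=> hp hq; case: hf => _ _ fD _; apply/polyP => i.
by rewrite coefD !coef_map_id0 ?rhom0 // coefD fD.
Qed.
Lemma rmapM p q : pov R p -> pov R q -> map_poly f (p * q) = map_poly f p * map_poly f q.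
Proof.
move=> hp hq; case: (hf) => _ _ _ fM; apply/polyP => i.
rewrite coef_map_id0 ?rhom0 // !coefM rhom_sum; last by move=> j; exact: srM.
by apply: eq_bigr => j _; rewrite fM // !coef_map_id0 ?rhom0.
Qed.
Lemma rmapC c : map_poly f c%:P = (f c)%:P.
Proof. by apply: map_polyC0; exact: rhom0. Qed.
Lemma rmapN p : pov R p -> map_poly f (- p) = - map_poly f p.
Proof.
by move=> hp; apply/polyP => i; rewrite coefN !coef_map_id0 ?rhom0 // coefN rhomN.
Qed.

Section Extend.
Variables (z w : T).
Hypothesis Fw : F w.
Hypothesis wd : forall p, pov R p -> p.[z] = 0 -> (map_poly f p).[w] = 0.

Lemma rhom_extend : exists f', rhom F (radj R z) f' /\
  forall p, pov R p -> f' p.[z] = (map_poly f p).[w].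
Proof.
have /choice[pf hpf] : forall x, exists p, radj R z x -> pov R p /\ x = p.[z].
  by move=> x; have [[p hp ->]|h] := pselect (radj R z x); [exists p|exists 0].
exists (fun x => (map_poly f (pf x)).[w]).
have key p : pov R p -> (map_poly f (pf p.[z])).[w] = (map_poly f p).[w].
  move=> hp; have [h1 h2] : pov R (pf p.[z]) /\ p.[z] = (pf p.[z]).[z].
    by apply: hpf; exists p.
  apply/eqP; rewrite -subr_eq0 -hornerN -hornerD -rmapN // -rmapD //; last first.
    by move=> i; rewrite coefN; exact: srN.
  apply/eqP; apply: wd; last by rewrite hornerD hornerN -h2 subrr.
  exact: rpovB.
split; last by [].
have FfR p : pov R p -> F (map_poly f p).[w].
  move=> hp; apply: (pov_horner hF) => // i; rewrite coef_map_id0 ?rhom0 //.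
  by case: hf => h _ _ _; exact: h.
split.
- by move=> _ [p hp ->]; rewrite key //; exact: FfR.
- move=> x Fx; have Rx := FR Fx; have hx : pov R x%:P by exact: rpovC.
  by have := key _ hx; rewrite hornerC => ->; rewrite rmapC hornerC; case: hf => _ h _ _; exact: h.
- move=> _ _ [p hp ->] [q hq ->]; rewrite -hornerD !key //; last exact: rpovD.
  by rewrite rmapD // hornerD.
- move=> _ _ [p hp ->] [q hq ->]; rewrite -hornerM !key //; last exact: rpovM.
  by rewrite rmapM // hornerM.
Qed.

End Extend.
End Hom.

Hypothesis char0 : [pchar T] =i pred0.

Lemma nat_nonroot (p : {poly T}) : p != 0 -> exists n : nat, p.[n%:R] != 0.
Proof.
move=> p0; apply: contrapT => h.
have all0 n : p.[n%:R] = 0 by apply: contrapT => /eqP e; apply: h; exists n.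
have := @max_poly_roots T p [seq n%:R | n <- iota 0 (size p)] p0.
rewrite size_map size_iota ltnn => H; apply/negP: isT; move: H; apply: contraPN => _ H.
suff : false by []. apply: H.
  by apply/allP => _ /mapP[n _ ->]; rewrite /root all0.
rewrite map_inj_uniq ?iota_uniq // => m n.
wlog le : m n / (m <= n)%N.
  by move=> W; have [|/ltnW] := leqP m n; [exact: W|move=> h' e; apply/esym/W].
move=> /eqP; rewrite eq_sym -subr_eq0 -natrB //; have /pcharf0P -> := char0.
by rewrite subn_eq0 => h'; apply/eqP; rewrite eqn_leq le h'.
Qed.

Section Step.
Variables (F R : set T) (hF : subfield F) (cF : alg_closed F).
Hypotheses (hR : sring R) (FR : F `<=` R).
Variables (z : T) (X : set T).
Hypotheses (XF : X `<=` F) (Xnat : forall n : nat, X n%:R).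

Definition rtrans := forall p, pov R p -> p.[z] = 0 -> p = 0.

(** One step of the extension theorem for homomorphisms. If z is transcendental, g is the leading
    coefficient of the polynomial in z that gives a, and z is sent to a natural number that is not a
    root of the image of this polynomial, hence into X. If z is algebraic, g is the leading
    coefficient of a minimal relation of z times the nonzero constant term of a relation of a: the
    first factor makes z extendable, the second keeps a from going to 0. *)
Lemma hom_step a : radj R z a -> a != 0 -> exists g, [/\ R g, g != 0 &
  forall f, rhom F R f -> f g != 0 -> exists f', [/\ rhom F (radj R z) f',
    forall x, R x -> f' x = f x, f' a != 0 & rtrans -> X (f' z)]].
Proof.
move=> [ph hph ->] hn0.
have fromC f f' : (forall p, pov R p -> f' p.[z] = (map_poly f p).[f' z]) ->
    rhom F R f -> forall x, R x -> f' x = f x.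
  move=> h hf x Rx; have := h x%:P (rpovC hR Rx); rewrite hornerC => ->.
  by rewrite (rmapC hF hf) hornerC.
have atz f w f' : rhom F R f -> (forall p, pov R p -> f' p.[z] = (map_poly f p).[w]) -> f' z = w.
  move=> hf h; have := h 'X (rpovX hR); rewrite hornerX => ->.
  have -> : map_poly f 'X = 'X; last by rewrite hornerX.
  apply/polyP => i; rewrite coef_map_id0 ?(rhom0 hF hf) // coefX.
  by case: eqP => _; rewrite ?(rhom0 hF hf) ?(rhom1 hF hf).
have [tr|ntr] := pselect rtrans.
  have p0 : ph != 0 by apply: contraNneq hn0 => ->; rewrite horner0.
  exists (lead_coef ph); split; [exact: hph|by rewrite lead_coef_eq0|move=> f hf fg].
  have [|n hn] := @nat_nonroot (map_poly f ph).
    rewrite -lead_coef_eq0 lead_coef_map_id0 // ?(rhom0 hF hf) //.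
  have [||f' [hf' e]] := @rhom_extend F R hF hR FR f hf z n%:R.
  - exact: XF.
  - by move=> p hp /(tr p hp) ->; rewrite map_poly0 horner0.
  have ez := atz _ _ _ hf e.
  exists f'; split => //.
  - by apply: (fromC f) => // p hp; rewrite ez; exact: e.
  - by rewrite e.
  - by rewrite ez.
have [m0 [hm0 m0z m0n]] : exists p, [/\ pov R p, p.[z] = 0 & p != 0].
  by move/existsNP: ntr => [p /not_implyP[h1 /not_implyP[h2 /eqP h3]]]; exists p.
pose P n := `[< exists p, [/\ pov R p, p.[z] = 0, p != 0 & size p = n] >].
have exP : exists n, P n by exists (size m0); apply/asboolP; exists m0.
case: (ex_minnP exP) => n /asboolP[m [hm mz mn sm]] min {m0 hm0 m0z m0n exP}.
have aclz : acl (smallest (@subfield T) R) z.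
  apply: (@aclI _ _ m) => //; last exact/eqP.
  by move=> i G [_]; apply; exact: hm.
have aclh : acl (smallest (@subfield T) R) ph.[z].
  have hs := acl_sf (smallest_sf R); apply: (pov_horner hs) => // i.
  by apply: (sub_acl (smallest_sf R)) => G [_]; apply; exact: hph.
have [r [hr r0 rh]] := clear_den0 hR hn0 aclh.
exists (lead_coef m * r`_0); split.
- by apply: (srM hR); [exact: hm|exact: hr].
- by rewrite mulf_neq0 // lead_coef_eq0.
move=> f hf; case: (hf) => fF fid fD fM.
rewrite fM ?mulf_eq0 ?negb_or; [|exact: hm|exact: hr].
move=> /andP[fl fr].
have f0 := rhom0 hF hf.
have sfm : size (map_poly f m) = size m by rewrite size_map_poly_id0.
have s2 : (1 < size m)%N.
  rewrite ltnNge; apply/negP => le; have /size_poly1P : size m == 1.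
    by rewrite eqn_leq le size_poly_gt0.
  by move=> [c c0 e]; move/eqP: mz; rewrite e hornerC (negbTE c0).
have [||w Fw mw] := cF (p := map_poly f m).
- apply/(povP hF) => i; rewrite coef_map_id0 //; exact: fF.
- by rewrite sfm.
have {}Fw := set_mem Fw.
(* Pseudo-division by m: multiplying by its leading coefficient, which f does not kill, avoids
   denominators. *)
have wd p : pov R p -> p.[z] = 0 -> (map_poly f p).[w] = 0.
  have [k] := ubnP (size p); elim: k p => // k IH p lt hp pz.
  have [->|p0] := eqVneq p 0; first by rewrite map_poly0 horner0.
  have le : (size m <= size p)%N.
    by rewrite sm; apply: min; apply/asboolP; exists p.
  pose t := lead_coef p *: 'X^(size p - size m).
  have ht : pov R t.
    by move=> i; rewrite coefZ coefXn; apply: (srM hR); first exact: hp; case: eqP => _; [exact: sr1|exact: sr0].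
  pose q := (lead_coef m)%:P * p - t * m.
  have hlm : pov R (lead_coef m)%:P by apply: (rpovC hR); exact: hm.
  have hq : pov R q := rpovB hR (rpovM hR hlm hp) (rpovM hR ht hm).
  have sq : (size q < size p)%N.
    have sp0 : (0 < size p)%N by rewrite size_poly_gt0.
    rewrite -(prednK sp0) ltnS; apply/leq_sizeP => j le'.
    rewrite /q coefB coefCM /t -scalerAl coefZ coefXnM.
    move: le'; rewrite leq_eqVlt => /orP[/eqP <-|lt'].
      have -> : ((size p).-1 < size p - size m)%N = false by lia.
      have -> : ((size p).-1 - (size p - size m))%N = (size m).-1 by lia.
      by rewrite mulrC subrr.
    rewrite (prednK sp0) in lt'.
    rewrite (nth_default _ lt') mulr0.
    case: ltnP => [_|ge]; first by rewrite mulr0 subrr.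
    rewrite [m`__]nth_default ?mulr0 ?subrr //.
    by rewrite leq_subRL // (subnK le).
  have qz : q.[z] = 0 by rewrite !hornerE pz mz !mulr0 subrr.
  have := IH q _ hq qz; move=> /(_ (leq_trans sq (ltnSE lt))).
  have hlp := rpovM hR hlm hp; have htm := rpovM hR ht hm.
  have hNtm : pov R (- (t * m)) by move=> i; rewrite coefN; apply: (srN hR); exact: htm.
  rewrite /q (rmapD hF hf hlp hNtm) (rmapN hF hR hf htm) (rmapM hF hR hf hlm hp).
  rewrite (rmapM hF hR hf ht hm) (rmapC hF hf).
  rewrite hornerD hornerN !hornerM hornerC; move/eqP: mw => ->; rewrite mulr0 subr0.
  by move=> /eqP; rewrite mulf_eq0 (negbTE fl) => /eqP.
have [f' [hf' e]] := rhom_extend hF hR FR hf Fw wd.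
have ez := atz _ _ _ hf e.
have fe x : R x -> f' x = f x by apply: (fromC f) => // p hp; rewrite ez; exact: e.
exists f'; split => //.
have hS := radj_sring z hR.
have Rh : radj R z ph.[z] by exists ph.
(* Were a sent to 0, applying [f'] to the relation r of a would send its constant term to 0. *)
apply/eqP => fh; move/negP: fr; apply.
have := congr1 f' rh; rewrite (rhom0 hF hf') horner_coef.
have sR := @sub_radj R z hR.
rewrite (rhom_sum hF hS hf'); last first.
  by move=> i; apply: (srM hS); [apply: sR; exact: hr|exact: srX].
have s0 : (0 < size r)%N.
  by rewrite size_poly_gt0; apply: contraNneq r0 => ->; rewrite coef0.
rewrite -(prednK s0) big_ord_recl /= expr0 mulr1 big1 ?addr0 ?fe ?hr //; first by move=> ->.
move=> i _; case: (hf') => _ _ _ fM'; rewrite fM'; last exact: srX.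
  by rewrite (rhomX hF hS hf') // fh expr0n mulr0.
by apply: sR; exact: hr.
Qed.

End Step.

Section Embedding.
Variables (F : set T) (hF : subfield F) (cF : alg_closed F).
Let sF : sring F := sf_sring hF.

(** Each element comes with the set prescribed for its image. It is transcendental over F and the
    elements after it in the list, so its image can be a natural number; hence the condition that
    the sets contain the naturals. *)
Fixpoint good (cs : seq (T * set T)) : Prop :=
  if cs is cx :: cs' then [/\ good cs', cx.2 `<=` F, forall n : nat, cx.2 n%:R
    & ~ acl (adjoin F [set` map fst cs']) cx.1] else True.

Lemma hom_exists cs zs h : good cs ->
  rgen F (zs ++ map fst cs) h -> h != 0 ->
  exists f, [/\ rhom F (rgen F (zs ++ map fst cs)) f, f h != 0
    & forall i, (i < size cs)%N -> (nth (0, setT) cs i).2 (f (nth (0, setT) cs i).1)].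
Proof.
move=> gcs; elim: zs h => [|z zs IH] h /=.
  elim: cs gcs h => [_ h Fh h0|[c X] cs IH [gcs XF Xn nc] h hR h0] /=.
    by exists id; split => //; split.
  have sR := rgen_sring (map fst cs) sF.
  have [g [Rg g0 hg]] := hom_step hF cF sR (sub_rgen _ sF) XF Xn hR h0.
  have [f [hf fg hX]] := IH gcs g Rg g0.
  have [f' [hf' ff' f'h f'z]] := hg f hf fg.
  exists f'; split => // -[_|i lt] /=.
    apply: f'z => p hp pz; apply: contrapT => /eqP p0; apply: nc.
    apply: (aclI (p := p)) => //; last exact/eqP.
    move=> i; apply: (rgen_min (sf_sring (adjoin_sf F _)) (@sub_adjoinl _ _ _)) (hp i).
    by move=> y ys; exact: sub_adjoinr.
  rewrite ff'; first exact: hX.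
  by apply: rgen_mem => //; apply: map_f; exact: mem_nth.
move=> hR h0; have sR := rgen_sring (zs ++ map fst cs) sF.
have Fn (n : nat) : F n%:R by exact: sfnat.
have [g [Rg g0 hg]] := hom_step hF cF sR (sub_rgen _ sF) (@subset_refl _ F) Fn hR h0.
have [f [hf fg hX]] := IH g Rg g0.
have [f' [hf' ff' f'h f'z]] := hg f hf fg.
exists f'; split => // i lt; rewrite ff'; first exact: hX.
by apply: rgen_mem => //; rewrite mem_cat map_f ?orbT //; exact: mem_nth.
Qed.

Lemma rhom_sub R R' f : R' `<=` R -> rhom F R f -> rhom F R' f.
Proof. by move=> h [h1 h2 h3 h4]; split; auto. Qed.

(* The homomorphisms of finitely generated subrings into F are assembled along an
   ultrafilter. *)
Lemma ultra_embedding cs : good cs -> exists (U : set_system (T -> T))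
    (hU : UltraFilter U) (psi : {rmorphism T -> upow T hU}),
  [/\ forall x, F x -> psi x = diag hU x, forall x, star F (psi x)
    & forall i, (i < size cs)%N -> star (nth (0, setT) cs i).2 (psi (nth (0, setT) cs i).1)].
Proof.
move=> gcs.
(* The functions that are homomorphisms on the ring generated by zs and the constrained elements,
   and that meet the constraints. These sets form a filter base. *)
pose A zs : set (T -> T) := [set f | rhom F (rgen F (zs ++ map fst cs)) f /\
  forall i, (i < size cs)%N -> (nth (0, setT) cs i).2 (f (nth (0, setT) cs i).1)].
have Asub zs zs' : (forall z, z \in zs' -> z \in zs) -> A zs `<=` A zs'.
  move=> h f [hf hX]; split => //; apply: rhom_sub hf.
  apply: rgen_min; [exact: rgen_sring|exact: sub_rgen|].
  move=> z; rewrite mem_cat => hz; apply: rgen_mem => //; rewrite mem_cat.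
  by case/orP: hz => [/h ->//|->]; rewrite orbT.
have PF : ProperFilter (filter_from [set: seq T] A).
  apply: filter_from_proper; last first.
    move=> zs _; have [||f [h1 _ h2]] := @hom_exists cs zs 1 gcs.
    - exact: (sr1 (rgen_sring _ sF)).
    - exact: oner_neq0.
    by exists f.
  apply: filter_from_filter; first by exists [::].
  move=> zs zs' _ _; exists (zs ++ zs') => // f hf; split.
    by apply: Asub hf => z hz; rewrite mem_cat hz.
  by apply: Asub hf => z hz; rewrite mem_cat hz orbT.
have [U [hU FU]] := ultraFilterLemma PF.
have UA zs : U (A zs) by apply: FU; exists zs.
have mem zs f z : A zs f -> z \in zs -> rgen F (zs ++ map fst cs) z.
  by move=> _ hz; apply: rgen_mem => //; rewrite mem_cat hz.
exists U, hU.
(* The indices are the functions themselves, so x goes to the class of evaluation at x. A ring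
   identity holds on every [A zs] for which zs contains the elements involved. *)
pose psi x : upow T hU := cls hU (fun f : T -> T => f x).
have psiB : zmod_morphism psi.
  move=> x y; rewrite /psi clsB; apply/clsE.
  apply: filterS (UA [:: x; y]) => f hf /=; case: (hf) => -[f1 f2 f3 f4] _.
  have sR := rgen_sring ([:: x; y] ++ map fst cs) sF.
  have Rx := mem _ _ x hf (mem_head _ _).
  have Ry : rgen F ([:: x; y] ++ map fst cs) y by apply: (mem _ _ _ hf); rewrite !inE eqxx orbT.
  rewrite f3 //; last exact: srN.
  by rewrite (rhomN hF sR (And4 f1 f2 f3 f4)).
have psiM : monoid_morphism psi.
  split.
    apply/clsE; apply: filterS (UA [::]) => f [[f1 f2 f3 f4] _] /=.
    by apply: f2; exact: sf1.
  move=> x y; rewrite /psi clsM; apply/clsE.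
  apply: filterS (UA [:: x; y]) => f hf /=; case: (hf) => -[f1 f2 f3 f4] _.
  apply: f4; first exact: (mem _ _ x hf (mem_head _ _)).
  by apply: (mem _ _ _ hf); rewrite !inE eqxx orbT.
pose psi' : {rmorphism T -> upow T hU} := HB.pack psi
  (GRing.isZmodMorphism.Build _ _ psi psiB) (GRing.isMonoidMorphism.Build _ _ psi psiM).
exists psi'; split.
- move=> x Fx; apply/clsE; apply: filterS (UA [::]) => f [[f1 f2 f3 f4] _] /=; exact: f2.
- move=> x; apply/starP; apply: filterS (UA [:: x]) => f hf /=; case: (hf) => -[f1 _ _ _] _.
  by apply: f1; exact: (mem _ _ x hf (mem_head _ _)).
- move=> i lt; apply/starP; apply: filterS (UA [::]) => f [_ h]; exact: h.
Qed.

End Embedding.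
End Subrings.

(** * Places of a function field of one variable *)

Section Valuations.
Variable N : fieldType.
Variable C : set N.

Definition vring (O : set N) := [/\ sring O, C `<=` O, forall z, O z \/ O z^-1
  & exists z, ~ O z].

(** For transcendental w this is linear dependence over C(w), with denominators cleared. *)
Definition dep w (J : finType) (b : J -> N) := exists p : J -> {poly N},
  [/\ forall i, pov C (p i), exists i, p i != 0 & \sum_i (p i).[w] * b i = 0].

Definition finite_over w := exists n, forall b : 'I_n -> N, dep w b.

(** A function field of one variable over an algebraically closed field of constants, expressed by
    degree bounds: N has finite degree over C(w) for every nonconstant w. *)
Definition curve := [/\ [pchar N] =i pred0, subfield C, alg_closed C
  & forall w, ~ C w -> finite_over w].

Hypothesis hN : curve.
Let hC : subfield C. Proof. by case: hN. Qed.
Let cC : alg_closed C. Proof. by case: hN. Qed.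
Let fin : forall w, ~ C w -> finite_over w. Proof. by case: hN. Qed.

#[local] Set Default Proof Using "All".

(** Common factors of the indeterminate can be cancelled because t is nonzero. *)
Lemma primitive_relation (J : finType) (b : J -> N) (t : N) : t != 0 -> dep t b ->
  exists p : J -> {poly N},
  [/\ forall i, pov C (p i), exists i, (p i).[0] != 0 & \sum_i (p i).[t] * b i = 0].
Proof.
move=> t0 [p [hp p0 e]].
have [k] := ubnP (\sum_i size (p i)); elim: k p hp p0 e => // k IH p hp [i0 pi0] e lt.
have [[i hi]|all0] := pselect (exists i, (p i).[0] != 0); first by exists p; split => //; exists i.
have pX i : p i = (\poly_(j < (size (p i)).-1) (p i)`_j.+1) * 'X.
  have h0 : (p i)`_0 = 0 by rewrite -horner_coef0; apply: contrapT => /eqP h; apply: all0; exists i.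
  apply/polyP => -[|j]; first by rewrite coefMX h0.
  rewrite coefMX /= coef_poly; case: ltnP => // ge; rewrite nth_default //; lia.
apply: (IH (fun i => \poly_(j < (size (p i)).-1) (p i)`_j.+1)).
- by move=> i j; rewrite coef_poly; case: ifP => _; [exact: (hp i)|exact: sf0].
- by exists i0; apply: contraNneq pi0 => h; rewrite pX h mul0r.
- apply: (mulfI t0); rewrite mulr0 mulr_sumr -[RHS]e; apply: eq_bigr => i _.
  by rewrite [in RHS]pX hornerMX; ring.
- rewrite -ltnS; apply: leq_trans lt; rewrite ltnS.
  pose r i := \poly_(j < (size (p i)).-1) (p i)`_j.+1.
  change (\sum_i size (r i) < \sum_i size (p i))%N.
  have h1 i : (size (r i) <= (size (p i)).-1)%N by exact: size_poly.
  rewrite (bigD1 i0) //= [X in (_ < X)%N](bigD1 i0) //= -addSn.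
  apply: leq_add; last by apply: leq_sum => i _; exact: (leq_trans (h1 i) (leq_pred _)).
  have s0 : (0 < size (p i0))%N by rewrite size_poly_gt0.
  by rewrite -(prednK s0) ltnS; exact: h1.
Qed.

Section Place.
Variables (O : set N) (hO : vring O).

Let sO : sring O. Proof. by case: hO. Qed.
Let CO : C `<=` O. Proof. by case: hO. Qed.

(** The maximal ideal of O. Zero is listed apart because its inverse is 0, which lies in O. *)
Definition mid : set N := [set z | O z /\ (z = 0 \/ ~ O z^-1)].

Lemma mid_sub : mid `<=` O. Proof. by move=> z []. Qed.
Lemma mid0 : mid 0. Proof. by split; [exact: sr0|left]. Qed.
Lemma not_mid1 : ~ mid 1.
Proof. by move=> [_ [/eqP|]]; rewrite ?oner_eq0 // invr1 => h; apply: h; exact: sr1. Qed.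
Lemma mid_inv z : ~ O z -> mid z^-1.
Proof.
move=> h; case: hO => _ _ /(_ z) [//|h'] _; split => //; right; by rewrite invrK.
Qed.
Lemma not_mid_inv z : O z -> ~ mid z -> O z^-1 /\ z != 0.
Proof.
move=> Oz h; have z0 : z != 0 by apply/eqP => e; apply: h; rewrite e; exact: mid0.
by split => //; apply: contrapT => h'; apply: h; split => //; right.
Qed.
Lemma midM a z : O a -> mid z -> mid (a * z).
Proof.
move=> Oa [Oz hz]; split; first exact: srM.
have [->|a0] := eqVneq a 0; first by left; rewrite mul0r.
have [->|z0] := eqVneq z 0; first by left; rewrite mulr0.
right=> h; case: hz => [e|]; first by rewrite e eqxx in z0.
by apply; have := srM sO Oa h; rewrite invfM mulrA mulfV // mul1r.
Qed.
Lemma midD y z : mid y -> mid z -> mid (y + z).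
Proof.
move=> my mz; have [->|y0] := eqVneq y 0; first by rewrite add0r.
have [->|z0] := eqVneq z 0; first by rewrite addr0.
case: (hO) => _ _ /(_ (y / z)) + _; rewrite invf_div => -[h|h].
  have -> : y + z = (y / z + 1) * z by rewrite mulrDl mul1r divfK.
  by apply: midM => //; apply: srD => //; exact: sr1.
have -> : y + z = (1 + z / y) * y by rewrite mulrDl mul1r divfK.
by apply: midM => //; apply: srD => //; exact: sr1.
Qed.
Lemma midN z : mid z -> mid (- z).
Proof. by move=> h; rewrite -mulN1r; apply: midM => //; apply: srN => //; exact: sr1. Qed.
Lemma mid_sum (I : Type) (r : seq I) (P : pred I) (E : I -> N) :
  (forall i, P i -> mid (E i)) -> mid (\sum_(i <- r | P i) E i).
Proof. by move=> h; elim/big_ind: _ => //; [exact: mid0|exact: midD]. Qed.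
Lemma midC c : C c -> mid c -> c = 0.
Proof. by move=> Cc [_ [//|h]]; exfalso; apply: h; apply: CO; exact: sfV. Qed.
Lemma mid_prime y z : O y -> O z -> mid (y * z) -> mid y \/ mid z.
Proof.
move=> Oy Oz h; apply: contrapT => /not_orP[ny nz].
have [Oy' y0] := not_mid_inv Oy ny; apply: nz.
by have := midM Oy' h; rewrite mulrA mulVf // mul1r.
Qed.
Lemma mid_notC z : mid z -> z != 0 -> ~ C z.
Proof. by move=> h z0 Cz; move: z0; rewrite (midC Cz h) eqxx. Qed.
Lemma mid_root q z : O z -> pov O q -> mid z -> mid (q.[z] - q.[0]).
Proof.
move=> Oz hq mz; have [r e] : exists r, q = r * 'X + q.[0]%:P /\ pov O r.
  exists (\poly_(j < (size q).-1) q`_j.+1); split.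
    apply/polyP => -[|j]; rewrite coefD coefMX coefC /= ?add0r ?addr0 ?horner_coef0 //.
    by rewrite coef_poly; case: ltnP => // ge; rewrite nth_default //; lia.
  by move=> i; rewrite coef_poly; case: ifP => _; [exact: hq|exact: sr0].
case: e => {1}-> hr; rewrite hornerD hornerMX hornerC addrK.
by apply: midM => //; exact: (rpov_horner sO).
Qed.

Lemma pole_exists : exists2 t, mid t & t != 0.
Proof.
case: (hO) => _ _ _ [z hz]; exists z^-1; first exact: mid_inv.
by rewrite invr_eq0; apply/eqP => e; apply: hz; rewrite e; exact: sr0.
Qed.

(** The residue field is C: a primitive relation over C[t] among powers of z, reduced modulo t, is a
    nonzero polynomial over C that z satisfies modulo the maximal ideal. *)
Lemma residue z : O z -> exists c, C c /\ mid (z - c).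
Proof.
move=> Oz; have [t mt t0] := pole_exists.
have [n hn] := fin (mid_notC mt t0).
have [p [hp [i0 pi0] e]] := primitive_relation t0 (hn (fun i => z ^+ i)).
pose P := \poly_(i < n) (if insub i is Some i' then (p i').[0] else 0).
have Pi (i : 'I_n) : P`_i = (p i).[0] by rewrite coef_poly ltn_ord valK.
have P0 : P != 0 by apply/eqP => h; move: pi0; rewrite -Pi h coef0 eqxx.
have hP : pov C P.
  move=> i; rewrite coef_poly; case: ifP => _; last exact: sf0.
  by case: insubP => [i' _ _|_]; [apply: (pov_horner hC) => //; exact: sf0|exact: sf0].
have mP : mid P.[z].
  have -> : P.[z] = \sum_(i < n) (p i).[0] * z ^+ i.
    by rewrite horner_poly; apply: eq_bigr => i _; rewrite valK.
  have -> : \sum_(i < n) (p i).[0] * z ^+ i = - \sum_(i < n) ((p i).[t] - (p i).[0]) * z ^+ i.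
    apply/eqP; rewrite -addr_eq0 -big_split; apply/eqP; rewrite -[RHS]e.
    by apply: eq_bigr => i _; rewrite /=; ring.
  apply: midN; apply: mid_sum => i _; rewrite mulrC; apply: midM; first exact: srX.
  by apply: mid_root => //; [exact: mid_sub|move=> j; apply: CO; exact: (hp i)].
(* P splits over C, and the maximal ideal is prime *)
have [k] := ubnP (size P); elim: k P {Pi} P0 hP mP => // k IH P P0 hP mP lt.
have [s1|s1] := leqP (size P) 1.
  have /size_poly1P[c c0 e1] : size P == 1 by rewrite eqn_leq s1 size_poly_gt0.
  have Cc : C c by have := hP 0; rewrite e1 coefC.
  by move: c0; rewrite (midC Cc) ?eqxx //; move: mP; rewrite e1 hornerC.
have [|c Cc /factor_theorem[Q eQ]] := cC _ s1; first by apply/(povP hC).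
have {}Cc := set_mem Cc.
have Q0 : Q != 0 by apply: contraNneq P0 => h; rewrite eQ h mul0r.
have hQ : pov C Q.
  have [P' eP] := pov_lift hC hP.
  have cX : 'X - c%:P = map_poly (@sfval _ _ hC) ('X - (sfin hC Cc)%:P).
    by rewrite rmorphB /= map_polyX map_polyC.
  have -> : Q = P %/ ('X - c%:P) by rewrite eQ mulpK // polyXsubC_eq0.
  by rewrite eP cX -map_divp; exact: pov_map.
move: mP; rewrite eQ hornerM !hornerE => mP.
have OQ : O Q.[z] by apply: (rpov_horner sO) => // i; apply: CO; exact: hQ.
have [mQ|mz] := mid_prime OQ (srB sO Oz (CO Cc)) mP; last by exists c.
apply: (IH Q Q0 hQ mQ); rewrite -ltnS; apply: leq_trans lt.
by rewrite eQ size_Mmonic ?monicXsubC // size_XsubC addn2.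
Qed.

(** Elements of O with strictly increasing values below that of t are independent over C[t]. In a
    primitive relation take the least i with p_i(0) nonzero. The earlier terms are divisible by t
    and the later ones have larger value, so the term of index i is alone of its value. A chain is
    therefore bounded by the degree over C(t). *)
Lemma chain_bound t n (a : nat -> N) : mid t -> t != 0 ->
  (forall b : 'I_n -> N, dep t b) -> (forall i j, (i < j < n)%N -> mid (a j / a i)) ->
  (forall i, (i < n)%N -> O (a i)) -> (forall i, (i < n)%N -> mid (t / a i)) -> (forall i, (i < n)%N -> a i != 0) -> False.
Proof.
move=> mt t0 hn aa aO ta a0.
have [p [hp [i0 pi0] e]] := primitive_relation t0 (hn (fun i => a i)).
have [i pi min] := @arg_minnP _ i0 (fun i => (p i).[0] != 0) (fun i => nat_of_ord i) pi0.
have pO q : pov C q -> O q.[t].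
  by move=> hq; apply: (rpov_horner sO) => [j|]; [apply: CO; exact: hq|exact: mid_sub].
have mp : mid (p i).[t].
  have -> : (p i).[t] = - \sum_(j | j != i) (p j).[t] * (a j / a i).
    apply: (mulIf (a0 i (ltn_ord i))); rewrite mulNr mulr_suml.
    move/eqP: e; rewrite (bigD1 i) //= addr_eq0 => /eqP ->; congr (- _).
    by apply: eq_bigr => j _; rewrite -mulrA divfK // a0.
  apply: midN; apply: mid_sum => j ji.
  have [lt|ge] := ltnP i j.
    by apply: midM; [apply: pO|apply: aa; rewrite lt ltn_ord].
  have lt : (j < i)%N by rewrite ltn_neqAle ge andbT.
  have z0 : (p j).[0] = 0.
    by apply/eqP/negP => /negP /min; rewrite leqNgt lt.
  have [r [er hr]] : exists r, p j = r * 'X /\ pov C r.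
    exists (\poly_(k < (size (p j)).-1) (p j)`_k.+1); split.
      apply/polyP => -[|k]; first by rewrite coefMX /= -horner_coef0 z0.
      by rewrite coefMX coef_poly /=; case: ltnP => // h; rewrite nth_default //; lia.
    by move=> k; rewrite coef_poly; case: ifP => _; [exact: (hp j)|exact: sf0].
  rewrite er hornerMX -mulrA; apply: midM; first exact: pO.
  by rewrite mulrCA; apply: midM; [exact: aO|exact: ta].
have := midC (c := (p i).[0]); move/eqP: pi => pi h; apply: pi; apply: h.
  by apply: (pov_horner hC) => //; exact: sf0.
have -> : (p i).[0] = (p i).[t] - ((p i).[t] - (p i).[0]) by ring.
apply: midD => //; apply: midN; apply: mid_root => //; first exact: mid_sub.
by move=> j; apply: CO; exact: (hp i).
Qed.

Definition unif x := [/\ mid x, x != 0 & forall y, mid y -> O (y / x)].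

(** Without an element of least positive value, one could descend from t through chains of every
    length. *)
Lemma uniformizer : exists x, unif x.
Proof.
apply: contrapT => none; have [t mt t0] := pole_exists.
have /choice[f hf] : forall x, exists y, mid x -> x != 0 -> [/\ mid y, y != 0 & mid (x / y)].
  move=> x; have [[mx x0]|h] := pselect (mid x /\ x != 0); last first.
    by exists 0 => m0 n0; exfalso; apply: h.
  have /existsNP[y /not_implyP[my ny]] : ~ forall y, mid y -> O (y / x).
    by move=> h; apply: none; exists x.
  have y0 : y != 0 by apply/eqP => e; apply: ny; rewrite e mul0r; exact: sr0.
  by exists y => _ _; split => //; rewrite -invf_div; exact: mid_inv.
pose y i := iter i f t.
have hy i : mid (y i) /\ y i != 0.
  by elim: i => [|i [m n0]]; [split|have [h1 h2 _] := hf _ m n0; split].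
have step i k : (i < k)%N -> mid (y i / y k).
  elim: k => // k IH; rewrite ltnS leq_eqVlt.
  have [m n0] := hy k; have [_ _ mk] := hf _ m n0.
  move=> /orP[/eqP ->|/IH h]; first exact: mk.
  have -> : y i / y k.+1 = (y k / y k.+1) * (y i / y k).
    by rewrite [RHS]mulrC mulrA divfK.
  by apply: midM => //; exact: mid_sub mk.
have [n hn] := fin (mid_notC mt t0).
(* The values of [y] decrease, so the sequence is read backwards; the indices n - i are positive,
   which keeps t divided by each term in the maximal ideal. *)
apply: (@chain_bound t n (fun i => y (n - i)%N) mt t0 hn).
- by move=> i j /andP[ij jn]; apply: step; lia.
- by move=> i _; apply: mid_sub; case: (hy (n - i)%N).
- by move=> i lt; apply: (step 0%N); lia.
- by move=> i _; case: (hy (n - i)%N).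
Qed.

Variable x : N.
Hypothesis hx : unif x.
Let mx : mid x. Proof. by case: hx. Qed.
Let x0 : x != 0. Proof. by case: hx. Qed.
Let gx : forall y, mid y -> O (y / x). Proof. by case: hx. Qed.

Let xX k : x ^+ k != 0. Proof. by rewrite expf_neq0. Qed.

Lemma mid_xX k : (0 < k)%N -> mid (x ^+ k).
Proof.
by case: k => // k _; rewrite exprS mulrC; apply: midM => //; apply: (srX sO); exact: mid_sub.
Qed.

Lemma order_nat y : O y -> y != 0 -> exists k : nat, O (y / x ^+ k) /\ O (y / x ^+ k)^-1.
Proof.
move=> Oy y0; apply: contrapT => none.
have all k : O (y / x ^+ k).
  elim: k => [|k IH]; first by rewrite expr0 divr1.
  suff m : mid (y / x ^+ k) by have := gx m; rewrite exprSr invfM mulrA.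
  by apply: contrapT => m; apply: none; exists k; have [h _] := not_mid_inv IH m.
have my : mid y.
  by have := midM (all 1%N) mx; rewrite expr1 divfK.
have [n hn] := fin (mid_notC my y0).
apply: (@chain_bound y n (fun i => x ^+ i) my y0 hn).
- move=> i j /andP[ij jn]; have -> : x ^+ j / x ^+ i = x ^+ (j - i).
    by rewrite -{1}(subnK (ltnW ij)) exprD mulfK.
  by apply: mid_xX; lia.
- by move=> i _; apply: (srX sO); exact: mid_sub.
- move=> i _; have -> : y / x ^+ i = (y / x ^+ i.+1) * x.
    by rewrite exprSr invfM mulrA divfK.
  exact: midM.
- by move=> i _.
Qed.

(** No valuation function is introduced: [vge k] says that the value is at least k and [ord k] that
    it is k, both measured by the uniformizer x. *)
Definition vge (k : int) : set N := [set z | O (z * x ^ (- k))].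
Definition ord (k : int) z := z != 0 /\ (O (z * x ^ (- k)) /\ O (z * x ^ (- k))^-1).

Lemma xz k : x ^ k != 0. Proof. by rewrite expfz_neq0. Qed.

Lemma vge0 k : vge k 0. Proof. by rewrite /vge /= mul0r; exact: sr0. Qed.
Lemma vgeB k y z : vge k y -> vge k z -> vge k (y - z).
Proof. by rewrite /vge /= mulrBl; exact: srB. Qed.
Lemma vgeD k y z : vge k y -> vge k z -> vge k (y + z).
Proof. by rewrite /vge /= mulrDl; exact: srD. Qed.
Lemma vgeN k z : vge k z -> vge k (- z).
Proof. by rewrite /vge /= mulNr; exact: srN. Qed.
Lemma vge_sum k (I : Type) (r : seq I) (P : pred I) (E : I -> N) :
  (forall i, P i -> vge k (E i)) -> vge k (\sum_(i <- r | P i) E i).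
Proof. by move=> h; elim/big_ind: _ => //; [exact: vge0|exact: vgeD]. Qed.
Lemma vgeM k l y z : vge k y -> vge l z -> vge (k + l) (y * z).
Proof.
rewrite /vge /= => hy hz; rewrite opprD expfzDr // mulrACA; exact: srM.
Qed.
Lemma vge_x k : vge k (x ^ k).
Proof. by rewrite /vge /= -expfzDr // subrr expr0z; exact: sr1. Qed.
Lemma vge_O z : vge 0 z <-> O z.
Proof. by rewrite /vge /= oppr0 expr0z mulr1. Qed.
Lemma vge_C c : C c -> vge 0 c. Proof. by move=> Cc; apply/vge_O; exact: CO. Qed.
Lemma vgeCM c k z : C c -> vge k z -> vge k (c * z).
Proof. by move=> Cc hz; rewrite -[k]add0r; apply: vgeM => //; exact: vge_C. Qed.
Lemma vge_mono k l z : (l <= k)%R -> vge k z -> vge l z.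
Proof.
move=> lk; rewrite /vge /= => h; have -> : - l = - k + (k - l) by ring.
rewrite expfzDr // mulrA; apply: srM => //.
have -> : k - l = Posz `|k - l|%N by lia.
by rewrite -exprnP; apply: (srX sO); exact: mid_sub.
Qed.
Lemma ord_vge k z : ord k z -> vge k z. Proof. by case=> _ []. Qed.
Lemma ord_neq0 k z : ord k z -> z != 0. Proof. by case. Qed.
Lemma ordV k z : ord k z -> ord (- k) z^-1.
Proof.
move=> [z0 [h1 h2]]; split; first by rewrite invr_eq0.
have -> : z^-1 * x ^ (- - k) = (z * x ^ (- k))^-1 by rewrite opprK invfM invr_expz opprK.
by rewrite invrK.
Qed.
Lemma ordM k l y z : ord k y -> ord l z -> ord (k + l) (y * z).
Proof.
move=> [y0 [h1 h2]] [z0 [h3 h4]]; split; first by rewrite mulf_neq0.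
by rewrite opprD expfzDr // mulrACA invfM; split; exact: srM.
Qed.
Lemma ord_x k : ord k (x ^ k).
Proof.
split; first exact: xz.
by rewrite -expfzDr // subrr expr0z invr1; split; exact: sr1.
Qed.
Lemma ord_C c : C c -> c != 0 -> ord 0 c.
Proof.
move=> Cc c0; split => //; rewrite oppr0 expr0z mulr1.
by split; apply: CO => //; exact: sfV.
Qed.
Lemma ord_not_vge k z : ord k z -> ~ vge (k + 1) z.
Proof.
move=> [z0 [h1 h2]]; rewrite /vge /= opprD expfzDr // mulrA => h.
apply: not_mid1; have := midM (srM sO h2 h) mx.
by rewrite mulrA mulVf ?mul1r ?mulVf // mulf_neq0 ?xz.
Qed.
Lemma ord_exists z : z != 0 -> exists k, ord k z.
Proof.
move=> z0; case: (hO) => _ _ /(_ z) hz _.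
have pos y : O y -> y != 0 -> exists k, ord k y.
  by move=> Oy y0; have [k hk] := order_nat Oy y0; exists k; split => //; rewrite -exprnN.
case: hz => [Oz|/pos[]]; [exact: pos|by rewrite invr_eq0|move=> k /ordV].
by rewrite invrK; exists (- k).
Qed.
Lemma ord_le k l z : ord k z -> vge l z -> (l <= k)%R.
Proof.
move=> hk hl; rewrite leNgt; apply/negP => lt; apply: (ord_not_vge hk).
by apply: vge_mono hl; lia.
Qed.
Lemma ord_uniq k l z : ord k z -> ord l z -> k = l.
Proof.
move=> hk hl; apply/eqP; rewrite eq_le (ord_le hk (ord_vge hl)).
by rewrite (ord_le hl (ord_vge hk)).
Qed.
Lemma vge_ord k z : vge k z -> ~ vge (k + 1) z -> ord k z.
Proof.
move=> h1 h2; have z0 : z != 0 by apply/eqP => e; apply: h2; rewrite e; exact: vge0.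
have [l hl] := ord_exists z0; suff -> : k = l by [].
have := ord_le hl h1; rewrite le_eqVlt => /orP[/eqP//|lt].
by exfalso; apply: h2; apply: vge_mono (ord_vge hl); lia.
Qed.
Lemma ordD k y z : ord k y -> vge (k + 1) z -> ord k (y + z).
Proof.
move=> hy hz; apply: vge_ord.
  by apply: vgeD; [exact: ord_vge|apply: vge_mono hz; lia].
by move=> h; apply: (ord_not_vge hy); have := vgeB h hz; rewrite addrK.
Qed.
Lemma mid_vge z : mid z <-> vge 1 z.
Proof.
rewrite /vge /= -invr_expz expr1z; split => [|h]; first exact: gx.
by have := midM h mx; rewrite divfK.
Qed.
Lemma vge_lead k z : vge k z -> exists c, C c /\ vge (k + 1) (z - c * x ^ k).
Proof.
move=> /residue[c [Cc /mid_vge h]]; exists c; split => //.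
have := vgeM (vge_x k) h; rewrite mulrBr [x ^ k * (z * _)]mulrCA -expfzDr // subrr expr0z mulr1.
by rewrite [c * _]mulrC.
Qed.
Lemma ord_lead k z : ord k z -> exists c, [/\ C c, c != 0 & vge (k + 1) (z - c * x ^ k)].
Proof.
move=> hz; have [c [Cc h]] := vge_lead (ord_vge hz); exists c; split => //.
by apply/eqP => c0; apply: (ord_not_vge hz); move: h; rewrite c0 mul0r subr0.
Qed.

End Place.
Unset Default Proof Using.
End Valuations.

Section Closed.
Variables (T : fieldType) (F : set T).
Hypothesis hF : subfield F.

Lemma pov_divX (p : {poly T}) c : pov F p -> F c -> root p c ->
  exists q, pov F q /\ p = q * ('X - c%:P).
Proof.
move=> hp Fc /factor_theorem[Q eQ]; exists Q; split => //.
have [P' eP] := pov_lift hF hp.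
have cX : 'X - c%:P = map_poly (@sfval _ _ hF) ('X - (sfin hF Fc)%:P).
  by rewrite rmorphB /= map_polyX map_polyC.
have -> : Q = p %/ ('X - c%:P) by rewrite eQ mulpK // polyXsubC_eq0.
by rewrite eP cX -map_divp; exact: pov_map.
Qed.

Lemma closed_acl : alg_closed F -> acl F `<=` F.
Proof.
move=> cF x [p /(povP hF) hp /andP[p0 /eqP px]].
have [k] := ubnP (size p); elim: k p p0 hp px => // k IH p p0 hp px lt.
have [s1|s1] := leqP (size p) 1.
  have /size_poly1P[c c0 e1] : size p == 1 by rewrite eqn_leq s1 size_poly_gt0.
  by move: px c0; rewrite e1 hornerC => ->; rewrite eqxx.
have [|c Fc hc] := cF _ _ s1; first by apply/(povP hF).
have {}Fc := set_mem Fc; have [q [hq e]] := pov_divX hp Fc hc.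
have q0 : q != 0 by apply: contraNneq p0 => h; rewrite e h mul0r.
move: px; rewrite e hornerM !hornerE => /eqP; rewrite mulf_eq0 subr_eq0.
move=> /orP[/eqP qx|/eqP ->//]; apply: (IH q q0 hq qx).
by move: lt; rewrite e size_Mmonic ?monicXsubC // size_XsubC addn2.
Qed.

Lemma acl_closed : alg_closed [set: T] -> alg_closed (acl F).
Proof.
move=> cT p /(povP (acl_sf hF)) hp s1.
have [|x _ px] := cT p _ s1; first by apply/(all_nthP 0) => i _; exact: mem_set.
exists x => //; apply: mem_set; apply: (acl_root hF hp) => //.
by rewrite -size_poly_gt0; apply: ltnW.
Qed.

End Closed.

(** * Existence and incomparability of places *)

Section Places.
Variables (N : fieldType) (C : set N).
Hypothesis hN : curve C.
Let hC : subfield C. Proof. by case: hN. Qed.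
Let cC : alg_closed C. Proof. by case: hN. Qed.

(* Chevalley: a subring maximal among those avoiding z is a valuation ring. *)
Lemma chevalley (R : set N) z : sring R -> C `<=` R -> z != 0 -> ~ radj R z^-1 z ->
  exists O, [/\ vring C O, R `<=` O, ~ O z & O z^-1].
Proof.
move=> hR CR z0 nz; pose R' := radj R z^-1.
have hR' : sring R' by exact: radj_sring.
pose P (Y : set N) := sring (Y `|` R') /\ ~ (Y `|` R') z.
have chain (F : set (set N)) : F `<=` P -> total_on F subset -> P (\bigcup_(Y in F) Y).
  move=> FP tot.
  have two p q : (\bigcup_(Y in F) Y `|` R') p -> (\bigcup_(Y in F) Y `|` R') q ->
     (R' p /\ R' q) \/ exists2 Y, F Y & (Y `|` R') p /\ (Y `|` R') q.
    case=> [[Y FY Yp]|Xp] [[Z FZ Zq]|Xq].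
    - right; have [YZ|ZY] := tot _ _ FY FZ.
        by exists Z => //; split; left => //; exact: YZ.
      by exists Y => //; split; left => //; exact: ZY.
    - by right; exists Y => //; split; [left|right].
    - by right; exists Z => //; split; [right|left].
    - by left.
  have inc Y : F Y -> Y `|` R' `<=` \bigcup_(Y in F) Y `|` R'.
    by move=> FY p [Yp|Xp]; [left; exists Y|right].
  split; last by case=> [[Y FY Yz]|//]; have [_] := FP Y FY; apply; left.
  split.
  - by right; exact: sr1.
  - move=> p q hp hq; have [[Xp Xq]|[Y FY [Yp Yq]]] := two p q hp hq.
      by right; exact: srB.
    by apply: (inc Y FY); have [h _] := FP Y FY; exact: (srB h).
  - move=> p q hp hq; have [[Xp Xq]|[Y FY [Yp Yq]]] := two p q hp hq.
      by right; exact: srM.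
    by apply: (inc Y FY); have [h _] := FP Y FY; exact: (srM h).
have [A [[hS Sz] maxA]] := Zorn_bigcup chain.
set S := A `|` R' in hS Sz.
have maxS S' : sring S' -> S `<=` S' -> ~ S' z -> S' `<=` S.
  move=> hS' SS' S'z; apply: contrapT => n; apply: (maxA S'); last first.
    rewrite /P; suff -> : S' `|` R' = S' by [].
    by apply/seteqP; split=> [p [|Rp]|p Sp] //; [apply: SS'; right|left].
  split; first by move=> p Ap; apply: SS'; left.
  by move=> h; apply: n => p Sp; left; exact: h.
have Sw : S z^-1 by right; exact: radj_gen.
have RS : R `<=` S by move=> r Rr; right; exact: sub_radj.
(* By maximality of S, the element 1/z lies in its Jacobson radical. *)
have jac s : S s -> 1 - z^-1 * s != 0 /\ S (1 - z^-1 * s)^-1.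
  move=> Ss; have n0 : 1 - z^-1 * s != 0.
    apply/eqP => /eqP; rewrite subr_eq0 => /eqP e; apply: Sz.
    suff -> : z = s by []. by apply: (mulfI (invr_neq0 z0)); rewrite -e mulVf.
  split => //; set v := 1 - _ in n0 *.
  apply: (maxS (radj S v^-1)); [exact: radj_sring|exact: sub_radj| |exact: radj_gen].
  move=> [p hp e].
  have Sv : S v by apply: (srB hS); [exact: sr1|exact: srM].
  have [s' Ss' ev] : exists2 s', S s' & v ^+ size p = 1 - z^-1 * s'.
    elim: (size p) => [|k [s' Ss' IH]].
      by exists 0; [exact: sr0|rewrite expr0 mulr0 subr0].
    exists (s + s' - z^-1 * s * s').
      by apply: (srB hS); [exact: srD|do 2?apply: (srM hS)].
    by rewrite exprS IH /v; ring.
  apply: Sz; have -> : z = z * v ^+ size p + s' by rewrite ev mulrBr mulrA mulfV // mul1r mulr1 subrK.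
  apply: (srD hS) => //; rewrite [X in X * _]e horner_coef mulr_suml; apply: (sr_sum hS) => i _.
  have -> : p`_i * v^-1 ^+ i * v ^+ size p = p`_i * v ^+ (size p - i).
    rewrite -mulrA; congr (_ * _).
    have -> : v ^+ size p = v ^+ (size p - i) * v ^+ i by rewrite -exprD subnK // ltnW.
    by rewrite exprVn mulrC mulfK // expf_neq0.
  by apply: (srM hS); [exact: hp|exact: srX].
exists S; split => //.
split => //; [by move=> c /CR/RS| |by exists z].
have minp u : ~ S u -> exists p, [/\ pov S p, p.[u] = z &
    forall q, pov S q -> q.[u] = z -> (size p <= size q)%N].
  move=> nu; have [p hp e] : radj S u z.
    apply: contrapT => n; apply: nu; apply: (maxS (radj S u)) => //.
    - exact: radj_sring.
    - exact: sub_radj.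
    - exact: radj_gen.
  pose Q n := `[< exists p, [/\ pov S p, p.[u] = z & size p = n] >].
  have exQ : exists n, Q n by exists (size p); apply/asboolP; exists p.
  case: (ex_minnP exQ) => n /asboolP[p' [h1 h2 h3]] min; exists p'; split => // q hq eq.
  by rewrite h3; apply: min; apply/asboolP; exists q.
(* The relation q writes 1 as a combination of negative powers of u, its constant term being
   absorbed into the unit a. Multiplying the leading term of p by this expression lowers the degree
   of p. *)
have main u p q : u != 0 -> pov S p -> p.[u] = z -> pov S q -> q.[u^-1] = z ->
    (size q <= size p)%N -> exists p', [/\ pov S p', p'.[u] = z & (size p' < size p)%N].
  move=> u0 hp pz hq qz le.
  have s2 : (1 < size q)%N.
    rewrite ltnNge; apply/negP => h; apply: Sz; rewrite -qz (size1_polyC h) hornerC; exact: hq.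
  have [a0 Sa] := jac _ (hq 0%N); set a := 1 - _ in a0 Sa.
  pose l := lead_coef p.
  pose r := \poly_(i < (size p).-1) (p`_i + (if ((size p).-1 - i < size q)%N then
     a^-1 * z^-1 * q`_((size p).-1 - i) * l else 0)).
  exists r; split.
  - move=> i; rewrite coef_poly; case: ifP => _; last exact: sr0.
    apply: (srD hS); first exact: hp.
    case: ifP => _; last exact: sr0.
    apply: (srM hS); last exact: hp.
    by apply: (srM hS); [exact: srM|exact: hq].
  - have ea : \sum_(j < (size q).-1) z^-1 * q`_j.+1 * u^-1 ^+ j.+1 = a.
      have := qz; rewrite horner_coef -(prednK (ltnW s2)) big_ord_recl /= expr0 mulr1.
      move=> e; under eq_bigr do rewrite -mulrA.
      rewrite -mulr_sumr; have -> : \sum_(i < (size q).-1) q`_i.+1 * u^-1 ^+ i.+1 = z - q`_0.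
        by rewrite -e addrAC subrr add0r.
      by rewrite mulrBr mulVf.
    have s1 : (0 < size p)%N by apply: leq_trans le; apply: ltnW.
    rewrite horner_poly; under eq_bigr do rewrite mulrDl.
    rewrite big_split /= -[RHS]pz horner_coef -[in RHS](prednK s1) big_ord_recr /=; congr (_ + _).
    rewrite -/(lead_coef p) -/l.
    have -> : l * u ^+ (size p).-1 = a^-1 * l * u ^+ (size p).-1 *
        \sum_(j < (size q).-1) z^-1 * q`_j.+1 * u^-1 ^+ j.+1.
      by rewrite ea [RHS]mulrC !mulrA mulfV // mul1r.
    rewrite mulr_sumr.
    rewrite (reindex_inj rev_ord_inj) /=.
    have le' : ((size q).-1 <= (size p).-1)%N by lia.
    rewrite (big_ord_widen _ (fun j => a^-1 * l * u ^+ (size p).-1 * (z^-1 * q`_j.+1 * u^-1 ^+ j.+1)) le').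
    rewrite [RHS]big_mkcond /=; apply: eq_bigr => j _.
    have lt := ltn_ord j.
    rewrite (subKn lt).
    have -> : (j.+1 < size q)%N = (j < (size q).-1)%N by rewrite -[in LHS](prednK (ltnW s2)).
    case: ifP => _; last by rewrite mul0r.
    have -> : u ^+ (size p).-1 = u ^+ ((size p).-1 - j.+1) * u ^+ j.+1 by rewrite -exprD subnK.
    have : u ^+ j.+1 * u^-1 ^+ j.+1 = 1 by rewrite -exprMn mulfV // expr1n.
    move: (u ^+ j.+1) (u^-1 ^+ j.+1) => A1 A2 e.
    rewrite -[LHS]mulr1 -e; ring.
  - have s1 : (0 < size p)%N by apply: leq_trans le; apply: ltnW.
    by rewrite -(prednK s1) ltnS; exact: size_poly.
move=> u; apply: contrapT => /not_orP[nu nu'].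
have u0 : u != 0 by apply/eqP => e; apply: nu; rewrite e; exact: sr0.
have [p [hp pz pmin]] := minp _ nu; have [q [hq qz qmin]] := minp _ nu'.
have [le|/ltnW le] := leqP (size q) (size p).
  have [p' [h1 h2]] := main u p q u0 hp pz hq qz le.
  by rewrite ltnNge => /negP; apply; exact: pmin.
have u0' : u^-1 != 0 by rewrite invr_eq0.
have pz' : p.[u^-1^-1] = z by rewrite invrK.
have [p' [h1 h2]] := main _ q p u0' hq qz hp pz' le.
by rewrite ltnNge => /negP; apply; exact: qmin.
Qed.

(** If z were a polynomial in 1/z over C, then 1/z would be algebraic over C, hence in C. *)
Lemma place_avoiding z : ~ C z -> exists O, [/\ vring C O, ~ O z & O z^-1].
Proof.
move=> Cz; have z0 : z != 0 by apply/eqP => e; apply: Cz; rewrite e; exact: sf0.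
have [|O [h1 _ h2 h3]] := chevalley (sf_sring hC) (@subset_refl _ C) z0; last by exists O.
move=> [p hp e]; apply: Cz; rewrite -[z]invrK; apply: (sfV hC); apply: (closed_acl hC cC).
apply: (@aclI _ _ ('X * p - 1)).
- apply: (povD hC); first by apply: (povM hC) => //; exact: povX.
  by apply: (povN hC); apply: (povC hC); exact: sf1.
- apply/eqP => /polyP/(_ 0%N); rewrite coefB coefXM coef1 coef0 /= sub0r => /eqP.
  by rewrite oppr_eq0 oner_eq0.
- by rewrite /root !hornerE -e mulVf // subrr.
Qed.

(** Places are discrete, so there is no strict inclusion between them: a strict overring of O1
    contains 1/x for a uniformizer x, hence every element. *)
Lemma place_neq O1 O2 : vring C O1 -> vring C O2 -> O1 <> O2 -> exists z, O1 z /\ ~ O2 z.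
Proof.
move=> h1 h2 ne; apply: contrapT => none.
have sub z : O1 z -> O2 z by move=> hz; apply: contrapT => h; apply: none; exists z.
have [y [y2 y1]] : exists y, O2 y /\ ~ O1 y.
  apply: contrapT => h; apply: ne; apply/seteqP; split => // z hz.
  by apply: contrapT => h'; apply: h; exists z.
have [x hx] := uniformizer hN h1; have [mx x0 gx] := hx.
have s1 : sring O1 by case: h1. have s2 : sring O2 by case: h2.
have O2x : O2 x by apply: sub; exact: (mid_sub hN h1 mx).
have O2x' : O2 x^-1.
  have [Oy' y0] : O1 y^-1 /\ y != 0.
    by split; [case: (mid_inv hN h1 y1)|apply/eqP => e; apply: y1; rewrite e; exact: sr0].
  have my : mid O1 y^-1 by exact: (mid_inv hN h1).
  have := gx _ my => h; have := srM s2 y2 (sub _ h).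
  by rewrite mulrA mulfV // mul1r.
have all z : O2 z.
  have [->|z0] := eqVneq z 0; first exact: sr0.
  have [k [_ [hk _]]] := ord_exists hN h1 hx z0.
  have -> : z = (z * x ^ (- k)) * x ^ k by rewrite -mulrA -expfzDr // addNr expr0z mulr1.
  apply: (srM s2); first exact: sub.
  by case: (k) => n; rewrite ?NegzE -?exprnP -?exprnN -?exprVn; exact: srX.
by case: h2 => _ _ _ [z]; apply; exact: all.
Qed.

End Places.

Lemma uniform_bound (I : finType) (Q : I -> nat -> Prop) :
  (forall i m n, (m <= n)%N -> Q i m -> Q i n) -> (forall i, exists n, Q i n) ->
  exists n, forall i, Q i n.
Proof.
move=> mon /choice[f hf]; exists (\max_i f i)%N => i.
by apply: mon (hf i); exact: leq_bigmax.
Qed.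

(** * Independence of places and the fundamental inequality *)

Section OnePole.
Variables (N : fieldType) (C : set N).
Hypothesis hN : curve C.
Let hC : subfield C. Proof. by case: hN. Qed.
Let cC : alg_closed C. Proof. by case: hN. Qed.
Let char0 : [pchar N] =i pred0. Proof. by case: hN. Qed.

Lemma vge_nat O (hO : vring C O) x (hx : unif O x) z : exists n : nat, vge O x (- n%:Z) z.
Proof.
have [->|z0] := eqVneq z 0; first by exists 0%N; exact: (vge0 hN hO hx).
have [k hk] := ord_exists hN hO hx z0; exists `|k|%N.
by apply: (vge_mono hN hO hx) (ord_vge hN hO hx hk); lia.
Qed.

Lemma vgeX O (hO : vring C O) x (hx : unif O x) k z n :
  vge O x k z -> vge O x (k * n%:Z) (z ^+ n).
Proof.
move=> h; elim: n => [|n IH].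
  by rewrite mulr0 expr0; apply: (vge_C hN hO hx); exact: sf1.
have -> : k * n.+1%:Z = k + k * n%:Z by rewrite intS mulrDr mulr1.
by rewrite exprS; exact: (vgeM hN hO hx).
Qed.

Lemma ordX O (hO : vring C O) x (hx : unif O x) k z n :
  ord O x k z -> ord O x (k * n%:Z) (z ^+ n).
Proof.
move=> h; elim: n => [|n IH].
  by rewrite mulr0 expr0; apply: (ord_C hN hO hx); [exact: sf1|exact: oner_neq0].
have -> : k * n.+1%:Z = k + k * n%:Z by rewrite intS mulrDr mulr1.
by rewrite exprS; exact: (ordM hN hO hx).
Qed.

Section Distinct.
Variables (s : nat) (O : nat -> set N).
Hypothesis hO : forall i, (i < s)%N -> vring C (O i).
Hypothesis dist : forall i j, (i < s)%N -> (j < s)%N -> i != j -> O i <> O j.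

Lemma avoid (c : nat -> N) : exists2 a, C a & forall i, (i < s)%N -> a != c i.
Proof.
have p0 : \prod_(i < s) ('X - (c i)%:P) != 0.
  by apply/prodf_neq0 => i _; rewrite polyXsubC_eq0.
have [n] := nat_nonroot char0 p0; rewrite horner_prod => /prodf_neq0 h.
exists n%:R; first exact: (sfnat hC).
by move=> i lt; have := h (Ordinal lt) isT; rewrite !hornerE subr_eq0.
Qed.

(** For each j take z in O_i but not in O_j, and invert z - a, where a avoids the residues of z. The
    result is regular at every place of the list, a unit at O_i, and in the maximal ideal of O_j.
    The product over j has the required properties. *)
Lemma separator i : (i < s)%N -> exists h, [/\ h != 0, O i h, O i h^-1
  & forall j, (j < s)%N -> j != i -> mid (O j) h].
Proof.
move=> si; have sO l (lt : (l < s)%N) : sring (O l) by case: (hO lt).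
have CO l (lt : (l < s)%N) : C `<=` O l by case: (hO lt).
have pair j : exists g, (j < s)%N -> j != i -> [/\ g != 0, O i g, O i g^-1, mid (O j) g
    & forall l, (l < s)%N -> O l g].
  have [[sj ji]|h] := pselect ((j < s)%N /\ j != i); last by exists 0 => h1 h2; exfalso; apply: h.
  have [z [zi zj]] : exists z, O i z /\ ~ O j z.
    apply: (place_neq hN (hO si) (hO sj)); apply: dist => //; by rewrite eq_sym.
  have /choice[c hc] : forall l, exists c, (l < s)%N -> O l z -> C c /\ mid (O l) (z - c).
    move=> l; have [[sl Oz]|h] := pselect ((l < s)%N /\ O l z); last by exists 0 => h1 h2; exfalso; apply: h.
    by have [c hc] := residue hN (hO sl) Oz; exists c.
  have [a Ca ha] := avoid c.
  have unit l : (l < s)%N -> O l z -> O l (z - a)^-1 /\ z - a != 0.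
    move=> sl Oz; have [Cc mc] := hc l sl Oz.
    apply: (not_mid_inv hN (hO sl)); first by apply: (srB (sO l sl)) => //; exact: CO.
    move=> m; move: (ha l sl); rewrite -subr_eq0 => /eqP; apply.
    apply: (midC hN (hO sl)); first exact: (sfB hC).
    have -> : a - c l = (z - c l) - (z - a) by ring.
    by apply: (midD hN (hO sl)) => //; apply: (midN hN (hO sl)).
  have [ui n0] := unit i si zi.
  have nj l : (l < s)%N -> ~ O l z -> mid (O l) (z - a)^-1.
    move=> sl nz; apply: (mid_inv hN (hO sl)) => h; apply: nz.
    by rewrite -[z](subrK a); apply: (srD (sO l sl)) => //; exact: CO.
  exists (z - a)^-1 => _ _; split; rewrite ?invr_eq0 ?invrK //.
  - by apply: (srB (sO i si)) => //; exact: CO.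
  - exact: nj.
  - move=> l sl; have [/(unit l sl)[]//|/(nj l sl)] := pselect (O l z).
    exact: (mid_sub hN (hO sl)).
have /choice[g hg] := pair.
exists (\prod_(j < s | j != i :> nat) g j); split.
- by apply/prodf_neq0 => j ji; have [] := hg j (ltn_ord j) ji.
- by apply: (sr_prod (sO i si)) => j ji; have [] := hg j (ltn_ord j) ji.
- rewrite -prodfV; apply: (sr_prod (sO i si)) => j ji; by have [] := hg j (ltn_ord j) ji.
- move=> j sj ji; rewrite (bigD1 (Ordinal sj)) //= mulrC; apply: (midM hN (hO sj)).
    by apply: (sr_prod (sO j sj)) => l /andP[li _]; have [_ _ _ _] := hg l (ltn_ord l) li; apply.
  by have [] := hg j sj ji.
Qed.

Variables (x : nat -> N) (e : nat -> nat) (t : N).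
Hypothesis hx : forall i, (i < s)%N -> unif (O i) (x i).
Hypothesis ht : forall i, (i < s)%N -> ord (O i) (x i) (e i)%:Z t.

(** The zeros of t, counted with multiplicities e_i, number at most the degree over C(t), because
    the elements h_i^E x_i^l with l < e_i are independent over C[t]. In a primitive relation,
    consider one place and its terms with nonzero p(0): the one of least l is alone of value l
    there, since terms with p(0) = 0 gain the value e_i and those of the other places vanish to high
    order. *)
Lemma fundamental_inequality d :
  (forall (J : finType) (b : J -> N), (d < #|J|)%N -> dep C t b) ->
  (forall i, (i < s)%N -> (0 < e i)%N) -> (\sum_(i < s) e i <= d)%N.
Proof.
move=> hd epos; rewrite leqNgt; apply/negP => lt.
pose J := {i : 'I_s & 'I_(e i)}; pose S := (\sum_(i < s) e i)%N.
have eS (i : 'I_s) : (e i <= S)%N by rewrite /S (bigD1 i) //= leq_addr.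
have /choice[h hh] : forall i : 'I_s, exists h, [/\ h != 0, O i h, O i h^-1
  & forall j, (j < s)%N -> j != i :> nat -> mid (O j) h] by move=> i; exact: separator.
have [P hP] : exists P, forall ij : 'I_s * 'I_s, vge (O ij.1) (x ij.1) (- P%:Z) (x ij.2).
  apply: uniform_bound => [[i j] m n mn|[i j]] /=.
    by apply: (vge_mono hN (hO (ltn_ord i)) (hx (ltn_ord i))); lia.
  exact: (vge_nat (hO (ltn_ord i)) (hx (ltn_ord i))).
(* P bounds the poles of the x_j at the places, so h_i^E makes the elements attached to i vanish to
   order at least S at all the other places. *)
pose E := (P * S + S)%N.
pose b (a : J) := h (tag a) ^+ E * x (tag a) ^+ tagged a.
have cJ : #|{: J}| = S.
  rewrite card_tagged sumnE big_map big_enum /=.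
  by apply: eq_bigr => i _; rewrite card_ord.
have t0 : t != 0.
  case: (s) ht lt => [|s'] ht' lt; first by move: lt; rewrite big_ord0.
  by case: (ht' 0%N isT).
have [|p [hp [a0 pa0] rel]] := primitive_relation hN t0 (hd J b _); first by rewrite cJ.
have [a /andP[pa /eqP ta] min] := @arg_minnP _ a0 (fun a => ((p a).[0] != 0) && (tag a == tag a0))
  (fun a => nat_of_ord (tagged a)) (introT andP (conj pa0 (eqxx _))).
pose i := tag a; pose k : nat := tagged a.
have hOi := hO (ltn_ord i); have hxi := hx (ltn_ord i).
have hti := ht (ltn_ord i).
have ke : (k < e i)%N by exact: ltn_ord.
have mt : mid (O i) t.
  apply/(mid_vge hN hOi hxi); apply: (vge_mono hN hOi hxi) (ord_vge hN hOi hxi hti).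
  by have := epos i (ltn_ord i); lia.
have sOi : sring (O i) by case: hOi.
have COi : C `<=` O i by case: hOi.
have pO q : pov C q -> O i q.[t].
  by move=> hq; apply: (rpov_horner sOi) => [j|]; [apply: COi; exact: hq|case: mt].
have pE q : pov C q -> q.[0] = 0 -> vge (O i) (x i) (e i)%:Z q.[t].
  move=> hq q0; have [r [er hr]] : exists r, q = r * 'X /\ pov C r.
    exists (\poly_(l < (size q).-1) q`_l.+1); split.
      apply/polyP => -[|l]; first by rewrite coefMX /= -horner_coef0 q0.
      by rewrite coefMX coef_poly /=; case: ltnP => // g; rewrite nth_default //; lia.
    by move=> l; rewrite coef_poly; case: ifP => _; [exact: (hq _)|exact: sf0].
  rewrite er hornerMX -[X in vge _ _ X]add0r; apply: (vgeM hN hOi hxi).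
    by apply/(vge_O hN hOi hxi); exact: pO.
  exact: (ord_vge hN hOi hxi hti).
have ordb : ord (O i) (x i) k%:Z ((p a).[t] * b a).
  rewrite -[k%:Z]add0r; apply: (ordM hN hOi hxi).
    have -> : (p a).[t] = (p a).[0] + ((p a).[t] - (p a).[0]) by ring.
    apply: (ordD hN hOi hxi).
      apply: (ord_C hN hOi hxi) => //; apply: (pov_horner hC) => //; exact: sf0.
    rewrite add0r; apply/(mid_vge hN hOi hxi); apply: (mid_root hN hOi) => //; first by case: mt.
    by move=> l; apply: COi; exact: (hp a).
  rewrite /b -[k%:Z]add0r; apply: (ordM hN hOi hxi).
    have [h0 h1 h2 _] := hh i; split; first by rewrite expf_neq0.
    by rewrite oppr0 expr0z mulr1 -exprVn; split; exact: srX.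
  by rewrite exprnP; exact: (ord_x hN hOi hxi).
have rest c : c != a -> vge (O i) (x i) (k%:Z + 1) ((p c).[t] * b c).
  move=> ca; have [tci|tci] := eqVneq (tag c) i; last first.
    rewrite -[k%:Z + 1]add0r; apply: (vgeM hN hOi hxi).
      by apply/(vge_O hN hOi hxi); exact: pO.
    have [h0 h1 h2 h3] := hh (tag c).
    have : mid (O i) (h (tag c)) by apply: h3 => //; rewrite eq_sym; apply: contraNneq tci => /val_inj ->.
    move=> /(mid_vge hN hOi hxi)/(vgeX hOi hxi E) v1.
    have /= v2 := vgeX hOi hxi (tagged c) (hP (i, tag c)).
    apply: (vge_mono hN hOi hxi) (vgeM hN hOi hxi v1 v2).
    have le1 : (P * tagged c <= P * S)%N.
      by rewrite leq_mul2l; apply/orP; right; apply: ltnW; apply: leq_trans (eS (tag c)).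
    have := leq_trans ke (eS i); move: le1; rewrite /E mul1r mulNr -PoszM.
    move: (P * tagged c)%N (P * S)%N => A1 A2 l1 l2; lia.
  have [h0 h1 h2 _] := hh i.
  have vb : vge (O i) (x i) (tagged c)%:Z (b c).
    rewrite /b -[(tagged c)%:Z]add0r; apply: (vgeM hN hOi hxi).
      by apply/(vge_O hN hOi hxi); apply: (srX sOi); rewrite tci.
    move: (nat_of_ord (tagged c)) => kk; rewrite tci exprnP; exact: (vge_x hN hOi hxi).
  have [kc|kc] := ltnP k (tagged c).
    rewrite -[k%:Z + 1]add0r; apply: (vgeM hN hOi hxi).
      by apply/(vge_O hN hOi hxi); exact: pO.
    by apply: (vge_mono hN hOi hxi) vb; lia.
  have ne : (tagged c : nat) != k.
    apply: contraNneq ca => E1; move: tci E1 {vb kc}; rewrite /i /k; case: c => c1 c2; case: (a) => a1 a2 /= E1.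
    by subst c1 => E2; apply/eqP; congr existT; exact: val_inj.
  have p0 : (p c).[0] = 0.
    apply/eqP/negP => /negP pc; have tc0 : tag c == tag a0 by rewrite tci /i ta.
    by have := min c (introT andP (conj pc tc0)); rewrite -/k leqNgt ltn_neqAle ne kc.
  have := vgeM hN hOi hxi (pE _ (hp c) p0) vb.
  by apply: (vge_mono hN hOi hxi); lia.
have : ord (O i) (x i) k%:Z (\sum_c (p c).[t] * b c).
  rewrite (bigD1 a) //=; apply: (ordD hN hOi hxi) => //.
  exact: (vge_sum hN hOi hxi).
by rewrite rel => -[]; rewrite eqxx.
Qed.

End Distinct.
End OnePole.

(** * Functions with a single pole *)

Section OnePole.
Variables (N : fieldType) (C : set N).
Hypothesis hN : curve C.
Let hC : subfield C. Proof. by case: hN. Qed.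
Let cC : alg_closed C. Proof. by case: hN. Qed.
Let fin : forall w, ~ C w -> finite_over C w. Proof. by case: hN. Qed.

Lemma dep_reverse u (J : finType) (b : J -> N) : u != 0 -> dep C u b -> dep C u^-1 b.
Proof.
move=> u0 [p [hp [i0 pi0] e]]; pose K := \max_i size (p i).
have sK i : (size (p i) <= K)%N by exact: leq_bigmax.
exists (fun i => \poly_(j < K.+1) (p i)`_(K - j)); split.
- by move=> i j; rewrite coef_poly; case: ifP => _; [exact: (hp i)|exact: sf0].
- exists i0; apply: contraNneq pi0 => h; apply/eqP/polyP => j; rewrite coef0.
  have [lt|ge] := ltnP j (size (p i0)); last by rewrite nth_default.
  have jK : (j <= K)%N by apply: ltnW; apply: leq_trans (sK i0).
  move/polyP/(_ (K - j)%N): h; rewrite coef_poly coef0 ltnS leq_subr.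
  by rewrite subKn.
- apply: (mulfI (expf_neq0 K u0)); rewrite mulr0 mulr_sumr -[RHS]e; apply: eq_bigr => i _.
  rewrite mulrA; congr (_ * _); rewrite horner_poly mulr_sumr.
  rewrite (reindex_inj rev_ord_inj) /= (@horner_coef_wide _ K.+1); last exact: leqW.
  apply: eq_bigr => j _; rewrite subSS subKn; last by rewrite -ltnS.
  rewrite mulrCA; congr (_ * _).
  have -> : u ^+ K = u ^+ j * u ^+ (K - j) by rewrite -exprD subnKC // -ltnS.
  by rewrite -mulrA -exprMn mulfV // expr1n mulr1.
Qed.

Lemma dep_card w n (J : finType) (b : J -> N) :
  (forall b : 'I_n -> N, dep C w b) -> (n <= #|J|)%N -> dep C w b.
Proof.
move=> hn le; pose f (i : 'I_n) : J := enum_val (widen_ord le i).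
have fi : injective f by move=> i j /enum_val_inj/(congr1 val) /= h; exact: val_inj.
have [p [hp [i0 pi0] e]] := hn (b \o f).
exists (fun j => \sum_(i | f i == j) p i); split.
- by move=> j k; rewrite coef_sum; apply: (sf_sum hC) => i _; exact: (hp i).
- exists (f i0); rewrite (big_pred1 i0) // => i /=; exact: inj_eq.
- rewrite -[RHS]e (partition_big f predT) //=; apply: eq_bigr => j _.
  rewrite horner_sum mulr_suml; apply: eq_bigr => i /eqP <-; by [].
Qed.

Lemma field_basis u : ~ C u -> exists d (b : 'I_d -> N), ~ dep C u b /\
  forall (J : finType) (b : J -> N), (d < #|J|)%N -> dep C u b.
Proof.
move=> nu; pose P n := `[< forall b : 'I_n -> N, dep C u b >].
have exP : exists n, P n by have [n hn] := fin nu; exists n; apply/asboolP.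
case: (ex_minnP exP) => -[|d] /asboolP h min.
  by have [p [_ [[]]]] := h (fun=> 0).
exists d; have : ~ P d by move=> /min; rewrite ltnn.
move=> nP; have /existsNP[b hb] : ~ forall b : 'I_d -> N, dep C u b by move=> h'; apply: nP; apply/asboolP.
 exists b; split => // J b' lt.
exact: dep_card h lt.
Qed.

Lemma poly_transc u p : ~ C u -> pov C p -> p != 0 -> p.[u] != 0.
Proof.
move=> nu hp p0; apply/eqP => e; apply: nu; apply: (closed_acl hC cC).
by apply: (aclI hp p0); apply/eqP.
Qed.

(** Multiplying b by the leading coefficient of an equation over C[u] makes it integral over C[u],
    and valuation rings are integrally closed. *)
Lemma integral_scale u b : ~ C u -> exists l, [/\ pov C l, l != 0 &
  forall O, vring C O -> O u -> O (l.[u] * b)].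
Proof.
move=> nu; have [n hn] := fin nu.
have [p [hp [i0 pi0] e]] := hn (fun i => b ^+ i).
have [i pi max] := @arg_maxnP _ i0 (fun i => p i != 0) (fun i => nat_of_ord i) pi0.
exists (p i); split => // O hO Ou; apply: contrapT => ny.
have sO : sring O by case: hO. have CO : C `<=` O by case: hO.
have pO q : pov C q -> O q.[u].
  by move=> hq; apply: (rpov_horner sO) => // j; apply: CO; exact: hq.
set l := (p i).[u] in ny; have l0 : l != 0 by exact: poly_transc.
set y := l * b in ny; have y0 : y != 0.
  by apply/eqP => h; apply: ny; rewrite h; exact: sr0.
have my := mid_inv hN hO ny; have Oy : O y^-1 by case: my.
have e1 : \sum_(j < n | (j < i)%N) (p j).[u] * b ^+ j = - (l * b ^+ i).
  apply/eqP; rewrite -addr_eq0 addrC; apply/eqP; rewrite -[RHS]e [RHS](bigD1 i) //=.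
  congr (_ + _).
  rewrite [LHS]big_mkcond [RHS]big_mkcond /=; apply: eq_bigr => j _.
  have [->|ji] := eqVneq j i; first by rewrite ltnn.
  case: ltnP => // ij; suff -> : p j = 0 by rewrite horner0 mul0r.
  by apply/eqP/negP => /negP /max /=; rewrite leqNgt ltn_neqAle ij eq_sym ji.
have [i00|ipos] := posnP i.
  move: e1; rewrite i00 expr0 mulr1 big1 => [/eqP|j]; last by rewrite ltn0.
  by rewrite eq_sym oppr_eq0 (negbTE l0).
apply: (not_mid1 hN hO).
have -> : 1 = - \sum_(j < n | (j < i)%N) ((p j).[u] * l ^+ (i.-1 - j)) * y^-1 ^+ (i - j).
  apply: (mulIf (expf_neq0 i y0)); rewrite mul1r mulNr mulr_suml.
  transitivity (- (l ^+ i.-1 * \sum_(j < n | (j < i)%N) (p j).[u] * b ^+ j)).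
    by rewrite e1 mulrN opprK mulrA -exprSr prednK // /y exprMn.
  congr (- _); rewrite mulr_sumr; apply: eq_bigr => j ji.
  have -> : y ^+ i = y ^+ (i - j) * y ^+ j by rewrite -exprD subnK // ltnW.
  have e2 : y^-1 ^+ (i - j) * y ^+ (i - j) = 1 by rewrite -exprMn mulVf // expr1n.
  rewrite [RHS](_ : _ = (p j).[u] * l ^+ (i.-1 - j) * y ^+ j); last first.
    by rewrite -[RHS]mulr1 -e2; ring.
  rewrite /y exprMn.
  have -> : l ^+ i.-1 = l ^+ (i.-1 - j) * l ^+ j.
    by rewrite -exprD subnK // -ltnS prednK.
  by ring.
apply: (midN hN hO); apply: (mid_sum hN hO) => j ji; apply: (midM hN hO).
  by apply: (srM sO); [exact: pO|apply: (srX sO); exact: pO].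
have -> : (i - j = (i - j).-1.+1)%N by rewrite prednK // subn_gt0.
by rewrite exprSr; apply: (midM hN hO) => //; exact: srX.
Qed.

Lemma expansion O (hO : vring C O) x (hx : unif O x) k z n : vge O x k z ->
  exists c : nat -> N, (forall i, C (c i)) /\
    vge O x (k + n%:Z) (z - \sum_(i < n) c i * x ^ (k + i%:Z)).
Proof.
move=> hz; elim: n => [|n [c [Cc h]]].
  exists (fun=> 0); split => [i|]; first exact: sf0.
  by rewrite big_ord0 !subr0.
have [a [Ca h']] := vge_lead hN hO hx h.
exists (fun i => if i == n then a else c i); split; first by move=> i; case: ifP.
have -> : k + n.+1%:Z = k + n%:Z + 1 by lia.
rewrite big_ord_recr /= eqxx opprD addrA.
suff -> : \sum_(i < n) (if (i : nat) == n then a else c i) * x ^ (k + i%:Z) =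
  \sum_(i < n) c i * x ^ (k + i%:Z) by [].
by apply: eq_bigr => i _; rewrite ltn_eqF.
Qed.

(** A weak form of Riemann-Roch, by counting. Over the poles of u, with orders e_i, the functions
    u^a b_j for a <= M span a space of dimension (M + 1) d and are regular wherever u is. Removing
    the polar parts and the constant terms at all the poles but the first costs the sum of the M e_i
    + B + 1 over these poles, which is smaller because the sum of all e_i is at most d and the first
    is positive. If u has only one pole, u itself serves. *)
Theorem one_pole u : ~ C u -> exists P f, [/\ vring C P, ~ C f
  & forall O, vring C O -> O <> P -> O f].
Proof.
move=> nu; have u0 : u != 0 by apply/eqP => e; apply: nu; rewrite e; exact: sf0.
have [d [b0 [indep hd]]] := field_basis nu.
have hdV (J : finType) (b : J -> N) : (d < #|J|)%N -> dep C u^-1 b.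
  by move=> /(hd J b); exact: dep_reverse.
pose dist s (O : nat -> set N) := [/\ forall i, (i < s)%N -> vring C (O i),
  forall i j, (i < s)%N -> (j < s)%N -> i != j -> O i <> O j & forall i, (i < s)%N -> ~ O i u].
have data s O : dist s O -> exists (x : nat -> N) (e : nat -> nat), [/\
    forall i, (i < s)%N -> unif (O i) (x i), forall i, (i < s)%N -> ord (O i) (x i) (e i)%:Z u^-1
    & forall i, (i < s)%N -> (0 < e i)%N].
  move=> [hO hdist hu].
  have /choice[x hx] : forall i, exists x, (i < s)%N -> unif (O i) x.
    move=> i; have [si|] := boolP (i < s)%N; last by exists 0.
    by have [x hx] := uniformizer hN (hO i si); exists x.
  have /choice[e he] : forall i, exists e : nat, (i < s)%N -> ord (O i) (x i) e%:Z u^-1 /\ (0 < e)%N.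
    move=> i; have [si|] := boolP (i < s)%N; last by exists 0%N.
    have hOi := hO i si; have hxi := hx i si.
    have ui0 : u^-1 != 0 by rewrite invr_eq0.
    have [k hk] := ord_exists hN hOi hxi ui0.
    have /(mid_vge hN hOi hxi) m := mid_inv hN hOi (hu i si).
    have le := ord_le hN hOi hxi hk m.
    exists `|k|%N => _; have -> : `|k|%N%:Z = k by lia.
    by split => //; lia.
  by exists x, e; split => // i si; case: (he i si).
have bound s O : dist s O -> (s <= d)%N.
  move=> hs; have [x [e [hx he epos]]] := data s O hs; case: hs => hO hdist hu.
  have := fundamental_inequality hN hO hdist hx he hdV epos.
  apply: leq_trans; rewrite -[X in (X <= _)%N]card_ord -sum1_card.
  by apply: leq_sum => i _; exact: epos.
pose Q s := `[< exists O, dist s O >].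
have exQ : exists s, Q s.
  by exists 0%N; apply/asboolP; exists (fun=> setT); split.
case: (@ex_maxnP Q d exQ) => [s /asboolP[O]|s /asboolP[O hs] maxs]; first exact: bound.
have [hO hdist hu] := hs.
have all P : vring C P -> ~ P u -> exists2 i, (i < s)%N & P = O i.
  move=> hP Pu; apply: contrapT => none.
  suff : Q s.+1 by move=> /maxs; rewrite ltnn.
  apply/asboolP; exists (fun i => if (i < s)%N then O i else P); split.
  - by move=> i _; case: ifP => // si; exact: hO.
  - move=> i j si sj ij; case: ifP => hi; case: ifP => hj; first exact: hdist.
    + by move=> e; apply: none; exists i.
    + by move=> e; apply: none; exists j.
    + by move: si sj ij; rewrite !ltnS => si sj /eqP; lia.
  - by move=> i _; case: ifP => // si; exact: hu.
have [P0 [hP0 P0u _]] := place_avoiding hN nu.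
have [i0 si0 _] := all P0 hP0 P0u.
have s0 : (0 < s)%N by exact: leq_ltn_trans si0.
have hO0 := hO 0%N s0.
have [s1|s2] := leqP s 1.
  exists (O 0%N), u; split => // P hP ne; apply: contrapT => Pu.
  have [i si e] := all P hP Pu; apply: ne; rewrite e; congr O; lia.
have [x [e [hx he epos]]] := data s O hs.
have fineq := fundamental_inequality hN hO hdist hx he hdV epos.
have /choice[l hl] : forall j, exists l, [/\ pov C l, l != 0 &
  forall O, vring C O -> O u -> O (l.[u] * b0 j)] by move=> j; exact: integral_scale.
pose b j := (l j).[u] * b0 j.
have [B hB] : exists B, forall ij : 'I_s * 'I_d, vge (O ij.1) (x ij.1) (- B%:Z) (b ij.2).
  apply: uniform_bound => [[i j] m n mn|[i j]] /=.
    by apply: (vge_mono hN (hO _ (ltn_ord i)) (hx _ (ltn_ord i))); lia.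
  exact: (vge_nat hN (hO _ (ltn_ord i)) (hx _ (ltn_ord i))).
(* The conditions number at most M (d - 1) + (s - 1)(B + 1); this M absorbs the second summand. *)
pose M := (s * B.+1)%N.
pose q i := (M * e i + B)%N.
pose w (aj : 'I_M.+1 * 'I_d) := u ^+ aj.1 * b aj.2.
have vw (i : 'I_s) aj : vge (O i) (x i) (- (q i)%:Z) (w aj).
  have hOi := hO _ (ltn_ord i); have hxi := hx _ (ltn_ord i).
  have /(ord_vge hN hOi hxi) := ordV hN hOi hxi (he _ (ltn_ord i)).
  rewrite invrK => /(vgeX hN hOi hxi aj.1) v1.
  have /= v2 := hB (i, aj.2); apply: (vge_mono hN hOi hxi) (vgeM hN hOi hxi v1 v2).
  have : (aj.1 * e i <= M * e i)%N by rewrite leq_mul2r -ltnS ltn_ord orbT.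
  by rewrite /q mulNr -PoszM mulnC; lia.
have /choice[c hc] : forall iaj : 'I_s * ('I_M.+1 * 'I_d), exists c : nat -> N,
    (forall k, C (c k)) /\ vge (O iaj.1) (x iaj.1) (- (q iaj.1)%:Z + (q iaj.1).+1%:Z)
      (w iaj.2 - \sum_(k < (q iaj.1).+1) c k * x iaj.1 ^ (- (q iaj.1)%:Z + k%:Z)).
  by move=> [i aj]; apply: (expansion (hO _ (ltn_ord i)) (hx _ (ltn_ord i))); exact: vw.
(* One condition for each coefficient of x^(-q), ..., x^0 at each pole but the first. Including x^0
   makes f vanish at these places, so that f is not constant. *)
pose I := {i : 'I_s.-1 & 'I_((q i.+1).+1)}.
have lts (i : 'I_s.-1) : (i.+1 < s)%N by have := ltn_ord i; lia.
pose A (r : I) (aj : 'I_M.+1 * 'I_d) := c (Ordinal (lts (tag r)), aj) (tagged r).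
have cI : (#|{: I}| < #|{: 'I_M.+1 * 'I_d}|)%N.
  rewrite card_tagged sumnE big_map big_enum /= card_prod !card_ord.
  under eq_bigr do rewrite card_ord /q -addnS.
  rewrite big_split /= sum_nat_const card_ord -big_distrr /=.
  have : (1 + \sum_(i < s.-1) e i.+1 <= d)%N.
    apply: leq_trans fineq; rewrite -[in X in (_ <= X)%N](prednK s0) big_ord_recl.
    by apply: leq_add => //; exact: epos.
  move: (\sum_(i < s.-1) e i.+1)%N => S' hS.
  have : (M * S' + M <= M * d)%N by rewrite -mulnSr leq_mul2l -add1n hS orbT.
  have : (s.-1 * B.+1 <= M)%N by rewrite /M leq_mul2r leq_pred orbT.
  have : (0 < d)%N by lia.
  by rewrite mulSn; lia.
have AC r aj : C (A r aj) by have [h _] := hc (Ordinal (lts (tag r)), aj); exact: h.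
have [y [Cy [j0 y0] hy]] := underdetermined hC AC cI.
pose f := \sum_aj y aj * w aj.
have fin0 : f != 0.
  apply/eqP => f0; apply: indep.
  pose p (j : 'I_d) := \poly_(a < M.+1) y (inord a, j) * l j.
  exists p; split.
  - move=> j; apply: (povM hC); last by case: (hl j).
    by move=> a; rewrite coef_poly; case: ifP => _; [exact: Cy|exact: sf0].
  - exists j0.2; rewrite mulf_neq0 //; last by case: (hl j0.2).
    apply/eqP => /polyP/(_ j0.1); rewrite coef_poly ltn_ord coef0 inord_val.
    by move=> h; move: y0; rewrite [j0]surjective_pairing h eqxx.
  - have ef : f = \sum_(a < M.+1) \sum_j y (a, j) * (u ^+ a * b j).
      by rewrite pair_bigA; apply: eq_bigr => -[a j] _.
    rewrite -[RHS]f0 ef exchange_big /=.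
    apply: eq_bigr => j _; rewrite hornerM -mulrA -/(b j) horner_poly mulr_suml.
    by apply: eq_bigr => a _; rewrite inord_val mulrA.
have mf (i : 'I_s.-1) : mid (O i.+1) f.
  have hOi := hO _ (lts i); have hxi := hx _ (lts i).
  apply/(mid_vge hN hOi hxi).
  have -> : f = \sum_aj y aj * (w aj - \sum_(k < (q i.+1).+1)
      c (Ordinal (lts i), aj) k * x i.+1 ^ (- (q i.+1)%:Z + k%:Z)).
    under eq_bigr do rewrite mulrBr.
    rewrite sumrB [X in _ - X](_ : _ = 0) ?subr0 //.
    under eq_bigr do rewrite mulr_sumr.
    rewrite exchange_big /= big1 // => k _.
    have := hy (Tagged (fun i : 'I_s.-1 => 'I_((q i.+1).+1)) k).
    move=> /(congr1 (fun z => z * x i.+1 ^ (- (q i.+1)%:Z + k%:Z))).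
    rewrite mul0r mulr_suml => e'; rewrite -[RHS]e'; apply: eq_bigr => aj _.
    by rewrite /A /= mulrA [y _ * _]mulrC.
  apply: (vge_sum hN hOi hxi) => aj _; apply: (vgeCM hN hOi hxi) => //.
  have [_ /=] := hc (Ordinal (lts i), aj).
  by apply: (vge_mono hN hOi hxi); lia.
exists (O 0%N), f; split => //.
  have i1 : (0 < s.-1)%N by lia.
  have h := mf (Ordinal i1).
  exact: (mid_notC hN (hO _ (lts (Ordinal i1))) h fin0).
move=> P hP ne; have [Pu|Pu] := pselect (P u).
  have sP : sring P by case: hP. have CP : C `<=` P by case: hP.
  apply: (sr_sum sP) => aj _; apply: (srM sP); first exact: CP.
  apply: (srM sP); first exact: srX.
  by have [_ _] := hl aj.2; apply.
have [[|i] si eP] := all P hP Pu; first by [].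
have hi : (i < s.-1)%N by lia.
by rewrite eP; exact: (mid_sub hN (hO _ si) (mf (Ordinal hi))).
Qed.

End OnePole.

(** * Lie algebras of derivations of a curve *)

Lemma der_exprz (T : fieldType) (d : T -> T) x k : derivation d -> x != 0 ->
  d (x ^ k) = k%:~R * x ^ (k - 1) * d x.
Proof.
move=> hd x0; case: k => n.
  case: n => [|n]; first by rewrite expr0z (der1 hd) mul0r mul0r.
  have -> : n.+1%:Z - 1 = n%:Z by lia.
  by rewrite -!exprnP (derX hd) -mulr_natl; ring.
rewrite NegzE -exprnN (derV hd) ?expf_neq0 // (derX hd).
have -> : - n.+1%:Z - 1 = - n.+2%:Z by lia.
have -> : (- n.+1%:Z)%:~R = - n.+1%:R :> T by rewrite mulrNz.
have xn : x ^+ n != 0 by rewrite expf_neq0.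
rewrite -exprnN -mulr_natl !exprS; move: (x ^+ n) xn n.+1%:R => y y0 k.
by field; rewrite x0 y0.
Qed.

Lemma alg_over_gen (N : fieldType) (C : set N) w z : curve C -> ~ C w -> acl (adjoin C [set w]) z.
Proof.
move=> hN nw; case: (hN) => _ hC cC fin; have [n hn] := fin w nw.
have [p [hp [i0 pi0] e]] := hn (fun i => z ^+ i).
have hA := adjoin_sf C [set w].
have Ap i : adjoin C [set w] (p i).[w].
  apply: (pov_horner hA); last exact: sub_adjoinr.
  by move=> j; apply: sub_adjoinl; exact: (hp i).
apply: (@aclI _ _ (\poly_(i < n) (if insub i is Some i' then (p i').[w] else 0))).
- move=> i; rewrite coef_poly; case: ifP => _; last exact: sf0.
  by case: insubP => // _; exact: sf0.
- apply/eqP => /polyP/(_ i0); rewrite coef_poly ltn_ord valK coef0.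
  by apply/eqP; exact: (poly_transc hN).
- rewrite /root horner_poly; apply/eqP; rewrite -[RHS]e.
  by apply: eq_bigr => i _; rewrite valK.
Qed.

Lemma der_determined (N : fieldType) (C : set N) d w z : curve C -> ~ C w -> derivation d ->
  (forall c, C c -> d c = 0) -> d w = 0 -> d z = 0.
Proof.
move=> hN nw hd dC dw; have hA := adjoin_sf C [set w].
have ch : [pchar N] =i pred0 by case: (hN).
apply: (der_zero_acl ch hd hA) (alg_over_gen z hN nw) => y hy.
suff : adjoin C [set w] y /\ d y = 0 by case.
have sf : subfield [set y | adjoin C [set w] y /\ d y = 0].
  have := constants_sf hd hA; congr subfield.
apply: (adjoin_min sf _ _ hy) => /=.
  by move=> c Cc; split; [exact: sub_adjoinl|exact: dC].
by move=> _ ->; split => //; exact: sub_adjoinr.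
Qed.

Lemma der_comb (N : fieldType) (d1 d2 : N -> N) a b : derivation d1 -> derivation d2 ->
  derivation (fun z => a * d1 z + b * d2 z).
Proof.
move=> h1 h2; split => y z; first by rewrite (derD h1) (derD h2); ring.
by rewrite (derM h1) (derM h2); ring.
Qed.

(** * Local behaviour of a derivation at a place *)

Section LocalDer.
Variables (N : fieldType) (C : set N).
Hypothesis hN : curve C.
Variables (O : set N) (hO : vring C O) (x : N) (hx : unif O x).
Variable d : N -> N.
Hypotheses (hd : derivation d) (dC : forall c, C c -> d c = 0).
Hypothesis dO : forall z, O z -> O (d z).
Let x0 : x != 0. Proof. by case: hx. Qed.

(** Write z = c + x w with c in C and w regular: then d z = w d x + x d w, and the factor x gains
    one order at each step of the induction. *)
Lemma der_vgeO (j : nat) z : vge O x j%:Z (d x) -> O z -> vge O x j%:Z (d z).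
Proof.
move=> hj; elim: j z hj => [|j IH] z hj Oz; first by apply/(vge_O hN hO hx); exact: dO.
have hj' : vge O x j%:Z (d x) by apply: (vge_mono hN hO hx) hj; lia.
have [c [Cc m]] := residue hN hO Oz.
have [_ _ gx] := hx; pose w := (z - c) / x; have Ow : O w by exact: gx.
have -> : z = c + x * w by rewrite /w mulrC divfK // addrC subrK.
rewrite (derD hd) (dC Cc) add0r (derM hd); apply: (vgeD hN hO hx).
  rewrite -[j.+1%:Z]addr0; apply: (vgeM hN hO hx) => //; exact/(vge_O hN hO hx).
have -> : j.+1%:Z = 1 + j%:Z by lia.
apply: (vgeM hN hO hx); last exact: IH.
by have := vge_x hN hO hx 1; rewrite expr1z.
Qed.

Lemma der_vge (j : nat) k z : vge O x j%:Z (d x) -> vge O x k z -> vge O x (k + j%:Z - 1) (d z).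
Proof.
move=> hj hz; pose u := z * x ^ (- k); have Ou : O u by [].
have -> : z = x ^ k * u by rewrite /u mulrCA -expfzDr // subrr expr0z mulr1.
rewrite (derM hd) (der_exprz _ hd x0); apply: (vgeD hN hO hx).
  have -> : k + j%:Z - 1 = (k - 1 + j%:Z) + 0 by ring.
  apply: (vgeM hN hO hx); last exact/(vge_O hN hO hx).
  apply: (vgeM hN hO hx) => //; apply: (vgeCM hN hO hx); last exact: (vge_x hN hO hx).
  have hC : subfield C by case: (hN).
  by case: (k) => n; rewrite ?NegzE ?mulrNz; [exact: (sfnat hC)|apply: (sfN hC); exact: (sfnat hC)].
have := vgeM hN hO hx (vge_x hN hO hx k) (der_vgeO hj Ou).
by apply: (vge_mono hN hO hx); lia.
Qed.

(** The leading term c x^k contributes k c x^(k-1) d x, and k is invertible in characteristic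
    zero. *)
Lemma der_ord (j : nat) k z : ord O x j%:Z (d x) -> ord O x k z -> k != 0 ->
  ord O x (k + j%:Z - 1) (d z).
Proof.
move=> hj hz k0; have [c [Cc c0 h]] := ord_lead hN hO hx hz.
have -> : z = c * x ^ k + (z - c * x ^ k) by ring.
rewrite (derD hd) (derM hd) (dC Cc) mul0r add0r (der_exprz _ hd x0).
apply: (ordD hN hO hx); last first.
  have := der_vge (ord_vge hN hO hx hj) h; by apply: (vge_mono hN hO hx); lia.
have -> : k + j%:Z - 1 = 0 + ((0 + (k - 1)) + j%:Z) by ring.
apply: (ordM hN hO hx); first exact: (ord_C hN hO hx).
apply: (ordM hN hO hx) => //; apply: (ordM hN hO hx); last exact: (ord_x hN hO hx).
have ch : [pchar N] =i pred0 by case: (hN). have hC : subfield C by case: (hN).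
apply: (ord_C hN hO hx).
  by case: (k) => n; rewrite ?NegzE ?mulrNz; [exact: (sfnat hC)|apply: (sfN hC); exact: (sfnat hC)].
case: (k) k0 => [[|n]|n] // _; first exact: (natr_neq0 ch).
by rewrite NegzE mulrNz oppr_eq0; exact: (natr_neq0 ch).
Qed.

End LocalDer.

(** * Lie algebras of derivations and functions regular outside one place *)

Section PoleRing.
Variables (N : fieldType) (C : set N).
Hypothesis hN : curve C.
Let char0 : [pchar N] =i pred0. Proof. by case: hN. Qed.
Let hC : subfield C. Proof. by case: hN. Qed.
Let cC : alg_closed C. Proof. by case: hN. Qed.

Variables (P : set N) (hP : vring C P) (x : N) (hx : unif P x).
Let sP : sring P. Proof. by case: hP. Qed.
Let CP : C `<=` P. Proof. by case: hP. Qed.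

Definition onepole : set N := [set z | forall O, vring C O -> O <> P -> O z].
Local Notation B := onepole.

Lemma onepole_sring : sring B.
Proof.
split=> [O hO _|y z hy hz O hO ne|y z hy hz O hO ne]; have sO : sring O by case: hO.
- exact: sr1.
- by apply: (srB sO); [exact: hy|exact: hz].
- by apply: (srM sO); [exact: hy|exact: hz].
Qed.
Let sB := onepole_sring.

Lemma onepoleC : C `<=` B.
Proof. by move=> c Cc O hO _; case: hO => _ h _ _; exact: h. Qed.

Lemma onepole_sqrt z : B (z ^+ 2) -> B z.
Proof.
move=> h O hO ne; apply: contrapT => nz; apply: nz.
have sO : sring O by case: hO.
have [->|z0] := eqVneq z 0; first exact: sr0.
case: (hO) => _ _ /(_ z)[//|h'] _.
by have := srM sO (h O hO ne) h'; rewrite expr2 -mulrA mulfV // mulr1.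
Qed.

Lemma onepole_const z : B z -> P z -> C z.
Proof.
move=> Bz Pz; apply: contrapT => nz; have [O [hO Oz _]] := place_avoiding hN nz.
by apply: Oz; have [->//|ne] := pselect (O = P); exact: Bz.
Qed.

Local Notation ge := (vge P x).
Local Notation od := (ord P x).

(** These k form the Weierstrass semigroup of P; its least positive element m governs the case
    distinction. *)
Definition hasord (k : nat) := exists2 b, B b & od (- k%:Z) b.

Lemma onepole_ord z : B z -> ~ C z -> exists k, (0 < k)%N /\ od (- k%:Z) z.
Proof.
move=> Bz nz; have z0 : z != 0 by apply/eqP => e; apply: nz; rewrite e; exact: sf0.
have [k hk] := ord_exists hN hP hx z0.
have [le|lt] := lerP 0 k.
  exfalso; apply: nz; apply: onepole_const => //; apply/(vge_O hN hP hx).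
  exact: (vge_mono hN hP hx) (ord_vge hN hP hx hk).
exists `|k|%N; split; first by lia.
by have -> : - `|k|%N%:Z = k by lia.
Qed.

Lemma reduce k z b : ge k z -> od k b -> exists2 c, C c & ge (k + 1) (z - c * b).
Proof.
move=> hz hb; have [a [Ca ha]] := vge_lead hN hP hx hz.
have [c [Cc c0 hc]] := ord_lead hN hP hx hb.
exists (a / c); first exact: (sfdiv hC).
have -> : z - a / c * b = (z - a * x ^ k) - a / c * (b - c * x ^ k).
  by move: (x ^ k) => y; field.
by apply: (vgeB hN hP hx) => //; apply: (vgeCM hN hP hx) => //; exact: (sfdiv hC).
Qed.

Variable m : nat.
Hypotheses (m0 : (0 < m)%N) (hm : forall k, (0 < k)%N -> hasord k -> (m <= k)%N).

Lemma small z : B z -> ge (1 - m%:Z) z -> C z.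
Proof.
move=> Bz gz; apply: contrapT => nz; have [k [k0 hk]] := onepole_ord Bz nz.
have : hasord k by exists z.
move=> /(hm k0) le; have := ord_le hN hP hx hk gz; lia.
Qed.

Variable LL : set (N -> N).
Hypothesis LLd : forall d, LL d -> derivation d.
Hypothesis LLC : forall d c, LL d -> C c -> d c = 0.
Hypothesis LLcomb : forall d d' a b, LL d -> LL d' -> C a -> C b ->
  LL (fun z => a * d z + b * d' z).
Hypothesis LLbr : forall d d', LL d -> LL d' -> LL (fun z => d (d' z) - d' (d z)).
Hypothesis LLO : forall d O z, LL d -> vring C O -> O z -> O (d z).

Lemma onepole_der d z : LL d -> B z -> B (d z).
Proof. by move=> hd Bz O hO ne; apply: (LLO hd hO); exact: Bz. Qed.

Definition quadratic f := forall d, LL d -> exists a b c, [/\ C a, C b, C c &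
  d f = a + b * f + c * f ^+ 2].

Lemma LL_ge d k z : LL d -> ge k z -> ge (k - 1) (d z).
Proof.
move=> hd hz; have h : ge 0%N%:Z (d x).
  by apply/(vge_O hN hP hx); apply: (LLO hd hP); case: hx => -[].
have := der_vge hN hP hx (LLd hd) (fun c => @LLC d c hd) (fun z => @LLO d P z hd hP) h hz.
by rewrite addr0.
Qed.

Variables (f : N) (Bf : B f) (of_ : od (- m%:Z) f).

(** For m = 1 the function f has a simple pole and no other, as a coordinate of the projective line.
    Then d f has at most a double pole, and multiples of f^2 and f remove its polar part. *)
Lemma order_one : m = 1%N -> quadratic f.
Proof.
move=> m1 d hd; have ofn : od (- 1) f by move: of_; rewrite m1.
have g := LL_ge hd (ord_vge hN hP hx ofn).
have of2 : od (- 1 - 1) (f ^+ 2) by rewrite expr2; exact: (ordM hN hP hx).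
have [c Cc h1] := reduce g of2.
have [b Cb h2] := reduce (k := -1) h1 ofn.
exists (d f - c * f ^+ 2 - b * f), b, c; split => //; last by ring.
apply: small; last by rewrite m1; exact: h2.
have BC := onepoleC; apply: (srB sB); last by apply: (srM sB) => //; exact: (BC b Cb).
apply: (srB sB); first exact: (onepole_der hd Bf).
by apply: (srM sB); [exact: (BC c Cc)|apply: (srX sB); exact: Bf].
Qed.

(** Derivations vanishing at P do not raise pole orders there, so d f minus a multiple of f has pole
    order below m and is constant. *)
Lemma vanishing_case : (forall d, LL d -> ge 1%N%:Z (d x)) -> quadratic f.
Proof.
move=> h d hd.
have g := der_vge hN hP hx (LLd hd) (fun c => @LLC d c hd) (fun z => @LLO d P z hd hP)
  (h d hd) (ord_vge hN hP hx of_).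
have {}g : ge (- m%:Z) (d f) by apply: (vge_mono hN hP hx) g; lia.
have [b Cb h2] := reduce g of_.
exists (d f - b * f), b, 0; split => //; [|exact: sf0|by ring].
apply: small; last by apply: (vge_mono hN hP hx) h2; lia.
apply: (srB sB); first exact: (onepole_der hd Bf).
by apply: (srM sB) => //; exact: (onepoleC Cb).
Qed.

Hypothesis m2 : (1 < m)%N.
Variables (th : N -> N) (Lth : LL th) (oth : od 0%N%:Z (th x)).

Let hth : derivation th. Proof. exact: LLd. Qed.
Let thC c : C c -> th c = 0. Proof. exact: LLC. Qed.
Let thP z : P z -> P (th z). Proof. exact: (LLO Lth hP). Qed.

Lemma th_ord k z : od k z -> k != 0 -> od (k - 1) (th z).
Proof.
move=> hz k0; have := der_ord hN hP hx hth thC thP oth hz k0.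
by rewrite addr0.
Qed.

(** As [th x] is a unit at P, applying [th] raises pole orders by exactly one, so all the orders
    from m on occur. *)
Lemma basis k : exists b, B b /\ od (- (m + k)%N%:Z) b.
Proof.
elim: k => [|k [b [Bb hb]]]; first by exists f; rewrite addn0.
exists (th b); split; first exact: onepole_der.
have -> : - (m + k.+1)%N%:Z = - (m + k)%N%:Z - 1 by lia.
by apply: th_ord => //; lia.
Qed.

Lemma x_notC : ~ C x.
Proof. by have [mx x0 _] := hx; exact: (mid_notC hN hP mx x0). Qed.

(* A derivation vanishing at P to order at least 2 would create a forbidden order. *)
Lemma no_double_zero d : LL d -> ge 2%:Z (d x) -> d x = 0.
Proof.
move=> hd g2; apply/eqP; apply: contrapT => /negP d0.
have [k hk] := ord_exists hN hP hx d0.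
have le := ord_le hN hP hx hk g2.
have {hk} hk : od `|k|%N%:Z (d x) by have -> : `|k|%N%:Z = k by lia.
set j := `|k|%N in hk; have j2 : (2 <= j)%N by rewrite /j; lia.
have key i b : B b -> od (- (m + i)%N%:Z) b -> (m + i + 1 < m + j)%N -> (j = m + i + 1)%N.
  move=> Bb hb lt.
  have ho := der_ord hN hP hx (LLd hd) (fun c => @LLC d c hd) (fun z => @LLO d P z hd hP) hk hb.
  have {}ho : od (- (m + i)%N%:Z + j%:Z - 1) (d b) by apply: ho; lia.
  have Bd := onepole_der hd Bb.
  have Cd : C (d b) by apply: small => //; apply: (vge_mono hN hP hx) (ord_vge hN hP hx ho); lia.
  have := ord_uniq hN hP hx ho (ord_C hN hP hx Cd (ord_neq0 hN hP hx ho)); lia.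
have [b0 [Bb0 hb0]] := basis 0; have [b1 [Bb1 hb1]] := basis 1.
have e0 := key 0%N b0 Bb0 hb0; have e1 := key 1%N b1 Bb1 hb1.
have [l0|] := boolP (m + 0 + 1 < m + j)%N; last by lia.
have {}e0 := e0 l0; have l1 : (m + 1 + 1 < m + j)%N by lia.
by have := e1 l1; lia.
Qed.

Lemma LL_eq d d' a b : LL d -> LL d' -> a * d x = b * d' x -> forall z, a * d z = b * d' z.
Proof.
move=> hd hd' e z; apply/eqP; rewrite -subr_eq0 -mulNr; apply/eqP.
apply: (der_determined (d := fun z => a * d z + (- b) * d' z) z hN x_notC).
- by apply: der_comb; exact: LLd.
- by move=> c Cc; rewrite (LLC hd Cc) (LLC hd' Cc) !mulr0 addr0.
- by rewrite e mulNr subrr.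
Qed.

(** Write d = g th. As no derivation has a double zero at P, the algebra is contained in (C + C g)
    th. The bracket of th and d is (th g) th, so th g is affine in g: this is the affine algebra of
    the line with coordinate g. *)
Lemma two_dim d : LL d -> ge 1 (d x) -> d x != 0 -> exists g, ~ C g /\ quadratic g.
Proof.
move=> hd g1 d0; have th0 : th x != 0 by have := ord_neq0 hN hP hx oth.
have o1 : od 1 (d x).
  apply: (vge_ord hN hP hx) => // h; move: d0; rewrite no_double_zero ?eqxx //.
pose g := d x / th x.
have og : od 1 g by have := ordM hN hP hx o1 (ordV hN hP hx oth); rewrite oppr0 addr0.
have dg z : d z = g * th z.
  have e : 1 * d x = g * th x by rewrite mul1r /g divfK.
  by have := LL_eq hd Lth e z; rewrite mul1r.
have span d' : LL d' -> exists a b, [/\ C a, C b & forall z, d' z = (a + b * g) * th z].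
  move=> hd'.
  have g0 : ge 0 (d' x) by apply/(vge_O hN hP hx); apply: (LLO hd' hP); case: hx => -[].
  have [a Ca h1] := reduce g0 oth.
  have [b Cb h2] := reduce (k := 1) h1 o1.
  exists a, b; split => // z.
  pose e z := 1 * (1 * d' z + (- a) * th z) + (- b) * d z.
  have Le : LL e.
    apply: LLcomb => //; last exact: (sfN hC).
      by apply: LLcomb => //; [exact: sf1|exact: (sfN hC)].
    exact: sf1.
  have ex : e x = 0.
    apply: no_double_zero => //; move: h2; rewrite /e; congr (ge _ _); by ring.
  have ez : e z = 0.
    by apply: (der_determined z hN x_notC (LLd Le)) => // c; exact: LLC.
  have -> : d' z = e z + a * th z + b * d z by rewrite /e; ring.
  by rewrite ez dg; ring.
exists g; split.
  move=> Cg; have := ord_uniq hN hP hx og (ord_C hN hP hx Cg (ord_neq0 hN hP hx og)); lia.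
have [a [b [Ca Cb hab]]] := span _ (LLbr Lth hd).
have thg : th g = a + b * g.
  apply: (mulIf th0); rewrite -hab dg (derM hth) -[d (th x)]/(d (th x)) dg; ring.
move=> d' /span[a' [b' [Ca' Cb' ->]]]; rewrite thg.
exists (a' * a), (a' * b + b' * a), (b' * b); split; try by ring.
- exact: (sfM hC).
- by apply: (sfD hC); exact: (sfM hC).
- exact: (sfM hC).
Qed.

Lemma one_dim : (forall d, LL d -> ge 1 (d x) -> d x = 0) ->
  forall d, LL d -> exists2 a, C a & forall z, d z = a * th z.
Proof.
move=> h d hd.
have g0 : ge 0 (d x) by apply/(vge_O hN hP hx); apply: (LLO hd hP); case: hx => -[].
have [a Ca h1] := reduce g0 oth; exists a => // z.
have Le : LL (fun z => 1 * d z + (- a) * th z).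
  by apply: LLcomb => //; [exact: sf1|exact: (sfN hC)].
have := h _ Le; rewrite mul1r mulNr => /(_ h1)/eqP; rewrite subr_eq0 => /eqP e.
have e1 : 1 * d x = a * th x by rewrite mul1r.
by have := LL_eq hd Lth e1 z; rewrite mul1r.
Qed.

Hypothesis LL1 : forall d, LL d -> exists2 a, C a & forall z, d z = a * th z.

Let nat_neq0 n : n.+1%:R != 0 :> N. Proof. exact: (natr_neq0 char0). Qed.

Lemma onepole_lin b c : B b -> C c -> B (c * b).
Proof. by move=> Bb Cc; apply: (srM sB) => //; exact: (onepoleC Cc). Qed.

Lemma notC_ord k z : od (- k.+1%:Z) z -> ~ C z.
Proof.
move=> hz Cz; have := ord_uniq hN hP hx hz (ord_C hN hP hx Cz (ord_neq0 hN hP hx hz)); lia.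
Qed.

(** V and h = th V have pole orders 2 and 3, so V^3, V h, V^2, h, V have pole orders 6, 5, 4, 3, 2,
    and h^2 is a combination of them up to a constant. After normalization, th W = Y + be W + ga.
    Since th is regular, the correction disappears: at a place over a root of the cubic, W minus
    this root is a product of two functions vanishing there, so th W vanishes, and so does be W +
    ga. Two distinct roots give be = ga = 0. *)
Lemma weierstrass_case : m = 2%N -> exists W Y g2 g3, [/\ ~ C W, C g2 /\ C g3,
  27%:R * g3 ^+ 2 - g2 ^+ 3 != 0, Y ^+ 2 = 4%:R * W ^+ 3 - g2 * W - g3
  & forall d, LL d -> exists2 a, C a & d W = a * Y].
Proof.
move=> m_2; have oV : od (- 2) f by move: of_; rewrite m_2.
set V := f in oV; pose h := th V.
have oh : od (- 3) h by exact: (th_ord oV).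
have BV : B V by []. have Bh : B h by exact: onepole_der.
have oVh : od (- 5) (V * h) by exact: (ordM hN hP hx oV oh).
have oV2 : od (- 4) (V ^+ 2) by rewrite expr2; exact: (ordM hN hP hx oV oV).
have oV3 : od (- 6) (V ^+ 3) by rewrite exprS; exact: (ordM hN hP hx oV oV2).
have oh2 : od (- 6) (h ^+ 2) by rewrite expr2; exact: (ordM hN hP hx oh oh).
have [a Ca r1] := reduce (ord_vge hN hP hx oh2) oV3.
have a0 : a != 0.
  by apply/eqP => a0; apply: (ord_not_vge hN hP hx oh2); move: r1; rewrite a0 mul0r subr0.
have [b Cb r2] := reduce (k := - 5) r1 oVh.
have [c Cc r3] := reduce (k := - 4) r2 oV2.
have [e Ce r4] := reduce (k := - 3) r3 oh.
have [g Cg r5] := reduce (k := - 2) r4 oV.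
have Cr : C (h ^+ 2 - a * V ^+ 3 - b * (V * h) - c * V ^+ 2 - e * h - g * V).
  apply: small; last by rewrite m_2.
  have BX n y : B y -> B (y ^+ n) := @srX _ _ sB y n.
  apply: (srB sB); last exact: (onepole_lin BV Cg).
  apply: (srB sB); last exact: (onepole_lin Bh Ce).
  apply: (srB sB); last exact: (onepole_lin (BX 2 _ BV) Cc).
  apply: (srB sB); last exact: (onepole_lin (srM sB BV Bh) Cb).
  apply: (srB sB); last exact: (onepole_lin (BX 3 _ BV) Ca).
  exact: (BX 2 _ Bh).
move: Cr; set r := _ - g * V => Cr.
have rel : h ^+ 2 = a * V ^+ 3 + b * (V * h) + c * V ^+ 2 + e * h + g * V + r by rewrite /r; ring.
have n2 : 2%:R != 0 :> N by exact: (nat_neq0 1).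
have n3 : 3%:R != 0 :> N by exact: (nat_neq0 2).
have n4 : 4%:R != 0 :> N by exact: (nat_neq0 3).
(* Completing the square removes the terms in V h and h. *)
pose h' := h - (b * V + e) / 2%:R.
pose c2 := c + b ^+ 2 / 4%:R; pose c1 := g + b * e / 2%:R; pose c0 := r + e ^+ 2 / 4%:R.
have Cn n : C n%:R by exact: (sfnat hC).
have Cc2 : C c2 by sfa hC. have Cc1 : C c1 by sfa hC. have Cc0 : C c0 by sfa hC.
have rel' : h' ^+ 2 = a * V ^+ 3 + c2 * V ^+ 2 + c1 * V + c0.
  transitivity (h ^+ 2 - (b * V + e) * h + (b * V + e) ^+ 2 / 4%:R); first by rewrite /h'; field; rewrite ?n2 ?n4.
  by rewrite rel /c2 /c1 /c0; field; rewrite ?n2 ?n4.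
(* The shift by mu kills the quadratic term, and the factor a / 4 turns the leading coefficient into
   4. *)
pose mu := - c2 / (3%:R * a); pose W := (V - mu) * (a / 4%:R); pose Y := h' * (a / 4%:R).
pose g2 := - (a / 4%:R) ^+ 2 * (3%:R * mu ^+ 2 * a + 2%:R * c2 * mu + c1) * (4%:R / a).
pose g3 := - (a / 4%:R) ^+ 2 * (a * mu ^+ 3 + c2 * mu ^+ 2 + c1 * mu + c0).
have Cmu : C mu by sfa hC.
have Cg2 : C g2 by rewrite /g2; sfa hC. have Cg3 : C g3 by rewrite /g3; sfa hC.
have relW : Y ^+ 2 = 4%:R * W ^+ 3 - g2 * W - g3.
  by rewrite /Y exprMn rel' /g2 /g3 /W /mu; field; rewrite ?a0 ?n3 ?n4.
have Ca4 : C (a / 4%:R) by sfa hC.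
have a4 : a / 4%:R != 0 by rewrite mulf_neq0 ?invr_eq0.
have VW : V = W * (4%:R / a) + mu by rewrite /W; field; rewrite ?n4 ?a0.
have nV : ~ C V by exact: (notC_ord (k := 1)).
have nW : ~ C W.
  by move=> CW; apply: nV; rewrite VW; sfa hC.
have BW : B W.
  rewrite /W mulrC; apply: onepole_lin => //; apply: (srB sB) => //; exact: (onepoleC Cmu).
have BY : B Y.
  rewrite /Y mulrC; apply: onepole_lin => //; apply: (srB sB) => //.
  rewrite mulrC; apply: onepole_lin; last exact: (sfV hC).
  by apply: (srD sB); [exact: onepole_lin|exact: (onepoleC Ce)].
pose be := b / 2%:R; pose ga := a / 4%:R * (b * mu + e) / 2%:R.
have Cbe : C be by sfa hC. have Cga : C ga by rewrite /ga; sfa hC.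
have thW : th W = Y + be * W + ga.
  rewrite /W mulrC (derM hth) (thC Ca4) mul0r add0r (derB hth) (thC Cmu) subr0 -/h.
  by rewrite /Y /h' /be /ga /W; field; rewrite ?n2 ?n4.
(* a double root would produce a function of order 1 in B *)
have simple ep : C ep -> 4%:R * ep ^+ 3 - g2 * ep - g3 = 0 -> 12%:R * ep ^+ 2 - g2 != 0.
  move=> Cep root_ep; apply/eqP => dbl.
  have We : W - ep != 0 by rewrite subr_eq0; apply/eqP => h0; apply: nW; rewrite h0.
  pose t := Y / (W - ep).
  have t2 : t ^+ 2 = 4%:R * (W + 2%:R * ep).
    rewrite /t expr_div_n relW.
    have -> : g2 = 12%:R * ep ^+ 2 by apply/eqP; rewrite eq_sym -subr_eq0 dbl.
    have -> : g3 = 4%:R * ep ^+ 3 - g2 * ep.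
      by apply/eqP; rewrite eq_sym -subr_eq0 root_ep.
    have -> : g2 = 12%:R * ep ^+ 2 by apply/eqP; rewrite eq_sym -subr_eq0 dbl.
    by field; rewrite ?We.
  have Bt : B t.
    apply: onepole_sqrt; rewrite t2; apply: onepole_lin => //; apply: (srD sB) => //.
    by apply: onepoleC; sfa hC.
  have oW : od (- 2) (4%:R * (W + 2%:R * ep)).
    have -> : 4%:R * (W + 2%:R * ep) = a * V + (4%:R * (2%:R * ep) - a * mu).
      by rewrite VW; field; rewrite ?n4 ?a0.
    apply: (ordD hN hP hx).
      by rewrite -[- 2]add0r; apply: (ordM hN hP hx) => //; exact: (ord_C hN hP hx).
    have Cz : C (4%:R * (2%:R * ep) - a * mu) by sfa hC.
    by apply: (vge_mono hN hP hx) (vge_C hN hP hx Cz).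
  have t0 : t != 0.
    by have := ord_neq0 hN hP hx oW; rewrite -t2 expf_eq0.
  have [k hk] := ord_exists hN hP hx t0.
  have := ordX hN hP hx 2 hk; rewrite t2 => ok2.
  have := ord_uniq hN hP hx ok2 oW => ek.
  have k1 : k = - 1 by lia.
  have Ct : C t.
    apply: small => //; rewrite m_2; rewrite k1 in hk.
    exact: (ord_vge hN hP hx hk).
  apply: nW; have -> : W = t ^+ 2 / 4%:R - 2%:R * ep by rewrite t2; field; rewrite ?n4.
  by sfa hC.
(* When the discriminant vanishes, -3 g3 / (2 g2), or 0 if g2 = 0, is a double root. *)
have disc : 27%:R * g3 ^+ 2 - g2 ^+ 3 != 0.
  apply/eqP => d0; have [g20|g20] := eqVneq g2 0.
    have g30 : g3 = 0.
      move: d0; rewrite g20 expr0n subr0 => /eqP; rewrite mulf_eq0 (negbTE (nat_neq0 26)) /=.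
      by rewrite expf_eq0 => /eqP.
    have e0 : 4%:R * 0 ^+ 3 - g2 * 0 - g3 = 0 by rewrite g20 g30; ring.
    have := simple 0 (sf0 hC) e0; rewrite g20.
    have -> : 12%:R * 0 ^+ 2 - 0 = 0 :> N by ring.
    by rewrite eqxx.
  pose ep := - (3%:R * g3) / (2%:R * g2).
  have Cep : C ep by rewrite /ep; sfa hC.
  have e1 : 27%:R * g3 ^+ 2 = g2 ^+ 3 by apply/eqP; rewrite -subr_eq0 d0.
  have e2 : 12%:R * ep ^+ 2 - g2 = (27%:R * g3 ^+ 2 - g2 ^+ 3) / g2 ^+ 2.
    by rewrite /ep; field; rewrite ?g20 ?n2.
  have e3 : 4%:R * ep ^+ 3 - g2 * ep - g3 = - g3 * (27%:R * g3 ^+ 2 - g2 ^+ 3) / (2%:R * g2 ^+ 3).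
    by rewrite /ep; field; rewrite ?g20 ?n2.
  have h3 : 4%:R * ep ^+ 3 - g2 * ep - g3 = 0 by rewrite e3 d0 mulr0 mul0r.
  by have := simple ep Cep h3; rewrite e2 d0 mul0r eqxx.
(* At a place where W takes the value ep, the square of Y is W - ep times a unit, because ep is a
   simple root. *)
have atroot ep : C ep -> 4%:R * ep ^+ 3 - g2 * ep - g3 = 0 -> be * ep + ga = 0.
  move=> Cep root_ep; have sep := simple _ Cep root_ep.
  have nWe : ~ C (W - ep)^-1.
    move=> h0; apply: nW; have h1 := sfV hC h0; rewrite invrK in h1.
    by rewrite -[W](subrK ep); sfa hC.
  have [O [hO nO Oi]] := place_avoiding hN nWe; rewrite invrK in Oi.
  have mO : mid O (W - ep) by have := mid_inv hN hO nO; rewrite invrK.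
  have sO : sring O by case: hO. have CO : C `<=` O by case: hO.
  pose q z := 4%:R * z ^+ 2 + 4%:R * ep * z + (4%:R * ep ^+ 2 - g2).
  have Yq : Y ^+ 2 = (W - ep) * q W.
    rewrite relW /q; have -> : g3 = 4%:R * ep ^+ 3 - g2 * ep.
      by apply/eqP; rewrite eq_sym -subr_eq0 root_ep.
    by ring.
  have OW : O W by rewrite -[W](subrK ep); apply: (srD sO) => //; exact: CO.
  have Oq : O (q W).
    rewrite /q; have ? : O (4%:R * ep) by apply: CO; sfa hC.
    have ? : O (4%:R * ep ^+ 2 - g2) by apply: CO; sfa hC.
    have ? : O 4%:R by apply: CO.
    apply: (srD sO) => //; apply: (srD sO); apply: (srM sO) => //; exact: srX.
  have uq : ~ mid O (q W).
    move=> mq; move/eqP: sep; apply; apply: (midC hN hO); first by sfa hC.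
    have -> : 12%:R * ep ^+ 2 - g2 = q W - (4%:R * (W + ep) + 4%:R * ep) * (W - ep) by rewrite /q; ring.
    apply: (midD hN hO) => //; apply: (midN hN hO); apply: (midM hN hO) => //.
    have ? : O (4%:R * ep) by apply: CO; sfa hC.
    have ? : O ep by apply: CO.
    have ? : O 4%:R by apply: CO.
    by apply: (srD sO) => //; apply: (srM sO) => //; apply: (srD sO).
  have [Oq' q0] := not_mid_inv hN hO Oq uq.
  have OY : O Y.
    apply: contrapT => nY; have mY := mid_inv hN hO nY.
    have OY' : O Y^-1 by case: mY.
    have Y0 : Y != 0 by apply/eqP => Y0; apply: nY; rewrite Y0; exact: sr0.
    apply: nY; have -> : Y = Y^-1 * Y ^+ 2 by rewrite expr2 mulKf.
    by rewrite Yq; apply: (srM sO) => //; apply: (srM sO).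
  have mY : mid O Y.
    have : mid O (Y * Y).
      by rewrite -expr2 Yq mulrC; exact: (midM hN hO).
    by move=> /(mid_prime hN hO OY OY)[].
  have thO z : O z -> O (th z) by exact: (LLO Lth hO).
  have mth : mid O (th (W - ep)).
    have -> : W - ep = Y * (Y * (q W)^-1) by rewrite mulrA -expr2 Yq mulfK.
    rewrite (derM hth); apply: (midD hN hO).
      by rewrite mulrCA mulrC; apply: (midM hN hO) => //; apply: (srM sO) => //; exact: thO.
    by rewrite mulrC; apply: (midM hN hO) => //; apply: thO; exact: srM.
  apply: (midC hN hO); first by sfa hC.
  have -> : be * ep + ga = th (W - ep) - Y - be * (W - ep).
    by rewrite (derB hth) (thC Cep) thW; ring.
  apply: (midD hN hO); last by apply: (midN hN hO); apply: (midM hN hO) => //; exact: CO.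
  by apply: (midD hN hO) => //; exact: (midN hN hO).
have [e1 [Ce1 he1]] : exists e1, C e1 /\ 4%:R * e1 ^+ 3 - g2 * e1 - g3 = 0.
  pose p : {poly N} := 4%:R *: 'X^3 - g2 *: 'X - g3%:P.
  have hp : pov C p.
    apply: (povD hC); last by apply: (povN hC); exact: povC.
    apply: (povD hC); last by apply: (povN hC); apply: (povZ hC) => //; exact: povX.
    by apply: (povZ hC) => // i; rewrite coefXn; exact: Cn.
  have sp : size p = 4%N.
    rewrite /p -addrA size_polyDl size_scale ?size_polyXn // -opprD size_polyN.
    apply: leq_ltn_trans (size_polyD _ _) _; rewrite gtn_max !ltnS.
    rewrite (leq_trans (size_scale_leq _ _)) ?size_polyX //.
    by rewrite (leq_trans (size_polyC_leq1 _)).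
  have [||e1 Ce1 /eqP] := cC (p := p); [exact/(povP hC)|by rewrite sp|].
  rewrite /p !(hornerD, hornerN, hornerZ, hornerXn, hornerX, hornerC) => he.
  by exists e1; split; [exact: set_mem|].
(* A root of the quotient of the cubic by the factor belonging to e1. *)
have [e2 [Ce2 he2]] : exists e2, C e2 /\ 4%:R * e2 ^+ 2 + 4%:R * e1 * e2 + (4%:R * e1 ^+ 2 - g2) = 0.
  pose p : {poly N} := 4%:R *: 'X^2 + (4%:R * e1) *: 'X + (4%:R * e1 ^+ 2 - g2)%:P.
  have hp : pov C p.
    apply: (povD hC); last by apply: (povC hC); sfa hC.
    apply: (povD hC); last by apply: (povZ hC); [sfa hC|exact: povX].
    by apply: (povZ hC) => // i; rewrite coefXn; exact: Cn.
  have sp : size p = 3%N.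
    rewrite /p -addrA size_polyDl size_scale ?size_polyXn //.
    apply: leq_ltn_trans (size_polyD _ _) _; rewrite gtn_max !ltnS.
    rewrite (leq_trans (size_scale_leq _ _)) ?size_polyX //.
    by rewrite (leq_trans (size_polyC_leq1 _)).
  have [||e2 Ce2 /eqP] := cC (p := p); [exact/(povP hC)|by rewrite sp|].
  rewrite /p !(hornerD, hornerN, hornerZ, hornerXn, hornerX, hornerC) => he.
  by exists e2; split; [exact: set_mem|].
have e12 : e2 - e1 != 0.
  apply/eqP => e0; move/eqP: (simple _ Ce1 he1); apply.
  have -> : 12%:R * e1 ^+ 2 - g2 = (4%:R * e2 ^+ 2 + 4%:R * e1 * e2 + (4%:R * e1 ^+ 2 - g2))
     - (4%:R * (e2 + e1) + 4%:R * e1) * (e2 - e1) by ring.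
  by rewrite he2 e0 mulr0 subr0.
have he2' : 4%:R * e2 ^+ 3 - g2 * e2 - g3 = 0.
  have -> : 4%:R * e2 ^+ 3 - g2 * e2 - g3 = (4%:R * e1 ^+ 3 - g2 * e1 - g3) +
    (e2 - e1) * (4%:R * e2 ^+ 2 + 4%:R * e1 * e2 + (4%:R * e1 ^+ 2 - g2)) by ring.
  by rewrite he1 he2 mulr0 addr0.
have k1 := atroot _ Ce1 he1; have k2 := atroot _ Ce2 he2'.
have be0 : be = 0.
  apply: (mulIf e12); rewrite mul0r.
  have -> : be * (e2 - e1) = (be * e2 + ga) - (be * e1 + ga) by ring.
  by rewrite k1 k2 subrr.
have ga0 : ga = 0 by move: k1; rewrite be0 mul0r add0r.
exists W, Y, g2, g3; split => // d /LL1[a' Ca' ha']; exists a' => //.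
by rewrite ha' thW be0 ga0 mul0r !addr0.
Qed.

(** * Regular differentials as functionals, for least pole order at least three *)

Section Functionals.
Hypothesis m3 : (2 < m)%N.

(** The functionals on N / (B + P), the first cohomology group of the structure sheaf; by Serre
    duality they are the regular differentials. The gaps at P are 1, ..., m - 1, and the classes of
    x^-1, ..., x^-(m-1) form a basis of the quotient. *)
Definition fnl (z : N -> N) := [/\ forall w, C (z w),
  forall v w, z (v + w) = z v + z w, forall c w, C c -> z (c * w) = c * z w,
  forall w, B w -> z w = 0 & forall w, P w -> z w = 0].

(** The highest power of 1/x with nonzero coefficient would give b a pole of order below m. *)
Lemma gap_uniq b o (a : nat -> N) : B b -> P o -> (forall i, C (a i)) ->
  b + o + \sum_(i < m.-1) a i * x ^ (- i.+1%:Z) = 0 -> forall i, (i < m.-1)%N -> a i = 0.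
Proof.
move=> Bb Po Ca e i lt; apply/eqP; apply: contrapT => /negP ai0.
have [j aj max] := @arg_maxnP _ (Ordinal lt) (fun i => a i != 0) (fun i => nat_of_ord i) ai0.
have ob : od (- j.+1%:Z) b.
  have -> : b = (- a j) * x ^ (- j.+1%:Z) - (o + \sum_(i < m.-1 | i != j) a i * x ^ (- i.+1%:Z)).
    apply/eqP; rewrite -subr_eq0; apply/eqP; rewrite -[RHS]e [in RHS](bigD1 j) //=; ring.
  apply: (ordD hN hP hx).
    have Cj : C (- a j) by exact: (sfN hC). have j0 : - a j != 0 by rewrite oppr_eq0.
    have := ordM hN hP hx (ord_C hN hP hx Cj j0) (ord_x hN hP hx (- j.+1%:Z)).
    by rewrite add0r.
  apply: (vgeN hN hP hx); apply: (vgeD hN hP hx).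
    by apply: (vge_mono hN hP hx (k := 0)); [lia|apply/(vge_O hN hP hx)].
  apply: (vge_sum hN hP hx) => l lj; have [lt'|ge'] := ltnP l j.
    apply: (vgeCM hN hP hx) => //; apply: (vge_mono hN hP hx) (vge_x hN hP hx _); lia.
  suff -> : a l = 0 by rewrite mul0r; exact: (vge0 hN hP hx).
  apply/eqP/negP => /negP /max /=; rewrite leqNgt ltn_neqAle ge' andbT => /negP; apply.
  by rewrite eq_sym.
have : hasord j.+1 by exists b.
by move=> /(hm (ltn0Sn j)); have := ltn_ord j; lia.
Qed.

Lemma gap_decomp w : exists b o (a : nat -> N), [/\ B b, P o, forall i, C (a i)
  & w = b + o + \sum_(i < m.-1) a i * x ^ (- i.+1%:Z)].
Proof.
have [n hn] := vge_nat hN hP hx w; elim: n w hn => [|n IH] w hw.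
  exists 0, w, (fun=> 0); split; [exact: sr0| |by move=> i; exact: sf0|].
    by apply/(vge_O hN hP hx); move: hw; rewrite oppr0.
  by rewrite big1 ?add0r ?addr0 // => i _; rewrite mul0r.
have en : - n.+1%:Z + 1 = - n%:Z by lia.
have [lt|ge'] := ltnP n m.-1.
  have [c [Cc]] := vge_lead hN hP hx hw; rewrite en => /IH[b [o [a [Bb Po Ca e]]]].
  exists b, o, (fun i => a i + (if i == n then c else 0)); split => //.
    by move=> i; apply: (sfD hC) => //; case: ifP => // _; exact: sf0.
  rewrite -[w](subrK (c * x ^ (- n.+1%:Z))) e -addrA; congr (_ + _).
  under [RHS]eq_bigr do rewrite mulrDl.
  rewrite big_split /=; congr (_ + _); rewrite (bigD1 (Ordinal lt)) //= eqxx big1 ?addr0 // => i.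
  by rewrite -val_eqE /= => /negbTE ->; rewrite mul0r.
have [b0 [Bb0 ob0]] := basis (n.+1 - m).
have em : (m + (n.+1 - m) = n.+1)%N by lia.
rewrite em in ob0.
have [c Cc] := reduce hw ob0; rewrite en => /IH[b [o [a [Bb Po Ca e]]]].
exists (b + c * b0), o, a; split => //.
  by apply: (srD sB) => //; exact: onepole_lin.
by rewrite -[w](subrK (c * b0)) e; ring.
Qed.

Lemma coordinates : exists z : nat -> N -> N, (forall i, (i < m.-1)%N -> fnl (z i)) /\
  forall i j, (i < m.-1)%N -> (j < m.-1)%N -> z i (x ^ (- j.+1%:Z)) = (i == j)%:R.
Proof.
have /choice[F hF] : forall w, exists boa : N * N * (nat -> N), [/\ B boa.1.1, P boa.1.2,
    forall i, C (boa.2 i) & w = boa.1.1 + boa.1.2 + \sum_(i < m.-1) boa.2 i * x ^ (- i.+1%:Z)].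
  by move=> w; have [b [o [a h]]] := gap_decomp w; exists (b, o, a).
have key w b o (a : nat -> N) (i : nat) : B b -> P o -> (forall i, C (a i)) ->
    w = b + o + \sum_(i < m.-1) a i * x ^ (- i.+1%:Z) -> (i < m.-1)%N -> (F w).2 i = a i.
  move=> Bb Po Ca e lt; have [B1 P1 C1 e1] := hF w.
  apply/eqP; rewrite -subr_eq0; apply/eqP.
  apply: (@gap_uniq ((F w).1.1 - b) ((F w).1.2 - o) (fun i => (F w).2 i - a i)) => //.
  - exact: (srB sB).
  - exact: (srB sP).
  - by move=> j; exact: (sfB hC).
  under eq_bigr do rewrite mulrBl.
  rewrite sumrB.
  transitivity (((F w).1.1 + (F w).1.2 + \sum_(i < m.-1) (F w).2 i * x ^ (- i.+1%:Z)) -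
    (b + o + \sum_(i < m.-1) a i * x ^ (- i.+1%:Z))); first by ring.
  by rewrite -e1 -e subrr.
exists (fun i w => (F w).2 i); split => [i lt|i j lti ltj].
  split.
  - by move=> w; have [_ _ h _] := hF w.
  - move=> v w; have [B1 P1 C1 e1] := hF v; have [B2 P2 C2 e2] := hF w.
    apply: (key _ ((F v).1.1 + (F w).1.1) ((F v).1.2 + (F w).1.2) (fun i => (F v).2 i + (F w).2 i)) => //.
    + exact: (srD sB).
    + exact: (srD sP).
    + by move=> l; exact: (sfD hC).
    + under eq_bigr do rewrite mulrDl.
      by rewrite big_split /= {1}e1 {1}e2; ring.
  - move=> c w Cc; have [B1 P1 C1 e1] := hF w.
    apply: (key _ (c * (F w).1.1) (c * (F w).1.2) (fun i => c * (F w).2 i)) => //.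
    + exact: onepole_lin.
    + by apply: (srM sP) => //; exact: CP.
    + by move=> l; exact: (sfM hC).
    + under eq_bigr do rewrite -mulrA.
      by rewrite -mulr_sumr {1}e1; ring.
  - move=> w Bw; apply: (key _ w 0 (fun=> 0)) => //; [exact: sr0|by move=> l; exact: sf0|].
    by rewrite big1 ?addr0 // => l _; rewrite mul0r.
  - move=> w Pw; apply: (key _ 0 w (fun=> 0)) => //; [exact: sr0|by move=> l; exact: sf0|].
    by rewrite big1 ?addr0 ?add0r // => l _; rewrite mul0r.
apply: (key _ 0 0 (fun i => (i == j)%:R)) => //.
- exact: sr0.
- exact: sr0.
- by move=> l; exact: (sfnat hC).
- rewrite !add0r (bigD1 (Ordinal ltj)) //= eqxx mul1r big1 ?addr0 // => l.
  by rewrite -val_eqE /= => /negbTE ->; rewrite mul0r.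
Qed.

Lemma fnl_sum (I : finType) (c : I -> N) (z : I -> N -> N) :
  (forall i, C (c i)) -> (forall i, fnl (z i)) -> fnl (fun w => \sum_i c i * z i w).
Proof.
move=> Cc hz; split.
- by move=> w; apply: (sf_sum hC) => i _; apply: (sfM hC) => //; case: (hz i).
- move=> v w; rewrite -big_split /=; apply: eq_bigr => i _.
  by case: (hz i) => _ -> _ _ _; rewrite mulrDr.
- move=> a w Ca; rewrite mulr_sumr; apply: eq_bigr => i _.
  by case: (hz i) => _ _ -> // _ _; rewrite mulrCA.
- by move=> w Bw; rewrite big1 // => i _; case: (hz i) => _ _ _ -> // _; rewrite mulr0.
- by move=> w Pw; rewrite big1 // => i _; case: (hz i) => _ _ _ _ -> //; rewrite mulr0.
Qed.

Lemma fnl0 z : fnl z -> z 0 = 0.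
Proof. by move=> [_ _ _ _ h]; apply: h; exact: sr0. Qed.

Lemma fnl_bigsum z n (E : 'I_n -> N) : fnl z -> z (\sum_i E i) = \sum_i z (E i).
Proof.
move=> hz; elim: n E => [|n IH] E; first by rewrite !big_ord0 fnl0.
by rewrite !big_ord_recl -IH; case: hz => _ -> _ _ _.
Qed.

Lemma fnl_ext z : fnl z -> (forall i, (i < m.-1)%N -> z (x ^ (- i.+1%:Z)) = 0) -> forall w, z w = 0.
Proof.
move=> hz h w; have [b [o [a [Bb Po Ca ->]]]] := gap_decomp w.
have hs := fnl_bigsum (fun i : 'I_m.-1 => a i * x ^ (- i.+1%:Z)) hz.
case: hz => _ zD zZ zB zP; rewrite !zD zB // zP // add0r add0r hs big1 // => i _.
by rewrite zZ // h // mulr0.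
Qed.

Lemma fnl_dep (z : 'I_m -> N -> N) : (forall i, fnl (z i)) -> exists c : 'I_m -> N,
  [/\ forall i, C (c i), exists i, c i != 0 & forall w, \sum_i c i * z i w = 0].
Proof.
move=> hz; pose A (r : 'I_m.-1) (i : 'I_m) := z i (x ^ (- r.+1%:Z)).
have AC r i : C (A r i) by rewrite /A; case: (hz i).
have cI : (#|'I_m.-1| < #|'I_m|)%N by rewrite !card_ord; lia.
have [c [Cc c0 hc]] := underdetermined hC AC cI.
exists c; split => // w; apply: (fnl_ext (fnl_sum Cc hz)) => i lt.
by rewrite -[RHS](hc (Ordinal lt)); apply: eq_bigr => j _; rewrite mulrC.
Qed.

(** The Lie derivative along [th]. With this sign it satisfies the Leibniz rule for the products (g
    z)(w) = z (g w). *)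
Definition dual (z : N -> N) w := - z (th w).

Lemma fnl_dual z : fnl z -> fnl (dual z).
Proof.
move=> [zC zD zZ zB zP]; split.
- by move=> w; exact: (sfN hC).
- by move=> v w; rewrite /dual (derD hth) zD opprD.
- by move=> c w Cc; rewrite /dual (derM hth) thC // mul0r add0r zZ // mulrN.
- by move=> w Bw; rewrite /dual zB ?oppr0 //; exact: onepole_der.
- by move=> w Pw; rewrite /dual zP ?oppr0 //; exact: thP.
Qed.

Definition act (p : {poly N}) z w := \sum_(i < size p) p`_i * iter i dual z w.

Lemma act_wide (p : {poly N}) z w n : (size p <= n)%N -> act p z w = \sum_(i < n) p`_i * iter i dual z w.
Proof.
move=> le; rewrite /act (big_ord_widen _ (fun i => p`_i * iter i dual z w) le).
rewrite big_mkcond /=; apply: eq_bigr => i _; case: ltnP => // ge'.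
by rewrite nth_default // mul0r.
Qed.

Lemma act_step (q : {poly N}) e z w : act (q * ('X - e%:P)) z w = dual (act q z) w - e * act q z w.
Proof.
rewrite (@act_wide _ _ _ (size q).+1); last first.
  have [->|q0] := eqVneq q 0; first by rewrite mul0r size_poly0.
  by rewrite size_Mmonic ?monicXsubC // size_XsubC addn2.
under eq_bigr do rewrite mulrBr coefB coefMX coefMC mulrBl.
rewrite sumrB big_ord_recl /= mul0r add0r; congr (_ - _).
  by rewrite /dual /act -sumrN; apply: eq_bigr => i _; rewrite mulrN.
rewrite (act_wide _ _ (leqnSn _)) mulr_sumr; apply: eq_bigr => i _.
by rewrite mulrCA mulrA.
Qed.

Lemma fnl_iter z i : fnl z -> fnl (iter i dual z).
Proof. by move=> hz; elim: i => //= i; exact: fnl_dual. Qed.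

(* An eigenvector modulo the subspace Z: the last nonzero factor of a minimal
   polynomial relation. *)
Lemma eigen_mod (Z : set (N -> N)) z : Z (fun=> 0) ->
  (forall c z, C c -> Z z -> Z (fun w => c * z w)) -> fnl z -> ~ Z z ->
  exists z1 e, [/\ fnl z1, ~ Z z1, C e & Z (fun w => dual z1 w - e * z1 w)].
Proof.
move=> Z0 ZZ hz nz.
pose Q n := `[< exists p, [/\ pov C p, p != 0, Z (act p z) & size p = n] >].
have exQ : exists n, Q n.
  have [c [Cc [i0 c0] hc]] := fnl_dep (fun i : 'I_m => fnl_iter i hz).
  pose p := \poly_(i < m) (if insub i is Some i' then c i' else 0).
  exists (size p); apply/asboolP; exists p; split => //.
  - move=> i; rewrite coef_poly; case: ifP => _; last exact: sf0.
    by case: insubP => // _; exact: sf0.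
  - by apply/eqP => /polyP/(_ i0); rewrite coef_poly ltn_ord valK coef0; apply/eqP.
  - have -> : act p z = (fun=> 0); last by [].
    apply: funext => w; rewrite (act_wide _ _ (size_poly _ _)) -[RHS](hc w).
    by apply: eq_bigr => i _; rewrite coef_poly ltn_ord valK.
case: (ex_minnP exQ) => n /asboolP[p [hp p0 Zp sp]] min.
have s2 : (1 < size p)%N.
  rewrite ltnNge; apply/negP => s1.
  have /size_poly1P[c c0 ep] : size p == 1%N by rewrite eqn_leq s1 size_poly_gt0.
  apply: nz; have Cc : C c by have := hp 0%N; rewrite ep coefC.
  have := ZZ c^-1 _ (sfV hC Cc) Zp; congr Z; apply: funext => w.
  by rewrite (act_wide _ _ s1) big_ord1 ep coefC /= mulKf.
have [|e Ce pe] := cC _ s2; first exact/(povP hC).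
have {}Ce := set_mem Ce; have [q [hq eq]] := pov_divX hC hp Ce pe.
have q0 : q != 0 by apply: contraNneq p0 => h; rewrite eq h mul0r.
exists (act q z), e; split => //.
- by apply: fnl_sum => i; [exact: hq|exact: fnl_iter].
- move=> Zq; have : Q (size q) by apply/asboolP; exists q.
  move=> /min; rewrite -sp eq size_Mmonic ?monicXsubC // size_XsubC addn2 /=.
  by rewrite ltnn.
- by move: Zp; congr Z; apply: funext => w; rewrite eq act_step.
Qed.

Lemma order_free (K : nat) (g c : nat -> N) : (forall i, (i < K)%N -> exists k : nat,
    od (- k%:Z) (g i) /\ forall j, (j < i)%N -> ge (1 - k%:Z) (g j)) ->
  (forall i, C (c i)) -> \sum_(i < K) c i * g i = 0 -> forall i, (i < K)%N -> c i = 0.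
Proof.
move=> hg Cc; elim: K hg => // K IH hg; rewrite big_ord_recr /= => e.
have cK : c K = 0.
  apply/eqP; apply: contrapT => /negP cK0.
  have [k [ok hk]] := hg K (ltnSn K).
  have oc : od (0 - k%:Z) (c K * g K) by apply: (ordM hN hP hx) => //; exact: (ord_C hN hP hx).
  have : od (0 - k%:Z) (c K * g K + \sum_(i < K) c i * g i).
    apply: (ordD hN hP hx) => //; apply: (vge_sum hN hP hx) => i _; apply: (vgeCM hN hP hx) => //.
    by have := hk i (ltn_ord i); apply: (vge_mono hN hP hx); lia.
  by rewrite [c K * _ + _]addrC e => /(ord_neq0 hN hP hx); rewrite eqxx.
move=> i; rewrite ltnS leq_eqVlt => /orP[/eqP ->//|]; apply: IH.
  by move=> j jK; apply: hg; exact: ltnW.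
by move: e; rewrite cK mul0r addr0.
Qed.

(** Two differentials have a ratio in N. The unknowns b1 and b2 range over the span of r - m + 2
    independent functions in B with pole orders at most r. A multiple of b1 or b2 by an element of B
    stays in B, and their multiples by x^r are regular at P, so the equation has to be tested only
    on x^-1, ..., x^-(m-1) and 1, ..., x^(r-1). The choice r = 3 m makes the unknowns outnumber the
    tests. *)
Lemma ratio z1 z2 : fnl z1 -> fnl z2 -> exists b1 b2,
  [/\ B b1, B b2, (b1 != 0) || (b2 != 0) & forall w, z1 (b1 * w) = z2 (b2 * w)].
Proof.
move=> h1 h2; pose r := (3 * m)%N; pose K := (r - m).+2.
have /choice[g0 hg0] : forall k, exists b, B b /\ od (- (m + k)%N%:Z) b by exact: basis.
pose g i := if i is i'.+1 then g0 i' else 1.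
have Bg i : B (g i) by case: i => [|i]; [exact: sr1|case: (hg0 i)].
have gr i : (i < K)%N -> ge (- r%:Z) (g i).
  case: i => [|i] lt /=.
    apply: (vge_mono hN hP hx (k := 0)); first by lia.
    by apply/(vge_O hN hP hx); exact: sr1.
  by case: (hg0 i) => _ /(ord_vge hN hP hx); apply: (vge_mono hN hP hx); rewrite /r /K in lt *; lia.
have gfree := @order_free K g.
pose t (i : 'I_m.-1 + 'I_r) := match i with inl i => x ^ (- i.+1%:Z) | inr i => x ^ i%:Z end.
pose A i (sj : bool * 'I_K) := if sj.1 then z1 (g sj.2 * t i) else - z2 (g sj.2 * t i).
have AC i sj : C (A i sj).
  by rewrite /A; case: sj.1; [case: h1|apply: (sfN hC); case: h2].
have cI : (#|{: 'I_m.-1 + 'I_r}| < #|{: bool * 'I_K}|)%N.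
  by rewrite card_sum card_prod card_bool !card_ord /K /r; lia.
have [c [Cc [[s0 j0] c0] hc]] := underdetermined hC AC cI.
pose b s := \sum_(j < K) c (s, j) * g j.
have Bb s : B (b s) by apply: (sr_sum sB) => j _; exact: onepole_lin.
have bge s : ge (- r%:Z) (b s).
  by apply: (vge_sum hN hP hx) => j _; apply: (vgeCM hN hP hx) => //; apply: gr.
have zb z s w : fnl z -> z (b s * w) = \sum_(j < K) c (s, j) * z (g j * w).
  move=> hz; rewrite mulr_suml fnl_bigsum //; apply: eq_bigr => j _.
  by case: hz => _ _ zZ _ _; rewrite -mulrA zZ.
exists (b true), (b false); split => //.
  rewrite -negb_and; apply/negP => /andP[/eqP bt /eqP bf].
  have bs : b s0 = 0 by case: (s0).
  have : c (s0, j0) = 0.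
    have := gfree (fun j => c (s0, inord j)); move=> /(_ _ _ _ j0 (ltn_ord j0)).
    rewrite inord_val; apply => [|//|].
      case=> [|i] lt /=; first by exists 0%N; split => //; apply: (ord_C hN hP hx); [exact: sf1|exact: oner_neq0].
      exists (m + i)%N; split; first by case: (hg0 i).
      case=> [|j] ji /=.
        apply: (vge_mono hN hP hx (k := 0)); first by lia.
        by apply/(vge_O hN hP hx); exact: sr1.
      case: (hg0 j) => _ /(ord_vge hN hP hx); apply: (vge_mono hN hP hx); lia.
    by rewrite -[RHS]bs; apply: eq_bigr => j _; rewrite inord_val.
  by move/eqP; rewrite (negbTE c0).
move=> w; apply/eqP; rewrite -subr_eq0; apply/eqP.
have test i : z1 (b true * t i) - z2 (b false * t i) = 0.
  rewrite !zb // -sumrN /= -[RHS](hc i).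
  have -> : \sum_sj A i sj * c sj = \sum_(s : bool) \sum_(j < K) A i (s, j) * c (s, j).
    by rewrite pair_bigA; apply: eq_bigr => -[].
  rewrite big_bool /= /A /=.
  by congr (_ + _); apply: eq_bigr => j _; ring.
have vanB z s v : fnl z -> B v -> z (b s * v) = 0.
  by move=> [_ _ _ zB _] Bv; apply: zB; exact: (srM sB).
have vanO z s v : fnl z -> ge r%:Z v -> z (b s * v) = 0.
  move=> [_ _ _ _ zP] gv; apply: zP; apply/(vge_O hN hP hx).
  by have := vgeM hN hP hx (bge s) gv; rewrite addNr.
pose D v := z1 (b true * v) - z2 (b false * v).
have DD u v : D (u + v) = D u + D v.
  rewrite /D !mulrDr; case: h1 => _ -> _ _ _; case: h2 => _ -> _ _ _; ring.
have DZ a v : C a -> D (a * v) = a * D v.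
  move=> Ca; have q s : b s * (a * v) = a * (b s * v) by ring.
  have [_ _ zZ1 _ _] := h1; have [_ _ zZ2 _ _] := h2.
  by rewrite /D !q (zZ1 _ _ Ca) (zZ2 _ _ Ca) mulrBr.
have testl (i : 'I_m.-1) : D (x ^ (- i.+1%:Z)) = 0 := test (inl i).
have testr (i : 'I_r) : D (x ^ i%:Z) = 0 := test (inr i).
have D0 : D 0 = 0 by rewrite /D !mulr0 (fnl0 h1) (fnl0 h2) subrr.
have Dsum n (E : 'I_n -> N) : D (\sum_i E i) = \sum_i D (E i).
  by elim: n E => [|n IH] E; rewrite ?big_ord0 // !big_ord_recl DD IH.
have [b' [o [a [Bb' Po Ca ->]]]] := gap_decomp w.
rewrite -/(D _) !DD [D b'](_ : _ = 0) ?add0r; last first.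
  by rewrite /D (vanB z1 true b' h1 Bb') (vanB z2 false b' h2 Bb') subrr.
rewrite Dsum [X in _ + X]big1 ?addr0; last by move=> i _; rewrite DZ // testl mulr0.
have Po0 : ge 0 o by apply/(vge_O hN hP hx).
have [a' [Ca' ho]] := expansion hN hP hx r Po0.
rewrite -[o](subrK (\sum_(i < r) a' i * x ^ (0 + i%:Z))) DD Dsum [X in _ + X]big1 ?addr0.
  move: ho; rewrite add0r => ho.
  rewrite /D -[RHS](subrr 0); congr (_ - _).
    by apply: (vanO z1) h1 _; move: ho; congr (ge _ _).
  by apply: (vanO z2) h2 _; move: ho; congr (ge _ _).
by move=> i _; rewrite DZ // add0r testr mulr0.
Qed.

(** Since m - 1 is at least 2, there are independent z2 and z1 on which [dual] acts triangularly:
    dual z2 = l z2 and dual z1 = e z1 + nu z2. With z1 = g z2, the Leibniz rule gives th g = (e - l)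
    g + nu, and g is not constant because z1 is not a multiple of z2. *)
Lemma high_case : exists g, ~ C g /\ quadratic g.
Proof.
have [z [hz zx]] := coordinates.
have [i0 i1] : (0 < m.-1)%N /\ (1 < m.-1)%N by lia.
have [z2 [l [f2 n2 Cl e2]]] : exists z1 e, [/\ fnl z1, ~ (forall w, z1 w = 0), C e &
    forall w, dual z1 w - e * z1 w = 0].
  pose Zz (z : N -> N) := forall w, z w = 0.
  have Z0 : Zz (fun=> 0) by [].
  have ZZ c w : C c -> Zz w -> Zz (fun v => c * w v) by move=> _ h v; rewrite h mulr0.
  have nZ : ~ Zz (z 0%N).
    by move=> h; have := h (x ^ (- 1%N%:Z)); rewrite zx // => /eqP; rewrite oner_eq0.
  exact: (eigen_mod Z0 ZZ (hz 0%N i0) nZ).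
pose Z (z : N -> N) := exists2 c, C c & forall w, z w = c * z2 w.
have [j [ij nj]] : exists j, (j < m.-1)%N /\ ~ Z (z j).
  apply: contrapT => none.
  have [a Ca ha] : Z (z 0%N) by apply: contrapT => h; apply: none; exists 0%N.
  have [b Cb hb] : Z (z 1%N) by apply: contrapT => h; apply: none; exists 1%N.
  have h4 := ha (x ^ (- 1%N%:Z)); have h3 := hb (x ^ (- 1%N%:Z)).
  have h1 := hb (x ^ (- 2%N%:Z)); rewrite !zx //= in h1 h3 h4.
  have b0 : b = 0.
    have v0 : z2 (x ^ (- 1%N%:Z)) != 0.
      by apply/eqP => v0; move: h4 => /eqP; rewrite v0 mulr0 oner_eq0.
    by apply: (mulIf v0); rewrite mul0r -h3.
  by move: h1 => /eqP; rewrite b0 mul0r oner_eq0.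
have [z1 [e [f1 n1 Ce [nu Cnu e1]]]] : exists z1 e, [/\ fnl z1, ~ Z z1, C e & Z (fun w => dual z1 w - e * z1 w)].
  have Z0 : Z (fun=> 0) by exists 0; [exact: sf0|move=> w; rewrite mul0r].
  have ZZ c w : C c -> Z w -> Z (fun v => c * w v).
    by move=> Cc [a Ca ha]; exists (c * a) => [|v]; [exact: (sfM hC)|rewrite ha mulrA].
  exact: (eigen_mod Z0 ZZ (hz j ij) nj).
have [b1 [b2 [Bb1 Bb2 b12 rel]]] := ratio f1 f2.
have b10 : b1 != 0.
  apply/eqP => b10; move: b12; rewrite b10 eqxx /= => b20; apply: n2 => w.
  by have := rel (w / b2); rewrite b10 mul0r (fnl0 f1) mulrC divfK.
pose g := b2 / b1.
have zg w : z1 w = z2 (g * w).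
  by have := rel (w / b1); rewrite mulrCA mulfV // mulr1 => ->; congr z2; rewrite /g; ring.
have D2 := f2; case: D2 => _ z2D z2Z _ _.
have Cm : C (- 1) by apply: (sfN hC); exact: sf1.
have key w : z2 ((th g + l * g - e * g - nu) * w) = 0.
  have q1 := e1 w; have q2 := e2 (g * w).
  move: q1 q2; rewrite /dual !zg (derM hth) z2D => q1 /eqP; rewrite subr_eq0 => /eqP q2.
  have -> : (th g + l * g - e * g - nu) * w = th g * w + (l * (g * w) + ((- 1) * (e * (g * w)) + (- 1) * (nu * w))) by ring.
  rewrite !z2D (z2Z _ _ Cl) !(z2Z _ _ Cm) (z2Z _ _ Ce) (z2Z _ _ Cnu).
  have q1' : z2 (g * th w) = - (e * z2 (g * w)) - nu * z2 w.
    by rewrite -q1; ring.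
  by move: q2; rewrite q1' => <-; ring.
have thg : th g + l * g - e * g - nu = 0.
  apply/eqP; apply: contrapT => /negP n0; apply: n2 => w.
  by have := key (w / (th g + l * g - e * g - nu)); rewrite mulrC divfK.
exists g; split.
  by move=> Cg; apply: n1; exists g => // w; rewrite zg z2Z.
move=> d /LL1[a Ca ha]; exists (a * nu), (a * (e - l)), 0; split.
- exact: (sfM hC).
- by apply: (sfM hC) => //; exact: (sfB hC).
- exact: sf0.
- rewrite ha; have -> : th g = (th g + l * g - e * g - nu) + nu + (e - l) * g by ring.
  by rewrite thg; ring.
Qed.

End Functionals.

End PoleRing.

Definition weierstrass_pair (N : fieldType) (C : set N) (LL : set (N -> N)) W Y g2 g3 :=
  [/\ ~ C W, C g2 /\ C g3,
  27%:R * g3 ^+ 2 - g2 ^+ 3 != 0, Y ^+ 2 = 4%:R * W ^+ 3 - g2 * W - g3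
  & forall d, LL d -> exists2 a, C a & d W = a * Y].

(** P carries a function regular elsewhere, and m is its least pole order. The cases are: all the
    derivations vanish at P; m = 1; some nonzero derivation vanishes at P but another does not;
    finally all are multiples of one [th], with m = 2 or m > 2. Only the case m = 2 leads to a
    Weierstrass pair. *)
Lemma classification (N : fieldType) (C : set N) (LL : set (N -> N)) u :
  curve C -> (forall d, LL d -> derivation d) -> (forall d c, LL d -> C c -> d c = 0) ->
  (forall d d' a b, LL d -> LL d' -> C a -> C b -> LL (fun z => a * d z + b * d' z)) ->
  (forall d d', LL d -> LL d' -> LL (fun z => d (d' z) - d' (d z))) ->
  (forall d O z, LL d -> vring C O -> O z -> O (d z)) -> ~ C u ->
  (exists f, ~ C f /\ quadratic C LL f) \/
  exists W Y g2 g3, weierstrass_pair C LL W Y g2 g3.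
Proof.
move=> hN LLd LLC LLcomb LLbr LLO nu.
have [P [f0 [hP nf0 Bf0]]] := one_pole hN nu.
have [x hx] := uniformizer hN hP.
pose Q k := `[< (0 < k)%N /\ hasord C P x k >].
have exQ : exists k, Q k.
  have [k [k0 ok]] := onepole_ord hN hP hx Bf0 nf0.
  by exists k; apply/asboolP; split => //; exists f0.
case: (ex_minnP exQ) => m /asboolP[m0 [f Bf of_]] min.
have hm k : (0 < k)%N -> hasord C P x k -> (m <= k)%N.
  by move=> k0 hk; apply: min; apply/asboolP.
have nf : ~ C f.
  move=> Cf; have := ord_uniq hN hP hx of_ (ord_C hN hP hx Cf (ord_neq0 hN hP hx of_)); lia.
have [van|nvan] := pselect (forall d, LL d -> vge P x 1%N%:Z (d x)).
  by left; exists f; split => //; exact: (vanishing_case hN hP hx m0 hm LLd LLC LLO Bf of_ van).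
have [m1|m1] := eqVneq m 1%N.
  by left; exists f; split => //; exact: (order_one hN hP hx m0 hm LLd LLC LLO Bf of_ m1).
have m2 : (1 < m)%N by lia.
have [th [Lth oth]] : exists th, LL th /\ ord P x 0%N%:Z (th x).
  move/existsNP: nvan => [th /not_implyP[Lth h]]; exists th; split => //.
  apply: (vge_ord hN hP hx) => //; apply/(vge_O hN hP hx); apply: (LLO th P x Lth hP).
  by case: hx => -[].
have [[d [Ld [g1 d0]]]|none] := pselect (exists d, LL d /\ (vge P x 1 (d x) /\ d x != 0)).
  left; have := two_dim hN hP hx m0 hm LLd LLC LLcomb LLbr LLO Bf of_ m2 Lth oth Ld g1 d0.
  by [].
have LL1 := one_dim hN hP hx LLd LLC LLcomb LLO Lth oth.
have {}LL1 : forall d, LL d -> exists2 a, C a & forall z, d z = a * th z.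
  apply: LL1 => d Ld g1; apply/eqP/negP => /negP d0; apply: none; by exists d.
have [m_2|m_2] := eqVneq m 2%N.
  by right; exact: (weierstrass_case hN hP hx m0 hm LLd LLC LLO Bf of_ m2 Lth oth LL1 m_2).
have m3 : (2 < m)%N by lia.
by left; exact: (high_case hN hP hx m0 hm LLd LLC LLO Bf of_ m2 Lth oth LL1 m3).
Qed.

(** * Places stable under derivations *)

Lemma rpov_comp (T : fieldType) (R : set T) (p q : {poly T}) : sring R ->
  pov R p -> pov R q -> pov R (p \Po q).
Proof.
move=> hR hp hq i; rewrite comp_polyE coef_sum; apply: (sr_sum hR) => j _.
rewrite coefZ; apply: (srM hR); first exact: hp.
elim: (nat_of_ord j) i => [|k IH] i; first by rewrite expr0; apply: (rpovC hR); exact: sr1.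
by rewrite exprS; exact: (rpovM hR hq IH).
Qed.

Lemma coef_comp_scaleX (T : fieldType) (p : {poly T}) a j : (p \Po (a *: 'X))`_j = a ^+ j * p`_j.
Proof.
rewrite comp_polyE coef_sum; under eq_bigr do rewrite exprZn scalerA coefZ coefXn.
have [lt|ge] := ltnP j (size p).
  rewrite (bigD1 (Ordinal lt)) //= eqxx mulr1 big1 ?addr0 1?mulrC // => i.
  by rewrite -val_eqE /= eq_sym => /negbTE ->; rewrite mulr0.
rewrite nth_default // mulr0 big1 // => i _.
by rewrite gtn_eqF ?mulr0 //; apply: leq_trans ge.
Qed.

Section Unramified.
Variables (N : fieldType) (C : set N).
Hypothesis hN : curve C.
Variables (O : set N) (hO : vring C O) (x : N) (hx : unif O x).
Variable d : N -> N.
Hypotheses (hd : derivation d) (dC : forall c, C c -> d c = 0) (dx : d x = 1).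
Let hC : subfield C. Proof. by case: hN. Qed.
Let x0 : x != 0. Proof. by case: hx. Qed.
Let mx : mid O x. Proof. by case: hx. Qed.
Let sO : sring O. Proof. by case: hO. Qed.
Let CO : C `<=` O. Proof. by case: hO. Qed.
Let Ox : O x. Proof. by case: mx. Qed.
Let nx : ~ C x. Proof. exact: (mid_notC hN hO mx x0). Qed.

Let polyO q : pov C q -> O q.[x].
Proof. by move=> hq; apply: (rpov_horner sO) => // i; apply: CO; exact: hq. Qed.

Let dpoly q : pov C q -> d q.[x] = q^`().[x].
Proof.
move=> hq; rewrite der_horner // dx mulr1 (_ : map_poly d q = 0) ?horner0 ?add0r //.
by apply/polyP => i; rewrite coef0 coef_map_id0 ?(der0 hd) //; apply: dC; exact: hq.
Qed.

Lemma strip_X (p : {poly N}) : pov C p -> p != 0 -> exists q k,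
  [/\ pov C q, q.[0] != 0 & p = q * 'X^k].
Proof.
have [n] := ubnP (size p); elim: n p => // n IH p lt hp p0.
have [e|ne] := eqVneq p.[0] 0; last by exists p, 0%N; rewrite expr0 mulr1.
have [|q [hq eq]] := pov_divX hC hp (sf0 hC); first exact/eqP.
have q0 : q != 0 by apply: contraNneq p0 => h; rewrite eq h mul0r.
have [|r [k [hr r0 er]]] := IH q _ hq q0.
  by move: lt; rewrite eq size_Mmonic ?monicXsubC // size_XsubC addn2.
by exists r, k.+1; split => //; rewrite eq er subr0 exprSr mulrA.
Qed.

Let unit_at0 q : pov C q -> q.[0] != 0 -> O q.[x]^-1 /\ q.[x] != 0.
Proof.
move=> hq q0; apply: (not_mid_inv hN hO); first exact: polyO.
move=> m; move/eqP: q0; apply; apply: (midC hN hO).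
  by apply: (pov_horner hC) => //; exact: sf0.
have -> : q.[0] = q.[x] - (q.[x] - q.[0]) by ring.
apply: (midD hN hO) => //; apply: (midN hN hO); apply: (mid_root hN hO) => //.
by move=> i; apply: CO; exact: hq.
Qed.

(** An element of C(x) regular at the place is a polynomial in x divided by one with nonzero value
    at 0, which is a unit; and d acts on polynomials in x as ordinary differentiation. *)
Lemma der_rational a : adjoin C [set x] a -> O a -> O (d a).
Proof.
move=> ha Oa; have [->|a0] := eqVneq a 0; first by rewrite (der0 hd); exact: sr0.
have [u [v [hu hv vx e]]] := adjoin1P hC ha.
have u0 : u != 0 by apply: contraNneq a0 => h; rewrite e h horner0 mul0r.
have v0 : v != 0 by apply: contraNneq vx => h; rewrite h horner0.
have [u1 [j [hu1 u10 eu]]] := strip_X hu u0; have [v1 [k [hv1 v10 ev]]] := strip_X hv v0.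
have [u1' u1n] := unit_at0 hu1 u10; have [v1' v1n] := unit_at0 hv1 v10.
have xn i : x ^+ i != 0 by rewrite expf_neq0.
have le : (k <= j)%N.
  rewrite leqNgt; apply/negP => lt; apply: (not_mid1 hN hO).
  have -> : 1 = (a * v1.[x] * u1.[x]^-1) * x ^+ (k - j).
    have -> : a = u1.[x] * x ^+ j / (v1.[x] * x ^+ k) by rewrite e eu ev !hornerM !hornerXn.
    have -> : x ^+ k = x ^+ (k - j) * x ^+ j by rewrite -exprD subnK // ltnW.
    by have := xn j; have := xn (k - j)%N; move: (x ^+ j) (x ^+ (k - j)) => A1 A2 h1 h2; field; rewrite ?u1n ?v1n ?h1 ?h2.
  apply: (midM hN hO); first by do 2?apply: (srM sO) => //; exact: polyO.
  have -> : (k - j = (k - j).-1.+1)%N by lia.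
  by rewrite exprSr; apply: (midM hN hO) => //; exact: srX.
pose u2 := u1 * 'X^(j - k).
have hu2 : pov C u2.
  by apply: (povM hC) => // i; rewrite coefXn; exact: (sfnat hC).
have ea : a = u2.[x] / v1.[x].
  rewrite e eu ev /u2 !hornerM !hornerXn -{1}(subnK le) exprD.
  by have := xn k; move: (x ^+ (j - k)) (x ^+ k) => A1 A2 h; field; rewrite ?v1n ?h.
rewrite ea (der_div hd) // !dpoly //; apply: (srM sO).
  by apply: (srB sO); apply: (srM sO); apply: polyO => //; exact: pov_deriv.
by rewrite -exprVn; exact: srX.
Qed.

(* Hensel: after the substitution z = p + x^K w the equation of w over C(x)
   has integral coefficients and a unit derivative at w. *)
Lemma der_unif z : O z -> O (d z).
Proof.
move=> Oz; pose R0 := adjoin C [set x]; have hR0 : subfield R0 by exact: adjoin_sf.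
have R0x : R0 x by exact: sub_adjoinr.
have CR0 : C `<=` R0 by exact: sub_adjoinl.
have ch : [pchar N] =i pred0 by case: hN.
have [F0 [hF0 F00 F0z F0'z]] := separable_root ch hR0 (alg_over_gen z hN nx).
have [M hM] : exists M : nat, forall i : 'I_(size F0), vge O x (- M%:Z) F0`_i.
  apply: uniform_bound => [i m n mn|i]; last exact: (vge_nat hN hO hx).
  by apply: (vge_mono hN hO hx); lia.
(* The factor x^M clears the poles of the coefficients. *)
pose F := x ^+ M *: F0.
have xM : x ^+ M != 0 by rewrite expf_neq0.
have hFR : pov R0 F by apply: (povZ hR0) => //; apply: (sfX hR0).
have hFO : pov O F.
  move=> i; rewrite coefZ; have [lt|ge] := ltnP i (size F0); last by rewrite nth_default // mulr0; exact: sr0.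
  have := hM (Ordinal lt); rewrite /vge /= opprK mulrC; by [].
have Fz : F.[z] = 0 by rewrite hornerZ; move/eqP: F0z => ->; rewrite mulr0.
have F'z : F^`().[z] != 0 by rewrite derivZ hornerZ mulf_neq0.
have hF'O : pov O F^`().
  move=> i; rewrite coef_deriv -mulr_natr; apply: (srM sO); first exact: hFO.
  by apply: CO; exact: (sfnat hC).
have OF'z : O F^`().[z] by exact: (rpov_horner sO).
have [e he] : exists e : nat, ord O x e%:Z F^`().[z].
  have [k hk] := ord_exists hN hO hx F'z.
  have /(vge_O hN hO hx) g := OF'z; have le := ord_le hN hO hx hk g.
  by exists `|k|%N; have -> : `|k|%N%:Z = k by lia.
(* K exceeds the order e of the derivative of F at z, so replacing z by its truncation p leaves that
   derivative divisible by x^e. *)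
pose K := e.+1.
have Oz0 : vge O x 0 z by exact/(vge_O hN hO hx).
have [c [Cc hc]] := expansion hN hO hx K Oz0.
pose p := \sum_(i < K) c i * x ^+ i.
have ep : \sum_(i < K) c i * x ^ (0 + i%:Z) = p by apply: eq_bigr => i _; rewrite add0r.
rewrite ep add0r in hc.
have R0p : R0 p by apply: (sf_sum hR0) => i _; apply: (sfM hR0); [apply: CR0; exact: Cc|apply: (sfX hR0)].
have Op : O p by apply: (sr_sum sO) => i _; apply: (srM sO); [apply: CO; exact: Cc|exact: srX].
pose xK := x ^+ K; have xK0 : xK != 0 by rewrite expf_neq0.
pose w := (z - p) / xK; have Ow : O w by move: hc; rewrite /vge /= -exprnN.
have ez : z = p + xK * w by rewrite /w mulrC divfK // addrC subrK.
have zE : xK * w + p = z by rewrite addrC -ez.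
have hXp (R : set N) : sring R -> R p -> pov R ('X + p%:P).
  by move=> hR Rp; apply: (rpovD hR); [exact: rpovX|exact: rpovC].
pose G := F \Po ('X + p%:P).
have hGO : pov O G by apply: (rpov_comp sO) => //; exact: hXp.
have hGR : pov R0 G.
  by apply: (rpov_comp (sf_sring hR0)) => //; apply: hXp => //; exact: sf_sring.
have Gev y : G.[y] = F.[y + p] by rewrite horner_comp hornerD hornerX hornerC.
have G'ev y : G^`().[y] = F^`().[y + p].
  by rewrite /G deriv_comp !derivE addr0 mulr1 horner_comp hornerD hornerX hornerC.
have xe0 : x ^+ (K + e) != 0 by rewrite expf_neq0.
pose H := (x ^+ (K + e))^-1 *: (G \Po (xK *: 'X)).
have Hc j : H`_j = (x ^+ (K + e))^-1 * (xK ^+ j * G`_j) by rewrite coefZ coef_comp_scaleX.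
have hHR : pov R0 H.
  move=> j; rewrite Hc; apply: (sfM hR0); first by apply: (sfV hR0); apply: (sfX hR0).
  by apply: (sfM hR0) => //; do 2?apply: (sfX hR0).
have Hw : H.[w] = 0.
  by rewrite hornerZ horner_comp hornerZ hornerX Gev zE Fz mulr0.
have xe : x ^+ e != 0 by rewrite expf_neq0.
have H'w : H^`().[w] = F^`().[z] / x ^+ e.
  rewrite derivZ deriv_comp derivZ derivX hornerZ hornerM horner_comp -polyC1 !hornerZ hornerX hornerC mulr1 G'ev zE.
  by rewrite /xK exprD; have := xe; have := xK0; rewrite /xK; move: (x ^+ K) (x ^+ e) => A1 A2 h1 h2; field; rewrite ?h1 ?h2.
have H'unit : O (H^`().[w])^-1 /\ H^`().[w] != 0.
  case: he => n0 [_]; rewrite -exprnN H'w => h; split => //.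
  by rewrite mulf_neq0 // invr_eq0.
(* The linear coefficient is regular by the choice of K; from degree two on, x^(2 K) absorbs the
   denominator x^(K + e); the constant coefficient is then regular because H(w) = 0. *)
have HO j : O H`_j.
  suff HO1 i : O H`_i.+1.
    case: j => // ; move: Hw; rewrite (@horner_coef_wide _ (size H).+1) //.
    rewrite big_ord_recl /= expr0 mulr1 => /eqP; rewrite addr_eq0 => /eqP ->.
    apply: (srN sO); apply: (sr_sum sO) => i _; apply: (srM sO); [exact: HO1|exact: srX].
  rewrite Hc; case: i => [|i].
    have G1 : vge O x e%:Z G`_1.
      have -> : G`_1 = G^`().[0] by rewrite horner_coef0 coef_deriv.
      have [r er] : exists r, G^`().[xK * w] = r * (xK * w) + G^`().[0] /\ O r.
        have hG' : pov O G^`().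
          move=> i; rewrite coef_deriv -mulr_natr; apply: (srM sO); first exact: hGO.
          by apply: CO; exact: (sfnat hC).
        pose q := \poly_(j < (size G^`()).-1) (G^`())`_j.+1.
        exists q.[xK * w]; split.
          rewrite -[X in _ + X](hornerC _ (xK * w)) -hornerMX -hornerD; congr (_.[_]).
          apply/polyP => -[|i]; rewrite coefD coefMX coefC /= ?add0r ?addr0 ?horner_coef0 //.
          by rewrite [RHS]coef_poly; case: ltnP => // ge; rewrite nth_default //; apply: (leq_trans (leqSpred _)); rewrite ltnS.
        apply: (rpov_horner sO) => [i|]; last by apply: (srM sO) => //; exact: srX.
        by rewrite coef_poly; case: ifP => _; [exact: hG'|exact: sr0].
      case: er => er Or; have -> : G^`().[0] = F^`().[z] - r * (xK * w).
        rewrite -{1}zE -G'ev er; ring.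
      apply: (vgeB hN hO hx); first exact: (ord_vge hN hO hx he).
      have : vge O x (0 + (K%:Z + 0)) (r * (xK * w)).
        apply: (vgeM hN hO hx); first exact/(vge_O hN hO hx).
        by apply: (vgeM hN hO hx); [exact: (vge_x hN hO hx)|exact/(vge_O hN hO hx)].
      by apply: (vge_mono hN hO hx); rewrite /K; lia.
    move: G1; rewrite /vge /= -exprnN; congr O.
    rewrite expr1 /xK exprD; have := xe; have := xK0; rewrite /xK.
    by move: (x ^+ K) (x ^+ e) => A1 A2 h1 h2; field; rewrite ?h1 ?h2.
  have -> : (x ^+ (K + e))^-1 * (xK ^+ i.+2 * G`_i.+2) = x * xK ^+ i * G`_i.+2.
    have -> : xK ^+ i.+2 = xK ^+ i * (x ^+ (K + e) * x).
      by rewrite -exprSr -addnS -/K exprD -/xK !exprS; ring.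
    by field; rewrite ?xe0.
  by do 2?apply: (srM sO) => //; do ?apply: (srX sO).
have Odw : O (d w).
  have [Hi Hn] := H'unit.
  have := congr1 d Hw; rewrite (der_horner _ _ hd) (der0 hd) => /eqP.
  rewrite addrC addr_eq0 => /eqP e1.
  have -> : d w = - (map_poly d H).[w] * (H^`().[w])^-1 by rewrite -e1 mulrC mulKf.
  apply: (srM sO) => //; apply: (srN sO); apply: (rpov_horner sO) => // j.
  rewrite coef_map_id0 ?(der0 hd) //; apply: der_rational; [exact: hHR|exact: HO].
rewrite ez (derD hd) (derM hd); apply: (srD sO); first exact: der_rational.
apply: (srD sO); last by apply: (srM sO) => //; exact: srX.
apply: (srM sO) => //; apply: der_rational; last exact: srX.
by apply: (sfX hR0).
Qed.

End Unramified.

(** * Extending a place trivially to new constants, and absence of poles *)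

Section StablePlace.
Variables (N : fieldType) (C : set N).
Hypothesis hN : curve C.
Variables (T : fieldType) (f : {rmorphism N -> T}).
Variable Om : set T.
Hypothesis hOm : subfield Om.
Hypothesis fC : forall c, C c -> Om (f c).
Hypothesis disjoint : forall (I : finType) (A : {set I}) (v : I -> N),
  lfree C A v -> lfree Om A (f \o v).
Let hC : subfield C. Proof. by case: hN. Qed.
Let charN : [pchar N] =i pred0. Proof. by case: hN. Qed.
Let charT : [pchar T] =i pred0.
Proof.
apply/pcharf0P => n; rewrite -(rmorph_nat f) fmorph_eq0.
by move/pcharf0P: charN => ->.
Qed.

Variables (O : set N) (hO : vring C O) (x : N) (hx : unif O x).
Let x0 : x != 0. Proof. by case: hx. Qed.
Local Notation X := (f x).
Let X0 : X != 0. Proof. by rewrite fmorph_eq0. Qed.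
Let fX k : f (x ^ k) = X ^ k.
Proof. by case: k => n; rewrite ?NegzE -?exprnP -?exprnN ?fmorphV rmorphXn. Qed.
Let Xk k : X ^ k != 0. Proof. exact: expfz_neq0. Qed.

(** The place of N extended to the ring generated by Om and f(N), trivially on Om: the Om-span of
    the elements of value at least k. *)
Definition fil (k : int) (z : T) := exists n (w : 'I_n -> T) (c : 'I_n -> N),
  [/\ forall i, Om (w i), forall i, vge O x k (c i) & z = \sum_i w i * f (c i)].

Lemma fil0 k : fil k 0.
Proof. by exists 0%N, (fun=> 0), (fun=> 0); split; [case|case|rewrite big_ord0]. Qed.

Lemma filD k y z : fil k y -> fil k z -> fil k (y + z).
Proof.
move=> [n [w [c [hw hc ->]]]] [n' [w' [c' [hw' hc' ->]]]].
exists (n + n')%N, (fun i => match split i with inl i => w i | inr i => w' i end),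
  (fun i => match split i with inl i => c i | inr i => c' i end); split.
- by move=> i; case: split.
- by move=> i; case: split.
- rewrite big_split_ord; congr (_ + _); apply: eq_bigr => i _.
    by case: split_ordP => j /eqP; rewrite ?eq_lrshift // eq_lshift => /eqP ->.
  by case: split_ordP => j /eqP; rewrite ?eq_rlshift // eq_rshift => /eqP ->.
Qed.

Lemma fil_sum k n (E : 'I_n -> T) : (forall i, fil k (E i)) -> fil k (\sum_i E i).
Proof. by move=> h; elim/big_ind: _ => //; [exact: fil0|exact: filD]. Qed.

Lemma fil_gen k w c : Om w -> vge O x k c -> fil k (w * f c).
Proof. by move=> hw hc; exists 1%N, (fun=> w), (fun=> c); rewrite big_ord1; split. Qed.

Lemma filM k l y z : fil k y -> fil l z -> fil (k + l) (y * z).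
Proof.
move=> [n [w [c [hw hc ->]]]] [n' [w' [c' [hw' hc' ->]]]].
rewrite mulr_suml; apply: fil_sum => i; rewrite mulr_sumr; apply: fil_sum => j.
by rewrite mulrACA -rmorphM; apply: fil_gen; [exact: (sfM hOm)|exact: (vgeM hN hO hx)].
Qed.

Lemma fil_Om w : Om w -> fil 0 w.
Proof.
move=> hw; rewrite -[w]mulr1 -(rmorph1 f); apply: fil_gen => //.
by apply: (vge_C hN hO hx); exact: sf1.
Qed.

Lemma filZ k w z : Om w -> fil k z -> fil k (w * z).
Proof. by move=> hw hz; rewrite -[k]add0r; apply: filM => //; exact: fil_Om. Qed.

Lemma filN k z : fil k z -> fil k (- z).
Proof. by move=> h; rewrite -mulN1r; apply: filZ => //; sfa hOm. Qed.

Lemma filB k y z : fil k y -> fil k z -> fil k (y - z).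
Proof. by move=> hy hz; apply: filD => //; exact: filN. Qed.

Lemma fil_mono k l z : (l <= k)%R -> fil k z -> fil l z.
Proof.
move=> le [n [w [c [hw hc ->]]]]; exists n, w, c; split => // i.
exact: (vge_mono hN hO hx le (hc i)).
Qed.

Lemma fil_X k w : Om w -> fil k (w * X ^ k).
Proof. by move=> hw; rewrite -fX; apply: fil_gen => //; exact: (vge_x hN hO hx). Qed.

(** Linear disjointness enters here: x^k is independent over C of any free family of elements of
    higher value, and it stays so over Om. *)
Lemma fil_X_sharp k w : Om w -> w != 0 -> ~ fil (k + 1) (w * X ^ k).
Proof.
move=> hw w0 [n [u [c [hu hc e]]]].
have [A [hA span]] := lfree_max c hC.
have /choice[m hm] : forall j, exists m : 'I_n -> N, (forall i, C (m i)) /\ c j = \sum_(i in A) m i * c i.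
  by move=> j; have [m h1 h2] := span j; exists m.
pose v (o : option 'I_n) := if o is Some j then c j else x ^ k.
pose B := (None |: [set Some j | j in A])%SET.
have nB : None \notin [set Some j | j in A]%SET.
  by apply/imsetP => -[j].
have sumB (R : nmodType) (F : option 'I_n -> R) :
    \sum_(o in B) F o = F None + \sum_(j in A) F (Some j).
  by rewrite big_setU1 //= big_imset //= => i j _ _ [].
have hB : lfree C B v.
  move=> g Cg; rewrite sumB /= => e0.
  have gN : g None = 0.
    apply/eqP; apply: contrapT => /negP g0.
    have og : ord O x (0 + k) (g None * x ^ k).
      by apply: (ordM hN hO hx); [exact: (ord_C hN hO hx)|exact: (ord_x hN hO hx)].
    have : ord O x (0 + k) (g None * x ^ k + \sum_(j in A) g (Some j) * c j).
      apply: (ordD hN hO hx) => //; apply: (vge_sum hN hO hx) => j _.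
      by rewrite add0r; apply: (vgeCM hN hO hx).
    by rewrite e0 => -[]; rewrite eqxx.
  move: e0; rewrite gN mul0r add0r => e0.
  have gA := hA (g \o Some) (fun i => Cg (Some i)) e0.
  by case=> [j|//] /setU1P[//|/imsetP[i iA [->]]]; exact: gA.
pose g (o : option 'I_n) := if o is Some j then - \sum_i u i * f (m i j) else w.
have Og o : Om (g o).
  case: o => [j|//]; apply: (sfN hOm); apply: (sf_sum hOm) => i _; apply: (sfM hOm) => //.
  by apply: fC; case: (hm i).
move/eqP: w0; apply; apply: (@disjoint _ B v hB g Og _ None); last by rewrite setU11.
rewrite sumB /= fX e.
under [X in _ + X]eq_bigr do rewrite mulNr mulr_suml.
rewrite sumrN exchange_big /= [X in X - _](_ : _ = \sum_i \sum_(j in A) u i * f (m i j) * f (c j)) ?subrr //.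
apply: eq_bigr => i _; have [_ {1}->] := hm i.
by rewrite rmorph_sum mulr_sumr; apply: eq_bigr => j _; rewrite rmorphM mulrA.
Qed.

Definition lead k z w := [/\ Om w, w != 0 & fil (k + 1) (z - w * X ^ k)].

Lemma lead_fil k z w : lead k z w -> fil k z.
Proof.
move=> [hw _ h]; rewrite -[z](subrK (w * X ^ k)); apply: filD; last exact: fil_X.
by apply: fil_mono h; lia.
Qed.

Lemma lead_not_fil k z w : lead k z w -> ~ fil (k + 1) z.
Proof.
move=> [hw w0 h] h'; apply: (@fil_X_sharp k w) => //.
by have := filB h' h; congr fil; ring.
Qed.

Lemma lead_ge k l z w : lead k z w -> fil l z -> (l <= k)%R.
Proof.
move=> hz hl; rewrite leNgt; apply/negP => lt; apply: (lead_not_fil hz).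
by apply: fil_mono hl; lia.
Qed.

Lemma lead_uniq k l z w w' : lead k z w -> lead l z w' -> k = l.
Proof.
move=> h1 h2; apply/eqP; rewrite eq_le (lead_ge h1 (lead_fil h2)).
by rewrite (lead_ge h2 (lead_fil h1)).
Qed.

Lemma lead_neq0 k z w : lead k z w -> z != 0.
Proof. by move=> h; apply/eqP => z0; apply: (lead_not_fil h); rewrite z0; exact: fil0. Qed.

Lemma leadM k l y z w w' : lead k y w -> lead l z w' -> lead (k + l) (y * z) (w * w').
Proof.
move=> hy hz; have fz := lead_fil hz; case: hy hz => hw w0 h [hw' w0' h']; split.
- exact: (sfM hOm).
- by rewrite mulf_neq0.
- have -> : y * z - w * w' * X ^ (k + l) = (y - w * X ^ k) * z + (w * X ^ k) * (z - w' * X ^ l).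
    by rewrite expfzDr //; ring.
  apply: filD.
    by have := filM h fz; congr fil; ring.
  by have := filM (fil_X k hw) h'; congr fil; ring.
Qed.

Lemma lead_add k z w y : lead k z w -> fil (k + 1) y -> lead k (z + y) w.
Proof.
move=> [hw w0 h] hy; split => //.
by have := filD h hy; congr fil; ring.
Qed.

Lemma lead_exists k z : fil k z -> z != 0 -> exists l w, lead l z w.
Proof.
move=> [n [w [c [hw hc ->]]]]; elim: n w c hw hc => [|n IH] w c hw hc z0.
  by move: z0; rewrite big_ord0 eqxx.
have [[i ci]|none] := pselect (exists i, c i = 0).
  move: z0; rewrite (bigD1_ord i) //= ci rmorph0 mulr0 add0r => z0.
  by apply: IH z0 => j.
have cn i : c i != 0 by apply/eqP => ci; apply: none; exists i.
(* eliminate a term of minimal order *)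
pose Q (j : nat) := `[< exists i, ord O x (k + j%:Z) (c i) >].
have ordc i : exists j : nat, ord O x (k + j%:Z) (c i).
  have [l hl] := ord_exists hN hO hx (cn i); have le := ord_le hN hO hx hl (hc i).
  by exists `|l - k|%N; have -> : k + `|l - k|%N%:Z = l by lia.
have exQ : exists j, Q j by have [j hj] := ordc ord0; exists j; apply/asboolP; exists ord0.
case: (ex_minnP exQ) => j /asboolP[i oi] min.
have gi i' : vge O x (k + j%:Z) (c i').
  have [j' hj'] := ordc i'; apply: (vge_mono hN hO hx) (ord_vge hN hO hx hj').
  have : Q j' by apply/asboolP; exists i'.
  by move/min; lia.
have [a [Ca a0 ha]] := ord_lead hN hO hx oi.
have /choice[g hg] : forall i', exists g, C g /\ vge O x (k + j%:Z + 1) (c i' - g * c i).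
  move=> i'; have [b [Cb hb]] := vge_lead hN hO hx (gi i'); exists (b / a).
  split; first exact: (sfdiv hC).
  have -> : c i' - b / a * c i = (c i' - b * x ^ (k + j%:Z)) - b / a * (c i - a * x ^ (k + j%:Z)).
    by move: (x ^ _) => y; field.
  apply: (vgeB hN hO hx) => //; apply: (vgeCM hN hO hx) => //; exact: (sfdiv hC).
pose W := w i + \sum_(l < n) w (lift i l) * f (g (lift i l)).
have OW : Om W.
  apply: (sfD hOm) => //; apply: (sf_sum hOm) => l _; apply: (sfM hOm) => //.
  by apply: fC; case: (hg (lift i l)).
have ez : \sum_i0 w i0 * f (c i0) = W * f (c i) +
    \sum_(l < n) w (lift i l) * f (c (lift i l) - g (lift i l) * c i).
  rewrite (bigD1_ord i) //= /W mulrDl -addrA; congr (_ + _).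
  rewrite mulr_suml -big_split /=; apply: eq_bigr => l _.
  by rewrite rmorphB rmorphM; ring.
have fl : fil (k + j%:Z + 1) (\sum_(l < n) w (lift i l) * f (c (lift i l) - g (lift i l) * c i)).
  by apply: fil_sum => l; apply: fil_gen => //; case: (hg (lift i l)).
have [W0|W0] := eqVneq W 0; last first.
  exists (k + j%:Z), (W * f a); rewrite ez; apply: lead_add => //; split.
  - by apply: (sfM hOm) => //; exact: fC.
  - by rewrite mulf_neq0 // fmorph_eq0.
  - have -> : W * f (c i) - W * f a * X ^ (k + j%:Z) = W * f (c i - a * x ^ (k + j%:Z)).
      by rewrite rmorphB rmorphM fX; ring.
    exact: fil_gen.
move: z0; rewrite ez W0 mul0r add0r; apply: IH => // l.
have [Cg hg'] := hg (lift i l).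
apply: (vgeB hN hO hx) => //; exact: (vgeCM hN hO hx).
Qed.

Lemma fil_ten z : ten Om (range f) z -> exists k, fil k z.
Proof.
move=> [s hs ->]; elim: s hs => [|p s IH] hs; first by exists 0; rewrite big_nil; exact: fil0.
have [k hk] := IH (fun q qs => hs q (@mem_behead _ (p :: s) q qs)).
have [Op [c _ ec]] := hs p (mem_head _ _).
have [n hn] := vge_nat hN hO hx c.
exists (if (k <= - n%:Z)%R then k else - n%:Z); rewrite big_cons -ec.
have h1 : fil (- n%:Z) (p.1 * f c) by exact: fil_gen.
by case: leP => le; apply: filD => //; apply: fil_mono h1 || apply: fil_mono hk; lia.
Qed.

Let hR : subfield (range f).
Proof.
apply/subfieldP; split.
- by exists 1 => //; rewrite rmorph1.
- by move=> _ _ [a _ <-] [b _ <-]; exists (a - b) => //; rewrite rmorphB.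
- by move=> _ _ [a _ <-] [b _ <-]; exists (a / b) => //; rewrite fmorph_div.
Qed.

(** The extended valuation on fractions, kept as a relation; by [qord_uniq] the representation of z
    is immaterial. *)
Definition qord n z := exists P S p q w w', [/\ lead p P w, lead q S w', z = P / S & n = p - q].

Lemma qord_exists z : adjoin Om (range f) z -> z != 0 -> exists n, qord n z.
Proof.
move=> /(compositumP hOm hR)[P [S [hP hS S0 e]]] z0.
have P0 : P != 0 by apply: contraNneq z0 => P0; rewrite e P0 mul0r.
have [k hk] := fil_ten hP; have [l hl] := fil_ten hS.
have [p [w hw]] := lead_exists hk P0; have [q [w' hw']] := lead_exists hl S0.
by exists (p - q), P, S, p, q, w, w'.
Qed.

Lemma qord_uniq n m z : qord n z -> qord m z -> n = m.
Proof.
move=> [P [S [p [q [w [w' [h1 h2 -> ->]]]]]]] [P' [S' [p' [q' [u [u' [h1' h2' e ->]]]]]]].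
have e' : P * S' = P' * S.
  have := lead_neq0 h2; have := lead_neq0 h2' => n1 n2.
  by move/eqP: e; rewrite eqr_div // => /eqP.
have := leadM h1 h2'; rewrite e' => h; have := lead_uniq h (leadM h1' h2); lia.
Qed.

Lemma qord_div n m y z : qord n y -> qord m z -> qord (n - m) (y / z).
Proof.
move=> [P [S [p [q [w [w' [h1 h2 -> ->]]]]]]] [P' [S' [p' [q' [u [u' [h1' h2' -> ->]]]]]]].
exists (P * S'), (S * P'), (p + q'), (q + p'), (w * u'), (w' * u); split.
- exact: leadM.
- exact: leadM.
- by rewrite invf_div mulf_div.
- by ring.
Qed.

Variables (th : N -> N) (del : T -> T).
Hypotheses (hth : derivation th) (thC : forall c, C c -> th c = 0).
Hypotheses (hdel : derivation del) (delOm : forall w, Om w -> Om (del w)).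
Hypothesis delf : forall c, del (f c) = f (th c).
Variable NQ : set T.
Hypothesis hNQ : subfield NQ.
Hypothesis NQ0 : forall a, NQ a -> del a = 0.
Hypothesis NQsub : NQ `<=` adjoin Om (range f).
Hypothesis NQgen : range f `<=` adjoin Om NQ.

Section Pole.
Variable s : int.
Hypothesis s2 : (2 <= s)%R.
Hypothesis ths : ord O x (1 - s) (th x).

Let thx0 : th x != 0. Proof. exact: (ord_neq0 hN hO hx ths). Qed.

Let th_vge k z : vge O x k z -> vge O x (k - s) (th z).
Proof.
move=> hz; pose d z := (th x)^-1 * th z + 0 * th z.
have hd : derivation d by exact: der_comb.
have dC c : C c -> d c = 0 by move=> Cc; rewrite /d (thC Cc) !mulr0 addr0.
have dx : d x = 1 by rewrite /d mul0r addr0 mulVf.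
have dO := der_unif hN hO hx hd dC dx.
have d1 : vge O x 0%N%:Z (d x).
  by apply/(vge_O hN hO hx); rewrite dx; apply: (sr1 (R := O)); case: hO.
have g := der_vge hN hO hx hd dC dO d1 hz.
have -> : th z = th x * d z by rewrite /d mul0r addr0 mulrA mulfV // mul1r.
have := vgeM hN hO hx (ord_vge hN hO hx ths) g.
by apply: (vge_mono hN hO hx); lia.
Qed.

Let del_fil k z : fil k z -> fil (k - s) (del z).
Proof.
move=> [n [w [c [hw hc ->]]]]; rewrite (der_sum hdel); apply: fil_sum => i.
rewrite (derM hdel) delf; apply: filD; last by apply: fil_gen => //; exact: th_vge.
apply: (fil_mono (k := k)); first by lia.
by apply: fil_gen => //; exact: delOm.
Qed.

Let int_C k : C k%:~R.
Proof.
by case: k => n; rewrite ?NegzE ?mulrNz; [exact: (sfnat hC)|apply: (sfN hC); exact: (sfnat hC)].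
Qed.

(** For z with leading term w X^k, the part (del w) X^k has too high an order to matter. The leading
    term of del z comes from k w X^(k-1) f(th x), where th x starts with b x^(1-s). *)
Let del_lead : exists2 b, Om b /\ b != 0 & forall k z w, lead k z w ->
  fil (k - s + 1) (del z - k%:~R * b * w * X ^ (k - s)).
Proof.
have [b [Cb b0 hb]] := ord_lead hN hO hx ths.
exists (f b); first by split; [exact: fC|rewrite fmorph_eq0].
move=> k z w [hw w0 hz].
have Ok : Om k%:~R by rewrite -(rmorph_int f); exact: fC.
have -> : del z - k%:~R * f b * w * X ^ (k - s) =
    del w * X ^ k + (k%:~R * w) * X ^ (k - 1) * f (th x - b * x ^ (1 - s)) + del (z - w * X ^ k).
  have -> : X ^ (k - s) = X ^ (k - 1) * X ^ (1 - s).
    by rewrite -expfzDr //; congr (_ ^ _); ring.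
  rewrite (derB hdel) (derM hdel) (der_exprz _ hdel X0) delf rmorphB rmorphM fX; ring.
apply: filD; last by have := del_fil hz; congr fil; ring.
apply: filD; first by apply: (fil_mono (k := k)); [lia|apply: fil_X; exact: delOm].
have h1 : fil (1 - s + 1) (f (th x - b * x ^ (1 - s))).
  by rewrite -[f _]mul1r; apply: fil_gen => //; exact: sf1.
have := filM (fil_X (k - 1) (sfM hOm Ok hw)) h1.
by apply: fil_mono; lia.
Qed.

Let qord_del n z : qord n z -> n != 0 -> qord (n - s) (del z).
Proof.
have [b [Ob b0] hb] := del_lead.
move=> [P [S [p [q [w [w' [h1 h2 -> ->]]]]]]] pq.
have S0 := lead_neq0 h2.
exists (del P * S - P * del S), (S * S), (p + q - s), (q + q), ((p - q)%:~R * b * w * w'), (w' * w').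
have [Ow w0 _] := h1; have [Ow' w0' _] := h2.
split; last by ring.
- split.
  + do 3!apply: (sfM hOm) => //; rewrite -(rmorph_int f); apply: fC; exact: int_C.
  + rewrite !mulf_neq0 //; case: (p - q) pq => [[|k]|k] // _; first exact: (natr_neq0 charT).
    by rewrite NegzE mulrNz oppr_eq0; exact: (natr_neq0 charT).
  + have -> : del P * S - P * del S - (p - q)%:~R * b * w * w' * X ^ (p + q - s) =
      ((del P - p%:~R * b * w * X ^ (p - s)) * S + (p%:~R * b * w) * X ^ (p - s) * (S - w' * X ^ q))
      - (P * (del S - q%:~R * b * w' * X ^ (q - s)) + (P - w * X ^ p) * ((q%:~R * b * w') * X ^ (q - s))).
      have -> : X ^ (p + q - s) = X ^ (p - s) * X ^ q by rewrite -expfzDr //; congr (_ ^ _); ring.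
      have e : X ^ (p - s) * X ^ q = X ^ (q - s) * X ^ p.
        by rewrite -!expfzDr //; congr (_ ^ _); ring.
      rewrite rmorphB /=.
      transitivity (del P * S - P * del S - p%:~R * b * w * w' * (X ^ (p - s) * X ^ q)
        + q%:~R * b * w * w' * (X ^ (p - s) * X ^ q)); first by ring.
      by rewrite {2}e; ring.
    have Oc k u : Om u -> Om (k%:~R * b * u).
      move=> Ou; do 2!apply: (sfM hOm) => //; rewrite -(rmorph_int f); apply: fC; exact: int_C.
    have [_ _ g1] := h1; have [_ _ g2] := h2.
    apply: filB; apply: filD.
    * by have := filM (hb _ _ _ h1) (lead_fil h2); congr fil; ring.
    * by have := filM (fil_X (p - s) (Oc p w Ow)) g2; congr fil; ring.
    * by have := filM (lead_fil h1) (hb _ _ _ h2); congr fil; ring.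
    * by have := filM g1 (fil_X (q - s) (Oc q w' Ow')); congr fil; ring.
- exact: leadM.
- by rewrite (der_div hdel) // expr2.
Qed.

(* A finite-dimensional del-stable space contains no infinite sequence of
   decreasing orders. *)
Let qord_ten n z : ten Om NQ z -> qord n z -> exists l, n = l * s.
Proof.
move=> [t ht ez] hz; pose r := size t.
pose a (i : 'I_r) := (nth (0, 0) t i).2.
have Na i : NQ (a i) by case: (ht (nth (0, 0) t i)); rewrite ?mem_nth.
have /choice[F hF] : forall i, exists PS : T * T, [/\ ten Om (range f) PS.1,
    ten Om (range f) PS.2, PS.2 != 0 & a i = PS.1 / PS.2].
  by move=> i; have [P [S h]] := compositumP hOm hR (NQsub (Na i)); exists (P, S).
pose S := \prod_i (F i).2.
have tprod (I : Type) (u : seq I) (Pr : pred I) (E : I -> T) :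
    (forall i, ten Om (range f) (E i)) -> ten Om (range f) (\prod_(i <- u | Pr i) E i).
  move=> hE; elim/big_ind: _ => //; last exact: (tenM hOm hR).
  by apply: (ten_l hR); exact: sf1.
have tS : ten Om (range f) S by apply: tprod => i; case: (hF i).
have S0 : S != 0 by apply/prodf_neq0 => i _; case: (hF i).
have tSa i : ten Om (range f) (S * a i).
  have [h1 h2 h3 ->] := hF i; rewrite /S (bigD1 i) //= mulrC -mulrA.
  rewrite [_^-1 * _]mulrA mulVf // mul1r; apply: (tenM hOm hR) => //.
  by apply: tprod => j; case: (hF j).
have [B hB] : exists B, forall i, fil (- B%:Z) (S * a i).
  apply: uniform_bound => [i m m' mm|i]; first by apply: fil_mono; lia.
  have [k hk] := fil_ten (tSa i); exists `|k|%N; apply: fil_mono hk; lia.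
have [k0 hk0] := fil_ten tS; have [sg [wS hS]] := lead_exists hk0 S0.
pose V v := exists2 w : 'I_r -> T, forall i, Om (w i) & v = \sum_i w i * a i.
have Vz : V z.
  exists (fun i => (nth (0, 0) t i).1).
    by move=> i; case: (ht (nth (0, 0) t i)); rewrite ?mem_nth.
  by rewrite ez (big_nth (0, 0)) big_mkord.
have Vdel v : V v -> V (del v).
  move=> [w hw ->]; exists (del \o w) => [i|]; first exact: delOm.
  rewrite (der_sum hdel); apply: eq_bigr => i _.
  by rewrite (derM hdel) (NQ0 (Na i)) mulr0 addr0.
have Vlow v m : V v -> qord m v -> (- B%:Z - sg <= m)%R.
  move=> [w hw ev] [P [S' [p [q [u [u' [h1 h2 e ->]]]]]]].
  have fv : fil (- B%:Z) (S * v).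
    rewrite ev mulr_sumr; apply: fil_sum => i; rewrite mulrCA; exact: filZ.
  have v0 : v != 0 by rewrite e mulf_neq0 ?invr_eq0 ?(lead_neq0 h1) ?(lead_neq0 h2).
  have [k [wk hk]] := lead_exists fv (mulf_neq0 S0 v0).
  have le := lead_ge hk fv.
  have e' : S * v * S' = S * P by rewrite e -mulrA divfK // (lead_neq0 h2).
  have hk' := leadM hk h2; rewrite e' in hk'.
  have := lead_uniq hk' (leadM hS h1); lia.
apply: contrapT => nl.
have iter_ord (j : nat) : V (iter j del z) /\ qord (n - j%:Z * s) (iter j del z).
  elim: j => [|j [Vj oj]]; first by rewrite mul0r subr0.
  split; first exact: Vdel.
  have -> : n - j.+1%:Z * s = (n - j%:Z * s) - s by rewrite intS; ring.
  apply: qord_del => //; apply/eqP => e0; apply: nl; exists j%:Z.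
  by apply/eqP; rewrite -subr_eq0 e0.
(* Large enough for n - j s, where s is at least 2, to fall below the lower bound on orders. *)
pose j := absz (n + B%:Z + sg + 1)%R; have [Vj oj] := iter_ord j.
have le1 := Vlow _ _ Vj oj.
have le2 : (j%:Z * 2 <= j%:Z * s)%R by rewrite ler_wpM2l.
have le3 : (n + B%:Z + sg + 1 <= j%:Z)%R by rewrite /j; lia.
by move: le1 le2 le3; move: (j%:Z * s) => js; lia.
Qed.

(** By [qord_ten] the orders in the ring generated by Om and NQ are multiples of s, hence so are
    those of its fractions. But X is such a fraction, of order 1, and s is at least 2. *)
Lemma no_pole : False.
Proof.
have oX : qord 1 X.
  exists X, 1, 1, 0, 1, 1.
  have l1 : lead 0 1 1.
    by split; rewrite ?oner_neq0 ?expr0z ?mulr1 ?subrr //; [exact: sf1|exact: fil0].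
  split => //; last by rewrite divr1.
  by split; rewrite ?oner_neq0 ?expr1z ?mul1r ?subrr //; [exact: sf1|exact: fil0].
have [P [S [hP hS S0 e]]] := compositumP hOm hNQ (NQgen (ex_intro2 _ _ x I erefl)).
have P0 : P != 0 by apply: contraNneq X0 => P0; rewrite e P0 mul0r.
have sub z : ten Om NQ z -> adjoin Om (range f) z.
  move=> /(ten_sub) ; apply: adjoin_min; [exact: adjoin_sf|exact: sub_adjoinl|exact: NQsub].
have [n hn] := qord_exists (sub _ hP) P0; have [m hm] := qord_exists (sub _ hS) S0.
have [a ea] := qord_ten hP hn; have [b eb] := qord_ten hS hm.
have := qord_uniq oX; rewrite e => h; have := h _ (qord_div hn hm).
rewrite ea eb => e1; have {e1} : (a - b) * s = 1 by rewrite e1; ring.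
have s0 : (0 <= s)%R by lia.
have [le|lt] := lerP (a - b) 0.
  by have := ler_wpM2r s0 le; rewrite mul0r => l1 e1; move: l1; rewrite e1.
have le : (1 <= a - b)%R by lia.
by have := ler_wpM2r s0 le; rewrite mul1r => l1 e1; move: l1; rewrite e1; lia.
Qed.

End Pole.

(** Dividing th by th x gives a derivation with value 1 at x, which preserves O by [der_unif]. So th
    preserves O unless th x has a pole, and [no_pole] excludes this. *)
Lemma stable_place z : O z -> O (th z).
Proof.
move=> Oz; have sO : sring O by case: hO.
have nx : ~ C x by have [mx _ _] := hx; exact: (mid_notC hN hO mx x0).
have [t0|t0] := eqVneq (th x) 0.
  by rewrite (der_determined z hN nx hth thC t0); exact: sr0.
pose d z := (th x)^-1 * th z + 0 * th z.
have hd : derivation d by exact: der_comb.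
have dC c : C c -> d c = 0 by move=> Cc; rewrite /d (thC Cc) !mulr0 addr0.
have dx : d x = 1 by rewrite /d mul0r addr0 mulVf.
have -> : th z = th x * d z by rewrite /d mul0r addr0 mulrA mulfV // mul1r.
apply: (srM sO); last exact: (der_unif hN hO hx hd dC dx).
have [k hk] := ord_exists hN hO hx t0.
have [le|lt] := lerP 0 k.
  by apply/(vge_O hN hO hx); apply: (vge_mono hN hO hx) le (ord_vge hN hO hx hk).
exfalso; apply: (@no_pole (1 - k)); first by lia.
by have -> : 1 - (1 - k) = k by ring.
Qed.

End StablePlace.

(** * Finite extensions *)

Section FiniteExtensions.
Variable T : fieldType.
Implicit Types (F G K : set T).

Lemma finite_extP F K : finite_extension F K <-> [/\ subfield F, subfield K, F `<=` K &
  exists (n : nat) (e : 'I_n -> T), (forall i, K (e i)) /\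
    forall x, K x -> exists2 c : 'I_n -> T, forall i, F (c i) & x = \sum_i c i * e i].
Proof.
split=> -[hF hK FK [n [e [Ke span]]]]; split => //; exists n, e; split => [i|x Kx].
- exact: set_mem (Ke i).
- by have [c hc ->] := span x (mem_set Kx); exists c => // i; exact: set_mem (hc i).
- by apply: mem_set; exact: Ke.
- have [c Fc ->] := span x (set_mem Kx); exists c => // i; by apply: mem_set; exact: Fc.
Qed.

Lemma finite_ext_index F K (J : finType) (e : J -> T) : subfield F -> subfield K -> F `<=` K ->
  (forall j, K (e j)) ->
  (forall x, K x -> exists2 c : J -> T, forall j, F (c j) & x = \sum_j c j * e j) ->
  finite_extension F K.
Proof.
move=> hF hK FK Ke span; apply/finite_extP; split => //.
exists #|J|, (fun i => e (enum_val i)); split => // x /span[c Fc ->].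
exists (fun i => c (enum_val i)) => //.
by rewrite (reindex (@enum_val J predT)) //; apply: onW_bij; exact: enum_val_bij.
Qed.

Lemma finite_ext_trans F K L : finite_extension F K -> finite_extension K L -> finite_extension F L.
Proof.
move=> /finite_extP[hF hK FK [n [e [Ke se]]]] /finite_extP[_ hL KL [m [g [Lg sg]]]].
apply: (@finite_ext_index F L ('I_m * 'I_n)%type (fun ij => g ij.1 * e ij.2)) => //.
- by move=> x /FK/KL.
- by move=> [i j]; apply: (sfM hL) => //; apply: KL.
- move=> x /sg[c Kc ->]; have /choice[b hb] : forall i, exists b : 'I_n -> T,
    (forall j, F (b j)) /\ c i = \sum_j b j * e j.
    by move=> i; have [b h1 h2] := se _ (Kc i); exists b.
  exists (fun ij => b ij.1 ij.2); first by move=> [i j]; case: (hb i).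
  rewrite -(pair_bigA _ (fun i j => b i j * (g i * e j))) /=; apply: eq_bigr => i _.
  by have [_ ->] := hb i; rewrite mulr_suml; apply: eq_bigr => j _; rewrite mulrAC mulrA.
Qed.

Lemma finite_ext_base F F' K : finite_extension F K -> subfield F' -> F `<=` F' -> F' `<=` K ->
  finite_extension F' K.
Proof.
move=> /finite_extP[hF hK FK [n [e [Ke se]]]] hF' FF' F'K; apply/finite_extP; split => //.
by exists n, e; split => // x /se[c Fc ->]; exists c => // i; apply: FF'.
Qed.

Lemma finite_ext_dep F K : finite_extension F K -> exists n, forall b : 'I_n -> T,
  (forall i, K (b i)) -> exists c : 'I_n -> T,
  [/\ forall i, F (c i), exists i, c i != 0 & \sum_i c i * b i = 0].
Proof.
move=> /finite_extP[hF hK FK [n [e [Ke se]]]]; exists n.+1 => b Kb.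
have /choice[a ha] : forall i, exists a : 'I_n -> T, (forall j, F (a j)) /\ b i = \sum_j a j * e j.
  by move=> i; have [a h1 h2] := se _ (Kb i); exists a.
have [|c [Fc c0 hc]] := @underdetermined T F 'I_n 'I_n.+1 (fun j i => a i j) hF (fun j i => (ha i).1 j).
  by rewrite !card_ord.
exists c; split => //.
transitivity (\sum_j (\sum_i a i j * c i) * e j); last by rewrite big1 // => j _; rewrite hc mul0r.
under [RHS]eq_bigr do rewrite mulr_suml.
rewrite exchange_big /=; apply: eq_bigr => i _; have [_ ->] := ha i.
by rewrite mulr_sumr; apply: eq_bigr => j _; rewrite mulrCA mulrA.
Qed.

Lemma adjoin_id F A : subfield F -> A `<=` F -> adjoin F A = F.
Proof.
move=> hF AF; apply/seteqP; split; last exact: sub_adjoinl.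
by apply: adjoin_min.
Qed.

Lemma adjoin_cat F A B : adjoin (adjoin F A) B = adjoin F (A `|` B).
Proof.
apply/seteqP; split.
  apply: adjoin_min; first exact: adjoin_sf.
    apply: adjoin_min; [exact: adjoin_sf|exact: sub_adjoinl|].
    by move=> x Ax; apply: sub_adjoinr; left.
  by move=> x Bx; apply: sub_adjoinr; right.
apply: adjoin_min; first exact: adjoin_sf.
  by move=> x Fx; apply: sub_adjoinl; exact: sub_adjoinl.
by move=> x [Ax|Bx]; [apply: sub_adjoinl; exact: sub_adjoinr|exact: sub_adjoinr].
Qed.

Lemma adjoin_cons F y (s : seq T) : adjoin F [set` y :: s] = adjoin (adjoin F [set` s]) [set y].
Proof.
rewrite adjoin_cat; congr adjoin; apply/seteqP; split=> x /=; rewrite inE.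
  by case/orP => [/eqP ->|]; [right|left].
by case=> [->|->]; rewrite ?eqxx // orbT.
Qed.

Lemma finite_ext_refl F : subfield F -> finite_extension F F.
Proof.
move=> hF; apply: (@finite_ext_index F F 'I_1 (fun=> 1)) => //; first by move=> _; exact: sf1.
by move=> x Fx; exists (fun=> x) => //; rewrite big_ord1 mulr1.
Qed.

(** F[y] is already a field: an equation of u with nonzero constant term expresses 1/u as a
    polynomial in u. *)
Lemma finite_ext_simple F y : subfield F -> acl F y -> finite_extension F (adjoin F [set y]).
Proof.
move=> hF ay; have := ay; move=> [m /(povP hF) hm /andP[m0 /eqP my]].
have [m1 em] := pov_lift hF hm.
have red p : pov F p -> exists r, [/\ pov F r, (size r < size m)%N & r.[y] = p.[y]].
  move=> hp; have [p1 ep] := pov_lift hF hp.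
  have m10 : m1 != 0 by apply: contraNneq m0 => h; rewrite em h rmorph0.
  exists (map_poly (@sfval _ _ hF) (p1 %% m1)); split; first exact: pov_map.
    by rewrite em !size_map_poly ltn_modp.
  have e2 : p = map_poly (@sfval _ _ hF) (p1 %/ m1) * m + map_poly (@sfval _ _ hF) (p1 %% m1).
    by rewrite ep {1}(divp_eq p1 m1) rmorphD rmorphM /= em.
  by rewrite [in RHS]e2 hornerD hornerM my mulr0 add0r.
pose R := [set u | exists2 p, pov F p & u = p.[y]].
have sR : sring R by exact: (@radj_sring T F y (sf_sring hF)).
have FR : F `<=` R by exact: (@sub_radj T F y (sf_sring hF)).
have Ry : R y by exact: (@radj_gen T F y (sf_sring hF)).
have acR u : R u -> acl F u.
  have hA := acl_sf hF.
  by move=> [p hp ->]; apply: (pov_horner hA) => // i; apply: (sub_acl hF); exact: hp.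
have RV u : R u -> R u^-1.
  move=> Ru; have [->|u0] := eqVneq u 0; first by rewrite invr0; exact: sr0.
  have au : acl (smallest (@subfield T) F) u by apply: acl_mono (acR _ Ru) => z Fz G [_]; apply.
  have [p [hp p0 pu]] := clear_den0 (sf_sring hF) u0 au.
  have -> : u^-1 = - (p`_0)^-1 * \sum_(i < (size p).-1) p`_i.+1 * u ^+ i.
    have s0 : (0 < size p)%N by rewrite size_poly_gt0; apply: contraNneq p0 => ->; rewrite coef0.
    move: pu; rewrite horner_coef -[in X in X -> _](prednK s0) big_ord_recl /= expr0 mulr1 => /eqP.
    rewrite addr_eq0 => /eqP e; apply: (mulIf u0); rewrite mulVf // mulNr mulNr -mulrA mulr_suml.
    rewrite (eq_bigr (fun i : 'I_(size p).-1 => p`_(bump 0 i) * u ^+ (bump 0 i))); last first.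
      by move=> i _; rewrite -mulrA -exprSr.
    by apply: (mulfI p0); rewrite mulrN mulrA mulfV // mul1r mulr1.
  apply: (srM sR); first by apply: FR; apply: (sfN hF); exact: sfV.
  by apply: (sr_sum sR) => i _; apply: (srM sR); [apply: FR; exact: hp|exact: srX].
have hR : subfield R.
  apply/subfieldP; split; [exact: sr1|exact: srB|].
  by move=> u v Ru Rv; apply: (srM sR) => //; exact: RV.
apply: (@finite_ext_index F _ 'I_(size m) (fun i => y ^+ i)) => //; first exact: adjoin_sf.
- exact: sub_adjoinl.
- by move=> j; apply: (sfX (adjoin_sf _ _)); exact: sub_adjoinr.
- have sub : adjoin F [set y] `<=` R by apply: adjoin_min => // _ ->.
  move=> x /sub[p hp ->]; have [r [hr sr <-]] := red p hp.
  exists (fun i : 'I_(size m) => r`_i) => [i|]; first exact: hr.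
  by rewrite (horner_coef_wide _ (ltnW sr)).
Qed.

Lemma finite_ext_seq F (s : seq T) : subfield F -> (forall y, y \in s -> acl F y) ->
  finite_extension F (adjoin F [set` s]).
Proof.
move=> hF; elim: s => [|y s IH] hs.
  by rewrite adjoin_id //; exact: finite_ext_refl.
rewrite adjoin_cons; apply: finite_ext_trans.
  by apply: IH => z zs; apply: hs; rewrite inE zs orbT.
apply: finite_ext_simple; first exact: adjoin_sf.
by apply: acl_mono (hs y (mem_head _ _)); exact: sub_adjoinl.
Qed.

(** Take a generating subsequence of least length: minimality yields both independence and the
    absence of repetitions. *)
Lemma transcendence_basis F (s : seq T) : subfield F -> exists s' : seq T,
  [/\ {subset s' <= s}, uniq s', forall e, e \in s' -> ~ acl (adjoin F [set` rem e s']) e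
    & forall e, e \in s -> acl (adjoin F [set` s']) e].
Proof.
move=> hF; pose Q n := `[< exists s' : seq T, [/\ {subset s' <= s},
   forall e, e \in s -> acl (adjoin F [set` s']) e & size s' = n] >].
have exQ : exists n, Q n.
  exists (size s); apply/asboolP; exists s; split => // e es.
  by apply: (sub_acl (adjoin_sf _ _)); exact: sub_adjoinr.
case: (ex_minnP exQ) => n /asboolP[s' [sub gen sz]] min.
have indep e : e \in s' -> ~ acl (adjoin F [set` rem e s']) e.
  move=> es' ae; have s0 : (0 < size s')%N by case: (s') es'.
  have Qr : Q (size (rem e s')).
    apply/asboolP; exists (rem e s'); split => // [z /mem_rem/sub//|z /gen az].
    apply: (acl_acl (adjoin_sf F _)); apply: acl_mono az; apply: adjoin_min.
    - exact: (acl_sf (adjoin_sf _ _)).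
    - by move=> y Fy; apply: (sub_acl (adjoin_sf _ _)); exact: sub_adjoinl.
    - move=> y /= ys; have [->//|ye] := eqVneq y e.
      apply: (sub_acl (adjoin_sf _ _)); apply: sub_adjoinr => /=.
      have := perm_to_rem es'; move=> /perm_mem/(_ y); rewrite ys inE (negbTE ye) /= => <-.
      by [].
  by have := min _ Qr; rewrite size_rem // -sz; case: (size s') s0 => // k _; rewrite ltnn.
exists s'; split => //; rewrite -[uniq s']negbK -ltn_size_undup -leqNgt sz; apply: min.
apply/asboolP; exists (undup s'); split => // [z|z /gen]; first by rewrite mem_undup => /sub.
by apply: acl_mono; apply: adjoin_mono => // y /= ys; apply: sub_adjoinr; rewrite /= mem_undup.
Qed.

End FiniteExtensions.

Section Along.
Variables (T T' : fieldType) (psi : {rmorphism T -> T'}) (eta : T -> T').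
Hypothesis etaD : forall x y, eta (x + y) = eta x + eta y.
Hypothesis etaM : forall x y, eta (x * y) = eta x * psi y + psi x * eta y.

Lemma along_sf : subfield [set x | eta x = 0].
Proof.
have e0 : eta 0 = 0 by apply: (addrI (eta 0)); rewrite -etaD !addr0.
have e1 : eta 1 = 0.
  by apply: (addrI (eta 1)); rewrite addr0 -[in RHS](mulr1 1) etaM rmorph1 mulr1 mul1r.
have eN y : eta y = 0 -> eta (- y) = 0.
  by move=> hy; apply: (addrI (eta y)); rewrite -etaD subrr e0 hy add0r.
apply/subfieldP; split => [//|y z /= hy hz|y z /= hy hz].
  by rewrite etaD hy eN // addr0.
have [->|z0] := eqVneq z 0; first by rewrite invr0 mulr0 e0.
have : eta (z * z^-1) = 0 by rewrite mulfV.
rewrite etaM hz mul0r add0r => /eqP; rewrite mulf_eq0 fmorph_eq0 (negbTE z0) /= => /eqP h.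
by rewrite etaM hy h mul0r mulr0 addr0.
Qed.
End Along.

Lemma filter_fin (J : Type) (U : set_system J) (I : finType) (A : I -> set J) :
  Filter U -> (forall i, U (A i)) -> U [set j | forall i, A i j].
Proof.
move=> FU h.
suff : forall s : seq I, U [set j | forall i, i \in s -> A i j].
  by move=> /(_ (enum I)); apply: filterS => j /= h' i; apply: h'; rewrite mem_enum.
elim=> [|i s IH]; first by apply: filterE.
apply: filterS (filterI IH (h i)) => j /= [h1 h2] i'.
by rewrite inE => /orP[/eqP ->|/h1].
Qed.

(** The vectors with entries [g i l], for l in L, span a space of dimension at most q. A maximal
    independent family among them detects every linear relation, even one with coefficients outside
    F. *)
Lemma finite_functionals (T : fieldType) (F : set T) (J : Type) (L : set J) q (g : 'I_q -> J -> T) :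
  subfield F -> (forall i l, L l -> F (g i l)) -> exists K (l : 'I_K -> J),
  (forall k, L (l k)) /\ forall r : 'I_q -> T, (forall k, \sum_i r i * g i (l k) = 0) ->
    forall l', L l' -> \sum_i r i * g i l' = 0.
Proof.
move=> hF hg.
pose indep K (l : 'I_K -> J) := (forall k, L (l k)) /\ forall c : 'I_K -> T, (forall k, F (c k)) ->
  (forall i, \sum_k g i (l k) * c k = 0) -> forall k, c k = 0.
pose Q K := `[< exists l : 'I_K -> J, indep K l >].
have ub K : Q K -> (K <= q)%N.
  move=> /asboolP[l [Ll hl]]; rewrite leqNgt; apply/negP => lt.
  have [||c [Fc [k c0] hc]] := @underdetermined T F 'I_q 'I_K (fun i k => g i (l k)) hF.
  - by move=> i k; exact: hg.
  - by rewrite !card_ord.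
  - by move: c0; rewrite (hl c Fc hc) eqxx.
have exQ : exists K, Q K.
  by exists 0%N; apply/asboolP; exists (fun i : 'I_0 => False_rect J (notF (ltn_ord i))); split => [[]|c _ _ []].
case: (ex_maxnP exQ ub) => K /asboolP[l [Ll hl]] max.
exists K, l; split => // r hr l' Ll'.
pose l1 (o : 'I_K.+1) := if unlift ord0 o is Some k then l k else l'.
have [c [Fc [k0 c0] hc]] : exists c : 'I_K.+1 -> T, [/\ forall k, F (c k), exists k, c k != 0
    & forall i, \sum_k g i (l1 k) * c k = 0].
  apply: contrapT => none; suff : Q K.+1 by move/max; rewrite ltnn.
  apply/asboolP; exists l1; split; first by move=> o; rewrite /l1; case: unliftP.
  move=> c Fc hc k; apply/eqP; apply: contrapT => /negP ck; apply: none; exists c; split => //.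
  by exists k.
have e i : g i l' * c ord0 + \sum_k g i (l k) * c (lift ord0 k) = 0.
  rewrite -[RHS](hc i) big_ord_recl /l1 unlift_none; congr (_ + _).
  by apply: eq_bigr => k _; rewrite liftK.
have c00 : c ord0 != 0.
  apply/eqP => z; move/negP: c0; apply; apply/eqP.
  have h : forall k, c (lift ord0 k) = 0.
    apply: hl => // i; by have := e i; rewrite z mulr0 add0r.
  by case: (unliftP ord0 k0) => [j ->|->].
apply: (mulIf c00); rewrite mul0r mulr_suml.
transitivity (- \sum_k (\sum_i r i * g i (l k)) * c (lift ord0 k)); last first.
  by rewrite big1 ?oppr0 // => k _; rewrite hr mul0r.
under [in RHS]eq_bigr do rewrite mulr_suml.
rewrite exchange_big /= -sumrN; apply: eq_bigr => i _.
have := e i; move/eqP; rewrite addr_eq0 => /eqP; rewrite -mulrA => ->.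
rewrite mulrN; congr (- _); rewrite mulr_sumr; apply: eq_bigr => k _; by rewrite mulrA.
Qed.

(** * The curve of constants *)

Lemma der_sumf (T : fieldType) n (w : 'I_n -> T) (d : 'I_n -> T -> T) :
  (forall i, derivation (d i)) -> derivation (fun z => \sum_i w i * d i z).
Proof.
move=> hd; split => y z.
  by rewrite -big_split; apply: eq_bigr => i _; rewrite (derD (hd i)) mulrDr.
rewrite mulr_suml mulr_sumr -big_split; apply: eq_bigr => i _.
by rewrite (derM (hd i)) /=; ring.
Qed.

Lemma der_bracket (T : fieldType) (d d' : T -> T) : derivation d -> derivation d' ->
  derivation (fun z => d (d' z) - d' (d z)).
Proof.
move=> h h'; split => y z; first by rewrite (derD h) (derD h') (derD h) (derD h'); ring.
by rewrite (derM h) (derM h') (derD h) (derD h') !(derM h) !(derM h'); ring.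
Qed.

Lemma der_zero_gen (T : fieldType) (d : T -> T) F A : derivation d ->
  (forall x, F x -> d x = 0) -> (forall x, A x -> d x = 0) ->
  forall x, adjoin F A x -> d x = 0.
Proof.
move=> hd hF hA x hx; have sT : subfield [set: T] by apply/subfieldP.
have [] : constants d setT x; last by [].
apply: adjoin_min hx; first exact: (constants_sf hd sT).
  by move=> y Fy; split => //; exact: hF.
by move=> y Ay; split => //; exact: hA.
Qed.

Section ConstantField.
Variables (T : fieldType) (D : T -> T) (Om k1 : set T) (Y c : T).
Hypothesis char0 : [pchar T] =i pred0.
Hypothesis hD : derivation D.
Hypotheses (hOm : subfield Om) (cOm : alg_closed Om) (DOm : forall x, Om x -> Om (D x)).
Hypotheses (hk1 : subfield k1) (ck1 : alg_closed k1) (Dk1 : forall x, k1 x -> k1 (D x)).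
Hypothesis k1Om : k1 `<=` Om.
Local Notation C := (constants D Om).
Hypothesis Ck1 : C `<=` k1.
Hypotheses (nY : ~ Om Y) (aDY : acl (adjoin k1 [set Y]) (D Y)).
Hypotheses (Dc : D c = 0) (nc : ~ Om c) (ac : acl (adjoin Om [set Y]) c).

Definition genfield : set T := adjoin Om [set Y; D Y].
Local Notation G := genfield.

Lemma genfield_sf : subfield G. Proof. exact: adjoin_sf. Qed.
Let hG := genfield_sf.
Lemma Om_genfield : Om `<=` G. Proof. exact: sub_adjoinl. Qed.
Lemma Y_genfield : G Y. Proof. by apply: sub_adjoinr; left. Qed.
Lemma DY_genfield : G (D Y). Proof. by apply: sub_adjoinr; right. Qed.

Lemma acl_Om : acl Om `<=` Om. Proof. exact: closed_acl. Qed.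

Let hkY : subfield (adjoin k1 [set Y]). Proof. exact: adjoin_sf. Qed.

Lemma der_root (d : T -> T) F K y : derivation d -> subfield F -> subfield K -> F `<=` K ->
  (forall x, F x -> K (d x)) -> K y -> acl F y -> K (d y).
Proof.
move=> hd hF hK FK dFK Ky ay; have [p [hp p0 /eqP py p'y]] := separable_root char0 hF ay.
have := congr1 d py; rewrite (der_horner _ _ hd) (der0 hd) => /eqP; rewrite addrC addr_eq0 => /eqP e.
have -> : d y = - (map_poly d p).[y] / p^`().[y] by rewrite -e mulrC mulKf.
apply: (sfdiv hK); first apply: (sfN hK); apply: (pov_horner hK) => //.
  by move=> i; rewrite coef_map_id0 ?(der0 hd) //; apply: dFK; exact: hp.
by move=> i; apply: FK; exact: (pov_deriv hF hp i).
Qed.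

(** D Y is algebraic over k1(Y), so differentiating a separable equation expresses D (D Y)
    rationally in elements already present. *)
Lemma D_genfield x : G x -> G (D x).
Proof.
apply: (der_adjoin hD) => [y Oy|y [->|->]]; first by apply: Om_genfield; exact: DOm.
  exact: DY_genfield.
apply: (@der_root D _ _ (D Y) hD hkY hG _ _ DY_genfield aDY).
  apply: adjoin_min => //; first by move=> u /k1Om/Om_genfield.
  by move=> u ->; exact: Y_genfield.
suff h : forall u, adjoin k1 [set Y] u -> G (D u) /\ G u by move=> u /h[].
have sf : subfield [set x | G (D x) /\ G x].
  apply/subfieldP; split; first by rewrite /= (der1 hD); split; [exact: (sf0 hG)|exact: (sf1 hG)].
    by move=> u v [h1 h2] [h3 h4]; split; [rewrite (derB hD); exact: (sfB hG h1 h3)|exact: (sfB hG h2 h4)].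
  move=> u v [h1 h2] [h3 h4]; split; last exact: (sfdiv hG h2 h4).
  have [->|v0] := eqVneq v 0; first by rewrite invr0 mulr0 (der0 hD); exact: (sf0 hG).
  by rewrite (der_div hD) //; sfa hG.
apply: (adjoin_min sf).
  by move=> u ku; split; apply: Om_genfield; apply: k1Om => //; exact: Dk1.
by move=> u ->; split; [exact: DY_genfield|exact: Y_genfield].
Qed.

Definition constfield : set T := constants D G.
Local Notation C1 := constfield.
Lemma constfield_sf : subfield C1. Proof. exact: constants_sf. Qed.
Let hC1 := constfield_sf.
Let hC : subfield C. Proof. exact: constants_sf. Qed.
Lemma aclOm_mono F : F `<=` Om -> acl F `<=` Om.
Proof. by move=> h x /(acl_mono h)/acl_Om. Qed.

Lemma genfield_algebraic w : G w -> ~ Om w -> G `<=` acl (adjoin Om [set w]).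
Proof.
move=> Gw nw; have hw := adjoin_sf Om [set w]; have ha := acl_sf hw.
have GY : G `<=` acl (adjoin Om [set Y]).
  apply: adjoin_min; first exact: (acl_sf (adjoin_sf _ _)).
    by move=> x Ox; apply: (sub_acl (adjoin_sf _ _)); exact: sub_adjoinl.
  move=> x [->|->]; first by apply: (sub_acl (adjoin_sf _ _)); exact: sub_adjoinr.
  by apply: acl_mono aDY; apply: adjoin_mono => // y ->; exact: sub_adjoinr.
have aY : acl (adjoin Om [set w]) Y.
  by apply: (acl_exchange hOm) (GY _ Gw) => /acl_Om.
move=> x /GY ax; apply: (acl_acl hw); apply: acl_mono ax.
apply: (adjoin_min ha); last by move=> _ ->.
by move=> z Oz; apply: (sub_acl hw); exact: sub_adjoinl.
Qed.

(** The constant c is only algebraic over G. Its equation descends to one with constant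
    coefficients, so c is algebraic over C1; if C1 were contained in Om, then c would lie in Om. *)
Lemma constant_exists : exists2 c0, C1 c0 & ~ Om c0.
Proof.
apply: contrapT => none; apply: nc.
have sub : C1 `<=` Om by move=> x hx; apply: contrapT => h; apply: none; exists x.
have acG : acl G c.
  by apply: acl_mono ac; apply: adjoin_min => //; [exact: Om_genfield|move=> x ->; exact: Y_genfield].
have [p /(povP hG) hp /andP[p0 /eqP pc]] := acG.
have [] := @descent_constants T G hG 'I_(size p) [set D] _ _ (fun i => c ^+ i) (fun i => p`_i).
- by move=> d ->.
- by move=> d x -> Gx; exact: D_genfield.
- by move=> d j ->; case: (j) => -[|i] _ /=; rewrite ?expr0 ?(der1 hD) // (derX hD) Dc mul0r mul0rn.
- by move=> j; exact: hp.
- have s0 : (0 < size p)%N by rewrite size_poly_gt0.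
  have lt : ((size p).-1 < size p)%N by rewrite prednK.
  by exists (Ordinal lt) => /=; rewrite -/(lead_coef p) lead_coef_eq0.
- by rewrite -[RHS]pc horner_coef.
move=> b [Gb Db [j0 b0] e]; apply: (aclOm_mono sub).
apply: (@aclI _ _ (\poly_(i < size p) (if insub i is Some i' then b i' else 0))).
- move=> i; rewrite coef_poly; case: ifP => _; last exact: sf0.
  case: insubP => [i' _ _|_]; last exact: sf0.
  by split; [exact: Gb|exact: (Db D)].
- by apply/eqP => /polyP/(_ j0); rewrite coef_poly ltn_ord valK coef0; apply/eqP.
- rewrite /root horner_poly; apply/eqP; rewrite -[RHS]e.
  by apply: eq_bigr => i _; rewrite valK.
Qed.

Definition ctype := sftype hC1.
Definition cval : {rmorphism ctype -> T} := @sfval _ _ hC1.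
(** Elements of [ctype] are already killed by D, so lying in Om makes them constants of Om. *)
Definition Cs : set ctype := [set z | Om (cval z)].

Lemma CsP z : Cs z <-> C (cval z).
Proof. by split => [h|[]//]; split => //; case: (sfvalP z). Qed.

Lemma cvalK x (hx : C1 x) : cval (sfin hC1 hx) = x. Proof. by []. Qed.
Lemma cvalC1 z : C1 (cval z). Proof. exact: sfvalP. Qed.

Lemma Cs_sf : subfield Cs.
Proof.
apply/subfieldP; split; rewrite /Cs /=; first by rewrite rmorph1; exact: sf1.
  by move=> x y hx hy; rewrite rmorphB; exact: sfB.
by move=> x y hx hy; rewrite fmorph_div; exact: sfdiv.
Qed.

(** Constants are linearly disjoint from Om over the constants of Om: a relation over Om among
    constants descends along D to constant coefficients. *)
Lemma cval_free (I : finType) (A : {set I}) (v : I -> ctype) :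
  lfree Cs A v -> lfree Om A (cval \o v).
Proof.
move=> hA w Ow e i iA; apply/eqP; apply: contrapT => /negP wi.
have [] := @descent_constants T Om hOm 'I_#|A| [set D] _ _ (fun j => cval (v (enum_val j)))
  (fun j => w (enum_val j)).
- by move=> d ->.
- by move=> d x -> Ox; exact: DOm.
- by move=> d j ->; case: (cvalC1 (v (enum_val j))).
- by move=> j; exact: Ow.
- by exists (enum_rank_in iA i); rewrite enum_rankK_in.
- by rewrite -[RHS]e [in RHS]big_enum_val.
move=> b [Ob Db [j0 b0] eb].
have C1b j : C1 (b j) by split; [exact: Om_genfield|exact: (Db D)].
pose g (i : I) : ctype := if (i \in A) then sfin hC1 (C1b (enum_rank_in iA i)) else 0.
have Cg j : Cs (g j).
  by rewrite /g; case: ifP => _; [rewrite /Cs /= cvalK|rewrite /Cs /= rmorph0; exact: sf0].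
have /hA : \sum_(j in A) g j * v j = 0.
  apply: (@sfval_inj _ _ hC1); rewrite -/cval rmorph_sum rmorph0 -[RHS]eb big_enum_val.
  apply: eq_bigr => j _; rewrite /= rmorphM; congr (_ * _).
  by rewrite /g enum_valP cvalK enum_valK_in.
move=> /(_ Cg _ (enum_valP j0)); rewrite /g enum_valP => /(congr1 cval).
by rewrite cvalK enum_valK_in rmorph0; apply/eqP.
Qed.

(** Finiteness over C(w): G is finite over Om(w), which gives a relation over Om[w]. This is a
    relation over Om among the constants w^j b_i, and it descends to C. *)
Lemma Cs_curve : curve Cs.
Proof.
split.
- apply/pcharf0P => n; rewrite -(fmorph_eq0 cval) rmorph_nat.
  by move/pcharf0P: char0 => ->.
- exact: Cs_sf.
- move=> p /(povP Cs_sf) hp s1.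
  have sp : size (map_poly cval p) = size p by rewrite size_map_poly.
  have [||r /set_mem Or hr] := cOm (p := map_poly cval p).
  + by apply/(povP hOm) => i; rewrite coef_map; exact: hp.
  + by rewrite sp.
  have ar : acl C r.
    apply: (@aclI _ _ (map_poly cval p)) => //; last first.
      by rewrite -size_poly_gt0 sp; apply: ltnW.
    by move=> i; rewrite coef_map; apply/CsP; exact: hp.
  have Dr : D r = 0 by apply: (der_zero_acl char0 hD hC _ ar) => y [].
  have C1r : C1 r by split => //; exact: Om_genfield.
  exists (sfin hC1 C1r); first by apply: mem_set; rewrite /Cs /= cvalK.
  rewrite /root -(fmorph_eq0 cval) -horner_map cvalK; exact: hr.
- move=> w nw; pose F := adjoin Om [set cval w]; have hF : subfield F by exact: adjoin_sf.
  have [Gw Dw] := cvalC1 w.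
  have fin : finite_extension F (adjoin F [set` [:: Y; D Y]]).
    apply: finite_ext_seq => // y; rewrite !inE => hy.
    by apply: (genfield_algebraic Gw nw); case/orP: hy => /eqP ->; [exact: Y_genfield|exact: DY_genfield].
  have Gsub : G `<=` adjoin F [set` [:: Y; D Y]].
    apply: adjoin_min; first exact: adjoin_sf.
      by move=> y Oy; apply: sub_adjoinl; exact: sub_adjoinl.
    by move=> y [->|->]; apply: sub_adjoinr; rewrite /= !inE eqxx ?orbT.
  have [n hn] := finite_ext_dep fin; exists n => b.
  have [|g [Fg [i0 g0] e]] := hn (fun i => cval (b i)).
    by move=> i; apply: Gsub; case: (cvalC1 (b i)).
  have hpg : pov F (\poly_(i < n) (if insub i is Some i' then g i' else 0)).
    move=> i; rewrite coef_poly; case: ifP => _; last exact: (sf0 hF).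
    by case: insubP => // _; exact: (sf0 hF).
  have [v [u [hv v0 hu euv]]] := common_den hOm hpg.
  have gu (i : 'I_n) : v.[cval w] * g i = (u i).[cval w].
    by rewrite -euv coef_poly ltn_ord valK.
  pose S := (\max_(i < n) size (u i))%N.
  have sS (i : 'I_n) : (size (u i) <= S)%N by exact: leq_bigmax.
  have [] := @descent_constants T Om hOm ('I_n * 'I_S)%type [set D] _ _
    (fun ij => cval (w ^+ ij.2 * b ij.1)) (fun ij => (u ij.1)`_ij.2).
  + by move=> d ->.
  + by move=> d x -> Ox; exact: DOm.
  + by move=> d j ->; case: (cvalC1 (w ^+ j.2 * b j.1)).
  + by move=> j; exact: (hu j.1).
  + have un : u i0 != 0.
      by apply: contraNneq (mulf_neq0 v0 g0); rewrite gu => ->; rewrite horner0.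
    have lt : ((size (u i0)).-1 < S)%N by apply: leq_trans (sS i0); rewrite prednK // size_poly_gt0.
    by exists (i0, Ordinal lt) => /=; rewrite -/(lead_coef _) lead_coef_eq0.
  + transitivity (\sum_(i < n) \sum_(j < S) (u i)`_j * cval (w ^+ j * b i)); first by rewrite pair_bigA.
    rewrite -[RHS](mulr0 v.[cval w]) -[in RHS]e mulr_sumr; apply: eq_bigr => i _.
    rewrite mulrA gu (horner_coef_wide _ (sS i)) mulr_suml; apply: eq_bigr => j _.
    by rewrite rmorphM rmorphXn mulrA.
  move=> a [Oa Da [ij0 a0] ea].
  have C1a ij : C1 (a ij) by split; [exact: Om_genfield|exact: (Da D)].
  pose p (i : 'I_n) : {poly ctype} := \poly_(j < S) (if insub j is Some j' then sfin hC1 (C1a (i, j')) else 0).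
  exists p; split.
  + move=> i j; rewrite coef_poly; case: ifP => _; last exact: (sf0 Cs_sf).
    by case: insubP => [j' _ _|_]; [rewrite /Cs /= cvalK|exact: (sf0 Cs_sf)].
  + exists ij0.1; apply/eqP => /polyP/(_ ij0.2); rewrite coef_poly ltn_ord valK coef0 => /(congr1 cval).
    by rewrite cvalK rmorph0; move/eqP: a0; rewrite [in X in X -> _](surjective_pairing ij0).
  + apply: (@sfval_inj _ _ hC1); rewrite -/cval rmorph_sum rmorph0 -[RHS]ea.
    transitivity (\sum_(i < n) \sum_(j < S) a (i, j) * cval (w ^+ j * b i)); last by rewrite pair_bigA; apply: eq_bigr => -[].
    apply: eq_bigr => i _; rewrite rmorphM horner_poly rmorph_sum mulr_suml; apply: eq_bigr => j _.
    by rewrite !rmorphM rmorphXn valK cvalK mulrA.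
Qed.

(** The commutator of such a derivation with D is again of this kind ([Delta_D]). Preserving C1 is
    an additional property, singled out as [DeltaC]. *)
Definition Delta : set (T -> T) := [set d | [/\ derivation d,
  forall x, Om x -> Om (d x), forall x, k1 x -> d x = 0 & d Y = 0]].

Lemma Delta_DY d : Delta d -> d (D Y) = 0.
Proof.
move=> [hd _ dk1 dY]; apply: (der_zero_acl char0 hd hkY _ aDY).
by apply: der_zero_gen => // x ->.
Qed.

Lemma Delta_genfield d x : Delta d -> G x -> G (d x).
Proof.
move=> Dd; have [hd dOm _ dY] := Dd; apply: (der_adjoin hd) => [y Oy|y [->|->]].
- by apply: Om_genfield; exact: dOm.
- by rewrite dY; exact: (sf0 hG).
- by rewrite Delta_DY //; exact: (sf0 hG).
Qed.

Lemma Delta_comb d d' a b : Delta d -> Delta d' -> Om a -> Om b ->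
  Delta (fun z => a * d z + b * d' z).
Proof.
move=> [h1 h2 h3 h4] [h1' h2' h3' h4'] Oa Ob; split.
- exact: der_comb.
- by move=> x Ox; apply: (sfD hOm); apply: (sfM hOm) => //; [exact: h2|exact: h2'].
- by move=> x kx; rewrite (h3 x kx) (h3' x kx) !mulr0 addr0.
- by rewrite h4 h4' !mulr0 addr0.
Qed.

Lemma Delta_sum n (w : 'I_n -> T) (d : 'I_n -> T -> T) : (forall i, Om (w i)) ->
  (forall i, Delta (d i)) -> Delta (fun z => \sum_i w i * d i z).
Proof.
move=> Ow Dd; split.
- by apply: der_sumf => i; case: (Dd i).
- by move=> x Ox; apply: (sf_sum hOm) => i _; apply: (sfM hOm) => //; case: (Dd i) => _ h _ _; exact: h.
- by move=> x kx; rewrite big1 // => i _; case: (Dd i) => _ _ h _; rewrite h // mulr0.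
- by rewrite big1 // => i _; case: (Dd i) => _ _ _ h; rewrite h mulr0.
Qed.

Lemma Delta_bracket d d' : Delta d -> Delta d' -> Delta (fun z => d (d' z) - d' (d z)).
Proof.
move=> [h1 h2 h3 h4] [h1' h2' h3' h4']; split.
- exact: der_bracket.
- by move=> x Ox; apply: (sfB hOm); [apply: h2; exact: h2'|apply: h2'; exact: h2].
- by move=> x kx; rewrite (h3 x kx) (h3' x kx) (der0 h1) (der0 h1') subrr.
- by rewrite h4 h4' (der0 h1) (der0 h1') subrr.
Qed.

Lemma Delta_D d : Delta d -> Delta (fun z => D (d z) - d (D z)).
Proof.
move=> Dd; have [h1 h2 h3 h4] := Dd; split.
- exact: der_bracket.
- by move=> x Ox; apply: (sfB hOm); [apply: DOm; exact: h2|apply: h2; exact: DOm].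
- by move=> x kx; rewrite (h3 x kx) (h3 _ (Dk1 kx)) (der0 hD) subrr.
- by rewrite h4 Delta_DY // (der0 hD) subrr.
Qed.

(** The zero derivation of F is extended twice: to Om with value 1 at e, then to T with value 0 at
    Y, which is transcendental over Om. *)
Lemma Delta_dual F e : subfield F -> k1 `<=` F -> F `<=` Om -> Om e -> ~ acl F e ->
  exists d, [/\ Delta d, forall x, F x -> d x = 0 & d e = 1].
Proof.
move=> hF kF FOm Oe ne.
have [d1 [[d1Om d1D d1M] d1F d1e]] := der_extend (d := fun=> 0) char0 hOm hF FOm
  (fun _ _ => sf0 hOm) (fun _ _ _ _ => esym (addr0 0))
  (fun a b _ _ => esym (etrans (congr2 +%R (mul0r b) (mulr0 a)) (addr0 0))) Oe ne (sf1 hOm).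
have sT : subfield [set: T] by apply/subfieldP.
have nY' : ~ acl Om Y by move=> /acl_Om.
have [d [dT dOm dY]] := der_extend (d := d1) (x := Y) (v := 0) char0 sT hOm (fun _ _ => I)
  (fun _ _ => I) d1D d1M I nY' I.
exists d; split; last by rewrite dOm.
- split => //; first exact: deriv_onT.
    by move=> x Ox; rewrite dOm //; exact: d1Om.
  by move=> x kx; rewrite dOm ?d1F //; [exact: kF|exact: k1Om].
- by move=> x Fx; rewrite dOm ?d1F //; exact: FOm.
Qed.

Lemma Om_invariants x : Om x -> (forall d, Delta d -> d x = 0) -> k1 x.
Proof.
move=> Ox h; apply: contrapT => nk.
have [|d [Dd _ dx]] := Delta_dual hk1 (@subset_refl _ k1) k1Om Ox.
  by move=> /(closed_acl hk1 ck1).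
by have := h d Dd; rewrite dx => /eqP; rewrite oner_eq0.
Qed.

Definition DeltaC : set (T -> T) := [set d | Delta d /\ forall x, C1 x -> C1 (d x)].

Section Basis.
Variables (c0 : T) (s : seq T).
Hypotheses (C1c0 : C1 c0) (nc0 : ~ Om c0).
Hypotheses (us : uniq s) (Os : forall e, e \in s -> Om e).
Hypothesis indep : forall e, e \in s -> ~ acl (adjoin k1 [set` rem e s]) e.
Hypothesis gen0 : acl (adjoin (adjoin k1 [set` s]) [set Y]) c0.

Local Notation q := (size s).
Definition eps (j : 'I_q) : T := nth 0 s j.
Let eps_mem j : eps j \in s. Proof. exact: mem_nth. Qed.

Lemma dual_basis : exists d : 'I_q -> T -> T, (forall j, Delta (d j)) /\
  forall i j, d j (eps i) = (i == j)%:R.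
Proof.
have /choice[d hd] : forall j, exists d, Delta d /\ forall i, d (eps i) = (i == j)%:R.
  move=> j; have hF := adjoin_sf k1 [set` rem (eps j) s].
  have FOm : adjoin k1 [set` rem (eps j) s] `<=` Om.
    by apply: adjoin_min => // y /= /mem_rem/Os.
  have [d [Dd dF de]] := Delta_dual hF (@sub_adjoinl _ _ _) FOm (Os (eps_mem j)) (indep (eps_mem j)).
  exists d; split => // i; case: eqVneq => [->//|ij]; apply: dF; apply: sub_adjoinr => /=.
  by rewrite mem_rem_uniq // inE eps_mem andbT nth_uniq.
by exists d; split => [j|i j]; case: (hd j).
Qed.

Variable dd : 'I_q -> T -> T.
Hypotheses (Ddd : forall j, Delta (dd j)) (dde : forall i j, dd j (eps i) = (i == j)%:R).

Let hsY : subfield (adjoin (adjoin k1 [set` s]) [set Y]). Proof. exact: adjoin_sf. Qed.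

(** The difference of the two sides kills k1, the [eps j] and Y, hence everything algebraic over
    them. *)
Lemma Delta_expand d x : Delta d -> acl (adjoin (adjoin k1 [set` s]) [set Y]) x ->
  d x = \sum_j d (eps j) * dd j x.
Proof.
move=> [hd dOm dk dY] ax.
pose E z := 1 * d z + (- 1) * (\sum_j d (eps j) * dd j z).
have hE : derivation E.
  by apply: der_comb => //; apply: der_sumf => j; case: (Ddd j).
suff : E x = 0 by rewrite /E mul1r mulN1r => /eqP; rewrite subr_eq0 => /eqP.
apply: (der_zero_acl char0 hE hsY) ax; apply: der_zero_gen => //; last first.
  move=> _ ->; rewrite /E dY big1 ?mulr0 ?addr0 // => j _.
  by case: (Ddd j) => _ _ _ ->; rewrite mulr0.
apply: der_zero_gen => // y hy.
  rewrite /E dk // big1 ?mulr0 ?addr0 // => j _.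
  by case: (Ddd j) => _ _ h _; rewrite h // mulr0.
have lt : (index y s < q)%N by rewrite index_mem.
have -> : y = eps (Ordinal lt) by rewrite /eps nth_index.
rewrite /E (bigD1 (Ordinal lt)) //= dde eqxx mulr1 big1 => [|j]; first by ring.
by rewrite dde eq_sym => /negbTE ->; rewrite mulr0.
Qed.

Lemma C1_acl x : C1 x -> acl (adjoin C [set c0]) x.
Proof.
move=> C1x; pose z := sfin hC1 C1x; pose w : ctype := sfin hC1 C1c0.
have nw : ~ Cs w by [].
have [p /(povP (adjoin_sf _ _)) hp /andP[p0 pz]] := alg_over_gen z Cs_curve nw.
have sub : forall u, adjoin Cs [set w] u -> adjoin C [set c0] (cval u).
  have hA := adjoin_sf C [set c0].
  have sf : subfield [set u : ctype | adjoin C [set c0] (cval u)].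
    apply/subfieldP; split; first by rewrite /= rmorph1; exact: (sf1 hA).
      by move=> u v hu hv; rewrite /= rmorphB; exact: (sfB hA hu hv).
    by move=> u v hu hv; rewrite /= fmorph_div; exact: (sfdiv hA hu hv).
  move=> u; apply: (adjoin_min sf) => [v Cv|_ ->] /=.
    by apply: sub_adjoinl; apply/CsP.
  by apply: sub_adjoinr; rewrite cvalK.
apply: (@aclI _ _ (map_poly cval p)).
- by move=> i; rewrite coef_map; apply: sub; exact: hp.
- by rewrite map_poly_eq0.
- by rewrite -[x](cvalK C1x) /root horner_map fmorph_eq0.
Qed.

(** The commutator of D and d kills k1, which contains C; if it also kills c0, it kills C1, which is
    algebraic over C(c0). *)
Lemma DeltaC_from d : Delta d -> D (d c0) = 0 -> DeltaC d.
Proof.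
move=> Dd Dd0; split => // x C1x; have [Gx Dx] := C1x.
split; first exact: Delta_genfield.
have [hE _ Ek _] := Delta_D Dd; have [hd _ _ _] := Dd.
have : D (d x) - d (D x) = 0.
  apply: (der_zero_acl char0 hE (adjoin_sf _ _) _ (C1_acl C1x)).
  apply: der_zero_gen => // [y /Ck1/Ek //|_ ->].
  by case: C1c0 => _ /= ->; rewrite Dd0 (der0 hd) subrr.
by rewrite Dx (der0 hd) subr0.
Qed.

(* The vectors (d c0) over Delta satisfy a linear differential system over Om.
   Composing with enough D-compatible coordinates G -> Om turns its solution
   into solutions in Om, whose span has a D-constant basis. *)
Lemma dd_span j : exists n (w : 'I_n -> T) (d : 'I_n -> T -> T), [/\ forall p, Om (w p),
  forall p, DeltaC (d p) & dd j c0 = \sum_p w p * d p c0].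
Proof.
pose sv i := dd i c0; have Gc0 : G c0 by case: C1c0.
have Gs i : G (sv i) by exact: Delta_genfield.
(* As D c0 = 0, D (dd j c0) is the commutator of D and dd j at c0; its expansion in the dual
   derivations has these coefficients. *)
pose B j i := - dd j (D (eps i)).
have OB j' i : Om (B j' i).
  apply: (sfN hOm); case: (Ddd j') => _ h _ _; apply: h; apply: DOm; exact: Os.
have Ds j' : D (sv j') = \sum_i B j' i * sv i.
  have [_ Dc0] := C1c0; have [h1 _ _ _] := Ddd j'.
  have := Delta_expand (Delta_D (Ddd j')) gen0; rewrite Dc0 (der0 h1) subr0 => ->.
  apply: eq_bigr => i _; congr (_ * _); rewrite /B dde.
  by case: eqP => _; rewrite ?(der1 hD) ?(der0 hD) sub0r.
have COm : C `<=` Om by move=> x [].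
have Cn (n : nat) : C n%:R by split; [exact: (sfnat hOm)|exact: dernat].
(* Sending c0 to constants of Om makes [chi] commute with D on G, so the coordinates of the
   specialized vector solve the same system inside Om. *)
have gd : good Om [:: (c0, C)].
  split => //= ; rewrite adjoin_id //; first by move=> /acl_Om.
have [U [hU [chi [chiOm chiS chic]]]] := ultra_embedding char0 hOm cOm gd.
have {}chic : star C (chi c0) by exact: (chic 0%N isT).
pose sg i := rep (chi (sv i)).
have esg i : chi (sv i) = cls hU (sg i) by rewrite repK.
pose eta x := dstar D (chi x) - chi (D x).
have hDs : derivation (dstar (hU := hU) D) by exact: dstar_der.
have etaD x y : eta (x + y) = eta x + eta y.
  by rewrite /eta rmorphD (derD hDs) (derD hD) rmorphD; ring.
have etaM x y : eta (x * y) = eta x * chi y + chi x * eta y.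
  by rewrite /eta rmorphM (derM hDs) (derM hD) rmorphD !rmorphM; ring.
have hZ := along_sf etaD etaM.
have eta0 x : G x -> eta x = 0.
  move=> Gx; apply: (along_zero char0 etaD etaM hZ (fun y h => h)).
  apply: acl_mono (genfield_algebraic Gc0 nc0 Gx); apply: adjoin_min => //.
    move=> y Oy; rewrite /= /eta chiOm // dstar_diag chiOm; first by rewrite subrr.
    exact: DOm.
  move=> _ ->; rewrite /= /eta; have [_ ->] := C1c0; rewrite rmorph0 subr0.
  rewrite -[chi c0]repK dstarE; apply/clsE; move: chic; apply: filterS => l [_ h].
  exact: h.
pose L : set (T -> T) := [set l | (forall i, Om (sg i l)) /\
  forall i, D (sg i l) = \sum_i' B i i' * sg i' l].
have UL : U L.
  have U1 : U [set l | forall i, Om (sg i l)] by apply: filter_fin => i; exact: chiS.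
  have U2 : U [set l | forall i, D (sg i l) = \sum_i' B i i' * sg i' l].
    apply: filter_fin => i; apply/clsE; rewrite -dstarE -esg.
    have := eta0 _ (Gs i); rewrite /eta => /eqP; rewrite subr_eq0 => /eqP ->.
    rewrite Ds rmorph_sum -cls_sum; apply: eq_bigr => i' _.
    by rewrite rmorphM chiOm // esg clsM.
  by apply: filterS (filterI U1 U2) => l [].
(* Finitely many of these solutions detect every linear relation over Om among the dd i c0. *)
have [K [l [Ll hl]]] := @finite_functionals T Om (T -> T) L _ sg hOm (fun i l' (h : L l') => h.1 i).
have sep (r : 'I_q -> T) : (forall i, Om (r i)) -> (forall k, \sum_i r i * sg i (l k) = 0) ->
    \sum_i r i * sv i = 0.
  move=> Or hr; apply: (fmorph_inj chi); rewrite rmorph0 rmorph_sum.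
  under eq_bigr do rewrite rmorphM (chiOm _ (Or _)) esg clsM.
  rewrite cls_sum; apply/clsE; apply: filterS UL => l' Ll'; exact: (hl r hr).
pose W (w : 'I_K -> T) := exists2 r : 'I_q -> T, forall i, Om (r i) &
  forall k, w k = \sum_i r i * sg i (l k).
have Wj : W (fun k => sg j (l k)).
  exists (fun i => (i == j)%:R) => [i|k]; first exact: (sfnat hOm).
  by rewrite (bigD1 j) //= eqxx mul1r big1 ?addr0 // => i /negbTE ->; rewrite mul0r.
have [] := @pivot_span T Om hOm 'I_K [set D] _ W _ _ _ _ _ Wj.
- by move=> d ->.
- move=> w k [r Or ->]; apply: (sf_sum hOm) => i _; apply: (sfM hOm) => //.
  by case: (Ll k).
- by exists (fun=> 0) => [i|k]; [exact: sf0|rewrite big1 // => i _; rewrite mul0r].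
- move=> w w' a [r Or e] [r' Or' e'] Oa; exists (fun i => r i + a * r' i) => [i|k].
    by apply: (sfD hOm) => //; exact: (sfM hOm).
  rewrite e e' mulr_sumr -big_split; apply: eq_bigr => i _ /=; ring.
- move=> d w -> [r Or e]; exists (fun i => D (r i) + \sum_i' r i' * B i' i) => [i|k].
    apply: (sfD hOm); first exact: DOm.
    by apply: (sf_sum hOm) => i' _; exact: (sfM hOm).
  rewrite e (der_sum hD); under eq_bigr do rewrite (derM hD).
  rewrite big_split; under [RHS]eq_bigr do rewrite mulrDl.
  rewrite big_split; congr (_ + _); under [RHS]eq_bigr do rewrite mulr_suml.
  rewrite exchange_big; apply: eq_bigr => i _ /=; have [_ ->] := Ll k.
  by rewrite mulr_sumr; apply: eq_bigr => i' _; rewrite mulrA.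
move=> n [w [v [Ow Wv Dv e]]].
have /choice[r hr] : forall p, exists r : 'I_q -> T, (forall i, Om (r i)) /\
    forall k, v p k = \sum_i r i * sg i (l k).
  by move=> p; have [r h1 h2] := Wv p; exists r.
exists n, w, (fun p z => \sum_i r p i * dd i z); split => //; last first.
  apply/eqP; rewrite -subr_eq0; apply/eqP.
  transitivity (\sum_i ((i == j)%:R - \sum_p w p * r p i) * sv i).
    under [RHS]eq_bigr do rewrite mulrBl.
    rewrite sumrB; congr (_ - _).
      by rewrite (bigD1 j) //= eqxx mul1r big1 ?addr0 // => i /negbTE ->; rewrite mul0r.
    under [RHS]eq_bigr do rewrite mulr_suml.
    rewrite exchange_big; apply: eq_bigr => p _ /=; rewrite mulr_sumr.
    by apply: eq_bigr => i _; rewrite mulrA.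
  apply: sep => [i|k].
    apply: (sfB hOm); first exact: (sfnat hOm).
    by apply: (sf_sum hOm) => p _; apply: (sfM hOm) => //; case: (hr p).
  under eq_bigr do rewrite mulrBl.
  rewrite sumrB (bigD1 j) //= eqxx mul1r [X in _ + X - _]big1 ?addr0; last first.
    by move=> i /negbTE ->; rewrite mul0r.
  rewrite e; apply/eqP; rewrite subr_eq0; apply/eqP.
  under [RHS]eq_bigr do rewrite mulr_suml.
  rewrite exchange_big; apply: eq_bigr => p _ /=; have [_ ->] := hr p.
  by rewrite mulr_sumr; apply: eq_bigr => i _; rewrite mulrA.
move=> p; have [Or er] := hr p; apply: DeltaC_from; first exact: Delta_sum.
rewrite (der_sum hD); under eq_bigr do rewrite (derM hD) -/(sv _) Ds mulr_sumr.
rewrite big_split /= [X in _ + X]exchange_big /= -big_split /=.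
transitivity (\sum_i (D (r p i) + \sum_i' r p i' * B i' i) * sv i).
  apply: eq_bigr => i _; rewrite mulrDl mulr_suml; congr (_ + _).
  by apply: eq_bigr => i' _; rewrite mulrA.
apply: sep => [i|k].
  apply: (sfD hOm); first exact: DOm.
  by apply: (sf_sum hOm) => i' _; exact: (sfM hOm).
rewrite -[RHS](Dv D p k erefl) er (der_sum hD); under [RHS]eq_bigr do rewrite (derM hD).
rewrite [RHS]big_split; under [LHS]eq_bigr do rewrite mulrDl.
rewrite big_split; congr (_ + _); under [LHS]eq_bigr do rewrite mulr_suml.
rewrite exchange_big; apply: eq_bigr => i _ /=; have [_ ->] := Ll k.
by rewrite mulr_sumr; apply: eq_bigr => i' _; rewrite mulrA.
Qed.

Lemma Delta_span d : Delta d -> exists n (w : 'I_n -> T) (d' : 'I_n -> T -> T),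
  [/\ forall p, Om (w p), forall p, DeltaC (d' p) &
      forall x, C1 x -> d x = \sum_p w p * d' p x].
Proof.
move=> Dd; have /choice[F hF] : forall j, exists nwd : {n : nat & (('I_n -> T) * ('I_n -> T -> T))%type},
  [/\ forall p, Om ((projT2 nwd).1 p), forall p, DeltaC ((projT2 nwd).2 p)
    & dd j c0 = \sum_p (projT2 nwd).1 p * (projT2 nwd).2 p c0].
  by move=> j; have [n [w [d' h]]] := dd_span j; exists (existT _ n (w, d')).
pose I := {j : 'I_q & 'I_(projT1 (F j))}.
pose w (i : 'I_#|{: I}|) := d (eps (tag (enum_val i))) * (projT2 (F (tag (enum_val i)))).1 (tagged (enum_val i)).
pose d' (i : 'I_#|{: I}|) := (projT2 (F (tag (enum_val i)))).2 (tagged (enum_val i)).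
have [hd dOm dk dY] := Dd.
have Ow i : Om (w i).
  apply: (sfM hOm); first by apply: dOm; exact: Os.
  by have [h _ _] := hF (tag (enum_val i)); exact: h.
have Cd' i : DeltaC (d' i) by have [_ h _] := hF (tag (enum_val i)); exact: h.
exists #|{: I}|, w, d'; split => // x C1x.
pose E z := 1 * d z + (- 1) * (\sum_i w i * d' i z).
have hE : derivation E by apply: der_comb => //; apply: der_sumf => i; case: (Cd' i) => -[].
suff : E x = 0 by rewrite /E mul1r mulN1r => /eqP; rewrite subr_eq0 => /eqP.
apply: (der_zero_acl char0 hE (adjoin_sf _ _) _ (C1_acl C1x)).
apply: der_zero_gen => // [y /Ck1 ky|_ ->].
  rewrite /E dk // big1 ?mulr0 ?addr0 // => i _.
  by case: (Cd' i) => -[_ _ h _] _; rewrite h // mulr0.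
rewrite /E (Delta_expand Dd gen0).
rewrite [X in _ + _ * X](_ : _ = \sum_(i : I) d (eps (tag i)) * (projT2 (F (tag i))).1 (tagged i) *
   (projT2 (F (tag i))).2 (tagged i) c0); last first.
  rewrite [RHS](reindex (@enum_val I predT)) //; apply: onW_bij; exact: enum_val_bij.
have -> : \sum_(i : I) d (eps (tag i)) * (projT2 (F (tag i))).1 (tagged i) *
   (projT2 (F (tag i))).2 (tagged i) c0 =
   \sum_j \sum_p d (eps j) * (projT2 (F j)).1 p * (projT2 (F j)).2 p c0.
  by rewrite sig_big_dep; apply: eq_bigl.
rewrite mul1r mulN1r; apply/eqP; rewrite subr_eq0; apply/eqP; apply: eq_bigr => j _.
by have [_ _ ->] := hF j; rewrite mulr_sumr; apply: eq_bigr => p _; rewrite mulrA.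
Qed.

End Basis.

(** The invariants of Delta in Om are k1, so a relation between elements of Om with invariant
    coefficients descends to one over k1. *)
Lemma Delta_free (J : finType) (A : {set J}) (m a : J -> T) : (forall j, Om (m j)) ->
  lfree k1 A m -> (forall d j, Delta d -> d (a j) = 0) ->
  \sum_(j in A) a j * m j = 0 -> forall j, j \in A -> a j = 0.
Proof.
move=> Omm hA ka e j jA; apply/eqP; apply: contrapT => /negP aj.
have [] := @descent_invariants T Om hOm 'I_#|A| Delta _ _ (fun i => m (enum_val i)) (fun i => a (enum_val i)).
- by move=> d [].
- by move=> d x [_ h _ _]; exact: h.
- by move=> d i Dd; exact: ka.
- by move=> i; exact: Omm.
- by exists (enum_rank_in jA j); rewrite enum_rankK_in.
- by rewrite -[RHS]e [in RHS]big_enum_val.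
move=> b [Ob kb [i0 b0] eb].
have kb1 i : k1 (b i) by apply: Om_invariants => // d; exact: kb.
pose g (i : J) := if i \in A then b (enum_rank_in jA i) else 0.
have kg i : k1 (g i) by rewrite /g; case: ifP => // _; exact: (sf0 hk1).
have := hA g kg _ _ (enum_valP i0).
rewrite /g enum_valP enum_valK_in => h; move/eqP: b0; apply; apply: h.
rewrite big_enum_val -[RHS]eb; apply: eq_bigr => i _.
by rewrite /g enum_valP enum_valK_in.
Qed.

Definition LL : set (ctype -> ctype) :=
  [set th | exists2 d, DeltaC d & forall z, cval (th z) = d (cval z)].

Lemma LL_of d : DeltaC d -> exists2 th, LL th & forall z, cval (th z) = d (cval z).
Proof.
move=> Dd; have [_ h] := Dd; pose th z : ctype := sfin hC1 (h _ (cvalC1 z)).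
have e z : cval (th z) = d (cval z) by [].
by exists th => //; exists d.
Qed.

Let cvalI : injective cval. Proof. exact: (@sfval_inj _ _ hC1). Qed.

Lemma LL_der th : LL th -> derivation th.
Proof.
move=> [d [[hd _ _ _] _] e]; split => x y; apply: cvalI.
  by rewrite rmorphD !e rmorphD (derD hd).
by rewrite rmorphD !rmorphM !e rmorphM (derM hd).
Qed.

Lemma LL_const th z : LL th -> Cs z -> th z = 0.
Proof.
move=> [d [[_ _ dk _] _] e] /CsP/Ck1 kz; apply: cvalI.
by rewrite e rmorph0 dk.
Qed.

Lemma LL_comb th th' a b : LL th -> LL th' -> Cs a -> Cs b -> LL (fun z => a * th z + b * th' z).
Proof.
move=> [d [Dd dC] e] [d' [Dd' dC'] e'] Ca Cb.
exists (fun z => cval a * d z + cval b * d' z); last first.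
  by move=> z; rewrite rmorphD !rmorphM e e'.
split; first exact: Delta_comb.
by move=> x C1x; apply: (sfD hC1); apply: (sfM hC1); [exact: cvalC1|exact: dC|exact: cvalC1|exact: dC'].
Qed.

Lemma LL_bracket th th' : LL th -> LL th' -> LL (fun z => th (th' z) - th' (th z)).
Proof.
move=> [d [Dd dC] e] [d' [Dd' dC'] e'].
exists (fun z => d (d' z) - d' (d z)); last by move=> z; rewrite rmorphB !(e, e').
split; first exact: Delta_bracket.
by move=> x C1x; apply: (sfB hC1); [apply: dC; exact: dC'|apply: dC'; exact: dC].
Qed.

Section Invariants.
Hypothesis Q_stable : forall d x, Delta d -> adjoin Om (range cval) x -> adjoin Om (range cval) (d x).
Local Notation Q := (adjoin Om (range cval)).
Let hQ : subfield Q. Proof. exact: adjoin_sf. Qed.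

Definition invariants : set T := [set a | Q a /\ forall d, Delta d -> d a = 0].

Lemma invariants_sf : subfield invariants.
Proof.
apply/subfieldP; split.
- by split; [exact: (sf1 hQ)|move=> d [hd _ _ _]; exact: der1].
- move=> x y [Qx kx] [Qy ky]; split; first exact: (sfB hQ Qx Qy).
  by move=> d Dd; have [hd _ _ _] := Dd; rewrite (derB hd) (kx d Dd) (ky d Dd) subrr.
- move=> x y [Qx kx] [Qy ky]; split; first exact: (sfdiv hQ Qx Qy).
  move=> d Dd; have [hd _ _ _] := Dd.
  have [->|y0] := eqVneq y 0; first by rewrite invr0 mulr0 (der0 hd).
  by rewrite (der_div hd) // (kx d Dd) (ky d Dd) mul0r mulr0 subrr mul0r.
Qed.

(* z = P / S with P, S in Om[k1(Y, D Y)]; the invariance of the coefficients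
   allows to replace k1(Y, D Y) by the invariants of Q. *)
Lemma invariants_gen : range cval `<=` adjoin Om invariants.
Proof.
move=> z Rz; have Qz : Q z by exact: sub_adjoinr.
have Gz : G z by move: Rz => [w _ <-]; case: (cvalC1 w).
pose N' := adjoin k1 [set Y; D Y]; have hN' : subfield N' by exact: adjoin_sf.
have kN' x : N' x -> forall d, Delta d -> d x = 0.
  move=> Nx d Dd; have [hd _ dk dY] := Dd; apply: der_zero_gen Nx => // y [->|->] //.
  exact: Delta_DY.
have : adjoin N' Om z.
  apply: adjoin_min Gz; first exact: adjoin_sf.
    by move=> y Oy; exact: sub_adjoinr.
  by move=> y hy; apply: sub_adjoinl; exact: sub_adjoinr.
move=> /(compositumP hN' hOm)[P [S [hP hS S0 ez]]].
have [J [A [m [a [b [Omm hA hab eP eS]]]]]] := ten_free2 hN' hk1 (@sub_adjoinl _ _ _) hP hS.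
pose v (o : bool * 'I_#|A|) := if o.1 then m (enum_val o.2) else - (z * m (enum_val o.2)).
pose u (o : bool * 'I_#|A|) := if o.1 then a (enum_val o.2) else b (enum_val o.2).
have split_sum (F : bool * 'I_#|A| -> T) :
    \sum_o F o = \sum_i F (true, i) + \sum_i F (false, i).
  rewrite (eq_bigr (fun p => F (p.1, p.2))); last by move=> [].
  by rewrite -(pair_bigA _ (fun s i => F (s, i))) big_bool.
have [] := @descent_invariants T Q hQ (bool * 'I_#|A|)%type Delta _ _ v u.
- by move=> d [].
- by move=> d x; exact: Q_stable.
- move=> d [[] i] Dd; have [h1 h2] := hab (enum_val i); first exact: (kN' _ h1 d Dd).
  exact: (kN' _ h2 d Dd).
- move=> [[] i]; rewrite /v /=; first by apply: sub_adjoinl; exact: Omm.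
  by apply: (sfN hQ); apply: (sfM hQ) => //; apply: sub_adjoinl; exact: Omm.
- have [i bi] : exists i : 'I_#|A|, b (enum_val i) != 0.
    apply: contrapT => none; move/eqP: S0; apply; rewrite eS big_enum_val big1 // => i _.
    by apply/eqP; rewrite mulf_eq0; apply/orP; left; apply/negP => /negP h; apply: none; exists i.
  by exists (false, i).
- rewrite split_sum /u /v /=.
  have -> : \sum_(i < #|A|) a (enum_val i) * m (enum_val i) = P by rewrite eP [RHS](big_enum_val (fun j => a j * m j)).
  under eq_bigr do rewrite mulrN mulrCA.
  rewrite sumrN -mulr_sumr; have -> : \sum_(i < #|A|) b (enum_val i) * m (enum_val i) = S by rewrite eS [RHS](big_enum_val (fun j => b j * m j)).
  by rewrite ez divfK // subrr.
move=> g [Qg kg [[s0 i0] g0] eg].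
have Ig o : invariants (g o) by split => // d; exact: kg.
have free s : \sum_i g (s, i) * m (enum_val i) = 0 -> forall i, g (s, i) = 0.
  move=> e i; have jA := enum_valP i.
  pose h (j : J) := if j \in A then g (s, enum_rank_in jA j) else 0.
  have := @Delta_free J A m h Omm hA _ _ _ jA.
  rewrite /h enum_valP enum_valK_in; apply.
    by move=> d j Dd; rewrite /h; case: ifP => _; [exact: kg|apply: der0; case: Dd].
  rewrite big_enum_val -[RHS]e; apply: eq_bigr => j _.
  by rewrite enum_valP enum_valK_in.
have eqz : z * \sum_i g (false, i) * m (enum_val i) = \sum_i g (true, i) * m (enum_val i).
  move: eg; rewrite split_sum /v /=; under [X in _ + X]eq_bigr do rewrite mulrN mulrCA.
  by rewrite sumrN -mulr_sumr => /eqP; rewrite subr_eq0 => /eqP.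
have S'0 : \sum_i g (false, i) * m (enum_val i) != 0.
  apply/eqP => e; have hf := free false e; move: eqz; rewrite e mulr0 => /esym/free ht.
  by move: g0; case: (s0); rewrite ?hf ?ht eqxx.
have hI := adjoin_sf Om invariants.
have sumI s : adjoin Om invariants (\sum_i g (s, i) * m (enum_val i)).
  apply: (sf_sum hI) => i _; apply: (sfM hI); first by apply: sub_adjoinr.
  by apply: sub_adjoinl; exact: Omm.
have -> : z = (\sum_i g (true, i) * m (enum_val i)) / (\sum_i g (false, i) * m (enum_val i)).
  by rewrite -eqz mulfK.
exact: (sfdiv hI).
Qed.

Lemma LL_stable th O z : LL th -> vring Cs O -> O z -> O (th z).
Proof.
move=> Lth hO Oz; have [d [Dd dC] e] := Lth; have [hd dOm _ _] := Dd.
have [x hx] := uniformizer Cs_curve hO.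
apply: (@stable_place ctype Cs Cs_curve T cval Om hOm (fun c h => h) cval_free O hO x hx th d
  (LL_der Lth) (fun c => LL_const Lth) hd dOm (fun c => esym (e c)) invariants
  invariants_sf _ _ invariants_gen) => //.
- by move=> a [_ h]; exact: h.
- by move=> a [].
Qed.

End Invariants.

Lemma basis_exists c0 : C1 c0 -> exists s : seq T, [/\ uniq s, forall e, e \in s -> Om e,
  forall e, e \in s -> ~ acl (adjoin k1 [set` rem e s]) e
  & acl (adjoin (adjoin k1 [set` s]) [set Y]) c0].
Proof.
move=> [Gc0 _]; have : adjoin (adjoin k1 [set Y; D Y]) Om c0.
  apply: adjoin_min Gc0; first exact: adjoin_sf.
    by move=> y Oy; exact: sub_adjoinr.
  by move=> y hy; apply: sub_adjoinl; exact: sub_adjoinr.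
move=> /adjoin_fin[t tOm hc0].
have [s [sub us indep gen]] := transcendence_basis t hk1.
exists s; split => //; first by move=> e /sub/tOm.
have hA := adjoin_sf (adjoin k1 [set` s]) [set Y].
have ks : k1 `<=` adjoin (adjoin k1 [set` s]) [set Y].
  by move=> x kx; apply: sub_adjoinl; exact: sub_adjoinl.
apply: (adjoin_min (acl_sf hA)) hc0.
  apply: adjoin_min; [exact: (acl_sf hA)|by move=> x /ks; exact: (sub_acl hA)|].
  move=> x [->|->]; first by apply: (sub_acl hA); exact: sub_adjoinr.
  by apply: acl_mono aDY; apply: (adjoin_min hA) => [y /ks|y ->] //; exact: sub_adjoinr.
move=> x /= /gen; apply: acl_mono; exact: sub_adjoinl.
Qed.

(** The classification gives equations with coefficients in C for the derivations in [DeltaC], with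
    one f or W common to all. On C1 each dual derivation is an Om-combination of these, so its
    equation has the same shape with coefficients in Om. *)
Lemma generic_equation : exists (s : seq T) (dd : 'I_(size s) -> T -> T),
  [/\ forall e, e \in s -> Om e, forall j, Delta (dd j),
      forall i j, dd j (eps i) = (i == j)%:R,
      forall x, C1 x -> acl (adjoin (adjoin k1 [set` s]) [set Y]) x &
  (exists f, [/\ C1 f, ~ Om f & forall j, exists a b c, [/\ Om a, Om b, Om c &
     dd j f = a + b * f + c * f ^+ 2]]) \/
  (exists W Z g2 g3, [/\ C1 W /\ C1 Z, ~ Om W, C g2 /\ C g3,
     27%:R * g3 ^+ 2 - g2 ^+ 3 != 0 /\ Z ^+ 2 = 4%:R * W ^+ 3 - g2 * W - g3
     & forall j, exists2 a, Om a & dd j W = a * Z])].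
Proof.
have [c0 C1c0 nc0] := constant_exists.
have [s [us Os indep gen0]] := basis_exists C1c0.
have [dd [Ddd dde]] := dual_basis us Os indep.
exists s, dd.
have span d := @Delta_span c0 s C1c0 nc0 Os gen0 dd Ddd dde d.
have Q_stable d x : Delta d -> adjoin Om (range cval) x -> adjoin Om (range cval) (d x).
  move=> Dd; have [hd dOm _ _] := Dd; apply: (der_adjoin hd).
    by move=> y Oy; apply: sub_adjoinl; exact: dOm.
  move=> _ [z _ <-]; have [n [w [d' [Ow Cd' e]]]] := span d Dd.
  rewrite (e _ (cvalC1 z)); have hQ := adjoin_sf Om (range cval).
  apply: (sf_sum hQ) => p _; apply: (sfM hQ); first exact: sub_adjoinl.
  have [th _ eth] := LL_of (Cd' p); rewrite -eth; apply: sub_adjoinr; by exists (th z).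
split => //.
  move=> x C1x; have hA := adjoin_sf (adjoin k1 [set` s]) [set Y].
  apply: (acl_acl hA); apply: acl_mono (C1_acl C1c0 nc0 C1x).
  apply: adjoin_min; [exact: acl_sf| |by move=> _ ->].
  by move=> y /Ck1 ky; apply: (sub_acl hA); apply: sub_adjoinl; exact: sub_adjoinl.
have nu : ~ Cs (sfin hC1 C1c0) by [].
have [] := @classification ctype Cs LL _ Cs_curve LL_der LL_const LL_comb LL_bracket
  (LL_stable Q_stable) nu.
  move=> [f [nf hf]]; left; exists (cval f); split; [exact: cvalC1|exact: nf|].
  move=> j; have [n [w [d' [Ow Cd' e]]]] := span _ (Ddd j).
  have /choice[abc habc] : forall p, exists abc : T * T * T, [/\ Om abc.1.1, Om abc.1.2, Om abc.2 &
      d' p (cval f) = abc.1.1 + abc.1.2 * cval f + abc.2 * cval f ^+ 2].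
    move=> p; have [th Lth eth] := LL_of (Cd' p); have [a [b [c' [Ca Cb Cc ef]]]] := hf th Lth.
    exists (cval a, cval b, cval c'); split => //=.
    by rewrite -eth ef -?expr2 !rmorphD !rmorphM.
  exists (\sum_p w p * (abc p).1.1), (\sum_p w p * (abc p).1.2), (\sum_p w p * (abc p).2).
  split; try by apply: (sf_sum hOm) => p _; apply: (sfM hOm) => //; case: (habc p).
  rewrite (e _ (cvalC1 f)) !mulr_suml -!big_split /=; apply: eq_bigr => p _.
  by have [_ _ _ ->] := habc p; ring.
move=> [W [Z [g2 [g3 [nW [Cg2 Cg3] disc rel hW]]]]]; right.
exists (cval W), (cval Z), (cval g2), (cval g3); split.
- by split; exact: cvalC1.
- exact: nW.
- by split; apply/CsP.
- split; last by rewrite -rmorphXn rel !rmorphB !rmorphM ?rmorphXn !rmorph_nat.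
  have -> : 27%:R * cval g3 ^+ 2 - cval g2 ^+ 3 = cval (27%:R * g3 ^+ 2 - g2 ^+ 3).
    by rewrite rmorphB rmorphM ?rmorphXn rmorph_nat.
  by rewrite fmorph_eq0.
- move=> j; have [n [w [d' [Ow Cd' e]]]] := span _ (Ddd j).
  have /choice[a ha] : forall p, exists a, Om a /\ d' p (cval W) = a * cval Z.
    move=> p; have [th Lth eth] := LL_of (Cd' p); have [a Ca ea] := hW th Lth.
    by exists (cval a); split => //; rewrite -eth ea rmorphM.
  exists (\sum_p w p * a p).
    by apply: (sf_sum hOm) => p _; apply: (sfM hOm) => //; case: (ha p).
  rewrite (e _ (cvalC1 W)) mulr_suml; apply: eq_bigr => p _.
  by have [_ ->] := ha p; rewrite mulrA.
Qed.

End ConstantField.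

(** * Specialization *)

Lemma sf_preim (T T' : fieldType) (psi : {rmorphism T -> T'}) (G : set T') :
  subfield G -> subfield [set x | G (psi x)].
Proof.
move=> hG; apply/subfieldP; split => /=.
- by rewrite rmorph1; exact: (sf1 hG).
- by move=> x y hx hy; rewrite rmorphB; exact: (sfB hG).
- by move=> x y hx hy; rewrite fmorph_div; exact: (sfdiv hG).
Qed.

Lemma acl_map (T T' : fieldType) (psi : {rmorphism T -> T'}) (F : set T) (G : set T') x :
  subfield F -> subfield G -> (forall y, F y -> G (psi y)) -> acl F x -> acl G (psi x).
Proof.
move=> hF hG FG [p /(povP hF) hp /andP[p0 px]].
apply: (@aclI _ _ (map_poly psi p)); last by rewrite fmorph_root.
  by move=> i; rewrite coef_map; apply: FG; exact: hp.
by rewrite map_poly_eq0.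
Qed.

Lemma acl_fin (T : fieldType) (F A : set T) x : acl (adjoin F A) x ->
  exists2 s : seq T, (forall y, y \in s -> A y) & acl (adjoin F [set` s]) x.
Proof.
move=> [p /(povP (adjoin_sf _ _)) hp /andP[p0 px]].
suff [s sA hs] : exists2 s : seq T, (forall y, y \in s -> A y) & pov (adjoin F [set` s]) p.
  by exists s => //; apply: (aclI hs).
have /choice[s hs] : forall i, exists s : seq T, (forall y, y \in s -> A y) /\ adjoin F [set` s] p`_i.
  by move=> i; have [s h1 h2] := adjoin_fin (hp i); exists s.
exists (flatten [seq s i | i <- iota 0 (size p)]).
  by move=> y /flatten_mapP[i _]; case: (hs i) => h _; exact: h.
move=> i; have [lt|le] := ltnP i (size p); last by rewrite nth_default //; exact: (sf0 (adjoin_sf _ _)).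
have [_] := hs i; apply: adjoin_mono => // y ys; apply: sub_adjoinr => /=.
by apply/flatten_mapP; exists i => //; rewrite mem_iota add0n.
Qed.

Lemma star_const (T : fieldType) (D : T -> T) (J : Type) (U : set_system J) (hU : UltraFilter U)
  (F : set T) (x : upow T hU) : star (constants D F) x -> star F x /\ dstar D x = 0.
Proof.
elim/up_ind: x => f /starP h; split.
  by apply/starP; apply: filterS h => j [].
by rewrite dstarE; apply/clsE; apply: filterS h => j [].
Qed.

Lemma der_gen (T : fieldType) (d : T -> T) (F A G : set T) : derivation d -> subfield G ->
  adjoin F A `<=` G -> (forall x, F x -> G (d x)) -> (forall x, A x -> G (d x)) ->
  forall x, adjoin F A x -> G (d x).
Proof.
move=> hd hG AG dF dA.
suff : adjoin F A `<=` [set x | G x /\ G (d x)] by move=> h x /h[].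
apply: adjoin_min; last 2 first.
- by move=> x Fx; split; [apply: AG; exact: sub_adjoinl|exact: dF].
- by move=> x Ax; split; [apply: AG; exact: sub_adjoinr|exact: dA].
apply/subfieldP; split => /=.
- by rewrite (der1 hd); split; [exact: (sf1 hG)|exact: (sf0 hG)].
- by move=> x y [hx dx] [hy dy]; rewrite (derB hd); split; exact: (sfB hG).
- move=> x y [hx dx] [hy dy]; split; first exact: (sfdiv hG).
  have [->|y0] := eqVneq y 0; first by rewrite invr0 mulr0 (der0 hd); exact: (sf0 hG).
  rewrite (der_div hd) //; apply: (sfdiv hG); last exact: (sfX hG).
  by apply: (sfB hG); exact: (sfM hG).
Qed.

Lemma acl_adjoin_der (T : fieldType) (d : T -> T) (F : set T) Y : [pchar T] =i pred0 ->
  derivation d -> (forall x, F x -> F (d x)) -> acl (adjoin F [set Y]) (d Y) ->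
  forall x, acl (adjoin F [set Y]) x -> acl (adjoin F [set Y]) (d x).
Proof.
move=> char0 hd dF dY; have hA := adjoin_sf F [set Y].
apply: (acl_der_stable char0 hd hA); apply: (der_gen hd (acl_sf hA) (sub_acl hA)) => [x Fx|_ -> //].
by apply: (sub_acl hA); apply: sub_adjoinl; exact: dF.
Qed.

(** Algebraic independence in the triangular form that [good] requires: each entry is transcendental
    over its successors. *)
Fixpoint seqindep (T : fieldType) (F : set T) (cs : seq T) : Prop :=
  if cs is c :: cs' then seqindep F cs' /\ ~ acl (adjoin F [set` cs']) c else True.

Lemma seqindep_cat (T : fieldType) (F : set T) (s cs : seq T) : subfield F -> uniq s ->
  (forall e, e \in s -> ~ acl (adjoin (acl (adjoin F [set` cs])) [set` rem e s]) e) ->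
  seqindep F cs -> seqindep F (s ++ cs).
Proof.
move=> hF us hs hcs; elim: s us hs => //= e s IH /andP[es us] hs; split.
  apply: IH => // e' e's h; apply: (hs e'); first by rewrite inE e's orbT.
  apply: acl_mono h; apply: adjoin_mono => // y ys; apply: sub_adjoinr => /=.
  by case: eqP => [_|_]; [exact: (mem_rem ys)|rewrite inE; apply/orP; right].

move=> h; apply: (hs e (mem_head _ _)); rewrite /= eqxx; apply: acl_mono h.
apply: adjoin_min; first exact: adjoin_sf.
  by move=> y Fy; apply: sub_adjoinl; apply: (sub_acl (adjoin_sf _ _)); exact: sub_adjoinl.
move=> y /=; rewrite mem_cat => /orP[ys|ys]; first exact: sub_adjoinr.
by apply: sub_adjoinl; apply: (sub_acl (adjoin_sf _ _)); exact: sub_adjoinr.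
Qed.

Section Specialization.
Variables (T : fieldType) (D : T -> T) (k0 Om : set T) (cs : seq T) (Y : T).
Hypothesis char0 : [pchar T] =i pred0.
Hypothesis cT : alg_closed [set: T].
Hypothesis hD : derivation D.
Hypotheses (hk0 : subfield k0) (ck0 : alg_closed k0) (Dk0 : forall x, k0 x -> k0 (D x)).
Hypotheses (hOm : subfield Om) (cOm : alg_closed Om) (k0Om : k0 `<=` Om).
Hypotheses (csOm : forall c, c \in cs -> Om c) (Dcs : forall c, c \in cs -> D c = 0).
Hypothesis icS : seqindep k0 cs.
Hypotheses (nY : ~ Om Y) (aDY : acl (adjoin k0 [set Y]) (D Y)).

Local Notation k1 := (acl (adjoin k0 [set` cs])).
Local Notation A := (acl (adjoin k0 [set Y])).
Let hk1 : subfield k1. Proof. exact: (acl_sf (adjoin_sf _ _)). Qed.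
Let hA : subfield A. Proof. exact: (acl_sf (adjoin_sf _ _)). Qed.
Let k0A : k0 `<=` A. Proof. by move=> x kx; apply: (sub_acl (adjoin_sf _ _)); exact: sub_adjoinl. Qed.

Lemma k0_k1 : k0 `<=` k1.
Proof. by move=> x kx; apply: (sub_acl (adjoin_sf _ _)); exact: sub_adjoinl. Qed.

Lemma k1_Om : k1 `<=` Om.
Proof.
move=> x h; apply: (closed_acl hOm cOm); apply: acl_mono h.
exact: (adjoin_min hOm).
Qed.

(** Independence over k0 persists over acl(k0(Y)): otherwise exchange would make Y algebraic over
    Om. *)
Lemma good_base X (s : seq T) : (forall c, c \in s -> Om c) -> seqindep k0 s -> X `<=` k0 ->
  (forall n : nat, X n%:R) -> forall (s' : seq T) X', X' `<=` k0 -> (forall n : nat, X' n%:R) ->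
  (forall c, c \in s' -> Om c) -> seqindep k0 (s' ++ s) ->
  good A ([seq (c, X') | c <- s'] ++ [seq (c, X) | c <- s]).
Proof.
have nA l c : (forall e, e \in l -> Om e) -> Om c -> ~ acl (adjoin k0 [set` l]) c ->
    ~ acl (adjoin A [set` l]) c.
  move=> lOm Oc nc h; apply: nY; apply: (closed_acl hOm cOm).
  have : acl (adjoin (adjoin k0 [set` l]) [set Y]) c.
    apply: (acl_acl (adjoin_sf _ _)); apply: acl_mono h; apply: adjoin_min.
    - exact: (acl_sf (adjoin_sf _ _)).
    - apply: acl_mono; apply: adjoin_mono; first exact: sub_adjoinl.
      by move=> _ ->; exact: sub_adjoinr.
    - by move=> x xl; apply: (sub_acl (adjoin_sf _ _)); apply: sub_adjoinl; exact: sub_adjoinr.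
  move/(acl_exchange (adjoin_sf _ _) nc); apply: acl_mono.
  apply: (adjoin_min hOm); last by move=> _ ->.
  exact: (adjoin_min hOm).
have fstK (X0 : set T) l : map fst [seq (c, X0) | c <- l] = l.
  by rewrite -map_comp map_id.
move=> sOm is1 Xk Xn; elim=> [|c s' IH] X' X'k X'n s'Om /=.
  move=> _; elim: s sOm is1 => //= c s IH sOm [is1 nc]; split => //.
  - by apply: IH => // e es; apply: sOm; rewrite inE es orbT.
  - by move=> x /Xk/k0A.
  - rewrite fstK; apply: nA => //; last by apply: sOm; rewrite mem_head.
    by move=> e es; apply: sOm; rewrite inE es orbT.
move=> [is2 nc]; split => //.
- by apply: IH => // e es; apply: s'Om; rewrite inE es orbT.
- by move=> x /X'k/k0A.
- rewrite map_cat !fstK; apply: nA => //; last by apply: s'Om; rewrite mem_head.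
  move=> e; rewrite mem_cat => /orP[es|]; last exact: sOm.
  by apply: s'Om; rewrite inE es orbT.
Qed.

(** The embedding is taken over acl(k0(Y)), so Y and D Y are fixed. Sending cs to constants makes
    [psi] commute with D on the algebraic closure of k1(Y). The transcendence basis s of t over k1
    only has to land in k0; [psi] need not commute with D on it. *)
Lemma specialization (t : seq T) : (forall e, e \in t -> Om e) ->
  exists (U : set_system (T -> T)) (hU : UltraFilter U) (psi : {rmorphism T -> upow T hU}),
  [/\ forall x, A x -> psi x = diag hU x,
      forall x, acl (adjoin k1 [set Y]) x -> dstar D (psi x) = psi (D x),
      forall x, k1 x -> star k0 (psi x) & forall x, x \in t -> star k0 (psi x)].
Proof.
move=> tOm; have [s [sub us indep gen]] := transcendence_basis t hk1.
have cA : alg_closed A by exact: (acl_closed (adjoin_sf _ _)).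
have sOm e : e \in s -> Om e by move/sub/tOm.
have k0n (n : nat) : k0 n%:R by exact: (sfnat hk0).
have Cn (n : nat) : constants D k0 n%:R by exact: (sfnat (constants_sf hD hk0)).
have gd := good_base csOm icS (@subIsetl _ _ _) Cn (@subset_refl _ k0) k0n sOm
  (seqindep_cat hk0 us indep icS).
have [U [hU [psi [psiA _ psil]]]] := ultra_embedding char0 hA cA gd.
have hs0 : subfield (star (hU := hU) k0) by exact: star_sf.
have cs0 : alg_closed (star (hU := hU) k0) by exact: star_closed.
have psi0 x : k0 x -> star k0 (psi x) by move=> kx; rewrite psiA; [apply/star_diag|exact: k0A].
have psic c : c \in cs -> star (constants D k0) (psi c).
  move=> ccs; have := psil (size s + index c cs)%N.
  rewrite size_cat !size_map ltn_add2l index_mem => /(_ ccs).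
  by rewrite nth_cat size_map ltnNge leq_addr /= addKn (nth_map 0) ?index_mem // nth_index.
have psie e : e \in s -> star k0 (psi e).
  move=> es; have := psil (index e s); rewrite size_cat !size_map.
  rewrite nth_cat size_map index_mem es (nth_map 0) ?index_mem //= nth_index //; apply.
  by apply: ltn_addr; rewrite index_mem.
have hpre := sf_preim psi hs0.
have psi1 x : k1 x -> star k0 (psi x).
  move=> k1x; apply: (closed_acl hs0 cs0); apply: (acl_map _ hs0 _ k1x); first exact: adjoin_sf.
  by apply: (adjoin_min hpre) => // c /= ccs; have [] := star_const (psic c ccs).
exists U, hU, psi; split => //; last first.
  move=> e et; apply: (closed_acl hs0 cs0); apply: (acl_map _ hs0 _ (gen e et)); first exact: adjoin_sf.
  by apply: (adjoin_min hpre).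
pose eta x := dstar D (psi x) - psi (D x).
have hd := dstar_der hU hD.
have etaD x y : eta (x + y) = eta x + eta y.
  by rewrite /eta (derD hD) !rmorphD (derD hd); ring.
have etaM x y : eta (x * y) = eta x * psi y + psi x * eta y.
  by rewrite /eta (derM hD) rmorphD !rmorphM (derM hd); ring.
have DA := acl_adjoin_der char0 hD Dk0 aDY.
have eA x : A x -> eta x = 0.
  by move=> Ax; rewrite /eta psiA // dstar_diag psiA ?subrr //; exact: DA.
suff h : forall x, acl (adjoin k1 [set Y]) x -> eta x = 0.
  by move=> x /h/eqP; rewrite subr_eq0 => /eqP.
have hz := along_sf etaD etaM.
apply: (along_zero char0 etaD etaM (adjoin_sf _ _)); apply: (adjoin_min hz).
  apply: (along_zero char0 etaD etaM (adjoin_sf _ _)); apply: (adjoin_min hz).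
    by move=> x /k0A/eA.
  move=> c ccs; have [_ h] := star_const (psic c ccs).
  by rewrite /= /eta h Dcs // rmorph0 subrr.
by move=> _ ->; apply: eA; apply: (sub_acl (adjoin_sf _ _)); exact: sub_adjoinr.
Qed.

End Specialization.

(** Each of the finitely many conditions holds at almost every index, so some index satisfies them
    all, and there they speak about T itself. *)
Lemma star_riccati (T : fieldType) (D : T -> T) (k0 N : set T) (J : Type) (U : set_system J)
    (hU : UltraFilter U) (x a b e : upow T hU) :
  star N x -> ~ star k0 x -> star k0 a -> star k0 b -> star k0 e ->
  dstar D x = a + b * x + e * x ^+ 2 ->
  exists t, [/\ N t, ~ k0 t & exists a b e, [/\ k0 a, k0 b, k0 e & D t = a + b * t + e * t ^+ 2]].
Proof.
elim/up_ind: x => x; elim/up_ind: a => a; elim/up_ind: b => b; elim/up_ind: e => e.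
move=> /starP h1 /star_notin h2 /starP h3 /starP h4 /starP h5.
rewrite dstarE clsX !clsM !clsD => /clsE h6.
have [i /= [e1 [e2 [e3 [e4 [e5 e6]]]]]] :=
  filter_ex (filterI h1 (filterI h2 (filterI h3 (filterI h4 (filterI h5 h6))))).
by exists (x i); split => //; exists (a i), (b i), (e i).
Qed.

Lemma star_weierstrass (T : fieldType) (D : T -> T) (k0 N : set T) (J : Type) (U : set_system J)
    (hU : UltraFilter U) (x z b g2 g3 : upow T hU) :
  star N x -> ~ star k0 x -> star k0 b -> star k0 g2 -> dstar D g2 = 0 ->
  star k0 g3 -> dstar D g3 = 0 -> 27%:R * g3 ^+ 2 - g2 ^+ 3 <> 0 ->
  z ^+ 2 = 4%:R * x ^+ 3 - g2 * x - g3 -> dstar D x = b * z ->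
  exists t, [/\ N t, ~ k0 t & exists z a g2 g3, [/\ k0 a, constants D k0 g2, constants D k0 g3,
     27%:R * g3 ^+ 2 - g2 ^+ 3 != 0 &
     z ^+ 2 = 4%:R * t ^+ 3 - g2 * t - g3 /\ D t = a * z]].
Proof.
have nat (n : nat) : n%:R = cls hU (fun=> n%:R) by exact: (esym (rmorph_nat (diag hU) n)).
elim/up_ind: x => x; elim/up_ind: z => z; elim/up_ind: b => b.
elim/up_ind: g2 => g2; elim/up_ind: g3 => g3.
rewrite !dstarE !clsX !nat !clsM (clsB _ _ (fun j => g2 j * x j)) !clsB.
move=> /starP f1 /star_notin f2 /starP f3 /starP f7 /clsE f8 /starP f9 /clsE f10 f6 /clsE f5 /clsE f4.
have f6' : U [set i | 27%:R * g3 i ^+ 2 - g2 i ^+ 3 != 0].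
  have [h|h] := in_ultra_setVsetC [set i | 27%:R * g3 i ^+ 2 - g2 i ^+ 3 = 0] hU.
    by exfalso; apply: f6; apply/clsE.
  by apply: filterS h => i /= /eqP.
have [i /= [x1 [x2 [x3 [x4 [x5 [x6 [x7 [x8 [x9 x10]]]]]]]]]] := filter_ex (filterI f1 (filterI f2
  (filterI f3 (filterI f4 (filterI f5 (filterI f6' (filterI f7 (filterI f8 (filterI f9 f10))))))))).
by exists (x i); split => //; exists (z i), (b i), (g2 i), (g3 i).
Qed.

Section Descent.
Variables (T : fieldType) (D : T -> T) (k0 Om : set T) (cs : seq T) (Y c : T).
Hypothesis char0 : [pchar T] =i pred0.
Hypothesis cT : alg_closed [set: T].
Hypothesis hD : derivation D.
Hypotheses (hk0 : subfield k0) (ck0 : alg_closed k0) (Dk0 : forall x, k0 x -> k0 (D x)).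
Hypotheses (hOm : subfield Om) (cOm : alg_closed Om) (k0Om : k0 `<=` Om).
Hypothesis DOm : forall x, Om x -> Om (D x).
Hypotheses (csOm : forall c, c \in cs -> Om c) (Dcs : forall c, c \in cs -> D c = 0).
Hypothesis icS : seqindep k0 cs.
Hypotheses (nY : ~ Om Y) (aDY : acl (adjoin k0 [set Y]) (D Y)).
Local Notation k1 := (acl (adjoin k0 [set` cs])).
Hypothesis Ck1 : constants D Om `<=` k1.
Hypotheses (Dc : D c = 0) (nc : ~ Om c) (ac : acl (adjoin Om [set Y]) c).

Local Notation N := (adjoin k0 [set Y; D Y]).

Lemma descended_equation : exists t, [/\ N t, ~ k0 t &
  (exists a b e, [/\ k0 a, k0 b, k0 e & D t = a + b * t + e * t ^+ 2]) \/
  (exists z a g2 g3, [/\ k0 a, constants D k0 g2, constants D k0 g3,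
     27%:R * g3 ^+ 2 - g2 ^+ 3 != 0 &
     z ^+ 2 = 4%:R * t ^+ 3 - g2 * t - g3 /\ D t = a * z])].
Proof.
have hk1 : subfield k1 by exact: (acl_sf (adjoin_sf _ _)).
have ck1 : alg_closed k1 by exact: (acl_closed (adjoin_sf _ _)).
have k0k1 : k0 `<=` k1 by exact: k0_k1.
have k1Om : k1 `<=` Om by exact: k1_Om.
have csk1 y : y \in cs -> k1 y.
  by move=> ycs; apply: (sub_acl (adjoin_sf _ _)); exact: sub_adjoinr.
have Dk1 x : k1 x -> k1 (D x).
  apply: (acl_der_stable char0 hD (adjoin_sf _ _)); apply: (der_gen hD hk1 (sub_acl (adjoin_sf _ _))).
    by move=> y /Dk0/k0k1.
  by move=> y /= /Dcs ->; exact: (sf0 hk1).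
have aDY1 : acl (adjoin k1 [set Y]) (D Y).
  apply: acl_mono aDY; apply: adjoin_mono; last exact: sub_adjoinr.
  exact: k0k1.
have [s [dd [sOm Ddd dde sC1 alt]]] :=
  generic_equation char0 hD hOm cOm DOm hk1 ck1 Dk1 k1Om Ck1 nY aDY1 Dc nc ac.
have hA := adjoin_sf k0 [set Y].
have hN : subfield N by exact: adjoin_sf.
have main f (t : seq T) : constfield D Om Y f -> ~ Om f -> (forall e, e \in t -> Om e) ->
  exists (U : set_system (T -> T)) (hU : UltraFilter U) (psi : {rmorphism T -> upow T hU})
     (w : 'I_(size s) -> upow T hU),
  [/\ star N (psi f) /\ ~ star k0 (psi f), forall x, x \in t -> star k0 (psi x),
    forall x, k1 x -> star k0 (psi x) /\ dstar D (psi x) = psi (D x),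
    forall j, star k0 (w j) &
    dstar D (psi f) = \sum_j w j * psi (dd j f)].
  move=> C1f nf tOm; have [Gf Df] := C1f.
  have [tf tfOm hf] : exists2 tf : seq T, (forall e, e \in tf -> Om e) & adjoin N [set` tf] f.
    apply: adjoin_fin; apply: adjoin_min Gf; first exact: adjoin_sf.
      by move=> y Oy; exact: sub_adjoinr.
    by move=> y hy; apply: sub_adjoinl; exact: sub_adjoinr.
  (* This keeps [psi f] out of [star k0]: Y is algebraic over k0(f, tY), so if psi f and the image
     of tY lay in [star k0], then so would psi Y, which is Y. *)
  have [tY tYOm hY] : exists2 tY : seq T, (forall e, e \in tY -> Om e) & acl (adjoin (adjoin k0 [set f]) [set` tY]) Y.
    apply: acl_fin; have nf' : ~ acl Om f by move=> /(closed_acl hOm cOm).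
    have : acl (adjoin Om [set Y]) f.
      apply: adjoin_min Gf; first exact: (acl_sf (adjoin_sf _ _)).
        by move=> y Oy; apply: (sub_acl (adjoin_sf _ _)); exact: sub_adjoinl.
      move=> y [->|->]; first by apply: (sub_acl (adjoin_sf _ _)); exact: sub_adjoinr.
      apply: acl_mono aDY; apply: adjoin_mono; last exact: sub_adjoinr.
      exact: k0Om.
    move/(acl_exchange hOm nf'); apply: acl_mono; apply: adjoin_min; first exact: adjoin_sf.
      by move=> y Oy; exact: sub_adjoinr.
    by move=> _ ->; apply: sub_adjoinl; exact: sub_adjoinr.
  pose t' := t ++ s ++ [seq D e | e <- s] ++ tf ++ tY.
  have t'Om e : e \in t' -> Om e.
    rewrite !mem_cat => /orP[/tOm //|/orP[/sOm //|/orP[/mapP[e' /sOm he' ->]|/orP[/tfOm //|/tYOm //]]]].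
    exact: DOm.
  have [U [hU [psi [psiA psiD psi1 psit]]]] :=
    specialization char0 cT hD hk0 ck0 Dk0 hOm cOm k0Om csOm Dcs icS nY aDY t'Om.
  exists U, hU, psi, (fun j : 'I_(size s) => dstar D (psi (eps j)) - psi (D (eps j))).
  have hs0 : subfield (star (hU := hU) k0) by exact: star_sf.
  have cs0 : alg_closed (star (hU := hU) k0) by exact: star_closed.
  have hpN := sf_preim psi (star_sf hU hN).
  have hp0 := sf_preim psi hs0.
  have psi0 x : k0 x -> star k0 (psi x) by move=> /k0k1/psi1.
  have k1A x : k1 x -> acl (adjoin k1 [set Y]) x.
    by move=> kx; apply: (sub_acl (adjoin_sf _ _)); exact: sub_adjoinl.
  have mem_s (j : 'I_(size s)) : eps j \in s by rewrite /eps mem_nth.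
  split.
  - split.
      apply: (adjoin_min hpN _ _ hf).
        apply: (adjoin_min hpN); first by move=> y /psi0; apply: star_mono; exact: sub_adjoinl.
        move=> y hy /=; rewrite psiA; first by apply/star_diag; exact: sub_adjoinr.
        case: hy => ->; last exact: aDY.
        by apply: (sub_acl hA); exact: sub_adjoinr.
      move=> y ytf; apply: (star_mono (@sub_adjoinl _ k0 [set Y; D Y])); apply: psit.
      by rewrite !mem_cat (ytf : y \in tf) !orbT.
    move=> h0; apply: nY; apply: k0Om; apply/(star_diag hU).
    rewrite -(psiA Y); last by apply: (sub_acl hA); exact: sub_adjoinr.
    apply: (closed_acl hs0 cs0); apply: (acl_map (adjoin_sf _ _) hs0 _ hY).
    apply: (adjoin_min hp0).
      by apply: (adjoin_min hp0) => // _ ->.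
    by move=> y ytY; apply: psit; rewrite !mem_cat (ytY : y \in tY) !orbT.
  - by move=> x xt; apply: psit; rewrite mem_cat xt.
  - by move=> x kx; split; [exact: psi1|apply: psiD; exact: k1A].
  - move=> j; apply: (sfB hs0).
      by apply: dstar_star; [exact: Dk0|apply: psit; rewrite !mem_cat mem_s !orbT].
    by apply: psit; rewrite !mem_cat (map_f D (mem_s j)) !orbT.
  (* The defect of commutation, minus its expansion in the dual derivations, kills k1, the [eps j]
     and Y. Hence it kills f, at which D vanishes. *)
  pose eta x := (dstar D (psi x) - psi (D x)) -
     \sum_j (dstar D (psi (eps j)) - psi (D (eps j))) * psi (dd j x).
  have hd := dstar_der hU hD.
  have etaD x y : eta (x + y) = eta x + eta y.
    rewrite /eta (derD hD) !rmorphD (derD hd).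
    under eq_bigr => j _ do (have [hj _ _ _] := Ddd j; rewrite (derD hj) rmorphD mulrDr).
    by rewrite big_split /=; ring.
  have etaM x y : eta (x * y) = eta x * psi y + psi x * eta y.
    rewrite /eta (derM hD) rmorphD !rmorphM (derM hd).
    have -> : \sum_j (dstar D (psi (eps j)) - psi (D (eps j))) * psi (dd j (x * y)) =
      (\sum_j (dstar D (psi (eps j)) - psi (D (eps j))) * psi (dd j x)) * psi y +
      psi x * (\sum_j (dstar D (psi (eps j)) - psi (D (eps j))) * psi (dd j y)).
      rewrite mulr_suml mulr_sumr -big_split /=; apply: eq_bigr => j _.
      by have [hj _ _ _] := Ddd j; rewrite (derM hj) rmorphD !rmorphM; ring.
    by ring.
  have hz := along_sf etaD etaM.
  have : eta f = 0.
    apply: (along_zero char0 etaD etaM _ _ (sC1 f C1f)); first exact: adjoin_sf.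
    have eta1 x : acl (adjoin k1 [set Y]) x -> (forall j, dd j x = 0) -> eta x = 0.
      move=> hx h; rewrite /eta psiD // subrr sub0r big1 ?oppr0 // => j _.
      by rewrite h rmorph0 mulr0.
    apply: (adjoin_min hz); first apply: (adjoin_min hz).
    - by move=> x kx; apply: eta1; [exact: k1A|move=> j; have [_ _ h _] := Ddd j; exact: h].
    - move=> e es; have es' : e \in s by [].
      pose i := Ordinal (etrans (index_mem e s) es').
      have -> : e = eps i by rewrite /eps nth_index.
      rewrite /= /eta (bigD1 i) //= big1 ?addr0; last first.
        by move=> j ji; rewrite dde eq_sym (negbTE ji) rmorph0 mulr0.
      by rewrite dde eqxx rmorph1 mulr1 subrr.
    - move=> _ ->; apply: eta1; first by apply: (sub_acl (adjoin_sf _ _)); exact: sub_adjoinr.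
      by move=> j; have [_ _ _ h] := Ddd j.
  by rewrite /eta Df rmorph0 subr0 => /eqP; rewrite subr_eq0 => /eqP.
case: alt => [[f [C1f nf hf]]|[W [Z [g2 [g3 [[C1W C1Z] nW [Cg2 Cg3] [disc rel] hW]]]]]].
  have /choice[abc habc] : forall j, exists abc : T * T * T, [/\ Om abc.1.1, Om abc.1.2, Om abc.2 &
      dd j f = abc.1.1 + abc.1.2 * f + abc.2 * f ^+ 2].
    by move=> j; have [a [b [e [h1 h2 h3 h4]]]] := hf j; exists (a, b, e).
  pose t := codom (fun j => (abc j).1.1) ++ codom (fun j => (abc j).1.2) ++ codom (fun j => (abc j).2).
  have tOm e : e \in t -> Om e.
    by rewrite !mem_cat => /orP[|/orP[]] /codomP[j ->]; case: (habc j).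
  have [U [hU [psi [w [[hN1 hN0] psit _ wk Deq]]]]] := main f t C1f nf tOm.
  have hs0 : subfield (star (hU := hU) k0) by exact: star_sf.
  pose a := \sum_j w j * psi (abc j).1.1; pose b := \sum_j w j * psi (abc j).1.2.
  pose e := \sum_j w j * psi (abc j).2.
  have ha : star k0 a.
    apply: (sf_sum hs0) => j _; apply: (sfM hs0) => //; apply: psit.
    by rewrite !mem_cat (codom_f (fun j => (abc j).1.1)).
  have hb : star k0 b.
    apply: (sf_sum hs0) => j _; apply: (sfM hs0) => //; apply: psit.
    by rewrite !mem_cat (codom_f (fun j => (abc j).1.2)) orbT.
  have he : star k0 e.
    apply: (sf_sum hs0) => j _; apply: (sfM hs0) => //; apply: psit.
    by rewrite !mem_cat (codom_f (fun j => (abc j).2)) !orbT.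
  have : dstar D (psi f) = a + b * psi f + e * psi f ^+ 2.
    rewrite Deq !mulr_suml -!big_split /=; apply: eq_bigr => j _.
    by have [_ _ _ ->] := habc j; rewrite !rmorphD !rmorphM /=; ring.
  move=> /(star_riccati hN1 hN0 ha hb he)[z [h1 h2 h3]]; exists z; split => //; by left.
have /choice[a ha] : forall j, exists a, Om a /\ dd j W = a * Z.
  by move=> j; have [a h1 h2] := hW j; exists a.
have tOm e : e \in codom a -> Om e by move=> /codomP[j ->]; case: (ha j).
have [U [hU [psi [w [[hN1 hN0] psit psi1 wk Deq]]]]] := main W _ C1W nW tOm.
have hs0 : subfield (star (hU := hU) k0) by exact: star_sf.
pose b := \sum_j w j * psi (a j).
have hb : star k0 b.
  by apply: (sf_sum hs0) => j _; apply: (sfM hs0) => //; apply: psit; exact: codom_f.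
have e1 : dstar D (psi W) = b * psi Z.
  rewrite Deq mulr_suml; apply: eq_bigr => j _.
  by have [_ ->] := ha j; rewrite rmorphM mulrA.
have e2 : psi Z ^+ 2 = 4%:R * psi W ^+ 3 - psi g2 * psi W - psi g3.
  by rewrite -rmorphXn rel !rmorphB !rmorphM ?rmorphXn !rmorph_nat.
have e3 : 27%:R * psi g3 ^+ 2 - psi g2 ^+ 3 <> 0.
  have -> : 27%:R * psi g3 ^+ 2 - psi g2 ^+ 3 = psi (27%:R * g3 ^+ 2 - g2 ^+ 3).
    by rewrite rmorphB rmorphM ?rmorphXn rmorph_nat.
  by apply/eqP; rewrite fmorph_eq0.
have cst g : constants D Om g -> star k0 (psi g) /\ dstar D (psi g) = 0.
  by move=> Cg; have [h1 h2] := psi1 _ (Ck1 Cg); rewrite h2; case: Cg => _ ->; rewrite rmorph0.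
have [h2 h2'] := cst _ Cg2; have [h3 h3'] := cst _ Cg3.
have [z [z1 z2 z3]] := star_weierstrass hN1 hN0 hb h2 h2' h3 h3' e3 e2 e1.
by exists z; split => //; right.
Qed.

End Descent.

(** * Strongly normal extensions *)

Lemma setT_sf (T : fieldType) : subfield [set: T].
Proof. by apply/subfieldP. Qed.

Section JointDerivation.
Variables (L M : fieldType) (d : L -> L) (F : set L) (i psi : {rmorphism L -> M}).
Hypothesis char0 : [pchar M] =i pred0.
Hypotheses (hd : derivation d) (hF : subfield F) (dF : forall x, F x -> F (d x)).
Hypothesis psiF : forall x, F x -> psi x = i x.
Hypothesis free : forall (I : finType) (A : {set I}) (m a : I -> L), lfree F A m ->
  \sum_(j in A) i (m j) * psi (a j) = 0 -> forall j, j \in A -> a j = 0.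

Let bil (s : seq (L * L)) : M := \sum_(p <- s) i p.1 * psi p.2.
Let dbil (s : seq (L * L)) : M :=
  \sum_(p <- s) (i (d p.1) * psi p.2 + i p.1 * psi (d p.2)).

(** The joint derivation is forced to be d tensor 1 + 1 tensor d. Rewriting a null sum in a basis
    over F of its left entries changes neither [bil] nor [dbil], as i and psi agree on F; by linear
    disjointness all the right coefficients are then 0. *)
Lemma dbil_wd s : bil s = 0 -> dbil s = 0.
Proof.
rewrite /bil /dbil !(big_nth (0, 0)) !big_mkord.
set n := size s; pose u (k : 'I_n) := (nth (0, 0) s k).1; pose v (k : 'I_n) := (nth (0, 0) s k).2.
rewrite -/(bil s).
have [A [fA span]] := lfree_max u hF.
have /choice[c hc] : forall k, exists c : 'I_n -> L, (forall j, F (c j)) /\ u k = \sum_(j in A) c j * u j.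
  by move=> k; have [c h1 h2] := span k; exists c.
have Fc k j : F (c k j) by have [h _] := hc k; exact: h.
pose a j := \sum_k c k j * v k.
move=> e; have a0 : forall j, j \in A -> a j = 0.
  apply: (free fA); rewrite -[RHS]e /a.
  under eq_bigr => j _ do rewrite rmorph_sum mulr_sumr.
  rewrite exchange_big /=; apply: eq_bigr => k _.
  rewrite -/(u k) -/(v k); have [_ ->] := hc k; rewrite rmorph_sum mulr_suml.
  by apply: eq_bigr => j _; rewrite !rmorphM (psiF (Fc k j)) mulrCA mulrA.
have -> : \sum_(k < n) (i (d (u k)) * psi (v k) + i (u k) * psi (d (v k))) =
    \sum_(j in A) (i (u j) * psi (d (a j)) + i (d (u j)) * psi (a j)).
  have da j : d (a j) = \sum_k (d (c k j) * v k + c k j * d (v k)).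
    by rewrite /a (der_sum hd); apply: eq_bigr => k _; rewrite (derM hd).
  under [RHS]eq_bigr => j _ do rewrite da /a !rmorph_sum !mulr_sumr -big_split /=.
  rewrite [RHS]exchange_big /=; apply: eq_bigr => k _.
  have [_ ek] := hc k; rewrite {1 2}ek (der_sum hd) !rmorph_sum !mulr_suml -big_split /=.
  apply: eq_bigr => j _; rewrite (derM hd) !(rmorphD, rmorphM) /=.
  by rewrite (psiF (Fc k j)) (psiF (dF (Fc k j))); ring.
rewrite big1 // => j jA; by rewrite a0 // (der0 hd) !rmorph0 !mulr0 addr0.
Qed.

Lemma joint_derivation : exists D : M -> M,
  [/\ derivation D, forall x, D (i x) = i (d x) & forall x, D (psi x) = psi (d x)].
Proof.
pose X : set (M * M) := [set q | exists s, q = (bil s, dbil s)].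
have gX : graph_ring setT X.
  split.
  - exists [:: (1, 1)]; rewrite /bil /dbil !big_seq1 /= (der1 hd) !rmorph1 !rmorph0.
    by congr pair; ring.
  - move=> _ _ [s ->] [t ->]; exists (s ++ [seq (- p.1, p.2) | p <- t]).
    rewrite /psub /bil /dbil !big_cat !big_map /= -!sumrN; congr (_ + _, _ + _).
      by apply: eq_bigr => p _; rewrite rmorphN mulNr.
    by apply: eq_bigr => p _; rewrite (derN hd) !rmorphN; ring.
  - move=> _ _ [s ->] [t ->]; exists [seq (p.1 * q.1, p.2 * q.2) | p <- s, q <- t].
    rewrite /pmul /bil /dbil !big_allpairs_dep /=; congr pair.
      rewrite mulr_suml; apply: eq_bigr => p _; rewrite mulr_sumr; apply: eq_bigr => q _.
      by rewrite !rmorphM; ring.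
    rewrite !mulr_suml -big_split /=; apply: eq_bigr => p _.
    rewrite !mulr_sumr -big_split /=; apply: eq_bigr => q _.
    by rewrite !(derM hd) !(rmorphD, rmorphM) /=; ring.
  - by move=> b [s [/esym e ->]]; exact: dbil_wd.
  - by [].
have [D [/deriv_onT hD eD]] := graph_total char0 (setT_sf _) gX.
exists D; split => // x.
  have := eD (i x, i (d x)); apply; exists [:: (x, 1)]; rewrite /bil /dbil !big_seq1 /= (der1 hd) rmorph1 rmorph0.
  by congr pair; ring.
have := eD (psi x, psi (d x)); apply; exists [:: (1, x)]; rewrite /bil /dbil !big_seq1 /= (der1 hd) rmorph1 rmorph0.
by congr pair; ring.
Qed.

End JointDerivation.

(** The second copy lands in [star F], so [star_lfree] makes it linearly disjoint over F from the
    diagonal copy. *)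
Lemma amalgam (L : fieldType) (d : L -> L) (F : set L) : [pchar L] =i pred0 ->
  alg_closed [set: L] -> derivation d -> subfield F -> alg_closed F -> (forall x, F x -> F (d x)) ->
  exists (M : fieldType) (D : M -> M) (i psi : {rmorphism L -> M}),
  [/\ [pchar M] =i pred0, alg_closed [set: M] &
   [/\ derivation D, forall x, D (i x) = i (d x), forall x, D (psi x) = psi (d x),
     forall x, F x -> psi x = i x &
     forall (I : finType) (A : {set I}) (m a : I -> L), lfree F A m ->
       \sum_(j in A) i (m j) * psi (a j) = 0 -> forall j, j \in A -> a j = 0]].
Proof.
move=> char0 cL hd hF cF dF.
have [U [hU [psi [psiF psiS _]]]] := ultra_embedding char0 hF cF (cs := [::]) I.
have cM : alg_closed [set: upow L hU].
  have := @star_closed _ _ _ hU _ (setT_sf L) cL; congr alg_closed.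
  by apply/seteqP; split => // x _; exact: starT.
have free (I : finType) (A : {set I}) (m a : I -> L) : lfree F A m ->
    \sum_(j in A) diag hU (m j) * psi (a j) = 0 -> forall j, j \in A -> a j = 0.
  move=> hA e j jA; have := @star_lfree _ _ _ hU _ _ _ _ hF hA (fun j => psi (a j)) (fun j => psiS _).
  have -> : \sum_(k in A) psi (a k) * diag hU (m k) = 0.
    by rewrite -[RHS]e; apply: eq_bigr => k _; rewrite mulrC.
  by move=> /(_ erefl j jA)/eqP; rewrite fmorph_eq0 => /eqP.
have [D [hD Di Dpsi]] := joint_derivation (up_char0 hU char0) hd hF dF psiF free.
by exists (upow L hU), D, (diag hU), psi; split => //; exact: up_char0.
Qed.

(** * Constants of algebraic extensions and of extensions by constants *)

Section ConstantDescent.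
Variables (T : fieldType) (D : T -> T) (G : set T).
Hypotheses (hD : derivation D) (hG : subfield G) (DG : forall x, G x -> G (D x)).

Let descent (J : finType) (a b : J -> T) := @descent_constants T G hG J [set D]
  (fun d (e : d = D) => eq_rect_r (@derivation T) hD e)
  (fun d x (e : d = D) (Gx : G x) => eq_rect_r (fun f => G (f x)) (DG Gx) e) a b.

(** The powers of x are constants, so a relation among them over G descends to constant
    coefficients. *)
Lemma constant_acl x : acl G x -> D x = 0 -> acl (constants D G) x.
Proof.
move=> [p /(povP hG) hp /andP[p0 px]] Dx.
have [||||b [Gb Db [j bj] e]] := @descent 'I_(size p) (fun j => x ^+ j) (fun j => p`_j).
- move=> d j ->; suff [] : constants D setT (x ^+ j) by [].
  by apply: (sfX (constants_sf hD (setT_sf T))); split.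
- by move=> j; exact: hp.
- have lt : ((size p).-1 < size p)%N by rewrite ltn_predL size_poly_gt0.
  by exists (Ordinal lt); rewrite -lead_coefE lead_coef_eq0.
- by move: px => /eqP; rewrite horner_coef.
pose q := \poly_(k < size p) (if insub k is Some k' then b k' else 0).
have qE (k : 'I_(size p)) : q`_k = b k by rewrite coef_poly ltn_ord valK.
apply: (@aclI _ _ q).
- move=> k; rewrite coef_poly; case: ifP => _; last exact: (sf0 (constants_sf hD hG)).
  case: insubP => [k' _ _|_]; last exact: (sf0 (constants_sf hD hG)).
  by split; [exact: Gb|exact: (Db D k' erefl)].
- by apply: contraNneq bj => q0; rewrite -qE q0 coef0.
- apply/eqP; rewrite (horner_coef_wide _ (size_poly _ _)) -[RHS]e.
  by apply: eq_bigr => k _; rewrite qE.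
Qed.

(** Write x = P / S, with P and S combinations over G of elements m of C(cs) independent over C. The
    equation P = x S is a relation over G among the constants m and x m, so it descends to C, where
    independence of the m keeps the new denominator nonzero. *)
Lemma constant_adjoin (cs : seq T) x : (forall c, c \in cs -> D c = 0) ->
  adjoin G [set` cs] x -> D x = 0 -> adjoin (constants D G) [set` cs] x.
Proof.
move=> Dcs Gx Dx; have hC := constants_sf hD hG.
have hC0 := adjoin_sf (constants D G) [set` cs].
have C0D y : adjoin (constants D G) [set` cs] y -> D y = 0.
  by apply: der_zero_gen => // z []. 
have : adjoin G (adjoin (constants D G) [set` cs]) x.
  apply: adjoin_mono Gx => // y ycs; apply: sub_adjoinr; exact: sub_adjoinr.
move=> /(compositumP hG hC0)[P [S [hP hS S0 ex]]].
have [J [A [m [a [b [C0m hA hab eP eS]]]]]] := ten_free2 hG hC (@subIsetl _ _ _) hP hS.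
pose v (o : bool * 'I_#|A|) := if o.1 then m (enum_val o.2) else - (x * m (enum_val o.2)).
pose u (o : bool * 'I_#|A|) := if o.1 then a (enum_val o.2) else b (enum_val o.2).
have split_sum (F : bool * 'I_#|A| -> T) :
    \sum_o F o = \sum_i F (true, i) + \sum_i F (false, i).
  rewrite (eq_bigr (fun p => F (p.1, p.2))); last by move=> [].
  by rewrite -(pair_bigA _ (fun s i => F (s, i))) big_bool.
have [||||g [Gg Dg [[s0 i0] g0] eg]] := @descent (bool * 'I_#|A|)%type v u.
- move=> d [[] i] ->; rewrite /v /=; first by apply: C0D; exact: C0m.
  by rewrite (derN hD) (derM hD) Dx (C0D _ (C0m _)) mul0r mulr0 addr0 oppr0.
- by move=> [[] i]; have [h1 h2] := hab (enum_val i).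
- have [i bi] : exists i : 'I_#|A|, b (enum_val i) != 0.
    apply: contrapT => none; move/eqP: S0; apply; rewrite eS big_enum_val big1 // => i _.
    by apply/eqP; rewrite mulf_eq0; apply/orP; left; apply/negP => /negP h; apply: none; exists i.
  by exists (false, i).
- rewrite split_sum /u /v /=.
  have -> : \sum_(i < #|A|) a (enum_val i) * m (enum_val i) = P by rewrite eP [RHS](big_enum_val (fun j => a j * m j)).
  under eq_bigr do rewrite mulrN mulrCA.
  rewrite sumrN -mulr_sumr; have -> : \sum_(i < #|A|) b (enum_val i) * m (enum_val i) = S by rewrite eS [RHS](big_enum_val (fun j => b j * m j)).
  by rewrite ex divfK // subrr.
have Cg o : constants D G (g o) by split; [exact: Gg|exact: (Dg D o erefl)].
have free s : \sum_i g (s, i) * m (enum_val i) = 0 -> forall i, g (s, i) = 0.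
  move=> e i; have jA := enum_valP i.
  pose h (j : J) := if j \in A then g (s, enum_rank_in jA j) else 0.
  have := @hA h _ _ _ jA; rewrite /h enum_valP enum_valK_in; apply.
    by move=> j; case: ifP => _; [exact: Cg|exact: (sf0 hC)].
  rewrite big_enum_val -[RHS]e; apply: eq_bigr => j _.
  by rewrite enum_valP enum_valK_in.
have eqx : x * \sum_i g (false, i) * m (enum_val i) = \sum_i g (true, i) * m (enum_val i).
  move: eg; rewrite split_sum /v /=; under [X in _ + X]eq_bigr do rewrite mulrN mulrCA.
  by rewrite sumrN -mulr_sumr => /eqP; rewrite subr_eq0 => /eqP.
have S'0 : \sum_i g (false, i) * m (enum_val i) != 0.
  apply/eqP => e; have hf := free false e; move: eqx; rewrite e mulr0 => /esym/free ht.
  by move: g0; case: (s0); rewrite ?hf ?ht eqxx.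
have sumC s : adjoin (constants D G) [set` cs] (\sum_i g (s, i) * m (enum_val i)).
  by apply: (sf_sum hC0) => i _; apply: (sfM hC0); [exact: sub_adjoinl|exact: C0m].
have -> : x = (\sum_i g (true, i) * m (enum_val i)) / (\sum_i g (false, i) * m (enum_val i)).
  by rewrite -eqx mulfK.
exact: (sfdiv hC0).
Qed.

End ConstantDescent.

Lemma image_sf (T T' : fieldType) (i : {rmorphism T -> T'}) F : subfield F -> subfield (i @` F).
Proof.
move=> hF; apply/subfieldP; split.
- by exists 1; [exact: (sf1 hF)|rewrite rmorph1].
- move=> _ _ [x Fx <-] [y Fy <-]; exists (x - y); last by rewrite rmorphB.
  exact: (sfB hF).
- move=> _ _ [x Fx <-] [y Fy <-]; exists (x / y); last by rewrite fmorph_div.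
  exact: (sfdiv hF).
Qed.

Lemma image_closed (T T' : fieldType) (i : {rmorphism T -> T'}) F : subfield F ->
  alg_closed F -> alg_closed (i @` F).
Proof.
move=> hF cF p /(povP (image_sf i hF)) hp sp.
have /choice[q hq] : forall k, exists y, F y /\ i y = p`_k.
  by move=> k; have [y Fy e] := hp k; exists y.
pose P := \poly_(k < size p) q k.
have ep : p = map_poly i P.
  apply/polyP => k; rewrite coef_map /P coef_poly; have [lt|le] := ltnP k (size p).
    by have [_ h] := hq k; exact: (esym h).
  exact: etrans (nth_default _ le) (esym (rmorph0 i)).
have [||x Fx Px] := cF P.
- apply/(povP hF) => k; rewrite coef_poly; case: ifP => _; last exact: (sf0 hF).
  by have [h _] := hq k.
- by move: sp; rewrite ep size_map_poly.
exists (i x); last by rewrite ep fmorph_root.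
by apply: mem_set; exists x => //; exact: set_mem.
Qed.

Section LinearDisjoint.
Variables (L M : fieldType) (F : set L) (i psi : {rmorphism L -> M}).
Hypothesis hF : subfield F.
Hypothesis psiF : forall x, F x -> psi x = i x.
Hypothesis free : forall (I : finType) (A : {set I}) (m a : I -> L), lfree F A m ->
  \sum_(j in A) i (m j) * psi (a j) = 0 -> forall j, j \in A -> a j = 0.

(** If z were outside F, then 1 and z would be independent over F, and psi x = i z would contradict
    linear disjointness. *)
Lemma images_meet x z : psi x = i z -> F x.
Proof.
move=> e; have [Fz|nz] := pselect (F z).
  by rewrite (_ : x = z) //; apply: (fmorph_inj psi); rewrite e psiF.
have fm : lfree F [set: bool]%SET (fun b : bool => if b then 1 else z).
  move=> c Fc; rewrite (eq_bigl predT); last by move=> b; rewrite finset.in_setT.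
  rewrite big_bool /= mulr1 => e0.
  have c0 : c false = 0.
    apply/eqP; apply: contrapT => /negP c0; apply: nz.
    have -> : z = - c true / c false.
      by apply: (mulfI c0); rewrite mulrC mulrCA mulfV // mulr1 -[RHS]add0r -e0; ring.
    by apply: (sfdiv hF) => //; exact: (sfN hF).
  by move=> [] _ //; move: e0; rewrite c0 mul0r addr0.
have := free (a := fun b : bool => if b then x else -1) fm _ (finset.in_setT false).
rewrite (eq_bigl predT); last by move=> b; rewrite finset.in_setT.
rewrite big_bool /= rmorph1 mul1r e rmorphN rmorph1 mulrN1 subrr => /(_ erefl)/eqP.
by rewrite oppr_eq0 oner_eq0.
Qed.

End LinearDisjoint.

(** The sequence is shortened from its head as long as y remains algebraic over the rest. *)
Lemma last_constant (T : fieldType) (G : set T) (s : seq T) y : seqindep G s -> ~ acl G y ->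
  subfield G -> acl (adjoin G [set` s]) y -> exists c cs,
  [/\ {subset c :: cs <= s}, seqindep G (c :: cs), ~ acl (adjoin G [set` cs]) y
    & acl (adjoin G [set` c :: cs]) y].
Proof.
move=> is_ ny hG; elim: s is_ => [|c s IH] is_ hy.
  by exfalso; apply: ny; move: hy; rewrite adjoin_id.
have [h|h] := pselect (acl (adjoin G [set` s]) y); last by exists c, s; split.
have [is1 _] := is_; have [c' [cs [sub h1 h2 h3]]] := IH is1 h.
by exists c', cs; split => // z /sub zs; rewrite inE zs orbT.
Qed.

Lemma seqindep_mono (T : fieldType) (F G : set T) (s : seq T) : F `<=` G -> seqindep G s -> seqindep F s.
Proof.
move=> FG; elim: s => //= c s IH [/IH h1 h2]; split => // h; apply: h2.
apply: acl_mono h; apply: adjoin_mono; last exact: sub_adjoinr.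
exact: FG.
Qed.

Lemma transcendence_seq (T : fieldType) (G : set T) (s : seq T) : subfield G ->
  exists s' : seq T, [/\ {subset s' <= s}, seqindep G s' & forall x, x \in s -> acl (adjoin G [set` s']) x].
Proof.
move=> hG; have [s' [sub us indep gen]] := transcendence_basis s hG.
exists s'; split => //; rewrite -(cats0 s'); apply: seqindep_cat => //.
move=> e es; have e0 : adjoin G [set` [::]] = G by apply: adjoin_id.
move=> h; apply: (indep e es); apply: (acl_acl (adjoin_sf _ _)); apply: acl_mono h.
apply: adjoin_min; first exact: (acl_sf (adjoin_sf _ _)).
  by rewrite e0; apply: acl_mono; exact: sub_adjoinl.
by move=> y ys; apply: (sub_acl (adjoin_sf _ _)); exact: sub_adjoinr.
Qed.

(** * Towers of strongly normal extensions *)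

Section Tower.
Variables (L : fieldType) (d : L -> L).
Hypothesis char0 : [pchar L] =i pred0.
Hypothesis cL : alg_closed [set: L].
Hypothesis hd : derivation d.

Lemma acl_diff F : subfield F -> (forall x, F x -> F (d x)) -> forall x, acl F x -> acl F (d x).
Proof.
by move=> hF dF; apply: (acl_der_stable char0 hd hF) => x Fx; apply: (sub_acl hF); exact: dF.
Qed.

(** The amalgam is formed over acl F0, because the homomorphisms behind the ultrapower embedding
    need an algebraically closed target. The two embeddings agree there, in particular on F0, so
    strong normality applies to them. *)
Lemma sn_amalgam F0 E0 : strongly_normal d F0 E0 ->
  exists (M : fieldType) (D : M -> M) (i psi : {rmorphism L -> M}),
  [/\ [pchar M] =i pred0, alg_closed [set: M],
   [/\ derivation D, forall x, D (i x) = i (d x), forall x, D (psi x) = psi (d x),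
     forall x, acl F0 x -> psi x = i x &
     forall (I : finType) (A : {set I}) (m a : I -> L), lfree (acl F0) A m ->
       \sum_(j in A) i (m j) * psi (a j) = 0 -> forall j, j \in A -> a j = 0],
   compositum (i @` E0) (psi @` E0) =
     compositum (i @` E0) (constants D (compositum (i @` E0) (psi @` E0))) &
   forall x, E0 x -> d x = 0 -> psi x = i x].
Proof.
move=> [[hF0 dF0] [hE0 dE0] F0E0 _ sn].
have hF := acl_sf hF0.
have cF : alg_closed (acl F0) by exact: acl_closed.
have dF x : acl F0 x -> acl F0 (d x).
  apply: acl_diff => // y Fy; exact: set_mem (dF0 _ (mem_set Fy)).
have [M [D [i [psi [cM clM [hD Di Dpsi psiF free]]]]]] := amalgam char0 cL hd hF cF dF.
have emb (f : {rmorphism L -> M}) : (forall x, D (f x) = f (d x)) -> diff_embedding d E0 D f.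
  move=> Df; split; first exact: rmorph1.
  - by move=> x y _ _; exact: rmorphD.
  - by move=> x y _ _; exact: rmorphM.
  - by move=> x _; rewrite Df.
have agree : {in F0, psi =1 i} by move=> x /set_mem Fx; apply: psiF; exact: (sub_acl hF0).
have [e1 _ e3] := sn M D i psi hD (emb i Di) (emb psi Dpsi) agree.
by exists M, D, i, psi; split => // x Ex dx; apply: e3; apply: mem_set.
Qed.

(** Both embeddings agree on the constants of E0, and their images meet only in that of acl F0. *)
Lemma sn_constants F0 E0 : strongly_normal d F0 E0 -> forall x, E0 x -> d x = 0 -> acl F0 x.
Proof.
move=> sn x Ex dx; have [M [D [i [psi [_ _ [_ _ _ psiF free] _ e]]]]] := sn_amalgam sn.
have [[hF0 _] _ _ _ _] := sn.
exact: (images_meet (acl_sf hF0) psiF free (e x Ex dx)).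
Qed.

Variables (n : nat) (E : nat -> set L).
Hypothesis sn : forall i, (i < n)%N -> strongly_normal d (E i) (E i.+1).
Local Notation k := (E 0%N).
Hypothesis hk : diff_subfield d k.
Hypothesis Ck : alg_closed (constants d k).
Hypothesis L_alg : forall x, acl (E n) x.

Lemma tower_diff i : (i <= n)%N -> subfield (E i) /\ forall x, E i x -> E i (d x).
Proof.
have h : forall F, diff_subfield d F -> subfield F /\ forall x, F x -> F (d x).
  by move=> F [h1 h2]; split => // x Fx; exact: set_mem (h2 _ (mem_set Fx)).
case: i => [_|i lt]; first exact: h.
by have [_ hE _ _ _] := sn lt; exact: h.
Qed.

(** A constant algebraic over a step of the tower is algebraic over the constants of that step, and
    these are algebraic over the previous step. At the bottom C is algebraically closed. *)
Lemma tower_constants i x : (i <= n)%N -> acl (E i) x -> d x = 0 -> constants d k x.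
Proof.
have [hk0 dk] := tower_diff (leq0n n); have hC := constants_sf hd hk0.
elim: i x => [|i IH] x lt ax dx.
  by apply: (closed_acl hC Ck); exact: constant_acl.
have [hE dE] := tower_diff lt.
apply: (IH x (ltnW lt)) => //; have [hE' _] := tower_diff (ltnW lt).
apply: (acl_acl hE'); apply: acl_mono (constant_acl hd hE dE ax dx).
by move=> y [Ey dy]; apply: (sn_constants (sn lt)).
Qed.

Lemma all_constants x : d x = 0 -> constants d k x.
Proof. by move=> dx; apply: (tower_constants (leqnn n)). Qed.

Lemma tower_equation y : ~ acl k y -> acl (adjoin k [set y]) (d y) ->
  exists t, [/\ adjoin (acl k) [set y; d y] t, ~ acl k t &
  (exists a b e, [/\ acl k a, acl k b, acl k e & d t = a + b * t + e * t ^+ 2]) \/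
  (exists a g2 g3, [/\ acl k a, constants d k g2, constants d k g3,
     27%:R * g3 ^+ 2 - g2 ^+ 3 != 0 &
     d t ^+ 2 = a ^+ 2 * (4%:R * t ^+ 3 - g2 * t - g3)])].
Proof.
move=> ny ady.
have [j [lt nj aj]] : exists j, [/\ (j < n)%N, ~ acl (E j) y & acl (E j.+1) y].
  suff gen m : (m <= n)%N -> acl (E m) y -> exists j, [/\ (j < n)%N, ~ acl (E j) y & acl (E j.+1) y].
    exact: (gen n (leqnn n)).
  elim: m => [|j IH] le h; first by case: ny.
  have [h'|h'] := pselect (acl (E j) y); last by exists j.
  exact: (IH (ltnW le) h').
have [M [D [i [psi [char0M cM [hD Di Dpsi psiF free] cE _]]]]] := sn_amalgam (sn lt).
have [hE0 dE0] := tower_diff (ltnW lt); have [hE1 dE1] := tower_diff lt.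
have hF0 := acl_sf hE0.
have [hk0 dk] := tower_diff (leq0n n); have ha := acl_sf hk0.
have kE m : (m <= n)%N -> k `<=` E m.
  elim: m => [|m IH] lm x kx //; have [_ _ h _ _] := sn lm; apply: h.
  exact: (IH (ltnW lm)).
have psik x : acl k x -> psi x = i x.
  by move=> kx; apply: psiF; apply: acl_mono kx; apply: kE; exact: ltnW.
pose iL := range i; have hiL : subfield iL by exact: (image_sf i (setT_sf L)).
have ciL : alg_closed iL by exact: (image_closed (setT_sf L) cL).
have DiL x : iL x -> iL (D x) by move=> [z _ <-]; rewrite Di; exists (d z).
have sub x : E j.+1 x -> adjoin (range i) (constants D setT) (psi x).
  move=> Ex; have : compositum (i @` E j.+1) (psi @` E j.+1) (psi x).
    by apply: (@sub_adjoinr _ (i @` E j.+1) (psi @` E j.+1)); exists x.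
  rewrite cE; apply: (@adjoin_mono _ (i @` E j.+1)).
    by move=> _ [z _ <-]; exists z.
  by move=> z [_ Dz]; apply: sub_adjoinr; split.
have nYi : ~ acl iL (psi y).
  by move=> /(closed_acl hiL ciL)[z _ /esym/(images_meet hF0 psiF free)].
have [t tC hy] : exists2 t : seq M, (forall c, c \in t -> constants D setT c) & acl (adjoin iL [set` t]) (psi y).
  apply: acl_fin; apply: (acl_map (psi := psi) hE1 (adjoin_sf _ _)) aj => x; exact: sub.
have [s [ss si sg]] := transcendence_seq t hiL.
have hy' : acl (adjoin iL [set` s]) (psi y).
  apply: (acl_acl (adjoin_sf _ _)); apply: acl_mono hy.
  apply: adjoin_min; [exact: (acl_sf (adjoin_sf _ _))|move=> x ix|exact: sg].
  by apply: (sub_acl (adjoin_sf _ _)); exact: sub_adjoinl.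
(* c is the constant whose adjunction makes psi y algebraic over the first copy of L; only cs enters
   Om. *)
have [c [cs [sub' si' nY aY]]] := last_constant si nYi hiL hy'.
have Dcs x : x \in c :: cs -> D x = 0 by move=> /sub'/ss/tC[].
pose Om := acl (adjoin iL [set` cs]).
have hOm : subfield Om by exact: (acl_sf (adjoin_sf _ _)).
have cOm : alg_closed Om by exact: (acl_closed (adjoin_sf _ _)).
have DX x : adjoin iL [set` cs] x -> adjoin iL [set` cs] (D x).
  apply: (der_adjoin hD) => z; first by move=> /DiL; exact: sub_adjoinl.
  by move=> zc; rewrite Dcs ?inE ?(zc : z \in cs) ?orbT //; exact: (sf0 (adjoin_sf _ _)).
have DOm x : Om x -> Om (D x).
  apply: (acl_der_stable char0M hD (adjoin_sf _ _)) => z /DX; exact: (sub_acl (adjoin_sf _ _)).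
pose k0 := i @` acl k; have hk0' : subfield k0 by exact: image_sf.
have ck0 : alg_closed k0 by apply: image_closed => //; exact: acl_closed.
have dak x : acl k x -> acl k (d x) by exact: acl_diff.
have Dk0 x : k0 x -> k0 (D x) by move=> [z kz <-]; rewrite Di; exists (d z) => //; exact: dak.
have k0iL : k0 `<=` iL by move=> _ [z _ <-]; exists z.
have iLOm : iL `<=` Om by move=> x ix; apply: (sub_acl (adjoin_sf _ _)); exact: sub_adjoinl.
have csOm x : x \in cs -> Om x by move=> xc; apply: (sub_acl (adjoin_sf _ _)); exact: sub_adjoinr.
have [sics nc] : seqindep iL cs /\ ~ Om c by exact: si'.
have hyk0 x : adjoin k [set y] x -> adjoin k0 [set psi y] (psi x).
  apply: (adjoin_min (sf_preim psi (adjoin_sf _ _))).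
    by move=> z kz; apply: sub_adjoinl; exists z; rewrite ?psik //; exact: (sub_acl hk0).
  by move=> _ -> ; exact: sub_adjoinr.
have aDY : acl (adjoin k0 [set psi y]) (D (psi y)).
  rewrite Dpsi; exact: (acl_map (adjoin_sf _ _) (adjoin_sf _ _) hyk0).
have Ck1 : constants D Om `<=` acl (adjoin k0 [set` cs]).
  move=> x [Ox Dx]; have := constant_acl hD (adjoin_sf _ _) DX Ox Dx.
  apply: acl_mono => z [hz Dz].
  have csD w : w \in cs -> D w = 0 by move=> wc; apply: Dcs; rewrite inE wc orbT.
  apply: adjoin_mono (constant_adjoin hD hiL DiL csD hz Dz); last exact: sub_adjoinr.
  move=> _ [[w _ <-] Dw]; exists w => //.
  have [|kw _] := @all_constants w; last exact: (sub_acl hk0).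
  by apply: (fmorph_inj i); rewrite -Di rmorph0.
have ac : acl (adjoin Om [set psi y]) c.
  have : acl (adjoin (adjoin iL [set` cs]) [set c]) (psi y) by rewrite -adjoin_cons.
  move=> /(acl_exchange (adjoin_sf _ _) nY); apply: acl_mono.
  apply: adjoin_mono; last exact: sub_adjoinr.
  exact: (sub_acl (adjoin_sf _ _)).
have [t0 [Nt nt eqn]] := descended_equation char0M cM hD hk0' ck0 Dk0 hOm cOm
  (subset_trans k0iL iLOm) DOm csOm (fun x xc => Dcs x (mem_behead (s := c :: cs) xc))
  (seqindep_mono k0iL sics) nY aDY Ck1 (Dcs c (mem_head _ _)) nc ac.
(* psi and i agree on acl k, so the equation lives in the image of psi and can be pulled back to
   L. *)
have pre x : k0 x -> exists2 z, acl k z & psi z = x.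
  by move=> [z kz <-]; exists z => //; exact: psik.
have [t1 Nt1 et] : exists2 z, adjoin (acl k) [set y; d y] z & psi z = t0.
  suff : adjoin k0 [set psi y; D (psi y)] `<=` psi @` adjoin (acl k) [set y; d y] by apply.
  apply: adjoin_min; first exact: (image_sf psi (adjoin_sf _ _)).
    by move=> _ /pre[z kz <-]; exists z => //; exact: sub_adjoinl.
  by move=> _ [->|->]; rewrite ?Dpsi; [exists y|exists (d y)] => //; apply: sub_adjoinr; [left|right].
exists t1; split => //.
  by move=> h; apply: nt; exists t1 => //; rewrite -et psik.
move: eqn; rewrite -et Dpsi => -[[a [b [e [/pre[a' ka <-] /pre[b' kb <-] /pre[e' ke <-] eq]]]]|].
  left; exists a', b', e'; split => //; apply: (fmorph_inj psi).
  by rewrite eq !rmorphD !rmorphM.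
move=> [z [a [g2 [g3 [/pre[a' ka <-] [/pre[g2' kg2 <-] Dg2] [/pre[g3' kg3 <-] Dg3] disc [rel eq]]]]]].
have cst g : D (psi g) = 0 -> constants d k g.
  by move=> h; apply: all_constants; apply: (fmorph_inj psi); rewrite -Dpsi h rmorph0.
have psin (m : nat) : m%:R = psi m%:R by rewrite rmorph_nat.
right; exists a', g2', g3'; split => //; try exact: cst.
  by apply: contraNneq disc => h; rewrite !psin -!rmorphXn -!rmorphM -rmorphB h rmorph0.
apply: (fmorph_inj psi); rewrite rmorphXn eq exprMn rel !psin.
by rewrite !(rmorphB, rmorphM, rmorphXn).
Qed.

End Tower.

(** * Finite generation *)

Section FiniteGeneration.
Variables (L : fieldType) (d : L -> L).
Hypothesis char0 : [pchar L] =i pred0.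
Hypothesis cL : alg_closed [set: L].
Hypothesis hd : derivation d.

Lemma der_adjoin_acl F x : subfield F -> (forall y, F y -> F (d y)) -> acl F x ->
  adjoin F [set x] (d x).
Proof.
move=> hF dF ax; have [p [hp p0 px dpx]] := separable_root char0 hF ax.
have hA := adjoin_sf F [set x].
have Ax : adjoin F [set x] x by exact: sub_adjoinr.
have e : d x = - ((map_poly d p).[x] / p^`().[x]).
  have := der_horner p x hd; move: px => /eqP ->; rewrite (der0 hd) => /esym/eqP.
  rewrite addr_eq0 => /eqP ->.
  by rewrite mulNr opprK mulrAC mulfV // mul1r.
rewrite e; apply: (sfN hA); apply: (sfdiv hA); apply: (pov_horner hA) => // i.
- by rewrite coef_map_id0 ?(der0 hd) //; apply: sub_adjoinl; apply: dF; exact: hp.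
- by apply: sub_adjoinl; exact: (pov_deriv hF).
Qed.

Lemma adjoin_acl_diff F (s : seq L) : subfield F -> (forall y, F y -> F (d y)) ->
  (forall x, x \in s -> acl F x) -> forall x, adjoin F [set` s] x -> adjoin F [set` s] (d x).
Proof.
move=> hF dF sF; apply: (der_adjoin hd) => x hx.
  by apply: sub_adjoinl; exact: dF.
apply: adjoin_mono (der_adjoin_acl hF dF (sF x hx)) => // _ ->; exact: sub_adjoinr.
Qed.

Lemma list_adjoin (T : fieldType) (A B : set T) (l : seq T) : (forall x, x \in l -> adjoin B A x) ->
  exists2 s : seq T, (forall y, y \in s -> A y) & forall x, x \in l -> adjoin B [set` s] x.
Proof.
elim: l => [|x l IH] hl; first by exists [::].
have [s sA hs] := IH (fun z zl => hl z (mem_behead (s := x :: l) zl)).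
have [t tA ht] := adjoin_fin (hl x (mem_head _ _)).
exists (t ++ s); first by move=> y; rewrite mem_cat => /orP[/tA|/sA].
move=> z; rewrite inE => /orP[/eqP ->|zl].
  by apply: adjoin_mono ht => // y yt; apply: sub_adjoinr; rewrite /= mem_cat (yt : y \in t).
by apply: adjoin_mono (hs z zl) => // y ys; apply: sub_adjoinr; rewrite /= mem_cat (ys : y \in s) orbT.
Qed.

Lemma diff_gen_min F0 (s : seq L) E0 G : E0 = smallest (diff_subfield d) (F0 `|` [set` s]) ->
  subfield G -> (forall x, G x -> G (d x)) -> F0 `<=` G -> (forall x, x \in s -> G x) -> E0 `<=` G.
Proof.
move=> -> hG dG FG sG x; apply; split; last by move=> y [/FG|/sG].
by split => // y /set_mem Gy; apply: mem_set; exact: dG.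
Qed.

(* The constants supplied by strong normality lie in the compositum, so finitely
   many conjugates psi g express them; linear disjointness pulls this back to E0. *)
Lemma sn_generated F0 E0 : strongly_normal d F0 E0 -> exists2 gs : seq L,
  forall g, g \in gs -> E0 g & E0 `<=` adjoin (acl F0) [set` gs].
Proof.
move=> sn; have [M [D [i [psi [_ _ [hD Di Dpsi psiF free] cE _]]]]] := sn_amalgam char0 cL hd sn.
have [[hF0 dF0] [hE0 dE0] F0E0 [s Es] _] := sn.
have hF := acl_sf hF0.
have hB : subfield (i @` E0) by exact: image_sf.
pose W := compositum (i @` E0) (psi @` E0).
have sE x : x \in s -> E0 x.
  by move=> xs; rewrite Es => G [_]; apply; right.
have [cs csC hcs] : exists2 cs : seq M, (forall c, c \in cs -> constants D W c) &
    forall x, x \in [seq psi z | z <- s] -> adjoin (i @` E0) [set` cs] x.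
  apply: list_adjoin => _ /mapP[x xs ->].
  have : W (psi x) by apply: (@sub_adjoinr _ (i @` E0) (psi @` E0)); exists x => //; exact: sE.
  by rewrite /W {1}cE.
have hH := adjoin_sf (i @` E0) [set` cs].
have DH x : adjoin (i @` E0) [set` cs] x -> adjoin (i @` E0) [set` cs] (D x).
  apply: (der_adjoin hD) => z; last by move=> /csC[_ ->]; exact: (sf0 hH).
  by move=> [w Ew <-]; rewrite Di; apply: sub_adjoinl; exists (d w) => //; exact: set_mem (dE0 _ (mem_set Ew)).
have psiE x : E0 x -> adjoin (i @` E0) [set` cs] (psi x).
  apply: (diff_gen_min Es (sf_preim psi hH)) x => /= [x hx|x Fx|x xs].
  - by rewrite /= -Dpsi; exact: DH.
  - rewrite /= (psiF _ (sub_acl hF0 Fx)); apply: sub_adjoinl; exists x => //; exact: F0E0.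
  - by apply: hcs; exact: map_f.
have [l lE hl] : exists2 l : seq M, (forall g, g \in l -> (psi @` E0) g) &
    forall x, x \in cs -> adjoin (i @` E0) [set` l] x.
  by apply: list_adjoin => x /csC[].
have [gs gsE egs] : exists2 gs : seq L, (forall g, g \in gs -> E0 g) & l = [seq psi g | g <- gs].
  elim: (l) lE => [_|x l' IH lE]; first by exists [::].
  have [gs h1 ->] := IH (fun z zl => lE z (mem_behead (s := x :: l') zl)).
  have [g Eg <-] := lE x (mem_head _ _); exists (g :: gs) => // z.
  by rewrite inE => /orP[/eqP ->|/h1].
exists gs => // x Ex.
pose R := adjoin (acl F0) [set` gs]; have hR : subfield R by exact: adjoin_sf.
have hG : subfield (psi @` R) by exact: image_sf.
have hiL : subfield (range i) by exact: (image_sf i (setT_sf L)).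
have hiF : subfield (i @` acl F0) by exact: image_sf.
have iFR : i @` acl F0 `<=` psi @` R.
  by move=> _ [z Fz <-]; exists z; [exact: sub_adjoinl|exact: psiF].
have : adjoin (psi @` R) (range i) (psi x).
  have hX := adjoin_sf (psi @` R) (range i).
  have iX : i @` E0 `<=` adjoin (psi @` R) (range i) by move=> _ [z _ <-]; apply: sub_adjoinr; exists z.
  apply: (adjoin_min hX iX) (psiE x Ex) => y /hl; apply: (adjoin_min hX iX) => z.
  rewrite egs => /mapP[g ggs ->]; apply: sub_adjoinl; exists g => //; exact: sub_adjoinr.
move=> /(compositumP hG hiL)[P [S [hP hS S0 ex]]].
have [J [A [m [a [b [mi hA hab eP eS]]]]]] := ten_free2 hG hiF iFR hP hS.
have /choice[m' hm'] : forall j, exists z, i z = m j by move=> j; have [z _ <-] := mi j; exists z.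
have /choice[a' ha'] : forall j, exists z, R z /\ psi z = a j.
  by move=> j; have [[z Rz <-] _] := hab j; exists z.
have /choice[b' hb'] : forall j, exists z, R z /\ psi z = b j.
  by move=> j; have [_ [z Rz <-]] := hab j; exists z.
have fm : lfree (acl F0) A m'.
  move=> c Fc e j jA; apply: (fmorph_inj i); rewrite rmorph0.
  apply: (hA (fun j => i (c j))) jA; first by move=> j'; exists (c j').
  by rewrite -[RHS](rmorph0 i) -e rmorph_sum; apply: eq_bigr => j' _; rewrite rmorphM hm'.
(* The equation psi x * S = P, read along a family m that is independent over acl F0, holds
   coefficient by coefficient. *)
have rel : forall j, j \in A -> x * b' j - a' j = 0.
  apply: (free _ _ _ _ fm).
  under eq_bigr => j _ do (have [_ ea] := ha' j; have [_ eb] := hb' j; rewrite rmorphB rmorphM hm' ea eb mulrBr mulrCA).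
  rewrite sumrB -mulr_sumr.
  have -> : \sum_(j in A) m j * b j = S by rewrite eS; apply: eq_bigr => j _; rewrite mulrC.
  have -> : \sum_(j in A) m j * a j = P by rewrite eP; apply: eq_bigr => j _; rewrite mulrC.
  by rewrite ex divfK // subrr.
have [j jA bj] : exists2 j, j \in A & b' j != 0.
  apply: contrapT => none; move/eqP: S0; apply; rewrite eS big1 // => j jA.
  have [_ <-] := hb' j; suff -> : b' j = 0 by rewrite rmorph0 mul0r.
  by apply/eqP; apply: contrapT => /negP h; apply: none; exists j.
have -> : x = a' j / b' j.
  by apply: (mulIf bj); rewrite divfK //; apply/eqP; rewrite -subr_eq0 rel.
have [Ra _] := ha' j; have [Rb _] := hb' j; exact: (sfdiv hR).
Qed.

(** E0 is contained in the field generated by gs over acl F0. Finitely many algebraic elements al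
    suffice to express the differential generators and the derivatives of gs; then F0(al, gs) is a
    differential field and contains E0. *)
Lemma sn_finitely_generated F0 E0 : strongly_normal d F0 E0 ->
  exists hs : seq L, E0 `<=` adjoin F0 [set` hs].
Proof.
move=> sn; have [gs gsE Egs] := sn_generated sn.
have [[hF0 dF0] [hE0 dE0] F0E0 [s Es] _] := sn.
have sE x : x \in s -> E0 x by move=> xs; rewrite Es => G [_]; apply; right.
have dE x : E0 x -> E0 (d x) by move=> Ex; exact: set_mem (dE0 _ (mem_set Ex)).
have dF x : F0 x -> F0 (d x) by move=> Ex; exact: set_mem (dF0 _ (mem_set Ex)).
have [al ha hal] : exists2 al : seq L, (forall x, x \in al -> acl F0 x) &
    forall x, x \in s ++ [seq d g | g <- gs] -> adjoin (adjoin F0 [set` gs]) [set` al] x.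
  apply: list_adjoin => x hx; have : adjoin (acl F0) [set` gs] x.
    apply: Egs; move: hx; rewrite mem_cat => /orP[/sE //|/mapP[g /gsE Eg ->]]; exact: dE.
  apply: adjoin_min; first exact: adjoin_sf.
    by move=> z; exact: sub_adjoinr.
  by move=> z zg; apply: sub_adjoinl; exact: sub_adjoinr.
have e : adjoin (adjoin F0 [set` gs]) [set` al] = adjoin (adjoin F0 [set` al]) [set` gs].
  by rewrite !adjoin_cat setUC.
exists (al ++ gs); rewrite (_ : [set` al ++ gs] = [set` al] `|` [set` gs]); last first.
  by apply/seteqP; split => x /=; rewrite mem_cat => /orP.
rewrite -adjoin_cat; have hH := adjoin_sf (adjoin F0 [set` al]) [set` gs].
apply: (diff_gen_min Es hH).
- apply: (der_adjoin hd) => x; last first.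
    by move=> xg; rewrite -e; apply: hal; rewrite mem_cat (map_f d (xg : x \in gs)) orbT.
  by move=> /(adjoin_acl_diff hF0 dF ha); exact: sub_adjoinl.
- by move=> x Fx; apply: sub_adjoinl; exact: sub_adjoinl.
- by move=> x xs; rewrite -e; apply: hal; rewrite mem_cat xs.
Qed.

(** This is the source of finiteness in the conclusion: K is algebraic over k(y), and finite
    generation of E is what bounds its degree. *)
Lemma tower_generated (n : nat) (E : nat -> set L) :
  (forall i, (i < n)%N -> strongly_normal d (E i) (E i.+1)) -> subfield (E 0%N) ->
  exists hs : seq L, E n `<=` adjoin (E 0%N) [set` hs].
Proof.
move=> + hE; elim: n => [|n IH] sn; first by exists [::]; exact: sub_adjoinl.
have [hs h1] := IH (fun i lt => sn i (ltnW lt)).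
have [l h2] := sn_finitely_generated (sn n (ltnSn n)).
exists (hs ++ l); apply: subset_trans h2 _; apply: adjoin_min; first exact: adjoin_sf.
  apply: subset_trans h1 _; apply: adjoin_mono => // x xh.
  by apply: sub_adjoinr; rewrite /= mem_cat (xh : x \in hs).
by move=> x xl; apply: sub_adjoinr; rewrite /= mem_cat (xl : x \in l) orbT.
Qed.

End FiniteGeneration.

(** * Algebraic subextensions of finitely generated extensions *)

Definition dependent (T : fieldType) (F : set T) n (b : 'I_n -> T) :=
  exists c : 'I_n -> T, [/\ forall i, F (c i), exists i, c i != 0 & \sum_i c i * b i = 0].

Lemma finite_ext_of_dep (T : fieldType) (F X : set T) n : subfield F -> subfield X -> F `<=` X ->
  (forall b : 'I_n -> T, (forall i, X (b i)) -> dependent F b) -> finite_extension F X.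
Proof.
move=> hF hX FX dep.
pose P m := `[< forall b : 'I_m -> T, (forall i, X (b i)) -> dependent F b >].
have exP : exists m, P m by exists n; apply/asboolP.
case: (ex_minnP exP) => -[|m] /asboolP hm min.
  have [|c [_ [i _] _]] := hm (fun=> 0); last by case: (i).
  by move=> _; exact: (sf0 hX).
have /existsNP[e /not_implyP[Xe ne]] : ~ forall b : 'I_m -> T, (forall i, X (b i)) -> dependent F b.
  by move=> h; have : P m by [apply/asboolP]; move=> /min; rewrite ltnn.
apply/finite_extP; split => //; exists m, e; split => // x Xx.
have [|c [Fc [i ci] e0]] := hm (fun i => if unlift ord0 i is Some j then e j else x).
  by move=> i; case: unliftP.
move: e0; rewrite big_ord_recl unlift_none; under eq_bigr do rewrite liftK.
move=> e0; have c0 : c ord0 != 0.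
  apply/eqP => c0; apply: ne; exists (fun j => c (lift ord0 j)); split => //.
    by move: ci; case: (unliftP ord0 i) => [j ->|->] ; [exists j|rewrite c0 eqxx].
  by move: e0; rewrite c0 mul0r add0r.
exists (fun j => - c (lift ord0 j) / c ord0).
  by move=> j; apply: (sfdiv hF) => //; exact: (sfN hF).
apply: (mulfI c0); rewrite mulr_sumr.
have -> : \sum_j c ord0 * (- c (lift ord0 j) / c ord0 * e j) = - \sum_j c (lift ord0 j) * e j.
  by rewrite -sumrN; apply: eq_bigr => j _; rewrite mulrA mulrCA mulfV // mulr1 mulNr.
by apply/eqP; rewrite -addr_eq0 e0.
Qed.

(** With denominators cleared, the relation says that y is a root of a polynomial over acl F. As y
    is transcendental this polynomial is zero, and a nonzero column of its coefficients is a
    relation over F. *)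
Lemma dependent_adjoin1 (T : fieldType) (F : set T) y n (b : 'I_n -> T) : subfield F ->
  (forall i, acl F (b i)) -> ~ acl F y -> dependent (adjoin F [set y]) b -> dependent F b.
Proof.
move=> hF ab ny [c [Fc [i0 ci0] e]].
pose q := \poly_(k < n) (if insub k is Some k' then c k' else 0).
have qE (k : 'I_n) : q`_k = c k by rewrite coef_poly ltn_ord valK.
have hq : pov (adjoin F [set y]) q.
  move=> k; rewrite coef_poly; case: ifP => _; last exact: (sf0 (adjoin_sf _ _)).
  by case: insubP => [k' _ _|_] //; exact: (sf0 (adjoin_sf _ _)).
have [v [w [hv v0 hw hvw]]] := common_den hF hq.
pose Q := \sum_(i < n) b i *: w i.
have Q0 : Q = 0.
  apply: contrapT => /eqP Q0; apply: ny; apply: (acl_acl hF); apply: (@aclI _ _ Q) => //.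
    move=> j; rewrite coef_sum; apply: (sf_sum (acl_sf hF)) => i _; rewrite coefZ.
    by apply: (sfM (acl_sf hF)) => //; apply: (sub_acl hF); exact: hw.
  apply/eqP; rewrite horner_sum.
  under eq_bigr => i _ do rewrite hornerZ -hvw qE mulrCA [b i * _]mulrC.
  by rewrite -mulr_sumr e mulr0.
have [j wj] : exists j, (w i0)`_j != 0.
  apply: contrapT => none; have w0 : w i0 = 0.
    by apply/polyP => j; rewrite coef0; apply: contrapT => /eqP h; apply: none; exists j.
  by have := hvw i0; rewrite w0 horner0 qE => /eqP; rewrite mulf_eq0 (negbTE v0) (negbTE ci0).
exists (fun i => (w i)`_j); split; [by move=> i; exact: hw|by exists i0|].
have : Q`_j = 0 by rewrite Q0 coef0.
by rewrite coef_sum => h; rewrite -[RHS]h; apply: eq_bigr => i _; rewrite coefZ mulrC.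
Qed.

Lemma dependent_adjoin (T : fieldType) (F : set T) (s : seq T) n (b : 'I_n -> T) : subfield F ->
  (forall i, acl F (b i)) -> seqindep F s -> dependent (adjoin F [set` s]) b -> dependent F b.
Proof.
move=> hF ab; elim: s => [_|y s IH [is_ ny]]; first by rewrite adjoin_id.
rewrite adjoin_cons => h; apply: IH => //; apply: dependent_adjoin1 h => //; first exact: adjoin_sf.
by move=> i; apply: acl_mono (ab i); exact: sub_adjoinl.
Qed.

(** Let B be a transcendence basis of s. The degree is bounded over F(B), and for elements algebraic
    over F, dependence over F(B) is dependence over F. *)
Lemma finite_ext_in_fg (T : fieldType) (F X : set T) (s : seq T) : subfield F -> subfield X ->
  F `<=` X -> X `<=` acl F -> X `<=` adjoin F [set` s] -> finite_extension F X.
Proof.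
move=> hF hX FX Xa Xs; have [B [_ iB sB]] := transcendence_seq s hF.
have [n hn] := finite_ext_dep (finite_ext_seq (adjoin_sf F [set` B]) sB).
apply: (finite_ext_of_dep (n := n)) => // b Xb.
apply: (dependent_adjoin hF _ iB) => [i|]; first exact: Xa.
apply: hn => i; apply: adjoin_mono (Xs _ (Xb i)); last exact: sub_adjoinr.
exact: sub_adjoinl.
Qed.

Section UnivariateIndependence.
Import mpoly.

Lemma alg_independent_acl (T : fieldType) (F : set T) (b : 'I_1 -> T) : subfield F ->
  alg_independent F b -> ~ acl F (b ord0).
Proof.
move=> hF indep [p /(povP hF) hp /andP[p0 px]].
pose q : {mpoly T[1]} := \sum_(i < size p) p`_i *: 'X_[U_(ord0) *+ i].
have coefq m : q@_m = \sum_(i < size p) p`_i * (U_(ord0) *+ i == m)%MM%:R.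
  by rewrite raddf_sum /=; apply: eq_bigr => i _; rewrite mcoeffZ mcoeffX.
have qF : q \is a mpolyOver 1 [pred x in F].
  apply/allP => _ /mapP[m _ ->]; apply: mem_set; rewrite coefq.
  by apply: (sf_sum hF) => i _; apply: (sfM hF) => //; exact: (sfnat hF).
have qb : q.@[b] = 0.
  rewrite raddf_sum /= -[RHS](eqP px) horner_coef; apply: eq_bigr => i _.
  by rewrite mevalZ mevalX big_ord1 mulmnE mnm1E eqxx mul1n.
have q0 := indep q qF qb; move/eqP: p0; apply; apply/polyP => j; rewrite coef0.
have [lt|le] := ltnP j (size p); last exact: nth_default.
have : q@_(U_(ord0) *+ j)%MM = 0 by rewrite q0 mcoeff0.
rewrite coefq (bigD1 (Ordinal lt)) //= eqxx mulr1 big1 ?addr0 // => i ij.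
case: eqP => [/mnmP/(_ ord0)|_]; last by rewrite mulr0.
rewrite !mulmnE mnm1E eqxx !mul1n => e; move: ij.
by rewrite -val_eqE /= e eqxx.
Qed.

End UnivariateIndependence.

(* L is an algebraic closure of E, with the derivation extending that of E. *)
Theorem theorem6p3 (L : closedFieldType) (d : L -> L) (k K E : set L)
    (char0 : [pchar L] =i pred0)
    (d_der : derivation d)
    (k_diff : diff_subfield d k)
    (C_closed : alg_closed (constants d k))
    (E_isn : iterated_strongly_normal d k E)
    (L_alg : forall x : L, algebraic_over E x)
    (K_diff : diff_subfield d K)
    (k_sub_K : k `<=` K)
    (K_sub_E : K `<=` E)
    (trdegK : trdeg_is k K 1) :
  exists (kt : set L) (t : L),
    [/\ finite_extension k kt,
        t \in compositum kt K &
        (finite_extension (adjoin kt [set t]) (compositum kt K)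
           /\ riccati_solution d kt t)
        \/
        (finite_extension (adjoin kt [set t; d t]) (compositum kt K)
           /\ weierstrass_solution d (constants d k) kt t)].
Proof.
have cL : alg_closed [set: L].
  move=> p _ sp; have /closed_rootP[x px] : size p != 1%N by rewrite neq_ltn sp orbT.
  by exists x => //; exact: mem_set.
have [n [T [T0 Tn sn]]] := E_isn.
have hk := proj1 k_diff.
have dk x : k x -> k (d x) by move=> kx; apply: set_mem; apply: (proj2 k_diff); exact: mem_set.
have dK x : K x -> K (d x) by move=> kx; apply: set_mem; apply: (proj2 K_diff); exact: mem_set.
have hK := proj1 K_diff.
have [b [Kb indep Kalg]] := trdegK.
pose y := b ord0; have Ky : K y by exact: set_mem (Kb ord0).
have rb : range b = [set y].
  by apply/seteqP; split => [_ [i _ <-]|_ ->]; [rewrite (ord1 i)|exists ord0].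
have aK x : K x -> acl (adjoin k [set y]) x by move=> Kx; rewrite -rb; apply: Kalg; exact: mem_set.
have ny : ~ acl k y by exact: alg_independent_acl.
have ha := acl_sf hk; have hky := adjoin_sf k [set y].
rewrite -T0 in C_closed; have Lalg x : acl (T n) x by rewrite Tn; exact: L_alg.
have kd0 : diff_subfield d (T 0%N) by rewrite T0.
have := tower_equation char0 cL d_der sn kd0 C_closed Lalg (y := y).
have const := all_constants char0 cL d_der sn kd0 C_closed Lalg.
rewrite !T0 in const * => /(_ ny (aK _ (dK _ Ky)))[t [Nt nt eqn]].
have [hs Ehs] := tower_generated char0 cL d_der sn (proj1 kd0).
rewrite T0 Tn in Ehs.
(* t is rational in y and d y over acl k; these finitely many algebraic elements suffice to express
   it. *)
have [s1 s1a s1t] : exists2 s : seq L, (forall x, x \in s -> acl k x) & adjoin (adjoin k [set y; d y]) [set` s] t.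
  apply: adjoin_fin; apply: adjoin_min Nt; first exact: adjoin_sf.
    by move=> x; exact: sub_adjoinr.
  by move=> x hx; apply: sub_adjoinl; exact: sub_adjoinr.
have at_ : acl (adjoin k [set y]) t.
  apply: adjoin_min Nt; first exact: (acl_sf hky).
    by apply: acl_mono; exact: sub_adjoinl.
  by move=> x [->|->]; apply: aK => //; exact: dK.
have main (s2 : seq L) : (forall x, x \in s2 -> acl k x) -> exists kt,
    [/\ finite_extension k kt, forall x, x \in s2 -> kt x, t \in compositum kt K,
      finite_extension (adjoin kt [set t]) (compositum kt K) &
      finite_extension (adjoin kt [set t; d t]) (compositum kt K)].
  move=> s2a; pose s := s1 ++ s2.
  have sa x : x \in s -> acl k x by rewrite mem_cat => /orP[/s1a|/s2a].
  exists (adjoin k [set` s]); set kt := adjoin k [set` s].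
  have hkt : subfield kt by exact: adjoin_sf.
  have kkt : k `<=` kt by exact: sub_adjoinl.
  have skt x : x \in s -> kt x by move=> xs; exact: sub_adjoinr.
  have kta : kt `<=` acl k by apply: (adjoin_min ha (sub_acl hk)).
  have hX : subfield (compositum kt K) by exact: (adjoin_sf kt K).
  have ktX : kt `<=` compositum kt K by exact: (@sub_adjoinl _ kt K).
  have KX : K `<=` compositum kt K by exact: (@sub_adjoinr _ kt K).
  have Xt : compositum kt K t.
    apply: (adjoin_min hX _ _ s1t).
      apply: (adjoin_min hX) => [x /kkt/ktX //|x [->|->]]; apply: KX => //; exact: dK.
    by move=> x xs; apply: ktX; apply: skt; rewrite mem_cat (xs : x \in s1).
  have Xdt : compositum kt K (d t).
    apply: (der_adjoin d_der _ _ Xt) => x hx; [apply: ktX|apply: KX; exact: dK].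
    exact: (adjoin_acl_diff char0 d_der hk dk sa).
  (* By exchange, y is algebraic over kt(t), and therefore so is K. *)
  have ay : acl (adjoin kt [set t]) y.
    apply: acl_mono (acl_exchange hk nt at_); apply: adjoin_mono => //; exact: sub_adjoinr.
  have hF := adjoin_sf kt [set t].
  have fin : finite_extension (adjoin kt [set t]) (compositum kt K).
    apply: (finite_ext_in_fg (s := hs)) => //.
    - by apply: adjoin_min => // _ ->.
    - apply: (adjoin_min (acl_sf hF)) => x.
        by move=> hx; apply: (sub_acl hF); exact: sub_adjoinl.
      move=> /aK; move=> h; apply: (acl_acl hF); apply: acl_mono h.
      apply: (adjoin_min (acl_sf hF)) => [z kz|_ -> //].
      by apply: (sub_acl hF); apply: sub_adjoinl; exact: kkt.
    - apply: (adjoin_min (adjoin_sf _ _)) => [x hx|x /K_sub_E/Ehs].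
        by apply: sub_adjoinl; exact: sub_adjoinl.
      apply: adjoin_mono; last exact: sub_adjoinr.
      by move=> z /kkt; exact: sub_adjoinl.
  split => //.
  - exact: finite_ext_seq.
  - by move=> x xs; apply: skt; rewrite mem_cat xs orbT.
  - exact: mem_set.
  - apply: (finite_ext_base fin); first exact: adjoin_sf.
      by apply: adjoin_mono => // x ->; apply: sub_adjoinr; left.
    by apply: adjoin_min => // x [->|->].
case: eqn => [[a0 [a1 [a2 [ka0 ka1 ka2 eq]]]]|[a [g2 [g3 [ka Cg2 Cg3 disc eq]]]]].
  have [|kt [fk kts kt_t fin _]] := main [:: a0; a1; a2].
    by move=> x; rewrite !inE => /or3P[] /eqP ->.
  exists kt, t; split => //; left; split => //; exists a2, a1, a0.
  split; try by apply: mem_set; apply: kts; rewrite !inE eqxx ?orbT.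
    (* If all the coefficients vanished, t would be a constant, hence in k. *)
    apply/negP => /and3P[/eqP e2 /eqP e1 /eqP e0]; apply: nt; apply: (sub_acl hk).
    by have [|h _] := const t; first by rewrite eq e0 e1 e2; ring.
  by rewrite eq; ring.
have [|kt [fk kts kt_t _ fin]] := main [:: a]; first by move=> x; rewrite inE => /eqP ->.
exists kt, t; split => //; right; split => //; exists a, g2, g3.
by split => //; apply: mem_set => //; apply: kts; exact: mem_head.
Qed.
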